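(* Let $\alpha>1$, $k\in\mathbb{N}$, $m\in\mathbb{N}_0$ with $m\ge 1+\frac{k}{2}$, and $f\in\mathcal{M}_{\alpha,m}$. Then for all $s$ in the strip $0<\operatorname{Re}(s)<1$, $$\zeta^k(s)f^*(s)=\int_0^\infty\left(\sum_{n=1}^\infty d_k(n)f(nx)-\int_0^\infty f(xy)P_{k-1}(\ln y)\,dy\right)x^{s-1}\,dx.$$
   Context: For $\alpha>1$ and $m\in\mathbb{N}_0$, the class $\mathcal{M}_{\alpha,m}$ consists of the functions $f$ defined on $[0,\infty)$ such that $f\in\mathcal{C}^{(m)}([0,\infty))$ and $f^{(j)}(x)=\mathcal{O}(x^{-\alpha-j})$ as $x\to\infty$, for all $j=0,1,\dots,m$. $f^*(s)=\int_0^\infty f(x)x^{s-1}dx$ is the Mellin transform of $f$. $\zeta$ is the Riemann zeta function. $d_k(n)$ is the number of ways of writing $n$ as an ordered product of $k$ natural numbers (so $\zeta^k(s)=\sum_{n\ge1}d_k(n)n^{-s}$ for $\operatorname{Re}s>1$). $P_{k-1}$ is the polynomial of degree $k-1$ determined by $P_{k-1}(\ln y)=\operatorname*{res}_{s=1}\big(\zeta^k(s)y^{s-1}\big)$ for $y>0$, so that $\operatorname*{res}_{s=1}(\zeta^k(s)f^*(s)x^{-s})=\int_0^\infty f(xy)P_{k-1}(\ln y)dy$; e.g. $P_0=1$, $P_1(t)=t+2\gamma$ with $\gamma$ the Euler–Mascheroni constant. *)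

(* Defs.v *)
From Stdlib Require Import Reals Lra List Arith.
From Coquelicot Require Import Coquelicot.
Import ListNotations.
Open Scope R_scope.

Definition Cexp (z : C) : C :=
  (exp (Re z) * cos (Im z), exp (Re z) * sin (Im z)).
Definition cpow (x : R) (s : C) : C := Cexp (Cmult s (RtoC (ln x))).

Fixpoint Cpown (z : C) (n : nat) : C :=
  match n with O => RtoC 1 | S n => Cmult z (Cpown z n) end.

Definition CSeries (a : nat -> C) : C :=
  (Series (fun n => Re (a n)), Series (fun n => Im (a n))).

(* Riemann zeta function on Re s > 0 (s <> 1), via the Dirichlet eta
   function:  zeta(s) = (1 - 2^(1-s))^(-1) * sum_{n>=1} (-1)^(n-1) n^(-s).
   For Re s > 1 this is the usual Dirichlet series; for 0 < Re s <= 1 it is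
   the analytic continuation. *)
Definition eta (s : C) : C :=
  CSeries (fun n => Cmult (RtoC ((-1) ^ n)) (cpow (INR (S n)) (Copp s))).
Definition zeta (s : C) : C :=
  Cdiv (eta s) (Cminus (RtoC 1) (cpow 2 (Cminus (RtoC 1) s))).

(* d_k(n): number of ordered k-tuples (a_1,...,a_k) of natural numbers with
   a_1 * ... * a_k = n  (for n >= 1 every a_i lies in {1,...,n}). *)
Fixpoint tuples (k : nat) (L : list nat) : list (list nat) :=
  match k with
  | O => [ [] ]
  | S k => flat_map (fun a => map (cons a) (tuples k L)) L
  end.
Definition dk (k n : nat) : nat :=
  length (filter (fun l => Nat.eqb (fold_right Nat.mul 1%nat l) n)
                 (tuples k (seq 1 n))).

(* P_{k-1}(ln y) := res_{s=1} ( zeta^k(s) y^(s-1) ), the residue computed as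
   (1/(2 pi i)) times the contour integral over the circle |s-1| = 1/2
   (zeta is holomorphic on the punctured closed disc |s-1| <= 1/2). *)
Definition Pres (k : nat) (y : R) : C :=
  @RInt C_R_CompleteNormedModule (fun th : R =>
          let w : C := Cmult (RtoC (1/2)) (Cexp (0, th)) in
          let s : C := Cplus (RtoC 1) w in
          Cmult (RtoC (/ (2 * PI)))
                (Cmult (Cmult (Cpown (zeta s) k) (cpow y (Cminus s (RtoC 1)))) w))
       0 (2 * PI).

Definition has_deriv_nonneg (g g' : R -> C) (x : R) : Prop :=
  filterlim (fun y => Cdiv (Cminus (g y) (g x)) (RtoC (y - x)))
            (within (fun y => 0 <= y /\ y <> x) (locally x)) (locally (g' x)).

Definition class_M (alpha : R) (m : nat) (f : R -> C) : Prop :=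
  exists g : nat -> R -> C,
    (forall x, 0 <= x -> g O x = f x) /\
    (forall j x, (j < m)%nat -> 0 <= x -> has_deriv_nonneg (g j) (g (S j)) x) /\
    (forall x, 0 <= x ->
        filterlim (g m) (within (fun y => 0 <= y) (locally x)) (locally (g m x))) /\
    (forall j, (j <= m)%nat -> exists M X : R, 0 < X /\
        forall x, X <= x -> Cmod (g j x) <= M * Rpower x (- alpha - INR j)).

(* Main.v *)
(* In the variable x = exp v, the Mellin transform is a two-sided Laplace transform, and m integrations by parts give f*(s) = O(|Im s|^-m) on closed substrips of 0 < Re s < alpha.
   Fourier inversion gives f(n x) as an integral of f*(s) (n x)^-s over Re s = c with 1 < c < alpha, and summing against d_k(n) turns the series into (2 pi i)^-1 times the integral of zeta^k f* x^-s over that line.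
   Moving the line to 0 < Re s < 1 picks up the residue at 1, which is the subtracted integral: the residue, written as an integral over a circle around 1, commutes with the integral defining f*.
   Hence the bracket is the inverse Mellin transform of zeta^k f* on a line inside the strip, and a second Fourier inversion recovers zeta^k f*.
   Convergence requires zeta(s) = O(|Im s|^(1/2 - delta)) for Re s >= c0 > 0, since m >= 1 + k/2 then leaves an integrable |Im s|^(-1 - k delta). This bound is obtained from the alternating series for eta, by Weyl differencing and the Kusmin-Landau inequality.
   The horizontal segments are placed at heights where 2^(1-s) is negative, so that dividing eta by 1 - 2^(1-s) does no harm. *)
Require Import Defs.
From Stdlib Require Import Reals Lra Lia List ZArith FunctionalExtensionality.
From Coquelicot Require Import Coquelicot.
Import ListNotations.
Open Scope R_scope.
Set Bullet Behavior "Strict Subproofs".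

(** Neither [zeta0] nor [mellin] is ever shown to be holomorphic. Contour identities are proved for
    the Euler-Maclaurin truncations [zeta_em N], which consist of exponentials and one inverse. They
    pass to $\zeta^k(s)e^{sv}$ by uniform convergence along the paths, and to $\zeta^k f^* x^{-s}$
    by integrating against $f$ and exchanging the integrals. Beyond that, only continuity and growth
    of the limits enter.

    The exponent $1/2$ is dictated by the hypothesis on $m$, and it must be beaten for every
    $\mathrm{Re}\,s>0$; the estimate $|t|^{1-\sigma}$ that Euler-Maclaurin summation gives is too
    weak for small $\sigma$. A square-root bound with logarithms for all partial sums of $\eta$ on
    $\sigma=0$ is enough: partial summation with the weights $n^{-\sigma}$ turns it into a power
    saving.

    Fourier inversion goes through Fejer means. Their kernel is absolutely integrable, so it
    suffices that the function and its transform are continuous and dominated by integrable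
    weights. *)

Lemma continuous_C {U : UniformSpace} (f : U -> C) (x : U) :
  continuous (fun y => Re (f y)) x -> continuous (fun y => Im (f y)) x -> continuous f x.
Proof.
  intros H1 H2.
  apply continuous_ext with (fun y => (Re (f y), Im (f y))).
  { intros y. unfold Re, Im. destruct (f y); reflexivity. }
  apply (continuous_comp_2 (fun y => Re (f y)) (fun y => Im (f y)) (fun a b => (a, b) : C)); auto.
  apply continuous_ext with (fun z : R * R => z).
  { intros [a b]; reflexivity. }
  apply continuous_id.
Qed.

Lemma continuous_Re {U : UniformSpace} (f : U -> C) (x : U) :
  continuous f x -> continuous (fun y => Re (f y)) x.
Proof.
  intros H. apply (continuous_comp f (fun z : R * R => fst z)); auto.
  destruct (f x). apply continuous_fst.
Qed.

Lemma continuous_Im {U : UniformSpace} (f : U -> C) (x : U) :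
  continuous f x -> continuous (fun y => Im (f y)) x.
Proof.
  intros H. apply (continuous_comp f (fun z : R * R => snd z)); auto.
  destruct (f x). apply continuous_snd.
Qed.

Lemma continuous_Rplus {U : UniformSpace} (f g : U -> R) (x : U) :
  continuous f x -> continuous g x -> continuous (fun y => f y + g y) x.
Proof. intros; apply (continuous_plus (V:=R_NormedModule) f g); auto. Qed.
Lemma continuous_Rminus {U : UniformSpace} (f g : U -> R) (x : U) :
  continuous f x -> continuous g x -> continuous (fun y => f y - g y) x.
Proof. intros; apply (continuous_minus (V:=R_NormedModule) f g); auto. Qed.
Lemma continuous_Ropp {U : UniformSpace} (f : U -> R) (x : U) :
  continuous f x -> continuous (fun y => - f y) x.
Proof. intros; apply (continuous_opp (V:=R_NormedModule) f); auto. Qed.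
Lemma continuous_Rmult {U : UniformSpace} (f g : U -> R) (x : U) :
  continuous f x -> continuous g x -> continuous (fun y => f y * g y) x.
Proof. intros; apply (continuous_mult (K:=R_AbsRing) f g); auto. Qed.

Lemma continuous_Rcomp {U : UniformSpace} (f : U -> R) (g : R -> R) (x : U) :
  continuous f x -> continuity_pt g (f x) -> continuous (fun y => g (f y)) x.
Proof.
  intros H1 H2; apply (continuous_comp f g); auto.
  now apply continuity_pt_filterlim.
Qed.

Lemma continuous_Rinv_comp {U : UniformSpace} (f : U -> R) (x : U) :
  continuous f x -> f x <> 0 -> continuous (fun y => / f y) x.
Proof.
  intros H1 H2. apply continuous_Rcomp; auto.
  apply continuity_pt_inv; auto. apply continuity_pt_id.
Qed.

Lemma continuous_Rabs_comp {U : UniformSpace} (f : U -> R) (x : U) :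
  continuous f x -> continuous (fun y => Rabs (f y)) x.
Proof. intros; apply continuous_Rcomp; auto. apply Rcontinuity_abs. Qed.

Lemma continuous_exp_comp {U : UniformSpace} (f : U -> R) (x : U) :
  continuous f x -> continuous (fun y => exp (f y)) x.
Proof.
  intros; apply continuous_Rcomp; auto.
  apply derivable_continuous_pt, derivable_pt_exp.
Qed.
Lemma continuous_cos_comp {U : UniformSpace} (f : U -> R) (x : U) :
  continuous f x -> continuous (fun y => cos (f y)) x.
Proof. intros; apply continuous_Rcomp; auto. apply continuity_cos. Qed.
Lemma continuous_sin_comp {U : UniformSpace} (f : U -> R) (x : U) :
  continuous f x -> continuous (fun y => sin (f y)) x.
Proof. intros; apply continuous_Rcomp; auto. apply continuity_sin. Qed.
Lemma continuous_ln_comp {U : UniformSpace} (f : U -> R) (x : U) :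
  continuous f x -> 0 < f x -> continuous (fun y => ln (f y)) x.
Proof.
  intros; apply (continuous_comp f ln); auto.
  apply continuous_ln; auto.
Qed.
Lemma continuous_sqrt_comp {U : UniformSpace} (f : U -> R) (x : U) :
  continuous f x -> continuous (fun y => sqrt (f y)) x.
Proof.
  intros; apply (continuous_comp f sqrt); auto.
  apply continuous_sqrt; auto.
Qed.
Lemma continuous_atan_comp {U : UniformSpace} (f : U -> R) (x : U) :
  continuous f x -> continuous (fun y => atan (f y)) x.
Proof.
  intros; apply continuous_Rcomp; auto.
  apply derivable_continuous_pt, derivable_pt_atan.
Qed.
Lemma continuous_pow_comp {U : UniformSpace} (f : U -> R) (n : nat) (x : U) :
  continuous f x -> continuous (fun y => f y ^ n) x.
Proof.
  intros; induction n; simpl. apply continuous_const. now apply continuous_Rmult.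
Qed.
Lemma continuous_RtoC {U : UniformSpace} (f : U -> R) (x : U) :
  continuous f x -> continuous (fun y => RtoC (f y)) x.
Proof. intros; apply continuous_C; simpl; auto. apply continuous_const. Qed.
Lemma continuous_pair {U : UniformSpace} (f g : U -> R) (x : U) :
  continuous f x -> continuous g x -> continuous (fun y => (f y, g y) : C) x.
Proof. intros; apply continuous_C; simpl; auto. Qed.
Lemma continuous_Cplus {U : UniformSpace} (f g : U -> C) (x : U) :
  continuous f x -> continuous g x -> continuous (fun y => Cplus (f y) (g y)) x.
Proof.
  intros Hf Hg; apply continuous_C.
  - apply (continuous_Rplus (fun y => Re (f y)) (fun y => Re (g y))); now apply continuous_Re.
  - apply (continuous_Rplus (fun y => Im (f y)) (fun y => Im (g y))); now apply continuous_Im.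
Qed.
Lemma continuous_Copp {U : UniformSpace} (f : U -> C) (x : U) :
  continuous f x -> continuous (fun y => Copp (f y)) x.
Proof.
  intros Hf; apply continuous_C.
  - apply (continuous_Ropp (fun y => Re (f y))); now apply continuous_Re.
  - apply (continuous_Ropp (fun y => Im (f y))); now apply continuous_Im.
Qed.
Lemma continuous_Cminus {U : UniformSpace} (f g : U -> C) (x : U) :
  continuous f x -> continuous g x -> continuous (fun y => Cminus (f y) (g y)) x.
Proof. intros; apply continuous_Cplus; auto; now apply continuous_Copp. Qed.
Lemma continuous_Cmult {U : UniformSpace} (f g : U -> C) (x : U) :
  continuous f x -> continuous g x -> continuous (fun y => Cmult (f y) (g y)) x.
Proof.
  intros Hf Hg.
  assert (F1 := continuous_Re f x Hf). assert (F2 := continuous_Im f x Hf).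
  assert (G1 := continuous_Re g x Hg). assert (G2 := continuous_Im g x Hg).
  apply continuous_C.
  - apply (continuous_Rminus (fun y => Re (f y) * Re (g y)) (fun y => Im (f y) * Im (g y)));
    now apply continuous_Rmult.
  - apply (continuous_Rplus (fun y => Re (f y) * Im (g y)) (fun y => Im (f y) * Re (g y)));
    now apply continuous_Rmult.
Qed.
Lemma continuous_Cexp {U : UniformSpace} (f : U -> C) (x : U) :
  continuous f x -> continuous (fun y => Cexp (f y)) x.
Proof.
  intros Hf.
  assert (F1 := continuous_exp_comp _ x (continuous_Re f x Hf)). assert (F2 := continuous_Im f x Hf).
  apply continuous_C.
  - apply (continuous_Rmult (fun y => exp (Re (f y))) (fun y => cos (Im (f y)))); auto.
    now apply continuous_cos_comp.
  - apply (continuous_Rmult (fun y => exp (Re (f y))) (fun y => sin (Im (f y)))); auto.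
    now apply continuous_sin_comp.
Qed.
Lemma continuous_Cpown {U : UniformSpace} (f : U -> C) (n : nat) (x : U) :
  continuous f x -> continuous (fun y => Cpown (f y) n) x.
Proof.
  intros; induction n; simpl. apply continuous_const. now apply continuous_Cmult.
Qed.
Lemma continuous_Cinv {U : UniformSpace} (f : U -> C) (x : U) :
  continuous f x -> f x <> RtoC 0 -> continuous (fun y => Cinv (f y)) x.
Proof.
  intros Hf H0.
  assert (H : Re (f x) * (Re (f x) * 1) + Im (f x) * (Im (f x) * 1) <> 0).
  { intros H. apply H0. unfold Re, Im in *. destruct (f x) as [a b]; simpl in *.
    apply injective_projections; simpl; nra. }
  assert (F1 := continuous_Re f x Hf). assert (F2 := continuous_Im f x Hf).
  assert (D : continuous (fun y => / (Re (f y) * (Re (f y) * 1) + Im (f y) * (Im (f y) * 1))) x).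
  { apply continuous_Rinv_comp; auto.
    apply continuous_Rplus; apply (continuous_pow_comp _ 2); auto. }
  apply continuous_C.
  - apply (continuous_Rmult (fun y => Re (f y))); auto.
  - apply (continuous_Rmult (fun y => - Im (f y))); auto. now apply continuous_Ropp.
Qed.
Lemma continuous_Cmod {U : UniformSpace} (f : U -> C) (x : U) :
  continuous f x -> continuous (fun y => Cmod (f y)) x.
Proof.
  intros. unfold Cmod. apply continuous_sqrt_comp, continuous_Rplus;
   apply (continuous_pow_comp _ 2); [now apply continuous_Re | now apply continuous_Im].
Qed.

Lemma continuous_fst_p {U V : UniformSpace} (p : U * V) : continuous fst p.
Proof. destruct p; apply continuous_fst. Qed.
Lemma continuous_snd_p {U V : UniformSpace} (p : U * V) : continuous snd p.
Proof. destruct p; apply continuous_snd. Qed.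

(** Matching is purely syntactic. The cases for partial applications such as [Rplus ?c], and for
    bare [exp] or [fst], catch functions that occur eta-reduced. *)
Ltac cont_step :=
  lazymatch goal with
  | |- continuous (fun _ => ?c) _ => apply continuous_const
  | |- continuous (fun x => x) _ => apply continuous_id
  | |- continuous Rabs _ => apply (continuous_Rabs_comp (fun y => y))
  | |- continuous exp _ => apply (continuous_exp_comp (fun y => y))
  | |- continuous cos _ => apply (continuous_cos_comp (fun y => y))
  | |- continuous sin _ => apply (continuous_sin_comp (fun y => y))
  | |- continuous RtoC _ => apply (continuous_RtoC (fun y => y))
  | |- continuous Cexp _ => apply (continuous_Cexp (fun y => y))
  | |- continuous (Rplus ?c) _ => apply (continuous_Rplus (fun _ => c) (fun y => y))
  | |- continuous (Rmult ?c) _ => apply (continuous_Rmult (fun _ => c) (fun y => y))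
  | |- continuous (Rminus ?c) _ => apply (continuous_Rminus (fun _ => c) (fun y => y))
  | |- continuous (Cplus ?c) _ => apply (continuous_Cplus (fun _ => c) (fun y => y))
  | |- continuous (Cmult ?c) _ => apply (continuous_Cmult (fun _ => c) (fun y => y))
  | |- continuous (Cminus ?c) _ => apply (continuous_Cminus (fun _ => c) (fun y => y))
  | |- continuous Ropp _ => apply (continuous_Ropp (fun y => y))
  | |- continuous Copp _ => apply (continuous_Copp (fun y => y))
  | |- continuous (pair ?c) _ => apply (continuous_pair (fun _ => c) (fun y => y))
  | |- continuous fst _ => apply continuous_fst_p
  | |- continuous snd _ => apply continuous_snd_p
  | |- continuous (fun x => fst x) _ => apply continuous_fst_p
  | |- continuous (fun x => snd x) _ => apply continuous_snd_p
  | |- continuous (fun x => Cplus _ _) _ => apply continuous_Cplus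
  | |- continuous (fun x => Cminus _ _) _ => apply continuous_Cminus
  | |- continuous (fun x => Copp _) _ => apply continuous_Copp
  | |- continuous (fun x => Cmult _ _) _ => apply continuous_Cmult
  | |- continuous (fun x => Cexp _) _ => apply continuous_Cexp
  | |- continuous (fun x => Cpown _ _) _ => apply continuous_Cpown
  | |- continuous (fun x => Cinv _) _ => apply continuous_Cinv
  | |- continuous (fun x => RtoC _) _ => apply continuous_RtoC
  | |- continuous (fun x => Cmod _) _ => apply continuous_Cmod
  | |- continuous (fun x => Rplus _ _) _ => apply continuous_Rplus
  | |- continuous (fun x => Rminus _ _) _ => apply continuous_Rminus
  | |- continuous (fun x => Ropp _) _ => apply continuous_Ropp
  | |- continuous (fun x => Rmult _ _) _ => apply continuous_Rmult
  | |- continuous (fun x => Rinv _) _ => apply continuous_Rinv_comp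
  | |- continuous (fun x => Rdiv _ _) _ => apply continuous_Rmult
  | |- continuous (fun x => exp _) _ => apply continuous_exp_comp
  | |- continuous (fun x => cos _) _ => apply continuous_cos_comp
  | |- continuous (fun x => sin _) _ => apply continuous_sin_comp
  | |- continuous (fun x => Rabs _) _ => apply continuous_Rabs_comp
  | |- continuous (fun x => atan _) _ => apply continuous_atan_comp
  | |- continuous (fun x => sqrt _) _ => apply continuous_sqrt_comp
  | |- continuous (fun x => pow _ _) _ => apply continuous_pow_comp
  | |- continuous (fun x => Re _) _ => apply continuous_Re
  | |- continuous (fun x => Im _) _ => apply continuous_Im
  | |- continuous (fun x => (_, _)) _ => apply continuous_pair
  end.
Ltac cont := repeat (first [assumption | cont_step]).

(** [ring] does not recognise [R] behind the carrier of a Coquelicot structure, so the equality is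
    retyped first. *)
Ltac req := lazymatch goal with |- @eq _ ?x ?y => change (@eq R x y) end.

(** * Integrals of complex functions of a real variable *)

(** Componentwise, so that substitution, Fubini and the fundamental theorem come from the real case.
    [is_RInt_CI] is the bridge to the integral valued in [C_R_NormedModule], in which the theorem is
    stated. *)
Definition CI (f : R -> C) (a b : R) : C :=
  (RInt (fun x => Re (f x)) a b, RInt (fun x => Im (f x)) a b).

(** Continuity at the end points is two-sided, in the full real line. *)
Definition contI {V : UniformSpace} (f : R -> V) (a b : R) := forall x, a <= x <= b -> continuous f x.

Lemma contI_sub {V : UniformSpace} (f : R -> V) (a b c d : R) :
  a <= c -> d <= b -> contI f a b -> contI f c d.
Proof. intros Hc Hd H x Hx. apply H. lra. Qed.

Lemma ex_RInt_contI (f : R -> R) a b : a <= b -> contI f a b -> ex_RInt f a b.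
Proof.
  intros Hab H. apply (ex_RInt_continuous (V:=R_CompleteNormedModule)).
  rewrite Rmin_left, Rmax_right by lra. exact H.
Qed.

Lemma ex_RInt_Re f a b : a <= b -> contI f a b -> ex_RInt (fun x => Re (f x)) a b.
Proof. intros Hab H. apply ex_RInt_contI; auto. intros x Hx. apply continuous_Re, H, Hx. Qed.
Lemma ex_RInt_Im f a b : a <= b -> contI f a b -> ex_RInt (fun x => Im (f x)) a b.
Proof. intros Hab H. apply ex_RInt_contI; auto. intros x Hx. apply continuous_Im, H, Hx. Qed.

Lemma is_RInt_CI f a b : a <= b -> contI f a b -> is_RInt (V:=C_R_NormedModule) f a b (CI f a b).
Proof.
  intros Hab H.
  apply (is_RInt_fct_extend_pair (U:=R_NormedModule) (V:=R_NormedModule) f a b);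
    apply (RInt_correct (V:=R_CompleteNormedModule)).
  now apply ex_RInt_Re. now apply ex_RInt_Im.
Qed.

Lemma norm_C_R (z : C) : norm (V:=C_R_NormedModule) z = Cmod z.
Proof.
  destruct z as [x y]. change (sqrt (norm x ^ 2 + norm y ^ 2) = sqrt (x ^ 2 + y ^ 2)).
  change (sqrt (Rabs x ^ 2 + Rabs y ^ 2) = sqrt (x ^ 2 + y ^ 2)).
  now rewrite !pow2_abs.
Qed.

(** The inequality is taken from the integral valued in the normed module: bounding real and
    imaginary parts separately would cost a constant factor. *)
Lemma CI_bound f w a b : a <= b -> contI f a b -> contI w a b ->
  (forall x, a <= x <= b -> Cmod (f x) <= w x) -> Cmod (CI f a b) <= RInt w a b.
Proof.
  intros Hab Hf Hw H. rewrite <- norm_C_R.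
  apply (norm_RInt_le (V:=C_R_NormedModule) f w a b); auto.
  intros; rewrite norm_C_R; auto. now apply is_RInt_CI.
  apply (RInt_correct (V:=R_CompleteNormedModule)). now apply ex_RInt_contI.
Qed.

Lemma RInt_const_R a b (M : R) : RInt (fun _ => M) a b = (b - a) * M.
Proof. now rewrite (RInt_const (V:=R_CompleteNormedModule)). Qed.

Lemma CI_bound_const f M a b : a <= b -> contI f a b ->
  (forall x, a <= x <= b -> Cmod (f x) <= M) -> Cmod (CI f a b) <= (b - a) * M.
Proof.
  intros Hab Hf H. rewrite <- (RInt_const_R a b M).
  apply CI_bound; auto. intros x _; apply continuous_const.
Qed.

Lemma CI_ext f g a b : a <= b -> (forall x, a < x < b -> f x = g x) -> CI f a b = CI g a b.
Proof.
  intros Hab H. unfold CI. f_equal; apply (RInt_ext (V:=R_CompleteNormedModule));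
  rewrite Rmin_left, Rmax_right by lra; intros x Hx; now rewrite H.
Qed.

Lemma CI_plus f g a b : a <= b -> contI f a b -> contI g a b ->
  CI (fun x => Cplus (f x) (g x)) a b = Cplus (CI f a b) (CI g a b).
Proof.
  intros Hab Hf Hg.
  apply injective_projections.
  - apply (RInt_plus (V:=R_CompleteNormedModule) (fun x => Re (f x)) (fun x => Re (g x))); apply ex_RInt_Re; auto.
  - apply (RInt_plus (V:=R_CompleteNormedModule) (fun x => Im (f x)) (fun x => Im (g x))); apply ex_RInt_Im; auto.
Qed.

Lemma RInt_lin (f g : R -> R) a b p q : ex_RInt f a b -> ex_RInt g a b ->
  RInt (fun x => p * f x + q * g x) a b = p * RInt f a b + q * RInt g a b.
Proof.
  intros Hf Hg.
  apply (is_RInt_unique (V:=R_CompleteNormedModule)).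
  apply (is_RInt_plus (V:=R_NormedModule) (fun x => p * f x) (fun x => q * g x));
  apply (is_RInt_scal (V:=R_NormedModule)); now apply (RInt_correct (V:=R_CompleteNormedModule)).
Qed.

Lemma CI_scal f c a b : a <= b -> contI f a b ->
  CI (fun x => Cmult c (f x)) a b = Cmult c (CI f a b).
Proof.
  intros Hab Hf. unfold CI, Cmult; simpl. f_equal.
  - rewrite <- (RInt_ext (V:=R_CompleteNormedModule) (fun x => fst c * Re (f x) + - snd c * Im (f x))).
    rewrite RInt_lin; [req; ring | now apply ex_RInt_Re | now apply ex_RInt_Im].
    intros x _. unfold Re, Im; simpl. req; ring.
  - rewrite <- (RInt_ext (V:=R_CompleteNormedModule) (fun x => fst c * Im (f x) + snd c * Re (f x))).
    rewrite RInt_lin; [req; ring | now apply ex_RInt_Im | now apply ex_RInt_Re].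
    intros x _. unfold Re, Im; simpl. req; ring.
Qed.

Lemma CI_minus f g a b : a <= b -> contI f a b -> contI g a b ->
  CI (fun x => Cminus (f x) (g x)) a b = Cminus (CI f a b) (CI g a b).
Proof.
  intros Hab Hf Hg. unfold Cminus. rewrite CI_plus; auto.
  - f_equal. rewrite (CI_ext _ (fun x => Cmult (RtoC (-1)) (g x))); auto.
    rewrite CI_scal; auto. ring. intros; ring.
  - intros x Hx; apply continuous_Copp; auto.
Qed.

Lemma CI_Chasles f a b c : a <= b <= c -> contI f a c ->
  Cplus (CI f a b) (CI f b c) = CI f a c.
Proof.
  intros Hab Hf.
  assert (F1 : contI f a b) by (apply (contI_sub f a c); auto; lra).
  assert (F2 : contI f b c) by (apply (contI_sub f a c); auto; lra).
  apply injective_projections.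
  - apply (RInt_Chasles (V:=R_CompleteNormedModule) (fun x => Re (f x))); apply ex_RInt_Re; auto; lra.
  - apply (RInt_Chasles (V:=R_CompleteNormedModule) (fun x => Im (f x))); apply ex_RInt_Im; auto; lra.
Qed.

(** * Derivatives of complex functions of a real variable *)

Definition cder (f : R -> C) (x : R) (l : C) :=
  is_derive (fun y => Re (f y)) x (Re l) /\ is_derive (fun y => Im (f y)) x (Im l).

Lemma cder_eq f x l l' : cder f x l -> l = l' -> cder f x l'.
Proof. now intros H <-. Qed.
Lemma cder_ext f g x l : (forall y, f y = g y) -> cder f x l -> cder g x l.
Proof.
  intros E [H1 H2]; split; (eapply is_derive_ext; [|eassumption]);
  intros; simpl; now rewrite E.
Qed.
Lemma is_derive_eq (f : R -> R) x l l' : is_derive f x l -> l = l' -> is_derive f x l'.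
Proof. now intros H <-. Qed.
Lemma cder_const c x : cder (fun _ => c) x (RtoC 0).
Proof. split; apply (is_derive_const (V:=R_NormedModule)). Qed.
Lemma cder_plus f g x df dg : cder f x df -> cder g x dg ->
  cder (fun y => Cplus (f y) (g y)) x (Cplus df dg).
Proof. intros [F1 F2] [G1 G2]; split; apply (is_derive_plus (V:=R_NormedModule)); auto. Qed.
Lemma is_derive_Rmult (f g : R -> R) x df dg : is_derive f x df -> is_derive g x dg ->
  is_derive (fun y => f y * g y) x (df * g x + f x * dg).
Proof. intros; apply (is_derive_mult f g); auto. intros; apply Rmult_comm. Qed.
Lemma cder_mult f g x df dg : cder f x df -> cder g x dg ->
  cder (fun y => Cmult (f y) (g y)) x (Cplus (Cmult df (g x)) (Cmult (f x) dg)).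
Proof.
  intros [F1 F2] [G1 G2]; split; simpl.
  - replace (fst df * fst (g x) - snd df * snd (g x) + (fst (f x) * fst dg - snd (f x) * snd dg))
     with ((Re df * Re (g x) + Re (f x) * Re dg) - (Im df * Im (g x) + Im (f x) * Im dg))
      by (unfold Re, Im; ring).
    apply (is_derive_minus (V:=R_NormedModule) (fun y => Re (f y) * Re (g y)) (fun y => Im (f y) * Im (g y)));
    now apply is_derive_Rmult.
  - replace (fst df * snd (g x) + snd df * fst (g x) + (fst (f x) * snd dg + snd (f x) * fst dg))
     with ((Re df * Im (g x) + Re (f x) * Im dg) + (Im df * Re (g x) + Im (f x) * Re dg))
      by (unfold Re, Im; ring).
    apply (is_derive_plus (V:=R_NormedModule) (fun y => Re (f y) * Im (g y)) (fun y => Im (f y) * Re (g y)));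
    now apply is_derive_Rmult.
Qed.
Lemma cder_RtoC f x l : is_derive f x l -> cder (fun y => RtoC (f y)) x (RtoC l).
Proof. intros; split; simpl; auto. apply (is_derive_const (V:=R_NormedModule)). Qed.
Lemma cder_pair f g x df dg : is_derive f x df -> is_derive g x dg ->
  cder (fun y => (f y, g y)) x (df, dg).
Proof. intros; split; simpl; auto. Qed.
Lemma cder_opp f x l : cder f x l -> cder (fun y => Copp (f y)) x (Copp l).
Proof. intros [F1 F2]; split; apply (is_derive_opp (V:=R_NormedModule)); auto. Qed.
Lemma cder_minus f g x df dg : cder f x df -> cder g x dg ->
  cder (fun y => Cminus (f y) (g y)) x (Cminus df dg).
Proof. intros; apply cder_plus; auto; now apply cder_opp. Qed.
Lemma is_derive_exp_comp (f : R -> R) x l : is_derive f x l -> is_derive (fun y => exp (f y)) x (l * exp (f x)).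
Proof. intros. apply (is_derive_comp exp f); auto. apply is_derive_exp. Qed.
Lemma cder_Cexp f x l : cder f x l -> cder (fun y => Cexp (f y)) x (Cmult (Cexp (f x)) l).
Proof.
  intros [F1 F2]; split; simpl.
  - replace (exp (Re (f x)) * cos (Im (f x)) * fst l - exp (Re (f x)) * sin (Im (f x)) * snd l)
     with ((Re l * exp (Re (f x))) * cos (Im (f x)) + exp (Re (f x)) * (Im l * - sin (Im (f x))))
      by (unfold Re, Im; ring).
    apply (is_derive_Rmult (fun y => exp (Re (f y))) (fun y => cos (Im (f y)))).
    + now apply is_derive_exp_comp.
    + apply (is_derive_comp cos (fun y => Im (f y))); auto. apply is_derive_cos.
  - replace (exp (Re (f x)) * cos (Im (f x)) * snd l + exp (Re (f x)) * sin (Im (f x)) * fst l)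
     with ((Re l * exp (Re (f x))) * sin (Im (f x)) + exp (Re (f x)) * (Im l * cos (Im (f x))))
      by (unfold Re, Im; ring).
    apply (is_derive_Rmult (fun y => exp (Re (f y))) (fun y => sin (Im (f y)))).
    + now apply is_derive_exp_comp.
    + apply (is_derive_comp sin (fun y => Im (f y))); auto. apply is_derive_sin.
Qed.
Lemma cder_Cinv f x l : cder f x l -> f x <> RtoC 0 ->
  cder (fun y => Cinv (f y)) x (Copp (Cmult l (Cmult (Cinv (f x)) (Cinv (f x))))).
Proof.
  intros [F1 F2] H0.
  assert (H : Re (f x) ^ 2 + Im (f x) ^ 2 <> 0).
  { intros H. apply H0. unfold Re, Im in *. destruct (f x) as [a b]; simpl in *.
    apply injective_projections; simpl; nra. }
  assert (D : is_derive (fun y => Re (f y) ^ 2 + Im (f y) ^ 2) x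
     (2 * Re (f x) * Re l + 2 * Im (f x) * Im l)).
  { apply (is_derive_ext (fun y => Re (f y) * Re (f y) + Im (f y) * Im (f y))).
    { intros; req; ring. }
    replace (2 * Re (f x) * Re l + 2 * Im (f x) * Im l) with
     ((Re l * Re (f x) + Re (f x) * Re l) + (Im l * Im (f x) + Im (f x) * Im l)) by ring.
    apply (is_derive_plus (V:=R_NormedModule)); now apply is_derive_Rmult. }
  split.
  - assert (E := is_derive_div _ _ x _ _ F1 D H).
    refine (is_derive_eq _ _ _ _ E _).
    unfold Re, Im in *. destruct (f x) as [u v], l as [p q]; simpl in *. field. nra.
  - assert (E := is_derive_div (fun y => - Im (f y)) _ x _ _ (is_derive_opp _ _ _ F2) D H).
    refine (is_derive_eq _ _ _ _ E _). change (opp (Im l)) with (- Im l).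
    unfold Re, Im in *. destruct (f x) as [u v], l as [p q]; simpl in *. field. nra.
Qed.

Ltac cder_step :=
  lazymatch goal with
  | |- cder (fun _ => ?c) _ _ => apply cder_const
  | |- cder (fun x => Cplus _ _) _ _ => apply cder_plus
  | |- cder (fun x => Cminus _ _) _ _ => apply cder_minus
  | |- cder (fun x => Copp _) _ _ => apply cder_opp
  | |- cder (fun x => Cmult _ _) _ _ => apply cder_mult
  | |- cder (fun x => Cexp _) _ _ => apply cder_Cexp
  end.

Lemma CI_derive (f df : R -> C) a b : a <= b ->
  (forall x, a <= x <= b -> cder f x (df x)) -> contI df a b ->
  CI df a b = Cminus (f b) (f a).
Proof.
  intros Hab Hd Hc. unfold CI.
  apply injective_projections; simpl;
  apply (is_RInt_unique (V:=R_CompleteNormedModule)).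
  - apply (is_RInt_derive (V:=R_CompleteNormedModule) (fun x => Re (f x)));
    rewrite Rmin_left, Rmax_right by lra; intros x Hx. apply Hd, Hx. apply continuous_Re, Hc, Hx.
  - apply (is_RInt_derive (V:=R_CompleteNormedModule) (fun x => Im (f x)));
    rewrite Rmin_left, Rmax_right by lra; intros x Hx. apply Hd, Hx. apply continuous_Im, Hc, Hx.
Qed.

Lemma CI_comp (f : R -> C) (g dg : R -> R) a b : a <= b ->
  (forall x, a <= x <= b -> continuous f (g x)) ->
  (forall x, a <= x <= b -> is_derive g x (dg x) /\ continuous dg x) ->
  CI (fun y => Cmult (RtoC (dg y)) (f (g y))) a b = CI f (g a) (g b).
Proof.
  intros Hab Hf Hg. unfold CI.
  apply injective_projections; simpl.
  - rewrite <- (RInt_comp (V:=R_CompleteNormedModule) (fun x => Re (f x)) g dg).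
    + apply (RInt_ext (V:=R_CompleteNormedModule)); intros; unfold scal; simpl.
      unfold mult; simpl. unfold Re; ring.
    + rewrite Rmin_left, Rmax_right by lra. intros; apply continuous_comp; auto.
      now apply (continuous_Re (fun z => z)), continuous_id.
    + rewrite Rmin_left, Rmax_right by lra; auto.
  - rewrite <- (RInt_comp (V:=R_CompleteNormedModule) (fun x => Im (f x)) g dg).
    + apply (RInt_ext (V:=R_CompleteNormedModule)); intros; unfold scal; simpl.
      unfold mult; simpl. unfold Im; ring.
    + rewrite Rmin_left, Rmax_right by lra. intros; apply continuous_comp; auto.
      now apply (continuous_Im (fun z => z)), continuous_id.
    + rewrite Rmin_left, Rmax_right by lra; auto.
Qed.

(** * Parameter integrals, Fubini and Green on a rectangle *)

Definition cont2 {V : UniformSpace} (K : R -> R -> V) (x y : R) :=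
  continuous (fun p : R * R => K (fst p) (snd p)) (x, y).

Lemma cont2_pt (K : R -> R -> R) x y : cont2 K x y <-> continuity_2d_pt K x y.
Proof. unfold cont2. rewrite continuity_2d_pt_filterlim. reflexivity. Qed.

Lemma cont2_l {V : UniformSpace} (K : R -> R -> V) x y : cont2 K x y -> continuous (fun x => K x y) x.
Proof.
  intros H. apply (continuous_comp_2 (fun x : R => x) (fun _ : R => y) K); auto.
  apply continuous_id. apply continuous_const.
Qed.
Lemma cont2_r {V : UniformSpace} (K : R -> R -> V) x y : cont2 K x y -> continuous (fun y => K x y) y.
Proof.
  intros H. apply (continuous_comp_2 (fun _ : R => x) (fun y : R => y) K); auto.
  apply continuous_const. apply continuous_id.
Qed.

Lemma continuous_eps (f : R -> R) x :
  (forall e, 0 < e -> exists d, 0 < d /\ forall y, Rabs (y - x) < d -> Rabs (f y - f x) < e) -> continuous f x.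
Proof.
  intros H. apply continuity_pt_filterlim. intros e He. destruct (H e He) as [d [Hd H']].
  exists d; split; auto. intros y [_ Hy]. apply H', Hy.
Qed.

Lemma continuous_eps_inv (f : R -> R) x : continuous f x ->
  forall e, 0 < e -> exists d, 0 < d /\ forall y, Rabs (y - x) < d -> Rabs (f y - f x) < e.
Proof.
  intros H e He. destruct (proj1 (filterlim_locally f (f x)) H (mkposreal e He)) as [d Hd].
  exists d; split. apply cond_pos. intros y Hy. apply (Hd y Hy).
Qed.

(** Continuity along the compact segment $\{x_0\}\times[c,d]$ is uniform, so for $x$ near $x_0$ the
    integrands differ by less than [e / (d - c + 1)]. The added 1 keeps the quotient meaningful when
    [c = d]. *)
Lemma continuous_RInt_param (K : R -> R -> R) c d x0 : c <= d ->
  (forall x y, c <= y <= d -> cont2 K x y) -> continuous (fun x => RInt (K x) c d) x0.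
Proof.
  intros Hcd H. apply continuous_eps. intros e He.
  assert (He' : 0 < e / (d - c + 1)) by (apply Rdiv_lt_0_compat; lra).
  destruct (uniform_continuity_2d_1d' K c d x0 (fun y Hy => proj1 (cont2_pt K x0 y) (H x0 y Hy))
    (mkposreal _ He')) as [del Hdel]; simpl in Hdel.
  assert (D := cond_pos del).
  exists del; split; auto. intros y Hy. apply Rabs_def2 in Hy.
  assert (E : forall x, ex_RInt (K x) c d).
  { intros x; apply ex_RInt_contI; auto. intros z Hz. apply cont2_r, H, Hz. }
  replace (RInt (K y) c d - RInt (K x0) c d) with (RInt (fun t => 1 * K y t + -1 * K x0 t) c d)
    by (rewrite RInt_lin by apply E; req; ring).
  apply Rle_lt_trans with ((d - c) * (e / (d - c + 1))).
  - apply (abs_RInt_le_const (fun t => 1 * K y t + -1 * K x0 t)); auto.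
    + apply (ex_RInt_plus (V:=R_NormedModule)); apply (ex_RInt_scal (V:=R_NormedModule)); apply E.
    + intros t Ht. left. replace (1 * K y t + -1 * K x0 t) with (K y t - K x0 t) by ring.
      apply (Hdel t x0 t y); try lra. rewrite Rminus_eq_0, Rabs_R0; auto.
  - apply Rmult_lt_reg_r with (d - c + 1); [lra|].
    field_simplify; [|lra]. nra.
Qed.

(** The right-hand side with [b] replaced by $x$ is [G x]; it vanishes at [a], and differentiation
    under the integral sign gives it the derivative $\int_c^d K(x,y)\,dy$. The fundamental theorem
    then yields the left-hand side. Continuity on the whole plane spares a discussion of one-sided
    neighbourhoods; [RInt_Fubini] removes it. *)
Lemma RInt_Fubini_glob (K : R -> R -> R) a b c d : a <= b -> c <= d ->
  (forall x y, cont2 K x y) ->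
  RInt (fun x => RInt (fun y => K x y) c d) a b = RInt (fun y => RInt (fun x => K x y) a b) c d.
Proof.
  intros Hab Hcd HK.
  assert (E1 : forall x a b, ex_RInt (fun y => K x y) a b).
  { intros x a' b'. apply (ex_RInt_continuous (V:=R_CompleteNormedModule)). intros z _. apply cont2_r, HK. }
  assert (E2 : forall y a b, ex_RInt (fun x => K x y) a b).
  { intros x a' b'. apply (ex_RInt_continuous (V:=R_CompleteNormedModule)). intros z _. apply cont2_l, HK. }
  set (G := fun x => RInt (fun y => RInt (fun u => K u y) a x) c d).
  assert (Dk : forall x y, is_derive (fun x => RInt (fun u => K u y) a x) x (K x y)).
  { intros x y. apply (is_derive_RInt (V:=R_NormedModule) (fun u => K u y) (fun x => RInt (fun u => K u y) a x) a).
    - apply filter_forall. intros z. apply (RInt_correct (V:=R_CompleteNormedModule)), E2.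
    - apply cont2_l, HK. }
  assert (C2 : forall x y, cont2 (fun x y => RInt (fun u => K u y) a x) x y).
  { intros x0 y0. unfold cont2. apply continuity_2d_pt_filterlim with (f := fun x y => RInt (fun u => K u y) a x).
    intros e.
    (* near (x0,y0): compare with the fixed upper limit x0 *)
    set (M := Rabs x0 + Rabs a + 1).
    assert (HM : a <= M /\ -M <= a /\ -M <= x0 - 1 /\ x0 + 1 <= M).
    { unfold M. unfold Rabs; destruct Rcase_abs, Rcase_abs; lra. }
    destruct (uniform_continuity_2d_1d K (-M) M y0 (fun x _ => proj1 (cont2_pt K x y0) (HK x y0))
       (mkposreal 1 Rlt_0_1)) as [d1 Hd1]; simpl in Hd1.
    assert (He : 0 < e / 2 / (2 * M)). { apply Rdiv_lt_0_compat. apply is_pos_div_2. lra. }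
    destruct (uniform_continuity_2d_1d K (-M) M y0 (fun x _ => proj1 (cont2_pt K x y0) (HK x y0))
       (mkposreal _ He)) as [d2 Hd2]; simpl in Hd2.
    assert (BK : exists B, 0 < B /\ forall x, -M <= x <= M -> Rabs (K x y0) <= B).
    { destruct (continuity_ab_maj (fun x => Rabs (K x y0)) (-M) M) as [m [Hm _]]. lra.
      intros x _. apply continuity_pt_filterlim. apply (continuous_Rabs_comp (fun x => K x y0)). apply (cont2_l K), HK.
      exists (Rabs (K m y0) + 1). split. assert (q := Rabs_pos (K m y0)); lra.
      intros; specialize (Hm x H); lra. }
    destruct BK as [B [HB0 HB]].
    assert (He3 : 0 < Rmin 1 (Rmin d1 (Rmin d2 (e / 2 / (B + 1))))).
    { repeat apply Rmin_pos; try lra; try apply cond_pos. apply Rdiv_lt_0_compat; [apply is_pos_div_2|lra]. }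
    exists (mkposreal _ He3); simpl. intros x y Hx Hy.
    assert (H1 := Rmin_l 1 (Rmin d1 (Rmin d2 (e / 2 / (B + 1))))).
    assert (H2 := Rmin_r 1 (Rmin d1 (Rmin d2 (e / 2 / (B + 1))))).
    assert (H3 := Rmin_l d1 (Rmin d2 (e / 2 / (B + 1)))).
    assert (H4 := Rmin_r d1 (Rmin d2 (e / 2 / (B + 1)))).
    assert (H5 := Rmin_l d2 (e / 2 / (B + 1))).
    assert (H6 := Rmin_r d2 (e / 2 / (B + 1))).
    assert (Hx' := Rabs_def2 _ _ Hx). assert (Hy' := Rabs_def2 _ _ Hy).
    assert (P1 := cond_pos d1). assert (P2 := cond_pos d2).
    rewrite <- (RInt_Chasles (V:=R_CompleteNormedModule) (fun u => K u y) a x0 x) by apply E2.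
    change plus with Rplus.
    replace (RInt (fun u => K u y) a x0 + RInt (fun u => K u y) x0 x - RInt (fun u => K u y0) a x0)
     with (RInt (fun u => 1 * K u y + -1 * K u y0) a x0 + RInt (fun u => K u y) x0 x)
      by (rewrite RInt_lin by apply E2; req; ring).
    apply Rle_lt_trans with (Rabs (RInt (fun u => 1 * K u y + -1 * K u y0) a x0) + Rabs (RInt (fun u => K u y) x0 x)).
    apply Rabs_triang.
    assert (EE : forall p q, ex_RInt (fun u => 1 * K u y + -1 * K u y0) p q).
    { intros. apply (ex_RInt_plus (V:=R_NormedModule)); apply (ex_RInt_scal (V:=R_NormedModule)); apply E2. }
    assert (Q1 : Rabs (RInt (fun u => 1 * K u y + -1 * K u y0) a x0) <= Rabs (x0 - a) * (e / 2 / (2 * M))).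
    { destruct (Rle_dec a x0).
      - rewrite (Rabs_pos_eq (x0 - a)) by lra. apply (abs_RInt_le_const (fun u => 1 * K u y + -1 * K u y0)); auto.
        intros t Ht. left. replace (1 * K t y + -1 * K t y0) with (K t y - K t y0) by ring.
        apply (Hd2 t y0 t y); try lra. rewrite Rminus_eq_0, Rabs_R0; auto.
      - rewrite <- (opp_RInt_swap (V:=R_CompleteNormedModule)) by apply EE. change opp with Ropp. rewrite Rabs_Ropp.
        rewrite (Rabs_minus_sym x0 a). rewrite (Rabs_pos_eq (a - x0)) by lra.
        apply (abs_RInt_le_const (fun u => 1 * K u y + -1 * K u y0)); auto; try lra.
        intros t Ht. left. replace (1 * K t y + -1 * K t y0) with (K t y - K t y0) by ring.
        apply (Hd2 t y0 t y); try lra. rewrite Rminus_eq_0, Rabs_R0; auto. }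
    assert (Q2 : Rabs (RInt (fun u => K u y) x0 x) <= Rabs (x - x0) * (B + 1)).
    { assert (HB' : forall t, -M <= t <= M -> Rabs (K t y) <= B + 1).
      { intros t Ht. replace (K t y) with (K t y0 + (K t y - K t y0)) by ring.
        eapply Rle_trans; [apply Rabs_triang|]. specialize (HB t Ht).
        assert (Rabs (K t y - K t y0) < 1); [|lra].
        apply (Hd1 t y0 t y); try lra. rewrite Rminus_eq_0, Rabs_R0; auto. }
      destruct (Rle_dec x0 x).
      - rewrite (Rabs_pos_eq (x - x0)) by lra. apply (abs_RInt_le_const (fun u => K u y)); auto.
        intros t Ht. apply HB'; lra.
      - rewrite <- (opp_RInt_swap (V:=R_CompleteNormedModule)) by apply E2. change opp with Ropp. rewrite Rabs_Ropp.
        rewrite (Rabs_minus_sym x x0). rewrite (Rabs_pos_eq (x0 - x)) by lra.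
        apply (abs_RInt_le_const (fun u => K u y)); auto; try lra.
        intros t Ht. apply HB'; lra. }
    assert (Q3 : Rabs (x0 - a) * (e / 2 / (2 * M)) <= e / 2).
    { assert (Rabs (x0 - a) <= 2 * M). { apply Rabs_le; lra. }
      apply Rle_trans with (2 * M * (e / 2 / (2 * M))). apply Rmult_le_compat_r; lra.
      right; field. lra. }
    assert (Q4 : Rabs (x - x0) * (B + 1) < e / 2).
    { apply Rlt_le_trans with (e / 2 / (B + 1) * (B + 1)). apply Rmult_lt_compat_r; lra. right; field; lra. }
    lra. }
  assert (DG : forall x, is_derive G x (RInt (fun y => K x y) c d)).
  { intros x. unfold G.
    replace (RInt (fun y => K x y) c d) with
      (RInt (fun t => Derive (fun u => RInt (fun u' => K u' t) a u) x) c d).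
    2:{ apply (RInt_ext (V:=R_CompleteNormedModule)). intros t _. apply is_derive_unique, Dk. }
    apply (is_derive_RInt_param (fun x y => RInt (fun u => K u y) a x) c d x).
    - apply filter_forall. intros z t _. eexists; apply Dk.
    - intros t _. apply continuity_2d_pt_ext with K.
      intros; symmetry; apply is_derive_unique, Dk. apply cont2_pt, HK.
    - apply filter_forall. intros z. apply (ex_RInt_continuous (V:=R_CompleteNormedModule)).
      intros t _. apply (cont2_r (fun x y => RInt (fun u => K u y) a x)), C2. }
  transitivity (G b - G a).
  - apply (is_RInt_unique (V:=R_CompleteNormedModule)).
    apply (is_RInt_derive (V:=R_CompleteNormedModule) G); intros x _. apply DG.
    apply (continuous_RInt_param K); auto.
  - unfold G. rewrite (RInt_ext (V:=R_CompleteNormedModule) (fun y => RInt (fun u => K u y) a a) (fun _ => 0)).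
    rewrite RInt_const_R. req; ring. intros; apply (RInt_point (V:=R_CompleteNormedModule)).
Qed.

(** Retraction of the line onto the interval. Composing with it extends a function that is
    continuous on an interval or a rectangle to the whole space, with the same values there and the
    same bounds. *)
Definition clamp (a b x : R) := Rmax a (Rmin b x).
Lemma clamp_in a b x : a <= b -> a <= clamp a b x <= b.
Proof. intros; unfold clamp, Rmax, Rmin. destruct (Rle_dec b x), (Rle_dec a _); lra. Qed.
Lemma clamp_id a b x : a <= x <= b -> clamp a b x = x.
Proof. intros; unfold clamp, Rmax, Rmin. destruct (Rle_dec b x), (Rle_dec a _); lra. Qed.
Lemma clamp_lip a b x y : Rabs (clamp a b x - clamp a b y) <= Rabs (x - y).
Proof.
  unfold clamp, Rmax, Rmin.
  destruct (Rle_dec b x), (Rle_dec b y); repeat match goal with |- context [Rle_dec ?u ?v] => destruct (Rle_dec u v) end;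
  unfold Rabs; repeat match goal with |- context [Rcase_abs ?u] => destruct (Rcase_abs u) end; lra.
Qed.
Lemma clamp_cont {U : UniformSpace} a b (f : U -> R) x : continuous f x -> continuous (fun y => clamp a b (f y)) x.
Proof.
  intros H. apply (continuous_comp f (clamp a b)); auto.
  apply continuous_eps. intros e He. exists e; split; auto. intros y Hy.
  eapply Rle_lt_trans; [apply clamp_lip|auto].
Qed.

Lemma RInt_Fubini (K : R -> R -> R) a b c d : a <= b -> c <= d ->
  (forall x y, a <= x <= b -> c <= y <= d -> cont2 K x y) ->
  RInt (fun x => RInt (fun y => K x y) c d) a b = RInt (fun y => RInt (fun x => K x y) a b) c d.
Proof.
  intros Hab Hcd HK.
  set (K' := fun x y => K (clamp a b x) (clamp c d y)).
  assert (L := RInt_Fubini_glob K' a b c d Hab Hcd).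
  assert (X : RInt (fun x => RInt (fun y => K' x y) c d) a b = RInt (fun x => RInt (fun y => K x y) c d) a b).
  { apply (RInt_ext (V:=R_CompleteNormedModule)). rewrite Rmin_left, Rmax_right by lra. intros x Hx.
    apply (RInt_ext (V:=R_CompleteNormedModule)). rewrite Rmin_left, Rmax_right by lra. intros y Hy.
    unfold K'. rewrite !clamp_id by lra. reflexivity. }
  assert (Y : RInt (fun y => RInt (fun x => K' x y) a b) c d = RInt (fun y => RInt (fun x => K x y) a b) c d).
  { apply (RInt_ext (V:=R_CompleteNormedModule)). rewrite Rmin_left, Rmax_right by lra. intros x Hx.
    apply (RInt_ext (V:=R_CompleteNormedModule)). rewrite Rmin_left, Rmax_right by lra. intros y Hy.
    unfold K'. rewrite !clamp_id by lra. reflexivity. }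
  rewrite <- X, <- Y. apply L.
  intros x y. unfold cont2, K'.
  apply (continuous_comp_2 (fun p : R * R => clamp a b (fst p)) (fun p : R * R => clamp c d (snd p)) K).
  apply clamp_cont. apply continuous_fst_p. apply clamp_cont. apply continuous_snd_p.
  apply HK; now apply clamp_in.
Qed.

Lemma cont2_Re (K : R -> R -> C) x y : cont2 K x y -> cont2 (fun x y => Re (K x y)) x y.
Proof. intros H. apply (continuous_Re (fun p : R * R => K (fst p) (snd p))), H. Qed.
Lemma cont2_Im (K : R -> R -> C) x y : cont2 K x y -> cont2 (fun x y => Im (K x y)) x y.
Proof. intros H. apply (continuous_Im (fun p : R * R => K (fst p) (snd p))), H. Qed.

Lemma CI_Fubini (K : R -> R -> C) a b c d : a <= b -> c <= d ->
  (forall x y, a <= x <= b -> c <= y <= d -> cont2 K x y) ->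
  CI (fun x => CI (fun y => K x y) c d) a b = CI (fun y => CI (fun x => K x y) a b) c d.
Proof.
  intros Hab Hcd HK. unfold CI; simpl. f_equal.
  - apply (RInt_Fubini (fun x y => Re (K x y))); auto. intros; apply cont2_Re; auto.
  - apply (RInt_Fubini (fun x y => Im (K x y))); auto. intros; apply cont2_Im; auto.
Qed.

(** With $\partial_u B=\partial_v A=K$, both sides are the integral of $K$ over the rectangle, taken
    in the two orders. No second derivative of a potential occurs. *)
Lemma green (A B K : R -> R -> C) a b c d : a <= b -> c <= d ->
  (forall u v, a <= u <= b -> c <= v <= d ->
     cder (fun u => B u v) u (K u v) /\ cder (fun v => A u v) v (K u v) /\ cont2 K u v) ->
  CI (fun v => Cminus (B b v) (B a v)) c d = CI (fun u => Cminus (A u d) (A u c)) a b.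
Proof.
  intros Hab Hcd H.
  rewrite (CI_ext _ (fun v => CI (fun u => K u v) a b)); auto.
  - rewrite <- CI_Fubini; auto.
    + apply CI_ext; auto. intros u Hu. apply CI_derive; auto.
      intros v Hv. apply H; lra. intros v Hv. apply cont2_r, H; lra.
    + intros; apply H; auto.
  - intros v Hv. symmetry. apply CI_derive with (f := fun u => B u v); auto.
    intros u Hu. apply H; lra. intros u Hu. apply (cont2_l K), H; lra.
Qed.

Lemma Cmod_minus_sym x y : Cmod (Cminus x y) = Cmod (Cminus y x).
Proof. rewrite <- Cmod_opp. f_equal. ring. Qed.
Lemma Cmod_minus_triangle x y z : Cmod (Cminus x z) <= Cmod (Cminus x y) + Cmod (Cminus y z).
Proof. replace (Cminus x z) with (Cplus (Cminus x y) (Cminus y z)) by ring. apply Cmod_triangle. Qed.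
Lemma Cmod_small_eq x y : (forall e, 0 < e -> Cmod (Cminus x y) <= e) -> x = y.
Proof.
  intros H. assert (H0 : Cmod (Cminus x y) = 0).
  { apply Rle_antisym; [|apply Cmod_ge_0]. apply le_epsilon. intros; rewrite Rplus_0_l; auto. }
  apply Cmod_eq_0 in H0. replace x with (Cplus (Cminus x y) y) by ring. rewrite H0. ring.
Qed.

Lemma continuous_CI_param (K : R -> R -> C) c d x0 : c <= d ->
  (forall x y, c <= y <= d -> cont2 K x y) -> continuous (fun x => CI (K x) c d) x0.
Proof.
  intros Hcd H. apply continuous_C.
  - apply (continuous_RInt_param (fun x y => Re (K x y))); auto. intros; apply cont2_Re; auto.
  - apply (continuous_RInt_param (fun x y => Im (K x y))); auto. intros; apply cont2_Im; auto.
Qed.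

Lemma continuous_C_eps (f : R -> C) x :
  (forall e, 0 < e -> exists d, 0 < d /\ forall y, Rabs (y - x) < d -> Cmod (Cminus (f y) (f x)) < e) -> continuous f x.
Proof.
  intros H. apply continuous_C; apply continuous_eps; intros e He;
  destruct (H e He) as [d [Hd Hd']]; exists d; split; auto; intros y Hy; specialize (Hd' y Hy);
  (eapply Rle_lt_trans; [|apply Hd']).
  - apply (re_le_Cmod (Cminus (f y) (f x))).
  - apply (Rle_trans _ _ _ (Rmax_r _ _) (Rmax_Cmod (Cminus (f y) (f x)))).
Qed.

Lemma continuous_C_eps_inv (f : R -> C) x : continuous f x ->
  forall e, 0 < e -> exists d, 0 < d /\ forall y, Rabs (y - x) < d -> Cmod (Cminus (f y) (f x)) < e.
Proof.
  intros H e He.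
  destruct (continuous_eps_inv (fun y => Cmod (Cminus (f y) (f x))) x) with (e := e) as [d [Hd Hd']]; auto.
  { cont. }
  exists d; split; auto. intros y Hy. specialize (Hd' y Hy).
  replace (Cminus (f x) (f x)) with (RtoC 0) in Hd' by ring. rewrite Cmod_0, Rminus_0_r in Hd'.
  rewrite Rabs_pos_eq in Hd'; auto. apply Cmod_ge_0.
Qed.

(** * Improper integrals of dominated functions *)

Definition contR {V : UniformSpace} (f : R -> V) := forall x, continuous f x.
Lemma contR_I {V : UniformSpace} (f : R -> V) a b : contR f -> contI f a b.
Proof. intros H x _; apply H. Qed.

(** Continuous integrable majorants. Integrability is expressed by small tails, because every later
    estimate needs a cutoff $T$ that depends on the majorant alone. *)
Definition good_weight (w : R -> R) :=
  contR w /\ (forall x, 0 <= w x) /\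
  forall e, 0 < e -> exists T, 0 < T /\ forall a b, T <= a <= b -> RInt w a b <= e /\ RInt w (- b) (- a) <= e.

(** The two ends tend to infinity independently, so this is the improper integral and not a
    principal value; reflection and translation are then immediate. *)
Definition is_Int (g : R -> C) (l : C) :=
  forall e, 0 < e -> exists T, 0 < T /\ forall a b, a <= - T -> T <= b -> Cmod (Cminus (CI g a b) l) <= e.

(* A symmetric limit with an unspecified value when it diverges: meaningful only for integrands dominated by a [good_weight]. *)
Definition IntR (g : R -> C) : C :=
  (real (Lim_seq (fun n => Re (CI g (- INR n) (INR n)))), real (Lim_seq (fun n => Im (CI g (- INR n) (INR n))))).

Lemma nat_above (T : R) : exists N : nat, forall n, (N <= n)%nat -> T <= INR n.
Proof.
  exists (Z.to_nat (up (Rabs T))). intros n Hn. apply le_INR in Hn.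
  destruct (archimed (Rabs T)) as [H _]. assert (q := Rabs_pos T).
  rewrite INR_IZR_INZ, Z2Nat.id in Hn. assert (q' := Rle_abs T). lra.
  apply le_IZR. lra.
Qed.

Lemma is_Int_Int g l : is_Int g l -> IntR g = l.
Proof.
  intros H. unfold IntR. destruct l as [p q].
  assert (HH : forall e : posreal, exists N : nat, forall n, (N <= n)%nat -> Cmod (Cminus (CI g (- INR n) (INR n)) (p, q)) < e).
  { intros e. destruct (H (e / 2) (is_pos_div_2 e)) as [T [HT HT']].
    destruct (nat_above T) as [N HN]. exists N. intros n Hn. specialize (HN n Hn).
    eapply Rle_lt_trans. apply HT'; lra. assert (X := cond_pos e). lra. }
  f_equal.
  - rewrite (is_lim_seq_unique _ (Finite p)); [reflexivity|]. apply is_lim_seq_spec.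
    intros e. destruct (HH e) as [N HN]. exists N. intros n Hn.
    eapply Rle_lt_trans; [|apply (HN n Hn)].
    apply (re_le_Cmod (Cminus (CI g (- INR n) (INR n)) (p, q))).
  - rewrite (is_lim_seq_unique _ (Finite q)); [reflexivity|]. apply is_lim_seq_spec.
    intros e. destruct (HH e) as [N HN]. exists N. intros n Hn.
    eapply Rle_lt_trans; [|apply (HN n Hn)].
    apply (Rle_trans _ _ _ (Rmax_r _ _) (Rmax_Cmod (Cminus (CI g (- INR n) (INR n)) (p, q)))).
Qed.

Lemma is_Int_ext g h l : (forall x, g x = h x) -> is_Int g l -> is_Int h l.
Proof.
  intros E H e He. destruct (H e He) as [T [HT HT']]. exists T; split; auto.
  intros a b Ha Hb. rewrite (CI_ext h g); auto. lra.
Qed.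

Lemma is_Int_eq g l l' : is_Int g l -> l = l' -> is_Int g l'.
Proof. now intros H <-. Qed.

Lemma is_Int_plus g h l m : contR g -> contR h -> is_Int g l -> is_Int h m ->
  is_Int (fun x => Cplus (g x) (h x)) (Cplus l m).
Proof.
  intros Cg Ch Hg Hh e He.
  destruct (Hg (e / 2)) as [T1 [HT1 H1]]. lra. destruct (Hh (e / 2)) as [T2 [HT2 H2]]. lra.
  exists (Rmax T1 T2). assert (q1 := Rmax_l T1 T2). assert (q2 := Rmax_r T1 T2). split. lra.
  intros a b Ha Hb. rewrite CI_plus by (try lra; now apply contR_I).
  replace (Cminus _ _) with (Cplus (Cminus (CI g a b) l) (Cminus (CI h a b) m)) by ring.
  eapply Rle_trans; [apply Cmod_triangle|].
  specialize (H1 a b). specialize (H2 a b). lra.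
Qed.

Lemma is_Int_scal g c l : contR g -> is_Int g l -> is_Int (fun x => Cmult c (g x)) (Cmult c l).
Proof.
  intros Cg Hg e He. assert (P := Cmod_ge_0 c).
  destruct (Hg (e / (Cmod c + 1))) as [T [HT H]]. apply Rdiv_lt_0_compat; lra.
  exists T; split; auto. intros a b Ha Hb. rewrite CI_scal by (try lra; now apply contR_I).
  replace (Cminus _ _) with (Cmult c (Cminus (CI g a b) l)) by ring. rewrite Cmod_mult.
  apply Rle_trans with (Cmod c * (e / (Cmod c + 1))).
  apply Rmult_le_compat_l; auto.
  apply Rle_trans with ((Cmod c + 1) * (e / (Cmod c + 1))).
  apply Rmult_le_compat_r. left; apply Rdiv_lt_0_compat; lra. lra. right; field. lra.
Qed.

Lemma is_Int_minus g h l m : contR g -> contR h -> is_Int g l -> is_Int h m ->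
  is_Int (fun x => Cminus (g x) (h x)) (Cminus l m).
Proof.
  intros Cg Ch Hg Hh. apply is_Int_eq with (Cplus l (Cmult (RtoC (-1)) m)); [|ring].
  apply is_Int_ext with (fun x => Cplus (g x) (Cmult (RtoC (-1)) (h x))). intros; ring.
  apply is_Int_plus; auto. intros x; cont. apply Ch. now apply is_Int_scal.
Qed.

Lemma is_Int_0 : is_Int (fun _ => RtoC 0) (RtoC 0).
Proof.
  intros e He. exists 1. split. lra. intros a b Ha Hb.
  replace (Cminus (CI (fun _ => RtoC 0) a b) (RtoC 0)) with (CI (fun _ => RtoC 0) a b) by ring.
  apply Rle_trans with ((b - a) * 0); [|lra]. apply CI_bound_const. lra.
  intros u _; cont. intros; rewrite Cmod_0; lra.
Qed.

Lemma is_Int_shift g h l : contR g -> is_Int g l -> is_Int (fun x => g (x + h)) l.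
Proof.
  intros Cg Hg e He. destruct (Hg e He) as [T [HT H]].
  exists (T + Rabs h). assert (q1 := Rle_abs h). assert (q2 := Rle_abs (- h)). rewrite Rabs_Ropp in q2.
  split. lra. intros a b Ha Hb.
  rewrite (CI_ext _ (fun y => Cmult (RtoC 1) (g (y + h)))).
  rewrite (CI_comp g (fun y => y + h) (fun _ => 1)). apply H; lra. lra.
  intros; apply Cg. intros x _. split. 2: apply continuous_const.
  auto_derive; auto. lra. intros; symmetry; apply Cmult_1_l.
Qed.

Lemma RInt_contR_Chasles w a b c : contR w -> RInt w a b + RInt w b c = RInt w a c.
Proof.
  intros H. apply (RInt_Chasles (V:=R_CompleteNormedModule) w);
  apply (ex_RInt_continuous (V:=R_CompleteNormedModule)); intros; apply H.
Qed.

Lemma ex_RInt_contR (w : R -> R) a b : contR w -> ex_RInt w a b.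
Proof. intros H; apply (ex_RInt_continuous (V:=R_CompleteNormedModule)); intros; apply H. Qed.

Lemma RInt_pos w a b : a <= b -> contR w -> (forall x, 0 <= w x) -> 0 <= RInt w a b.
Proof. intros. apply RInt_ge_0; auto. now apply ex_RInt_contR. Qed.

Lemma good_weight_bound w : good_weight w -> exists B, 0 <= B /\ forall a b, a <= b -> RInt w a b <= B.
Proof.
  intros [Cw [Pw Hw]]. destruct (Hw 1 Rlt_0_1) as [T [HT H]].
  assert (P0 : 0 <= RInt w (- T) T) by (apply RInt_pos; auto; lra).
  exists (RInt w (- T) T + 2). split. lra.
  intros a b Hab.
  set (A := Rmin a (- T)). set (B := Rmax b T).
  assert (HA : A <= a /\ A <= - T) by (split; [apply Rmin_l|apply Rmin_r]).
  assert (HB : b <= B /\ T <= B) by (split; [apply Rmax_l|apply Rmax_r]).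
  assert (E1 := RInt_contR_Chasles w A a b Cw). assert (E2 := RInt_contR_Chasles w A b B Cw).
  assert (E3 := RInt_contR_Chasles w A (- T) T Cw). assert (E4 := RInt_contR_Chasles w A T B Cw).
  assert (0 <= RInt w A a) by (apply RInt_pos; auto; lra).
  assert (0 <= RInt w b B) by (apply RInt_pos; auto; lra).
  assert (X1 : RInt w T B <= 1) by (destruct (H T B); lra).
  assert (X2 : RInt w (- (- A)) (- T) <= 1) by (destruct (H T (- A)); lra).
  rewrite Ropp_involutive in X2. lra.
Qed.

Definition dominated (g : R -> C) (w : R -> R) := contR g /\ forall x, Cmod (g x) <= w x.

Lemma dominated_CI g w a b : a <= b -> contR w -> dominated g w -> Cmod (CI g a b) <= RInt w a b.
Proof. intros Hab Cw [Cg Hg]. apply CI_bound; auto; now apply contR_I. Qed.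

Definition tail_at (w : R -> R) (e T : R) :=
  0 < T /\ forall a b, T <= a <= b -> RInt w a b <= e /\ RInt w (- b) (- a) <= e.

Lemma dominated_tail g w e T a b a' b' : contR w -> dominated g w -> tail_at w e T ->
  a <= - T -> T <= b -> a' <= a -> b <= b' -> Cmod (Cminus (CI g a' b') (CI g a b)) <= 2 * e.
Proof.
  intros Cw D [HT H] Ha Hb Ha' Hb'.
  rewrite <- (CI_Chasles g a' b b') by (try lra; apply contR_I, D).
  rewrite <- (CI_Chasles g a' a b) by (try lra; apply contR_I, D).
  replace (Cminus _ _) with (Cplus (CI g a' a) (CI g b b')) by ring.
  eapply Rle_trans; [apply Cmod_triangle|].
  assert (X := dominated_CI g w a' a Ha' Cw D). assert (Y := dominated_CI g w b b' Hb' Cw D).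
  assert (Z1 : RInt w (- (- a')) (- (- a)) <= e) by (destruct (H (- a) (- a')); lra).
  assert (Z2 : RInt w b b' <= e) by (destruct (H b b'); lra).
  rewrite !Ropp_involutive in Z1. lra.
Qed.

Lemma dominated_tail2 g w e T a b a' b' : contR w -> dominated g w -> tail_at w e T ->
  a <= - T -> T <= b -> a' <= - T -> T <= b' -> Cmod (Cminus (CI g a' b') (CI g a b)) <= 4 * e.
Proof.
  intros Cw D Ht Ha Hb Ha' Hb'.
  assert (X := dominated_tail g w e T a b (Rmin a a') (Rmax b b') Cw D Ht Ha Hb (Rmin_l _ _) (Rmax_l _ _)).
  assert (Y := dominated_tail g w e T a' b' (Rmin a a') (Rmax b b') Cw D Ht Ha' Hb' (Rmin_r _ _) (Rmax_r _ _)).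
  eapply Rle_trans; [apply (Cmod_minus_triangle _ (CI g (Rmin a a') (Rmax b b')))|].
  rewrite Cmod_minus_sym. lra.
Qed.

Lemma Cauchy_Re_Im (u : nat -> C) :
  (forall e, 0 < e -> exists N : nat, forall n m, (N <= n)%nat -> (N <= m)%nat -> Cmod (Cminus (u n) (u m)) <= e) ->
  exists l : C, forall e, 0 < e -> exists N : nat, forall n, (N <= n)%nat -> Cmod (Cminus (u n) l) <= e.
Proof.
  intros H.
  assert (C1 : ex_finite_lim_seq (fun n => Re (u n))).
  { apply ex_lim_seq_cauchy_corr. intros e. destruct (H (e / 2) (is_pos_div_2 e)) as [N HN].
    exists N. intros n m Hn Hm. eapply Rle_lt_trans; [apply (re_le_Cmod (Cminus (u n) (u m)))|].
    eapply Rle_lt_trans; [apply HN; auto|]. assert (X := cond_pos e); lra. }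
  assert (C2 : ex_finite_lim_seq (fun n => Im (u n))).
  { apply ex_lim_seq_cauchy_corr. intros e. destruct (H (e / 2) (is_pos_div_2 e)) as [N HN].
    exists N. intros n m Hn Hm.
    eapply Rle_lt_trans; [apply (Rle_trans _ _ _ (Rmax_r _ _) (Rmax_Cmod (Cminus (u n) (u m))))|].
    eapply Rle_lt_trans; [apply HN; auto|]. assert (X := cond_pos e); lra. }
  destruct C1 as [p Hp], C2 as [q Hq]. exists (p, q). intros e He.
  apply is_lim_seq_spec in Hp. apply is_lim_seq_spec in Hq.
  assert (He2 : 0 < e / 2) by lra.
  destruct (Hp (mkposreal _ He2)) as [N1 H1]. destruct (Hq (mkposreal _ He2)) as [N2 H2].
  exists (max N1 N2). intros n Hn.
  specialize (H1 n (Nat.le_trans _ _ _ (Nat.le_max_l _ _) Hn)). specialize (H2 n (Nat.le_trans _ _ _ (Nat.le_max_r _ _) Hn)).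
  simpl in H1, H2.
  replace (Cminus (u n) (p, q)) with (Cplus (RtoC (Re (u n) - p)) (Cmult Ci (RtoC (Im (u n) - q)))).
  2:{ unfold Re, Im. destruct (u n). apply injective_projections; simpl; ring. }
  eapply Rle_trans; [apply Cmod_triangle|]. rewrite Cmod_mult, !Cmod_R.
  replace (Cmod Ci) with 1. lra. unfold Cmod, Ci; simpl. replace (0 * (0 * 1) + 1 * (1 * 1)) with 1 by ring. symmetry; apply sqrt_1.
Qed.

(** The cutoff comes from [w] only, so the error is uniform over all integrands dominated by [w];
    continuity in a parameter and Fubini on a strip rest on this. The constant 4 arises because two
    intervals are compared through a common larger one, each time with two tails. *)
Lemma Int_tail g w e T : good_weight w -> dominated g w -> tail_at w e T ->
  is_Int g (IntR g) /\ forall a b, a <= - T -> T <= b -> Cmod (Cminus (CI g a b) (IntR g)) <= 4 * e.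
Proof.
  intros [Cw [Pw Hw]] D Ht.
  destruct (Cauchy_Re_Im (fun n => CI g (- INR n) (INR n))) as [l Hl].
  { intros e' He'. destruct (Hw (e' / 4)) as [T' [HT' H']]. lra.
    destruct (nat_above T') as [N HN]. exists N. intros n m Hn Hm.
    specialize (HN n Hn) as X. specialize (HN m Hm) as Y.
    eapply Rle_trans. apply (dominated_tail2 g w (e' / 4) T'); auto; try lra. split; auto. lra. }
  assert (L : forall e T, tail_at w e T -> forall a b, a <= - T -> T <= b -> Cmod (Cminus (CI g a b) l) <= 4 * e).
  { intros e' T' Ht' a b Ha Hb. apply le_epsilon. intros d Hd.
    destruct (Hl d Hd) as [N HN]. destruct (nat_above T') as [N' HN'].
    specialize (HN (max N N') (Nat.le_max_l _ _)). specialize (HN' (max N N') (Nat.le_max_r _ _)).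
    eapply Rle_trans; [apply (Cmod_minus_triangle _ (CI g (- INR (max N N')) (INR (max N N'))))|].
    assert (X := dominated_tail2 g w e' T' (- INR (max N N')) (INR (max N N')) a b Cw D Ht').
    lra. }
  assert (I : is_Int g l).
  { intros e' He'. destruct (Hw (e' / 4)) as [T' [HT' H']]. lra. exists T'. split; auto.
    intros a b Ha Hb. replace e' with (4 * (e' / 4)) by field. apply (L _ T'); auto. split; auto. }
  rewrite (is_Int_Int g l I). split; auto. apply L; auto.
Qed.

Lemma good_weight_tail w e : good_weight w -> 0 < e -> exists T, tail_at w e T.
Proof. intros [_ [_ H]] He. destruct (H e He) as [T [H1 H2]]. exists T. split; auto. Qed.

Lemma Int_correct g w : good_weight w -> dominated g w -> is_Int g (IntR g).
Proof. intros G D. destruct (good_weight_tail w 1 G Rlt_0_1) as [T HT]. apply (Int_tail g w 1 T); auto. Qed.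

Lemma is_Int_bound g w l B : contR w -> dominated g w -> (forall a b, a <= b -> RInt w a b <= B) ->
  is_Int g l -> Cmod l <= B.
Proof.
  intros Cw D HB H. apply le_epsilon. intros e He. destruct (H e He) as [T [HT HT']].
  specialize (HT' (- T) T). assert (X : Cmod (CI g (- T) T) <= B).
  { eapply Rle_trans; [apply (dominated_CI g w); auto; lra|]. apply HB; lra. }
  replace l with (Cminus (CI g (- T) T) (Cminus (CI g (- T) T) l)) by ring.
  eapply Rle_trans; [apply Cmod_triangle|]. rewrite Cmod_opp. lra.
Qed.

Lemma Int_cont (g : R -> R -> C) w : good_weight w ->
  (forall u t, cont2 g u t) -> (forall u t, Cmod (g u t) <= w t) -> contR (fun u => IntR (g u)).
Proof.
  intros G Cg Hg u0. apply continuous_C_eps. intros e He.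
  destruct (good_weight_tail w (e / 16) G) as [T HT]. lra.
  assert (D : forall u, dominated (g u) w). { intros u; split; auto. intros t. apply (cont2_r g), Cg. }
  assert (X : forall u, Cmod (Cminus (CI (g u) (- T) T) (IntR (g u))) <= 4 * (e / 16)).
  { intros u. apply (proj2 (Int_tail (g u) w _ T G (D u) HT)); lra. }
  assert (T0 : 0 < T) by apply HT.
  assert (TT : - T <= T) by lra.
  destruct (continuous_C_eps_inv _ u0 (continuous_CI_param g (- T) T u0 TT (fun x y _ => Cg x y)) (e / 4)) as [d [Hd Hd']].
  lra. exists d; split; auto. intros u Hu. specialize (Hd' u Hu).
  assert (X1 := X u). assert (X2 := X u0).
  eapply Rle_lt_trans; [apply (Cmod_minus_triangle _ (CI (g u) (- T) T))|].
  rewrite Cmod_minus_sym.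
  assert (Y := Cmod_minus_triangle (CI (g u) (- T) T) (CI (g u0) (- T) T) (IntR (g u0))). lra.
Qed.

(** For bounded [t] this is Fubini on a rectangle, and the remaining tail is small uniformly in
    [u]. *)
Lemma Int_Fubini (g : R -> R -> C) w a b : a <= b -> good_weight w ->
  (forall u t, cont2 g u t) -> (forall u t, Cmod (g u t) <= w t) ->
  is_Int (fun t => CI (fun u => g u t) a b) (CI (fun u => IntR (g u)) a b).
Proof.
  intros Hab G Cg Hg e He.
  assert (D : forall u, dominated (g u) w). { intros u; split; auto. intros t. apply (cont2_r g), Cg. }
  assert (He' : 0 < e / (4 * (b - a + 1))) by (apply Rdiv_lt_0_compat; lra).
  destruct (good_weight_tail w _ G He') as [T HT]. exists T. split. apply HT.
  intros p q Hp Hq. assert (T0 : 0 < T) by apply HT.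
  rewrite CI_Fubini with (K := fun t u => g u t); auto. 2: lra.
  2:{ intros x y _ _. unfold cont2. apply (continuous_comp_2 (fun p : R * R => snd p) (fun p : R * R => fst p) g).
      apply continuous_snd_p. apply continuous_fst_p. apply Cg. }
  assert (C1 : contI (fun u => CI (fun t => g u t) p q) a b).
  { intros u _. apply (continuous_CI_param g p q); auto. lra. }
  assert (C2 : contI (fun u => IntR (g u)) a b).
  { apply contR_I, (Int_cont g w); auto. }
  rewrite <- CI_minus; auto.
  apply Rle_trans with ((b - a) * (4 * (e / (4 * (b - a + 1))))).
  - apply CI_bound_const; auto. intros x Hx; apply continuous_Cminus; auto.
    intros u _. apply (proj2 (Int_tail (g u) w _ T G (D u) HT)); lra.
  - apply Rle_trans with ((b - a + 1) * (4 * (e / (4 * (b - a + 1))))).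
    apply Rmult_le_compat_r; lra. right. field. lra.
Qed.

Lemma good_weight_le w w' : contR w -> (forall x, 0 <= w x <= w' x) -> good_weight w' -> good_weight w.
Proof.
  intros Cw H [Cw' [Pw' Hw']]. split; auto. split. apply H.
  intros e He. destruct (Hw' e He) as [T [HT HT']]. exists T; split; auto.
  intros a b Hab. destruct (HT' a b Hab) as [X Y]. split.
  - eapply Rle_trans; [|apply X]. apply RInt_le; try lra; try now apply ex_RInt_contR. intros; apply H.
  - eapply Rle_trans; [|apply Y]. apply RInt_le; try lra; try now apply ex_RInt_contR. intros; apply H.
Qed.

Lemma good_weight_lin w1 w2 p q : 0 <= p -> 0 <= q -> good_weight w1 -> good_weight w2 -> good_weight (fun x => p * w1 x + q * w2 x).
Proof.
  intros Hp Hq [C1 [P1 H1]] [C2 [P2 H2]]. split; [|split].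
  - intros x. specialize (C1 x). specialize (C2 x). cont.
  - intros x. specialize (P1 x). specialize (P2 x). nra.
  - intros e He. assert (He' : 0 < e / (p + q + 1)) by (apply Rdiv_lt_0_compat; lra).
    destruct (H1 _ He') as [T1 [HT1 X1]]. destruct (H2 _ He') as [T2 [HT2 X2]].
    exists (Rmax T1 T2). assert (q1 := Rmax_l T1 T2). assert (q2 := Rmax_r T1 T2). split. lra.
    assert (E : p * (e / (p + q + 1)) + q * (e / (p + q + 1)) <= e).
    { apply Rle_trans with ((p + q + 1) * (e / (p + q + 1))). nra. right; field; lra. }
    intros a b Hab. destruct (X1 a b) as [Y1 Z1]. lra. destruct (X2 a b) as [Y2 Z2]. lra.
    rewrite !RInt_lin by now apply ex_RInt_contR. split; nra.
Qed.

Lemma good_weight_scal w p : 0 <= p -> good_weight w -> good_weight (fun x => p * w x).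
Proof.
  intros Hp G. apply (good_weight_le _ (fun x => p * w x + 0 * w x)).
  - intros x. cont. apply G.
  - intros x. assert (0 <= w x) by apply G. split; nra.
  - apply good_weight_lin; auto; lra.
Qed.

Lemma good_weight_cauchy : good_weight (fun t => / (1 + t ^ 2)).
Proof.
  assert (P : forall t : R, 0 < 1 + t ^ 2) by (intros; nra).
  assert (Cw : contR (fun t => / (1 + t ^ 2))). { intros x. cont. specialize (P x); lra. }
  assert (HI : forall a b, RInt (fun t => / (1 + t ^ 2)) a b = atan b - atan a).
  { intros a b. apply (is_RInt_unique (V:=R_CompleteNormedModule)).
    apply (is_RInt_derive (V:=R_CompleteNormedModule) atan). 2: intros; apply Cw.
    intros x _. apply is_derive_Reals. assert (X := derivable_pt_lim_atan x).
    unfold Rsqr in X. exact X. }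
  split; [exact Cw|]. split. intros x; left; apply Rinv_0_lt_compat, P.
  intros e He.
  (* From $\pi/2-\arctan a=\arctan(1/a)\le 1/a$. *)
  assert (L : exists T, 0 < T /\ forall a, T <= a -> PI / 2 - atan a <= e).
  { exists (/ e). split. now apply Rinv_0_lt_compat.
    intros a Ha. assert (0 < / e) by now apply Rinv_0_lt_compat.
    rewrite <- (Rinv_inv a). rewrite atan_inv by (apply Rinv_0_lt_compat; lra).
    assert (X : atan (/ a) <= / a).
    { destruct (MVT_cor2 atan (fun t => / (1 + t ^ 2)) 0 (/ a)) as [c [Hc1 Hc2]].
      apply Rinv_0_lt_compat; lra.
      intros x _. assert (X := derivable_pt_lim_atan x). unfold Rsqr in X. exact X.
      rewrite atan_0, !Rminus_0_r in Hc1. rewrite Hc1.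
      rewrite <- (Rmult_1_l (/ a)) at 2. apply Rmult_le_compat_r. left; apply Rinv_0_lt_compat; lra.
      rewrite <- Rinv_1. apply Rinv_le_contravar. lra. nra. }
    assert (/ a <= e). { rewrite <- (Rinv_inv e). apply Rinv_le_contravar; auto. }
    lra. }
  destruct L as [T [HT HT']]. exists T; split; auto. intros a b [Ha Hb].
  rewrite !HI, !atan_opp. destruct (atan_bound b). specialize (HT' a Ha). lra.
Qed.

Lemma exp_neg_bound e v : 0 < e -> exp (- (e * Rabs v)) <= (1 + 2 / e ^ 2) * / (1 + v ^ 2).
Proof.
  intros He. set (x := e * Rabs v). assert (Hx : 0 <= x) by (apply Rmult_le_pos; [lra|apply Rabs_pos]).
  (* Mean value theorem for $e^x-x-x^2/2$, whose derivative $e^c-1-c$ is nonnegative. The quadratic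
     growth of the exponential is what compares it with $1+v^2$. *)
  assert (X : 1 + x ^ 2 / 2 <= exp x).
  { destruct (Req_dec x 0) as [->|N]. rewrite exp_0. lra.
    destruct (MVT_cor2 (fun t => exp t - t - t ^ 2 / 2) (fun t => exp t - 1 - t) 0 x) as [c [Hc1 Hc2]]. lra.
    intros c _. apply is_derive_Reals. auto_derive; auto. field.
    rewrite exp_0 in Hc1. assert (1 + c <= exp c) by (left; apply exp_ineq1; lra). nra. }
  rewrite exp_Ropp.
  assert (V : v ^ 2 = x ^ 2 / e ^ 2). { unfold x. rewrite <- (pow2_abs v). field. lra. }
  assert (P : 0 < 1 + v ^ 2) by nra.
  apply Rmult_le_reg_r with (exp x). apply exp_pos. rewrite Rinv_l by (apply Rgt_not_eq, exp_pos).
  apply Rmult_le_reg_r with (1 + v ^ 2); auto.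
  replace ((1 + 2 / e ^ 2) * / (1 + v ^ 2) * exp x * (1 + v ^ 2)) with ((1 + 2 / e ^ 2) * exp x) by (field; lra).
  assert (Q : 0 < / e ^ 2) by (apply Rinv_0_lt_compat; nra).
  apply Rle_trans with ((1 + 2 / e ^ 2) * (1 + x ^ 2 / 2)). rewrite V. unfold Rdiv. nra.
  apply Rmult_le_compat_l; auto. unfold Rdiv; nra.
Qed.

Lemma good_weight_exp e : 0 < e -> good_weight (fun v => exp (- (e * Rabs v))).
Proof.
  intros He. apply (good_weight_le _ (fun v => (1 + 2 / e ^ 2) * / (1 + v ^ 2))).
  - intros v; cont.
  - intros v. split. left; apply exp_pos. now apply exp_neg_bound.
  - apply good_weight_scal. assert (0 < / e ^ 2) by (apply Rinv_0_lt_compat; nra). unfold Rdiv; nra. apply good_weight_cauchy.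
Qed.

(** The weight is $(1+|t|)^{-1-e}$. It serves as the majorant of $\zeta^k f^*$ on vertical lines,
    where only this small excess over the exponent 1 is available. *)
Lemma good_weight_power e : 0 < e -> good_weight (fun t => exp (- (1 + e) * ln (1 + Rabs t))).
Proof.
  intros He.
  assert (P : forall t, 0 < 1 + Rabs t) by (intros t; assert (X := Rabs_pos t); lra).
  assert (Cw : contR (fun t => exp (- (1 + e) * ln (1 + Rabs t)))).
  { intros x. cont. apply continuous_ln_comp; cont. apply P. }
  assert (HI : forall a b, 0 <= a <= b -> RInt (fun t => exp (- (1 + e) * ln (1 + Rabs t))) a b <= / e * exp (- e * ln (1 + a))).
  { intros a b Hab.
    assert (X : is_RInt (fun t => exp (- (1 + e) * ln (1 + Rabs t))) a b
      (minus (- / e * exp (- e * ln (1 + b))) (- / e * exp (- e * ln (1 + a))))).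
    { apply (is_RInt_ext (V:=R_NormedModule) (fun t => exp (- (1 + e) * ln (1 + t)))).
      rewrite Rmin_left, Rmax_right by lra. intros x Hx. rewrite Rabs_pos_eq; auto; lra.
      apply (is_RInt_derive (V:=R_CompleteNormedModule) (fun x => - / e * exp (- e * ln (1 + x))));
      rewrite Rmin_left, Rmax_right by lra; intros x Hx.
      - auto_derive. lra. replace (- (1 + e) * ln (1 + x)) with (- e * ln (1 + x) + - ln (1 + x)) by ring.
        rewrite exp_plus, exp_Ropp, exp_ln by lra. field. lra.
      - cont. apply continuous_ln_comp; cont. lra. }
    rewrite (is_RInt_unique (V:=R_CompleteNormedModule) _ _ _ _ X).
    change (minus (- / e * exp (- e * ln (1 + b))) (- / e * exp (- e * ln (1 + a)))) with
      (- / e * exp (- e * ln (1 + b)) - (- / e * exp (- e * ln (1 + a)))).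
    assert (0 < / e) by now apply Rinv_0_lt_compat. assert (Y := exp_pos (- e * ln (1 + b))). nra. }
  assert (HS : forall a b, 0 <= a <= b -> RInt (fun t => exp (- (1 + e) * ln (1 + Rabs t))) (- b) (- a) =
      RInt (fun t => exp (- (1 + e) * ln (1 + Rabs t))) a b).
  { intros a b Hab. rewrite <- (opp_RInt_swap (V:=R_CompleteNormedModule)) by now apply ex_RInt_contR.
    rewrite <- (RInt_comp (V:=R_CompleteNormedModule) _ Ropp (fun _ => -1)).
    2: intros; apply Cw.
    2: { intros; split; [auto_derive; auto; lra|apply continuous_const]. }
    rewrite (RInt_scal (V:=R_CompleteNormedModule) _ a b (-1)).
    2: { apply ex_RInt_contR. intros x. apply (continuous_comp Ropp (fun t => exp (- (1 + e) * ln (1 + Rabs t)))); [|apply Cw].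
         apply (continuous_Ropp (fun y => y)), continuous_id. }
    rewrite (RInt_ext (V:=R_CompleteNormedModule) (fun x => exp (- (1 + e) * ln (1 + Rabs (- x)))) (fun t => exp (- (1 + e) * ln (1 + Rabs t)))).
    2: { intros x _. now rewrite Rabs_Ropp. }
    match goal with |- opp (scal _ ?u) = _ => change (- (-1 * u) = u) end. ring. }
  split; [exact Cw|]. split. intros; left; apply exp_pos.
  (* For $a$ at least this cutoff, $e\ln(1+a)\ge|\ln(ed)|$, hence $(1+a)^{-e}/e\le d$. *)
  intros d Hd. exists (exp (Rabs (ln (e * d)) / e)). split. apply exp_pos.
  intros a b [Ha Hb]. assert (A0 := exp_pos (Rabs (ln (e * d)) / e)).
  rewrite HS by lra. assert (Y := HI a b). split; (eapply Rle_trans; [apply Y; lra|]).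
  all: replace d with (/ e * (e * d)) by (field; lra); apply Rmult_le_compat_l;
    [left; now apply Rinv_0_lt_compat|].
  all: rewrite <- (exp_ln (e * d)) by nra.
  all: assert (Z : Rabs (ln (e * d)) / e <= ln (1 + a));
   [ rewrite <- (ln_exp (Rabs (ln (e * d)) / e)); apply ln_le; lra | ].
  all: assert (Z' : Rabs (ln (e * d)) <= e * ln (1 + a)) by
    (replace (Rabs (ln (e * d))) with (e * (Rabs (ln (e * d)) / e)) by (field; lra); apply Rmult_le_compat_l; lra).
  all: assert (W := Rle_abs (- ln (e * d))); rewrite Rabs_Ropp in W.
  all: destruct (Req_dec (- e * ln (1 + a)) (ln (e * d))) as [->|Ne]; [lra|left; apply exp_increasing; lra].
Qed.

Lemma good_weight_shift w h : good_weight w -> good_weight (fun v => w (v + h)).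
Proof.
  intros [Cw [Pw Hw]].
  assert (Cs : contR (fun v => w (v + h))). { intros v. apply (continuous_comp (fun v => v + h) w). cont. apply Cw. }
  split; [exact Cs|]. split; [intros; apply Pw|]. intros e He. destruct (Hw e He) as [T [HT H]].
  assert (q1 := Rle_abs h). assert (q2 := Rle_abs (- h)). rewrite Rabs_Ropp in q2.
  exists (T + Rabs h). split. lra.
  assert (E : forall a b, RInt (fun v => w (v + h)) a b = RInt w (a + h) (b + h)).
  { intros a b. rewrite <- (RInt_comp (V:=R_CompleteNormedModule) w (fun v => v + h) (fun _ => 1)).
    - apply (RInt_ext (V:=R_CompleteNormedModule)). intros x _. symmetry. apply Rmult_1_l.
    - intros; apply Cw.
    - intros; split; [auto_derive; auto; ring|apply continuous_const]. }
  intros a b Hab. rewrite !E. split. destruct (H (a + h) (b + h)); lra.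
  replace (- b + h) with (- (b - h)) by ring. replace (- a + h) with (- (a - h)) by ring.
  destruct (H (a - h) (b - h)); lra.
Qed.

Lemma le_mult_inv a b c : 0 < b -> a * b <= c -> a <= c * / b.
Proof. intros Hb H. apply Rmult_le_reg_r with b; auto. rewrite Rmult_assoc, Rinv_l by lra. lra. Qed.

(** * Fourier inversion *)

Definition cis (x : R) : C := Cexp (0, x).

Lemma Cexp_plus a b : Cexp (Cplus a b) = Cmult (Cexp a) (Cexp b).
Proof.
  unfold Cexp. apply injective_projections; simpl; unfold Re, Im; simpl; rewrite exp_plus, ?cos_plus, ?sin_plus; ring.
Qed.
Lemma Cmod_Cexp z : Cmod (Cexp z) = exp (Re z).
Proof.
  unfold Cexp, Cmod; simpl.
  replace (exp (Re z) * cos (Im z) * (exp (Re z) * cos (Im z) * 1) + exp (Re z) * sin (Im z) * (exp (Re z) * sin (Im z) * 1))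
   with (exp (Re z) * exp (Re z) * (Rsqr (sin (Im z)) + Rsqr (cos (Im z)))) by (unfold Rsqr; ring).
  rewrite sin2_cos2, Rmult_1_r. apply sqrt_square. left; apply exp_pos.
Qed.
Lemma Cexp_0 : Cexp (RtoC 0) = RtoC 1.
Proof. unfold Cexp, RtoC; simpl. rewrite exp_0, cos_0, sin_0. apply injective_projections; simpl; ring. Qed.
Lemma Cmod_cis x : Cmod (cis x) = 1.
Proof. unfold cis. rewrite Cmod_Cexp. apply exp_0. Qed.
Lemma cis_plus a b : cis (a + b) = Cmult (cis a) (cis b).
Proof. unfold cis. rewrite <- Cexp_plus. f_equal. apply injective_projections; simpl; ring. Qed.
Lemma cis_0 : cis 0 = RtoC 1.
Proof. apply Cexp_0. Qed.
Lemma Cexp_split z : Cexp z = Cmult (RtoC (exp (Re z))) (cis (Im z)).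
Proof. unfold cis, Cexp. apply injective_projections; simpl; rewrite ?exp_0; ring. Qed.

Lemma cder_cis f x l : is_derive f x l -> cder (fun y => cis (f y)) x (Cmult (cis (f x)) (0, l)).
Proof. intros H. apply (cder_Cexp (fun y => (0, f y))). apply cder_pair; auto. apply (is_derive_const (V:=R_NormedModule)). Qed.

Lemma continuous_cis {U : UniformSpace} (f : U -> R) (x : U) : continuous f x -> continuous (fun y => cis (f y)) x.
Proof. intros. unfold cis. cont. Qed.

Lemma RtoC_inj_0 x : x <> 0 -> RtoC x <> RtoC 0.
Proof. intros H E. apply H. now injection E. Qed.

Lemma Cmod_minus_le x y : Cmod (Cminus x y) <= Cmod x + Cmod y.
Proof. unfold Cminus. rewrite <- (Cmod_opp y). apply Cmod_triangle. Qed.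

(** Triangular (Cesaro) weight. Clamping makes it continuous on the whole line and zero outside
    $[-T,T]$ when $T>0$. *)
Definition hat (T t : R) := 1 - Rabs (clamp (- T) T t) / T.

Lemma hat_bound T t : 0 < T -> 0 <= hat T t <= 1.
Proof.
  intros HT. unfold hat. assert (X := clamp_in (- T) T t).
  assert (Rabs (clamp (- T) T t) <= T) by (apply Rabs_le; lra).
  assert (P := Rabs_pos (clamp (- T) T t)).
  assert (0 <= Rabs (clamp (- T) T t) / T) by (apply Rdiv_le_0_compat; lra).
  assert (Rabs (clamp (- T) T t) / T <= 1) by (apply Rle_div_l; lra). lra.
Qed.
Lemma hat_in T t : - T <= t <= T -> hat T t = 1 - Rabs t / T.
Proof. intros; unfold hat. now rewrite clamp_id. Qed.
Lemma continuous_hat {U : UniformSpace} T (f : U -> R) (x : U) : continuous f x -> continuous (fun y => hat T (f y)) x.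
Proof. intros. unfold hat. cont. now apply clamp_cont. Qed.

(** The Fejer kernel, equal to $2(1-\cos cT)/(Tc^2)$ for $c\ne0$. *)
Definition fejer (c T : R) : C := CI (fun t => Cmult (RtoC (hat T t)) (cis (c * t))) (- T) T.

Lemma fejer_cont c T : contR (fun t => Cmult (RtoC (hat T t)) (cis (c * t))).
Proof. intros x. cont. apply continuous_hat; cont. apply continuous_cis; cont. Qed.

Lemma fejer_bound1 c T : 0 < T -> Cmod (fejer c T) <= 2 * T.
Proof.
  intros HT. replace (2 * T) with ((T - - T) * 1) by ring. apply CI_bound_const. lra.
  apply contR_I, fejer_cont. intros t _. rewrite Cmod_mult, Cmod_cis, Rmult_1_r, Cmod_R.
  assert (X := hat_bound T t HT). rewrite Rabs_pos_eq; lra.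
Qed.

Lemma fejer_bound2 c T : 0 < T -> c <> 0 -> Cmod (fejer c T) <= 4 / (T * c ^ 2).
Proof.
  (* [k] is $1/(ic)$. [F] and [G] are the primitives found by integrating by parts on the two halves
     of the interval; the terms linear in [k] cancel at 0, and what is left is
     $(e^{icT}+e^{-icT}-2)k^2/T$. *)
  intros HT Hc. set (k := (0, - / c) : C).
  assert (Ek : Cmult (0, c) k = RtoC 1).
  { unfold k. apply injective_projections; simpl; field; auto. }
  set (F := fun t => Cplus (Cmult (RtoC (1 - t / T)) (Cmult (cis (c * t)) k)) (Cmult (RtoC (/ T)) (Cmult (cis (c * t)) (Cmult k k)))).
  set (G := fun t => Cminus (Cmult (RtoC (1 + t / T)) (Cmult (cis (c * t)) k)) (Cmult (RtoC (/ T)) (Cmult (cis (c * t)) (Cmult k k)))).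
  assert (Dc : forall t, cder (fun t => cis (c * t)) t (Cmult (cis (c * t)) (0, c))).
  { intros t. apply cder_cis. auto_derive; auto; ring. }
  assert (DF : forall t, cder F t (Cmult (RtoC (1 - t / T)) (cis (c * t)))).
  { intros t. unfold F. eapply cder_eq.
    - repeat cder_step; [|apply Dc|apply Dc].
      apply cder_RtoC with (l := - / T). auto_derive; auto; field; lra.
    - replace (Cmult (cis (c * t)) (0, c)) with (Cmult (0, c) (cis (c * t))) by ring.
      transitivity (Cplus (Cplus (Cmult (RtoC (- / T)) (Cmult (cis (c * t)) k))
         (Cmult (RtoC (1 - t / T)) (Cmult (cis (c * t)) (Cmult (0, c) k))))
         (Cmult (RtoC (/ T)) (Cmult (cis (c * t)) (Cmult (Cmult (0, c) k) k)))). ring.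
      rewrite Ek, RtoC_opp. ring. }
  assert (DG : forall t, cder G t (Cmult (RtoC (1 + t / T)) (cis (c * t)))).
  { intros t. unfold G. eapply cder_eq.
    - repeat cder_step; [|apply Dc|apply Dc].
      apply cder_RtoC with (l := / T). auto_derive; auto; field; lra.
    - replace (Cmult (cis (c * t)) (0, c)) with (Cmult (0, c) (cis (c * t))) by ring.
      transitivity (Cminus (Cplus (Cmult (RtoC (/ T)) (Cmult (cis (c * t)) k))
         (Cmult (RtoC (1 + t / T)) (Cmult (cis (c * t)) (Cmult (0, c) k))))
         (Cmult (RtoC (/ T)) (Cmult (cis (c * t)) (Cmult (Cmult (0, c) k) k)))). ring.
      rewrite Ek. ring. }
  unfold fejer. rewrite <- (CI_Chasles _ (- T) 0 T); [|lra|apply contR_I, fejer_cont].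
  rewrite (CI_ext _ (fun t => Cmult (RtoC (1 + t / T)) (cis (c * t))) (- T) 0); [|lra|].
  2:{ intros t Ht. rewrite hat_in, Rabs_left by lra. do 2 f_equal. field; lra. }
  rewrite (CI_ext _ (fun t => Cmult (RtoC (1 - t / T)) (cis (c * t))) 0 T); [|lra|].
  2:{ intros t Ht. rewrite hat_in, Rabs_pos_eq by lra. reflexivity. }
  rewrite (CI_derive G); [|lra|intros; apply DG|]. 2: intros t _; cont; apply continuous_cis; cont.
  rewrite (CI_derive F); [|lra|intros; apply DF|]. 2: intros t _; cont; apply continuous_cis; cont.
  unfold F, G.
  replace (1 - T / T) with 0 by (field; lra). replace (1 + - T / T) with 0 by (field; lra).
  replace (0 / T) with 0 by (field; lra). rewrite Rplus_0_r, Rminus_0_r, Rmult_0_r, cis_0.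
  match goal with |- Cmod ?z <= _ => replace z with
    (Cmult (Cmult (RtoC (/ T)) (Cmult k k)) (Cminus (Cplus (cis (c * T)) (cis (c * - T))) (RtoC 2))) by (replace (RtoC 2) with (Cplus (RtoC 1) (RtoC 1)) by (rewrite <- RtoC_plus; f_equal; ring); ring) end.
  rewrite !Cmod_mult, Cmod_R.
  assert (Mk : Cmod k * Cmod k = / c ^ 2).
  { unfold Cmod, k; simpl. rewrite sqrt_sqrt. field; auto. nra. }
  rewrite Mk, Rabs_pos_eq by (left; now apply Rinv_0_lt_compat).
  assert (B : Cmod (Cminus (Cplus (cis (c * T)) (cis (c * - T))) (RtoC 2)) <= 4).
  { eapply Rle_trans; [apply Cmod_minus_le|]. rewrite Cmod_R, Rabs_pos_eq by lra.
    assert (X := Cmod_triangle (cis (c * T)) (cis (c * - T))). rewrite !Cmod_cis in X. lra. }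
  assert (c2 : 0 < c ^ 2) by (assert (0 < c * c) by (apply Rsqr_pos_lt; auto); simpl; lra).
  apply Rle_trans with (/ T * / c ^ 2 * 4).
  apply Rmult_le_compat_l; auto. apply Rmult_le_pos; left; now apply Rinv_0_lt_compat.
  right; field. split; lra.
Qed.

(** Both regimes, $2T$ for small $|Tc|$ and $4/(Tc^2)$ for large, fit under one Lorentz profile. Its
    integral does not depend on $T$, which makes the kernel an approximate identity with bounded
    mass. *)
Lemma fejer_bound c T : 0 < T -> Cmod (fejer c T) <= 8 * T * / (1 + (T * c) ^ 2).
Proof.
  intros HT. assert (P : 0 < 1 + (T * c) ^ 2) by nra.
  destruct (Rle_dec ((T * c) ^ 2) 1) as [H|H].
  - eapply Rle_trans; [now apply fejer_bound1|].
    apply le_mult_inv; auto. nra.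
  - assert (c <> 0) by (intros ->; apply H; nra).
    assert (0 < c ^ 2) by (assert (0 < c * c) by (apply Rsqr_pos_lt; auto); simpl; lra).
    eapply Rle_trans; [now apply fejer_bound2|].
    apply le_mult_inv; auto.
    apply Rmult_le_reg_r with (T * c ^ 2). nra.
    replace (4 / (T * c ^ 2) * (1 + (T * c) ^ 2) * (T * c ^ 2)) with (4 * (1 + (T * c) ^ 2)) by (field; lra).
    nra.
Qed.

Lemma RInt_fejer_dominated T a b : 0 < T -> a <= b -> RInt (fun c => 8 * T * / (1 + (T * c) ^ 2)) a b <= 8 * PI.
Proof.
  intros HT Hab.
  assert (P : forall c, 0 < 1 + (T * c) ^ 2) by (intros; nra).
  assert (X : is_RInt (fun c => 8 * T * / (1 + (T * c) ^ 2)) a b (minus (8 * atan (T * b)) (8 * atan (T * a)))).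
  { apply (is_RInt_derive (V:=R_CompleteNormedModule) (fun c => 8 * atan (T * c))).
    - intros x _. apply is_derive_eq with (8 * (T * / (1 + (T * x) ^ 2))); [|req; ring].
      apply (is_derive_scal (fun c => atan (T * c))).
      apply (is_derive_comp atan (fun c => T * c)).
      apply is_derive_Reals, derivable_pt_lim_atan. auto_derive; auto; ring.
    - intros x _. cont. specialize (P x); lra. }
  rewrite (is_RInt_unique (V:=R_CompleteNormedModule) _ _ _ _ X).
  change (8 * atan (T * b) - 8 * atan (T * a) <= 8 * PI).
  destruct (atan_bound (T * a)), (atan_bound (T * b)). lra.
Qed.

(** The sign of the phase is chosen so that the Mellin transform on $\mathrm{Re}\,s=c$ is the
    transform of $v\mapsto f(e^v)e^{cv}$. *)
Definition fourier (g : R -> C) (t : R) : C := IntR (fun v => Cmult (g v) (cis (v * t))).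

Definition fejer_mean (h : R -> C) (T : R) : C := CI (fun t => Cmult (RtoC (hat T t)) (h t)) (- T) T.

Lemma dominated_cis g w t : dominated g w -> dominated (fun v => Cmult (g v) (cis (v * t))) w.
Proof.
  intros [C H]; split.
  - intros v. cont. apply C. apply continuous_cis; cont.
  - intros v. rewrite Cmod_mult, Cmod_cis, Rmult_1_r. apply H.
Qed.

Lemma fourier_cont2 g u t : contR g -> cont2 (fun t v => Cmult (g v) (cis (v * t))) u t.
Proof.
  intros C. unfold cont2. cont. apply (continuous_comp (fun p : R * R => snd p) g).
  apply continuous_snd_p. apply C. apply continuous_cis; cont.
Qed.

Lemma fourier_cont g w : good_weight w -> dominated g w -> contR (fourier g).
Proof.
  intros G [C H]. apply (Int_cont (fun t v => Cmult (g v) (cis (v * t))) w); auto.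
  - intros; now apply fourier_cont2.
  - intros; rewrite Cmod_mult, Cmod_cis, Rmult_1_r. apply H.
Qed.

(** Fubini: averaging the transform with the triangular weight is the same as testing [g] against
    the Fejer kernel. *)
Lemma fejer_mean_fourier g w T : good_weight w -> dominated g w -> 0 < T ->
  is_Int (fun v => Cmult (g v) (fejer v T)) (fejer_mean (fourier g) T).
Proof.
  intros G [C H] HT. assert (TT : - T <= T) by lra.
  set (k := fun t v => Cmult (RtoC (hat T t)) (Cmult (g v) (cis (v * t)))).
  assert (X := Int_Fubini k w (- T) T TT G).
  assert (Hk : forall u t, Cmod (k u t) <= w t).
  { intros; unfold k. rewrite !Cmod_mult, Cmod_cis, Rmult_1_r, Cmod_R.
    assert (Y := hat_bound T u HT). rewrite Rabs_pos_eq by lra.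
    assert (Z := Cmod_ge_0 (g t)). specialize (H t). nra. }
  assert (Ck : forall u t, cont2 k u t).
  { intros. unfold cont2, k. apply continuous_Cmult. cont. apply continuous_hat; cont.
    apply fourier_cont2; auto. }
  specialize (X Ck Hk). eapply is_Int_ext; [|eapply is_Int_eq; [apply X|]].
  - intros v. cbv beta. unfold fejer. rewrite <- CI_scal; [|lra|apply contR_I, fejer_cont].
    apply CI_ext; auto. intros t _. unfold k. ring.
  - unfold fejer_mean. apply CI_ext; auto. intros t _. unfold k.
    apply is_Int_Int, is_Int_scal. apply dominated_cis with w; split; auto.
    apply Int_correct with w; auto. apply dominated_cis; split; auto.
Qed.

(** Approximate identity argument. For $|v|<d$ the function is small by continuity and the kernel
    has mass at most $8\pi$; for $|v|\ge d$ the kernel is at most $8/(Td^2)$ and [g] is integrable.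
    [T0] makes each contribution at most $e/2$. Since the value at 0 vanishes, the exact mass of the
    kernel does not enter. *)
Lemma fejer_mean_fourier_0 g w : good_weight w -> dominated g w -> g 0 = RtoC 0 ->
  forall e, 0 < e -> exists T0, 0 < T0 /\ forall T, T0 <= T -> Cmod (fejer_mean (fourier g) T) <= e.
Proof.
  intros G [C H] g0 e He.
  assert (PP := PI_RGT_0).
  assert (He1 : 0 < e / 2 / (8 * PI)) by (apply Rdiv_lt_0_compat; lra).
  destruct (continuous_C_eps_inv g 0 (C 0) _ He1) as [d [Hd Hd']].
  destruct (good_weight_bound w G) as [B [HB0 HB]].
  set (T0 := 8 * (B + 1) / (d ^ 2 * (e / 2))).
  assert (d2 : 0 < d ^ 2) by nra.
  assert (HT0 : 0 < T0). { apply Rdiv_lt_0_compat; nra. }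
  exists T0; split; auto. intros T HT. assert (T1 : 0 < T) by lra.
  set (W := fun v => e / 2 / (8 * PI) * (8 * T * / (1 + (T * v) ^ 2)) + 8 / (T * d ^ 2) * w v).
  assert (Pw : forall v, 0 <= w v) by apply G.
  assert (Pm : forall v, 0 < / (1 + (T * v) ^ 2)) by (intros; apply Rinv_0_lt_compat; nra).
  assert (Cm : contR (fun v => 8 * T * / (1 + (T * v) ^ 2))).
  { intros v. cont. assert (0 < 1 + (T * v) ^ 2) by nra. lra. }
  apply (is_Int_bound (fun v => Cmult (g v) (fejer v T)) W).
  - intros v. unfold W. apply continuous_Rplus; apply continuous_Rmult; try apply continuous_const. apply Cm. apply G.
  - split.
    + intros v. apply continuous_Cmult. apply C. unfold fejer.
      apply (continuous_CI_param (fun v t => Cmult (RtoC (hat T t)) (cis (v * t)))). lra.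
      intros x y _. unfold cont2. cont. apply continuous_hat; cont. apply continuous_cis; cont.
    + intros v. rewrite Cmod_mult. unfold W. assert (F := fejer_bound v T T1).
      assert (Y0 : 0 <= 8 / (T * d ^ 2) * w v).
      { apply Rmult_le_pos; auto. left; apply Rdiv_lt_0_compat; nra. }
      assert (Y1 : 0 <= e / 2 / (8 * PI) * (8 * T * / (1 + (T * v) ^ 2))).
      { apply Rmult_le_pos. lra. specialize (Pm v). nra. }
      assert (M0 := Cmod_ge_0 (g v)). assert (M1 := Cmod_ge_0 (fejer v T)).
      destruct (Rlt_dec (Rabs (v - 0)) d) as [Hv|Hv].
      * specialize (Hd' v Hv). rewrite g0 in Hd'. replace (Cminus (g v) (RtoC 0)) with (g v) in Hd' by ring.
        assert (Cmod (g v) * Cmod (fejer v T) <= e / 2 / (8 * PI) * (8 * T * / (1 + (T * v) ^ 2))).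
        { apply Rmult_le_compat; auto. lra. }
        lra.
      * rewrite Rminus_0_r in Hv. apply Rnot_lt_le in Hv.
        assert (v2 : d ^ 2 <= v ^ 2). { rewrite <- (pow2_abs v). nra. }
        assert (Z : Cmod (fejer v T) <= 8 / (T * d ^ 2)).
        { eapply Rle_trans; [apply F|]. unfold Rdiv. rewrite Rmult_assoc. apply Rmult_le_compat_l. lra.
          apply Rmult_le_reg_r with (1 + (T * v) ^ 2). nra. rewrite Rmult_assoc, Rinv_l by nra.
          apply Rmult_le_reg_r with (T * d ^ 2). nra.
          replace (/ (T * d ^ 2) * (1 + (T * v) ^ 2) * (T * d ^ 2)) with (1 + (T * v) ^ 2) by (field; lra).
          assert (T ^ 2 * d ^ 2 <= T ^ 2 * v ^ 2) by (apply Rmult_le_compat_l; nra). nra. }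
        assert (Cmod (g v) * Cmod (fejer v T) <= 8 / (T * d ^ 2) * w v).
        { rewrite Rmult_comm. apply Rmult_le_compat; auto. }
        lra.
  - intros a b Hab. unfold W. rewrite RInt_lin by (apply ex_RInt_contR; [exact Cm] || apply ex_RInt_contR, G).
    assert (X := RInt_fejer_dominated T a b T1 Hab).
    assert (Y := HB a b Hab).
    assert (Z : e / 2 / (8 * PI) * RInt (fun c => 8 * T * / (1 + (T * c) ^ 2)) a b <= e / 2).
    { apply Rle_trans with (e / 2 / (8 * PI) * (8 * PI)). apply Rmult_le_compat_l; lra. right; field; lra. }
    assert (8 / (T * d ^ 2) * RInt w a b <= e / 2).
    { apply Rle_trans with (8 / (T * d ^ 2) * (B + 1)).
      apply Rmult_le_compat_l. left; apply Rdiv_lt_0_compat; nra. lra.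
      apply Rmult_le_reg_r with (T * d ^ 2). nra.
      replace (8 / (T * d ^ 2) * (B + 1) * (T * d ^ 2)) with (8 * (B + 1)) by (field; lra).
      replace (8 * (B + 1)) with (T0 * (d ^ 2 * (e / 2))) by (unfold T0; field; lra).
      assert (0 < d ^ 2 * (e / 2)) by nra. nra. }
    lra.
  - apply fejer_mean_fourier with w; auto. split; auto.
Qed.

Lemma fejer_mean_lim h w : good_weight w -> dominated h w ->
  forall e, 0 < e -> exists T0, 0 < T0 /\ forall T, T0 <= T -> Cmod (Cminus (fejer_mean h T) (IntR h)) <= e.
Proof.
  intros G D e He. assert (Cw : contR w) by apply G. assert (Pw : forall x, 0 <= w x) by apply G.
  assert (He8 : 0 < e / 8) by lra.
  destruct (good_weight_tail w _ G He8) as [T1 HT1]. destruct (good_weight_bound w G) as [B [HB0 HB]].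
  assert (P1 : 0 < T1) by apply HT1.
  (* On $[-T_1,T_1]$ the weight falls short of 1 by at most $T_1/T$, so the loss there is at most
     $T_1B/T\le e/4$. Outside, the tail of [w] controls it. *)
  set (T0 := T1 + 4 * T1 * (B + 1) / e).
  assert (Q : 0 < 4 * T1 * (B + 1) / e). { apply Rdiv_lt_0_compat; nra. }
  exists T0. split. unfold T0; lra. intros T HT. assert (T1T : T1 <= T) by (unfold T0 in HT; lra).
  assert (TP : 0 < T) by lra.
  assert (X : Cmod (Cminus (CI h (- T) T) (IntR h)) <= 4 * (e / 8)).
  { apply (proj2 (Int_tail h w _ T1 G D HT1)); lra. }
  assert (Ch : contR (fun t => Cmult (RtoC (hat T t)) (h t))).
  { intros t. cont. apply continuous_hat; cont. apply D. }
  assert (Y : Cmod (Cminus (fejer_mean h T) (CI h (- T) T)) <= e / 2).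
  { unfold fejer_mean. rewrite <- CI_minus; [|lra|apply contR_I, Ch|apply contR_I, D].
    set (z := fun t => Cminus (Cmult (RtoC (hat T t)) (h t)) (h t)).
    assert (Cz : contR z). { intros t. unfold z. apply continuous_Cminus. apply Ch. apply D. }
    assert (Hz : forall t, Cmod (z t) = (1 - hat T t) * Cmod (h t)).
    { intros t. unfold z. replace (Cminus _ _) with (Cmult (RtoC (hat T t - 1)) (h t)) by (rewrite RtoC_minus; ring).
      rewrite Cmod_mult, Cmod_R. f_equal. assert (U := hat_bound T t TP). rewrite Rabs_left1; lra. }
    assert (Dz : dominated z w).
    { split; auto. intros t. rewrite Hz. assert (U := hat_bound T t TP). assert (V := proj2 D t).
      assert (V' := Cmod_ge_0 (h t)). nra. }
    assert (W : Cmod (Cminus (CI z (- T) T) (CI z (- T1) T1)) <= 2 * (e / 8)).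
    { apply (dominated_tail z w _ T1); auto; lra. }
    assert (W' : Cmod (CI z (- T1) T1) <= e / 4).
    { assert (Cq : contR (fun t => T1 / T * w t)). { intros t; cont. apply Cw. }
      eapply Rle_trans. apply (CI_bound z (fun t => T1 / T * w t)). lra. now apply contR_I. now apply contR_I.
      - intros t Ht. rewrite Hz. rewrite hat_in by lra.
        replace (1 - (1 - Rabs t / T)) with (Rabs t / T) by ring.
        apply Rmult_le_compat. apply Rdiv_le_0_compat; auto. apply Rabs_pos. apply Cmod_ge_0.
        apply Rmult_le_compat_r. left; now apply Rinv_0_lt_compat. apply Rabs_le; lra. apply D.
      - rewrite (RInt_scal (V:=R_CompleteNormedModule)) by now apply ex_RInt_contR.
        change (T1 / T * RInt w (- T1) T1 <= e / 4).
        assert (RB := HB (- T1) T1).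
        apply Rle_trans with (T1 / T * (B + 1)).
        apply Rmult_le_compat_l. apply Rdiv_le_0_compat; lra. lra.
        apply Rmult_le_reg_r with T; auto.
        replace (T1 / T * (B + 1) * T) with (T1 * (B + 1)) by (field; lra).
        assert (4 * T1 * (B + 1) / e <= T) by (unfold T0 in HT; lra).
        replace (T1 * (B + 1)) with (e / 4 * (4 * T1 * (B + 1) / e)) by (field; lra).
        apply Rmult_le_compat_l; lra. }
    replace (CI z (- T) T) with (Cplus (Cminus (CI z (- T) T) (CI z (- T1) T1)) (CI z (- T1) T1)) by ring.
    eapply Rle_trans; [apply Cmod_triangle|]. lra. }
  eapply Rle_trans; [apply (Cmod_minus_triangle _ (CI h (- T) T))|]. lra.
Qed.

(** Reference pair for calibrating the inversion formula. On each half line the integrand is a pure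
    exponential; [k2] and [k1] are the reciprocals of its exponents $1+ic$ and $-1+ic$, and their
    difference is the value. *)
Lemma is_Int_exp_abs c : is_Int (fun v => Cmult (RtoC (exp (- Rabs v))) (cis (v * c))) (RtoC (2 / (1 + c ^ 2))).
Proof.
  assert (P : 0 < 1 + c ^ 2) by nra.
  set (k1 := Cinv (- 1, c)). set (k2 := Cinv (1, c)).
  assert (E1 : Cmult (- 1, c) k1 = RtoC 1).
  { apply Cinv_r. intros H; injection H; lra. }
  assert (E2 : Cmult (1, c) k2 = RtoC 1).
  { apply Cinv_r. intros H; injection H; lra. }
  set (f := fun v => Cmult (RtoC (exp (- Rabs v))) (cis (v * c))).
  assert (Cf : contR f). { intros v; unfold f. cont. apply continuous_cis; cont. }
  assert (M1 : Cmod k1 <= 1).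
  { unfold k1. rewrite Cmod_inv by (intros H; injection H; lra). rewrite <- Rinv_1. apply Rinv_le_contravar. lra.
    unfold Cmod; simpl. rewrite <- sqrt_1 at 1. apply sqrt_le_1_alt. nra. }
  assert (M2 : Cmod k2 <= 1).
  { unfold k2. rewrite Cmod_inv by (intros H; injection H; lra). rewrite <- Rinv_1. apply Rinv_le_contravar. lra.
    unfold Cmod; simpl. rewrite <- sqrt_1 at 1. apply sqrt_le_1_alt. nra. }
  assert (I : forall a b, a <= 0 <= b -> CI f a b =
     Cplus (Cmult (Cminus (RtoC 1) (Cexp (a, a * c))) k2) (Cmult (Cminus (Cexp (- b, b * c)) (RtoC 1)) k1)).
  { intros a b Hab. rewrite <- (CI_Chasles f a 0 b); [|lra|now apply contR_I].
    f_equal.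
    - rewrite (CI_ext f (fun v => Cexp (v, v * c))); [|lra|].
      2:{ intros v Hv. unfold f. rewrite Rabs_left by lra. rewrite Ropp_involutive.
          rewrite (Cexp_split (v, v * c)). reflexivity. }
      rewrite (CI_derive (fun v => Cmult (Cexp (v, v * c)) k2)); [|lra| |].
      + rewrite Rmult_0_l. change (0, 0) with (RtoC 0). rewrite Cexp_0. ring.
      + intros v _. eapply cder_eq. apply cder_mult; [|apply cder_const].
        apply (cder_Cexp (fun v => (v, v * c))) with (l := (1, c)). apply cder_pair; auto_derive; auto; ring.
        transitivity (Cmult (Cexp (v, v * c)) (Cmult (1, c) k2)). ring. rewrite E2; ring.
      + intros v _. cont.
    - rewrite (CI_ext f (fun v => Cexp (- v, v * c))); [|lra|].
      2:{ intros v Hv. unfold f. rewrite Rabs_pos_eq by lra.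
          rewrite (Cexp_split (- v, v * c)). reflexivity. }
      rewrite (CI_derive (fun v => Cmult (Cexp (- v, v * c)) k1)); [|lra| |].
      + rewrite Rmult_0_l, Ropp_0. change (0, 0) with (RtoC 0). rewrite Cexp_0. ring.
      + intros v _. eapply cder_eq. apply cder_mult; [|apply cder_const].
        apply (cder_Cexp (fun v => (- v, v * c))) with (l := (- 1, c)). apply cder_pair; auto_derive; auto; ring.
        transitivity (Cmult (Cexp (- v, v * c)) (Cmult (- 1, c) k1)). ring. rewrite E1; ring.
      + intros v _. cont. }
  assert (S : Cminus k2 k1 = RtoC (2 / (1 + c ^ 2))).
  { unfold k1, k2. apply injective_projections; simpl; field; nra. }
  intros e He. exists (Rabs (ln (e / 2)) + 1). assert (A := Rabs_pos (ln (e / 2))). split. lra.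
  intros a b Ha Hb.
  assert (Ex : forall x, x <= - (Rabs (ln (e / 2)) + 1) -> exp x <= e / 2).
  { intros x Hx. rewrite <- (exp_ln (e / 2)) by lra. left; apply exp_increasing.
    assert (Y := Rle_abs (- ln (e / 2))). rewrite Rabs_Ropp in Y. lra. }
  rewrite I by lra. rewrite <- S.
  replace (Cminus _ _) with (Cminus (Cmult (Cexp (- b, b * c)) k1) (Cmult (Cexp (a, a * c)) k2)) by ring.
  eapply Rle_trans; [apply Cmod_minus_le|]. rewrite !Cmod_mult, !Cmod_Cexp; simpl.
  assert (X1 := Ex (- b)). assert (X2 := Ex a). assert (Y1 := exp_pos (- b)). assert (Y2 := exp_pos a).
  assert (Z1 := Cmod_ge_0 k1). assert (Z2 := Cmod_ge_0 k2).
  assert (exp (- b) * Cmod k1 <= e / 2) by nra. assert (exp a * Cmod k2 <= e / 2) by nra. lra.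
Qed.

Lemma is_Int_cauchy : is_Int (fun t => RtoC (2 / (1 + t ^ 2))) (RtoC (2 * PI)).
Proof.
  assert (P : forall t : R, 0 < 1 + t ^ 2) by (intros; nra).
  intros e He. exists (4 / e). split. apply Rdiv_lt_0_compat; lra. intros a b Ha Hb.
  assert (Q : 0 < 4 / e) by (apply Rdiv_lt_0_compat; lra).
  rewrite (CI_derive (fun t => RtoC (2 * atan t))); [|lra| |].
  - rewrite <- !RtoC_minus, Cmod_R.
    assert (L : forall x, 4 / e <= x -> PI / 2 - atan x <= e / 4).
    { intros x Hx. rewrite <- (Rinv_inv x). rewrite atan_inv by (apply Rinv_0_lt_compat; lra).
      assert (X : atan (/ x) <= / x).
      { assert (0 < / x) by (apply Rinv_0_lt_compat; lra).
        destruct (MVT_cor2 atan (fun t => / (1 + t ^ 2)) 0 (/ x)) as [c [Hc1 Hc2]]; auto.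
        intros y _. assert (X := derivable_pt_lim_atan y). unfold Rsqr in X. exact X.
        rewrite atan_0, !Rminus_0_r in Hc1. rewrite Hc1.
        rewrite <- (Rmult_1_l (/ x)) at 2. apply Rmult_le_compat_r. lra.
        rewrite <- Rinv_1. apply Rinv_le_contravar. lra. nra. }
      assert (/ x <= e / 4). { replace (e / 4) with (/ (4 / e)) by (field; lra). apply Rinv_le_contravar; auto. }
      lra. }
    assert (X1 := L b Hb). assert (X2 := L (- a)). rewrite atan_opp in X2.
    destruct (atan_bound a), (atan_bound b). apply Rabs_le. lra.
  - intros x _. apply cder_RtoC. apply is_derive_eq with (2 * / (1 + x ^ 2)); [|reflexivity].
    apply (is_derive_scal atan). apply is_derive_Reals.
    assert (X := derivable_pt_lim_atan x). unfold Rsqr in X. exact X.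
  - intros x _. cont. specialize (P x); lra.
Qed.

(* Fejer means of [fourier g] converge both to the integral of [fourier g] and to a multiple of [g 0]; the multiple is read off [exp (- |v|)]. *)
Lemma fourier_inv_0 g w w2 : good_weight w -> dominated g w -> good_weight w2 -> (forall t, Cmod (fourier g t) <= w2 t) ->
  is_Int (fourier g) (Cmult (RtoC (2 * PI)) (g 0)).
Proof.
  intros G D G2 H2.
  assert (D2 : dominated (fourier g) w2). { split; auto. now apply fourier_cont with w. }
  set (g0 := fun v => RtoC (exp (- (1 * Rabs v)))).
  assert (G0 := good_weight_exp 1 Rlt_0_1).
  assert (D0 : dominated g0 (fun v => exp (- (1 * Rabs v)))).
  { split. intros v; unfold g0; cont. intros v. unfold g0. rewrite Cmod_R, Rabs_pos_eq. lra. left; apply exp_pos. }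
  assert (F0 : forall t, fourier g0 t = RtoC (2 / (1 + t ^ 2))).
  { intros t. apply is_Int_Int. eapply is_Int_ext; [|apply is_Int_exp_abs].
    intros v. cbv beta. unfold g0. now rewrite Rmult_1_l. }
  assert (G02 : good_weight (fun t => 2 * / (1 + t ^ 2))) by (apply good_weight_scal; [lra|apply good_weight_cauchy]).
  assert (D02 : dominated (fourier g0) (fun t => 2 * / (1 + t ^ 2))).
  { split. now apply fourier_cont with (fun v => exp (- (1 * Rabs v))).
    intros t. rewrite F0, Cmod_R, Rabs_pos_eq. apply Rle_refl. apply Rdiv_le_0_compat; nra. }
  assert (I0 : IntR (fourier g0) = RtoC (2 * PI)).
  { apply is_Int_Int. eapply is_Int_ext; [|apply is_Int_cauchy]. intros t. now rewrite F0. }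
  (* Subtracting $g(0)e^{-|v|}$ makes the value at 0 vanish, so that [fejer_mean_fourier_0] applies
     to the difference. *)
  set (c := g 0). set (g1 := fun v => Cminus (g v) (Cmult c (g0 v))).
  set (w1 := fun v => 1 * w v + Cmod c * exp (- (1 * Rabs v))).
  assert (G1 : good_weight w1). { apply good_weight_lin; auto. lra. apply Cmod_ge_0. }
  assert (D1 : dominated g1 w1).
  { split. intros v; unfold g1. apply continuous_Cminus. apply D. apply continuous_Cmult. apply continuous_const. apply D0.
    intros v. unfold g1, w1. eapply Rle_trans; [apply Cmod_minus_le|]. rewrite Cmod_mult, Rmult_1_l.
    apply Rplus_le_compat. apply D. apply Rmult_le_compat_l. apply Cmod_ge_0. apply D0. }
  assert (F1 : forall t, fourier g1 t = Cminus (fourier g t) (Cmult c (fourier g0 t))).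
  { intros t. apply is_Int_Int.
    assert (J0 := is_Int_scal _ c _ (proj1 (dominated_cis g0 _ t D0)) (Int_correct _ _ G0 (dominated_cis g0 _ t D0))).
    assert (J := Int_correct _ w G (dominated_cis g w t D)).
    eapply is_Int_ext; [|apply (is_Int_minus _ _ _ _) with (3 := J) (4 := J0)].
    - intros v. cbv beta. unfold g1. ring.
    - apply dominated_cis with w; auto.
    - intros v. apply continuous_Cmult. apply continuous_const. apply (dominated_cis g0 _ t D0). }
  assert (Z1 : g1 0 = RtoC 0).
  { unfold g1, g0, c. rewrite Rabs_R0, Rmult_0_r, Ropp_0, exp_0. ring. }
  assert (E : IntR (fourier g) = Cmult (RtoC (2 * PI)) (g 0)).
  { apply Cmod_small_eq. intros e He.
    assert (Pc := Cmod_ge_0 c).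
    destruct (fejer_mean_fourier_0 g1 w1 G1 D1 Z1 (e / 3)) as [Ta [Ta0 HTa]]. lra.
    destruct (fejer_mean_lim (fourier g) w2 G2 D2 (e / 3)) as [Tb [Tb0 HTb]]. lra.
    destruct (fejer_mean_lim (fourier g0) _ G02 D02 (e / 3 / (Cmod c + 1))) as [Tc [Tc0 HTc]]. apply Rdiv_lt_0_compat; lra.
    set (T := Rmax Ta (Rmax Tb Tc)).
    assert (q1 := Rmax_l Ta (Rmax Tb Tc)). assert (q2 := Rmax_r Ta (Rmax Tb Tc)).
    assert (q3 := Rmax_l Tb Tc). assert (q4 := Rmax_r Tb Tc). fold T in q1, q2.
    specialize (HTa T). specialize (HTb T). specialize (HTc T). rewrite I0 in HTc.
    assert (FL : fejer_mean (fourier g1) T = Cminus (fejer_mean (fourier g) T) (Cmult c (fejer_mean (fourier g0) T))).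
    { unfold fejer_mean.
      assert (CC : forall h w', dominated h w' -> contI (fun t => Cmult (RtoC (hat T t)) (h t)) (- T) T).
      { intros h w' D' t _. apply continuous_Cmult. cont. apply continuous_hat; cont. apply D'. }
      assert (TT : - T <= T) by lra.
      rewrite <- CI_scal; auto. rewrite <- CI_minus; auto.
      apply CI_ext; auto. intros t _. rewrite F1. ring.
      now apply CC with w2. intros t Ht; apply continuous_Cmult. apply continuous_const. now apply (CC _ _ D02).
      now apply (CC _ _ D02). }
    rewrite FL in HTa.
    replace (Cminus (IntR (fourier g)) (Cmult (RtoC (2 * PI)) (g 0))) with
      (Cplus (Cminus (Cminus (fejer_mean (fourier g) T) (Cmult c (fejer_mean (fourier g0) T))) (Cminus (fejer_mean (fourier g) T) (IntR (fourier g))))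
         (Cmult c (Cminus (fejer_mean (fourier g0) T) (RtoC (2 * PI))))) by (unfold c; ring).
    eapply Rle_trans; [apply Cmod_triangle|].
    assert (Y := Cmod_minus_le (Cminus (fejer_mean (fourier g) T) (Cmult c (fejer_mean (fourier g0) T))) (Cminus (fejer_mean (fourier g) T) (IntR (fourier g)))).
    assert (X : Cmod (Cmult c (Cminus (fejer_mean (fourier g0) T) (RtoC (2 * PI)))) <= e / 3).
    { rewrite Cmod_mult. apply Rle_trans with ((Cmod c + 1) * (e / 3 / (Cmod c + 1))).
      assert (V : Cmod (Cminus (fejer_mean (fourier g0) T) (RtoC (2 * PI))) <= e / 3 / (Cmod c + 1)) by (apply HTc; lra).
      apply Rmult_le_compat; [exact Pc|apply Cmod_ge_0|lra|exact V]. right; field; lra. }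
    lra. }
  exact (is_Int_eq _ _ _ (Int_correct _ w2 G2 D2) E).
Qed.

Lemma fourier_inv g w w2 v0 : good_weight w -> dominated g w -> good_weight (fun v => w (v + v0)) -> good_weight w2 ->
  (forall t, Cmod (fourier g t) <= w2 t) ->
  is_Int (fun t => Cmult (fourier g t) (cis (- v0 * t))) (Cmult (RtoC (2 * PI)) (g v0)).
Proof.
  intros G D Gs G2 H2.
  set (g' := fun v => g (v + v0)).
  assert (D' : dominated g' (fun v => w (v + v0))).
  { split. intros v. unfold g'. apply (continuous_comp (fun v => v + v0) g). cont. apply D.
    intros v. apply D. }
  assert (F : forall t, fourier g' t = Cmult (fourier g t) (cis (- v0 * t))).
  { intros t. apply is_Int_Int.
    assert (J := is_Int_shift _ v0 _ (proj1 (dominated_cis g w t D)) (Int_correct _ w G (dominated_cis g w t D))).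
    assert (CJ : contR (fun v => Cmult (g (v + v0)) (cis ((v + v0) * t)))).
    { intros v. apply (continuous_comp (fun v => v + v0) (fun v => Cmult (g v) (cis (v * t)))). cont.
      apply (dominated_cis g w t D). }
    eapply is_Int_eq; [|apply Cmult_comm].
    eapply is_Int_ext; [|apply is_Int_scal with (1 := CJ) (2 := J)].
    intros v. cbv beta. unfold g'. replace ((v + v0) * t) with (v * t + v0 * t) by ring.
    rewrite cis_plus. transitivity (Cmult (Cmult (cis (- v0 * t)) (cis (v0 * t))) (Cmult (g (v + v0)) (cis (v * t)))). ring.
    rewrite <- cis_plus. replace (- v0 * t + v0 * t) with 0 by ring. rewrite cis_0. ring. }
  eapply is_Int_ext; [|eapply is_Int_eq; [apply (fourier_inv_0 g' _ w2 Gs D' G2)|]].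
  - intros t. apply F.
  - intros t. rewrite F, Cmod_mult, Cmod_cis, Rmult_1_r. apply H2.
  - unfold g'. now rewrite Rplus_0_l.
Qed.

(** * The zeta function to the right of 0 *)

Definition conv (u : nat -> C) (l : C) :=
  forall e, 0 < e -> exists N : nat, forall n, (N <= n)%nat -> Cmod (Cminus (u n) l) <= e.

Lemma conv_unique u l l' : conv u l -> conv u l' -> l = l'.
Proof.
  intros H H'. apply Cmod_small_eq. intros e He.
  destruct (H (e / 2)) as [N HN]. lra. destruct (H' (e / 2)) as [N' HN']. lra.
  specialize (HN (max N N') (Nat.le_max_l _ _)). specialize (HN' (max N N') (Nat.le_max_r _ _)).
  eapply Rle_trans; [apply (Cmod_minus_triangle _ (u (max N N')))|]. rewrite Cmod_minus_sym. lra.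
Qed.
Lemma conv_const l : conv (fun _ => l) l.
Proof. intros e He; exists O; intros. replace (Cminus l l) with (RtoC 0) by ring. rewrite Cmod_0; lra. Qed.
Lemma conv_ext u v l : (forall n, u n = v n) -> conv u l -> conv v l.
Proof. intros E H e He. destruct (H e He) as [N HN]; exists N; intros. rewrite <- E; auto. Qed.
Lemma conv_plus u v l m : conv u l -> conv v m -> conv (fun n => Cplus (u n) (v n)) (Cplus l m).
Proof.
  intros H H' e He. destruct (H (e / 2)) as [N HN]. lra. destruct (H' (e / 2)) as [N' HN']. lra.
  exists (max N N'). intros n Hn. specialize (HN n). specialize (HN' n).
  replace (Cminus _ _) with (Cplus (Cminus (u n) l) (Cminus (v n) m)) by ring.
  eapply Rle_trans; [apply Cmod_triangle|].
  assert (Cmod (Cminus (u n) l) <= e / 2) by (apply HN; lia).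
  assert (Cmod (Cminus (v n) m) <= e / 2) by (apply HN'; lia). lra.
Qed.
Lemma conv_scal u l c : conv u l -> conv (fun n => Cmult c (u n)) (Cmult c l).
Proof.
  intros H e He. assert (P := Cmod_ge_0 c). destruct (H (e / (Cmod c + 1))) as [N HN]. apply Rdiv_lt_0_compat; lra.
  exists N; intros n Hn. replace (Cminus _ _) with (Cmult c (Cminus (u n) l)) by ring. rewrite Cmod_mult.
  apply Rle_trans with ((Cmod c + 1) * (e / (Cmod c + 1))).
  apply Rmult_le_compat; auto; try lra. apply Cmod_ge_0. right; field; lra.
Qed.
Lemma conv_minus u v l m : conv u l -> conv v m -> conv (fun n => Cminus (u n) (v n)) (Cminus l m).
Proof.
  intros H H'. apply (conv_ext (fun n => Cplus (u n) (Cmult (RtoC (-1)) (v n)))). intros; ring.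
  replace (Cminus l m) with (Cplus l (Cmult (RtoC (-1)) m)) by ring. apply conv_plus; auto. now apply conv_scal.
Qed.
Lemma conv_bound u l M : conv u l -> (forall n, Cmod (u n) <= M) -> Cmod l <= M.
Proof.
  intros H HM. apply le_epsilon. intros e He. destruct (H e He) as [N HN]. specialize (HN N (le_n _)).
  replace l with (Cminus (u N) (Cminus (u N) l)) by ring.
  eapply Rle_trans; [apply Cmod_minus_le|]. specialize (HM N). lra.
Qed.

Definition CLim (u : nat -> C) : C :=
  (real (Lim_seq (fun n => Re (u n))), real (Lim_seq (fun n => Im (u n)))).

Lemma conv_Re u l : conv u l -> is_lim_seq (fun n => Re (u n)) (Finite (Re l)).
Proof.
  intros H. apply is_lim_seq_spec. intros e. destruct (H (e / 2) (is_pos_div_2 e)) as [N HN].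
  exists N. intros n Hn. eapply Rle_lt_trans; [apply (re_le_Cmod (Cminus (u n) l))|].
  eapply Rle_lt_trans; [apply HN; auto|]. assert (X := cond_pos e); lra.
Qed.
Lemma conv_Im u l : conv u l -> is_lim_seq (fun n => Im (u n)) (Finite (Im l)).
Proof.
  intros H. apply is_lim_seq_spec. intros e. destruct (H (e / 2) (is_pos_div_2 e)) as [N HN].
  exists N. intros n Hn. eapply Rle_lt_trans; [apply (Rle_trans _ _ _ (Rmax_r _ _) (Rmax_Cmod (Cminus (u n) l)))|].
  eapply Rle_lt_trans; [apply HN; auto|]. assert (X := cond_pos e); lra.
Qed.
Lemma CLim_conv u l : conv u l -> CLim u = l.
Proof.
  intros H. unfold CLim. rewrite (is_lim_seq_unique _ _ (conv_Re u l H)), (is_lim_seq_unique _ _ (conv_Im u l H)).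
  destruct l; reflexivity.
Qed.

Fixpoint Csum (f : nat -> C) (n : nat) : C :=
  match n with O => RtoC 0 | S n => Cplus (Csum f n) (f n) end.

Lemma Csum_ext f g n : (forall i, (i < n)%nat -> f i = g i) -> Csum f n = Csum g n.
Proof. induction n; intros H; simpl; auto. rewrite IHn, H; auto. Qed.
Lemma Csum_plus f g n : Csum (fun i => Cplus (f i) (g i)) n = Cplus (Csum f n) (Csum g n).
Proof. induction n; simpl. ring. rewrite IHn. ring. Qed.
Lemma Csum_scal c f n : Csum (fun i => Cmult c (f i)) n = Cmult c (Csum f n).
Proof. induction n; simpl. ring. rewrite IHn. ring. Qed.

Lemma CSeries_conv a l : conv (Csum a) l -> CSeries a = l.
Proof.
  intros H. unfold CSeries, Series.
  assert (E : forall n, (sum_n (fun k => Re (a k)) n, sum_n (fun k => Im (a k)) n) = Csum a (S n)).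
  { induction n.
    - rewrite !sum_O. simpl. destruct (a O); apply injective_projections; simpl; ring.
    - rewrite !sum_Sn. change (Csum a (S (S n))) with (Cplus (Csum a (S n)) (a (S n))). rewrite <- IHn.
      destruct (a (S n)); reflexivity. }
  assert (H' : conv (fun n => Csum a (S n)) l).
  { intros e He. destruct (H e He) as [N HN]. exists N. intros; apply HN; lia. }
  destruct l as [p q]. f_equal.
  - rewrite (is_lim_seq_unique _ (Finite p)); [reflexivity|].
    eapply is_lim_seq_ext; [|apply (conv_Re _ _ H')]. intros n. cbv beta. rewrite <- E. reflexivity.
  - rewrite (is_lim_seq_unique _ (Finite q)); [reflexivity|].
    eapply is_lim_seq_ext; [|apply (conv_Im _ _ H')]. intros n. cbv beta. rewrite <- E. reflexivity.
Qed.

Lemma Cmod_cpow x s : Cmod (cpow x s) = exp (Re s * ln x).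
Proof. unfold cpow. rewrite Cmod_Cexp. f_equal. unfold Re; simpl. ring. Qed.
Lemma cpow_plus x s t : cpow x (Cplus s t) = Cmult (cpow x s) (cpow x t).
Proof. unfold cpow. rewrite <- Cexp_plus. f_equal. ring. Qed.
Lemma cpow_mult x y s : 0 < x -> 0 < y -> cpow (x * y) s = Cmult (cpow x s) (cpow y s).
Proof. intros. unfold cpow. rewrite <- Cexp_plus, ln_mult, RtoC_plus by auto. f_equal. ring. Qed.
Lemma cpow_1_r x : 0 < x -> cpow x (RtoC 1) = RtoC x.
Proof.
  intros. unfold cpow. rewrite <- RtoC_mult, Rmult_1_l. unfold Cexp; simpl. rewrite exp_ln, cos_0, sin_0 by auto.
  apply injective_projections; simpl; ring.
Qed.
Lemma cpow_1_l s : cpow 1 s = RtoC 1.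
Proof. unfold cpow. rewrite ln_1, Cmult_0_r. apply Cexp_0. Qed.

Lemma INR_S_pos n : 0 < INR (S n).
Proof. apply lt_0_INR; lia. Qed.

Lemma cder_cpow s x : 0 < x -> cder (fun u => cpow u s) x (Cmult s (cpow x (Cminus s (RtoC 1)))).
Proof.
  intros Hx. unfold cpow.
  eapply cder_eq.
  - apply (cder_Cexp (fun u => Cmult s (RtoC (ln u)))). apply cder_mult. apply cder_const.
    apply cder_RtoC. apply is_derive_Reals, derivable_pt_lim_ln, Hx.
  - fold (cpow x s). rewrite RtoC_inv by lra.
    fold (cpow x (Cminus s (RtoC 1))). unfold Cminus. rewrite cpow_plus.
    replace (cpow x (Copp (RtoC 1))) with (Cinv (RtoC x)). unfold cpow. ring.
    assert (X : RtoC x <> RtoC 0) by (apply RtoC_inj_0; lra).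
    rewrite <- (Cmult_1_r (Cinv (RtoC x))).
    replace (RtoC 1) with (Cmult (cpow x (RtoC 1)) (cpow x (Copp (RtoC 1)))) at 1.
    rewrite cpow_1_r by auto. field; auto.
    rewrite <- cpow_plus. replace (Cplus (RtoC 1) (Copp (RtoC 1))) with (RtoC 0) by ring.
    unfold cpow. rewrite Cmult_0_l. apply Cexp_0.
Qed.

Lemma continuous_cpow {U : UniformSpace} (f : U -> R) (g : U -> C) x :
  continuous f x -> continuous g x -> 0 < f x -> continuous (fun y => cpow (f y) (g y)) x.
Proof. intros. unfold cpow. cont. apply continuous_ln_comp; auto. Qed.

(* By Euler-Maclaurin summation [zeta s] is the limit of [zeta_em N s = sum_(n <= N) n^-s - N^(1-s) / (1-s)] on [Re s > 0]. *)
Definition zeta_psum (N : nat) (s : C) : C := Csum (fun i => cpow (INR (S i)) (Copp s)) N.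
Definition zeta_em (N : nat) (s : C) : C :=
  Cminus (zeta_psum N s) (Cmult (cpow (INR N) (Cminus (RtoC 1) s)) (Cinv (Cminus (RtoC 1) s))).

Lemma Cminus_neq_0 a b : a <> b -> Cminus a b <> RtoC 0.
Proof. intros H E. apply H. replace a with (Cplus (Cminus a b) b) by ring. rewrite E. ring. Qed.

(** The increment is $\int_N^{N+1}\big((N+1)^{-s}-u^{-s}\big)du$, and the integrand is itself the
    integral of $-s\,w^{-s-1}$ over a subinterval of length at most 1. *)
Lemma zeta_em_step N s : (1 <= N)%nat -> 0 <= Re s -> s <> RtoC 1 ->
  Cmod (Cminus (zeta_em (S N) s) (zeta_em N s)) <= Cmod s * exp (- (Re s + 1) * ln (INR N)).
Proof.
  intros HN Hs H1.
  assert (H1' : Cminus (RtoC 1) s <> RtoC 0) by (apply Cminus_neq_0; auto).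
  assert (P : 1 <= INR N) by (apply (le_INR 1); auto).
  assert (E1 : INR (S N) = INR N + 1) by apply S_INR.
  set (f := fun u => Cminus (cpow (INR (S N)) (Copp s)) (cpow u (Copp s))).
  assert (Cf : contI f (INR N) (INR (S N))).
  { intros u Hu. unfold f. cont. apply continuous_cpow; cont. simpl; lra. }
  assert (E : Cminus (zeta_em (S N) s) (zeta_em N s) = CI f (INR N) (INR (S N))).
  { unfold f. rewrite CI_minus; [|lra| |].
    2: intros u _; cont. 2: intros u Hu; apply continuous_cpow; cont; simpl; lra.
    rewrite (CI_derive (fun u => Cmult (RtoC u) (cpow (INR (S N)) (Copp s)))); [|lra| |].
    2: { intros u _. eapply cder_eq. apply cder_mult; [|apply cder_const]. apply cder_RtoC with (l := 1).
         apply (is_derive_id (K:=R_AbsRing)). cbv beta; ring. }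
    2: intros u _; cont.
    rewrite (CI_derive (fun u => Cmult (cpow u (Cminus (RtoC 1) s)) (Cinv (Cminus (RtoC 1) s)))); [|lra| |].
    2: { intros u Hu. eapply cder_eq. apply cder_mult; [|apply cder_const]. apply cder_cpow; lra.
         cbv beta. replace (Cminus (Cminus (RtoC 1) s) (RtoC 1)) with (Copp s) by ring.
         rewrite Cmult_0_r, Cplus_0_r. field; auto. }
    2: intros u Hu; apply continuous_cpow; cont; simpl; lra.
    unfold zeta_em. change (zeta_psum (S N) s) with (Cplus (zeta_psum N s) (cpow (INR (S N)) (Copp s))). rewrite E1, RtoC_plus. ring. }
  rewrite E. replace (Cmod s * exp (- (Re s + 1) * ln (INR N))) with ((INR (S N) - INR N) * (Cmod s * exp (- (Re s + 1) * ln (INR N))))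
    by (rewrite E1; ring).
  apply CI_bound_const; [lra|auto|]. intros u Hu. unfold f.
  assert (Cg : contI (fun w => Cmult (Copp s) (cpow w (Cminus (Copp s) (RtoC 1)))) u (INR (S N))).
  { intros w Hw. cont. apply continuous_cpow; cont. simpl; lra. }
  rewrite <- (CI_derive (fun w => cpow w (Copp s)) (fun w => Cmult (Copp s) (cpow w (Cminus (Copp s) (RtoC 1))))); [|lra| |auto].
  2: intros w Hw; apply cder_cpow; lra.
  apply Rle_trans with ((INR (S N) - u) * (Cmod s * exp (- (Re s + 1) * ln (INR N)))).
  - apply CI_bound_const; [lra|auto|]. intros w Hw. rewrite Cmod_mult, Cmod_opp, Cmod_cpow.
    apply Rmult_le_compat_l. apply Cmod_ge_0.
    replace (Re (Cminus (Copp s) (RtoC 1))) with (- (Re s + 1)) by (unfold Re; simpl; ring).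
    assert (L : ln (INR N) <= ln w) by (apply ln_le; lra).
    assert (- (Re s + 1) * ln w <= - (Re s + 1) * ln (INR N)) by nra.
    destruct (Req_dec (- (Re s + 1) * ln w) (- (Re s + 1) * ln (INR N))) as [->|]; [lra|].
    left; apply exp_increasing; lra.
  - assert (0 <= Cmod s * exp (- (Re s + 1) * ln (INR N))).
    { apply Rmult_le_pos. apply Cmod_ge_0. left; apply exp_pos. }
    rewrite <- (Rmult_1_l (Cmod s * _)) at 2. apply Rmult_le_compat_r; auto. lra.
Qed.

Lemma exp_le_mono x y : x <= y -> exp x <= exp y.
Proof. intros [H| ->]; [left; now apply exp_increasing|lra]. Qed.

(** By the mean value theorem the difference on the right is $\sigma c^{-\sigma-1}$ for some $c\le
    2N$. Replacing $c$ by $2N$ costs $2^{\sigma+1}\le 2^4=16$; here $\sigma\le3$ enters, and all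
    later bounds on $\mathrm{Re}\,s$ by 3 come from this. *)
Lemma pow_telescope N sg : (1 <= N)%nat -> 0 < sg <= 3 ->
  exp (- (sg + 1) * ln (INR N)) <= 16 / sg * (exp (- sg * ln (INR N)) - exp (- sg * ln (INR (S N)))).
Proof.
  intros HN Hs. assert (P : 1 <= INR N) by (apply (le_INR 1); auto). rewrite S_INR.
  destruct (MVT_cor2 (fun u => exp (- sg * ln u)) (fun u => - sg * / u * exp (- sg * ln u)) (INR N) (INR N + 1)) as [c [Hc1 Hc2]].
  lra. intros c Hc. apply is_derive_Reals. auto_derive. lra. field; lra.
  replace (exp (- sg * ln (INR N)) - exp (- sg * ln (INR N + 1))) with (sg * / c * exp (- sg * ln c)) by lra.
  replace (16 / sg * (sg * / c * exp (- sg * ln c))) with (16 * (/ c * exp (- sg * ln c))) by (field; lra).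
  replace (/ c * exp (- sg * ln c)) with (exp (- (sg + 1) * ln c)).
  2: { replace (- (sg + 1) * ln c) with (- ln c + - sg * ln c) by ring. rewrite exp_plus, exp_Ropp, exp_ln by lra. ring. }
  assert (L : ln c <= ln 2 + ln (INR N)). { rewrite <- ln_mult by lra. apply ln_le; lra. }
  assert (L2 : ln 2 <= ln 2) by lra.
  apply Rle_trans with (exp (4 * ln 2) * exp (- (sg + 1) * (ln 2 + ln (INR N)))).
  - rewrite <- exp_plus. apply exp_le_mono. assert (0 < ln 2) by (rewrite <- ln_1; apply ln_increasing; lra). nra.
  - replace (exp (4 * ln 2)) with 16.
    apply Rmult_le_compat_l. lra. apply exp_le_mono. nra.
    replace (4 * ln 2) with (ln 2 + ln 2 + ln 2 + ln 2) by ring. rewrite !exp_plus, exp_ln by lra. ring.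
Qed.

Lemma zeta_em_cauchy N M s : (1 <= N)%nat -> (N <= M)%nat -> 0 < Re s <= 3 -> s <> RtoC 1 ->
  Cmod (Cminus (zeta_em M s) (zeta_em N s)) <= Cmod s * (16 / Re s) * (exp (- Re s * ln (INR N)) - exp (- Re s * ln (INR M))).
Proof.
  intros HN HM Hs H1. induction HM as [|M HM IH].
  - replace (Cminus (zeta_em N s) (zeta_em N s)) with (RtoC 0) by ring. rewrite Cmod_0. right; ring.
  - eapply Rle_trans; [apply (Cmod_minus_triangle _ (zeta_em M s))|].
    assert (X := zeta_em_step M s ltac:(lia) ltac:(lra) H1).
    assert (Y := pow_telescope M (Re s) ltac:(lia) Hs).
    assert (zeta0 : Cmod s * exp (- (Re s + 1) * ln (INR M)) <= Cmod s * (16 / Re s * (exp (- Re s * ln (INR M)) - exp (- Re s * ln (INR (S M)))))).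
    { apply Rmult_le_compat_l; auto. apply Cmod_ge_0. }
    lra.
Qed.

Lemma pow_small sg e : 0 < sg -> 0 < e -> exists N0 : nat, (1 <= N0)%nat /\ forall N, (N0 <= N)%nat -> exp (- sg * ln (INR N)) <= e.
Proof.
  intros Hs He. destruct (nat_above (exp (Rabs (ln e) / sg))) as [N0 HN0].
  exists (max 1 N0). split. lia. intros N HN. specialize (HN0 N ltac:(lia)).
  apply Rle_trans with (exp (ln e)); [|rewrite exp_ln; lra]. apply exp_le_mono.
  assert (L : Rabs (ln e) / sg <= ln (INR N)).
  { rewrite <- (ln_exp (Rabs (ln e) / sg)). apply ln_le; auto. apply exp_pos. }
  assert (X := Rle_abs (- ln e)). rewrite Rabs_Ropp in X.
  assert (Rabs (ln e) <= sg * ln (INR N)).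
  { replace (Rabs (ln e)) with (sg * (Rabs (ln e) / sg)) by (field; lra). apply Rmult_le_compat_l; lra. }
  lra.
Qed.

(* At the zeros [1 + 2 i PI l / ln 2] of [1 - 2^(1-s)] other than [1], the quotient defining [zeta] has a zero denominator; [zeta0] is continuous there. *)
Definition zeta0 (s : C) : C := CLim (fun n => zeta_em n s).

Lemma zeta_em_conv s : 0 < Re s <= 3 -> s <> RtoC 1 -> conv (fun n => zeta_em n s) (zeta0 s).
Proof.
  intros Hs H1.
  destruct (Cauchy_Re_Im (fun n => zeta_em n s)) as [l Hl].
  - intros e He. assert (P := Cmod_ge_0 s).
    set (K := Cmod s * (16 / Re s)). assert (HK : 0 <= K).
    { apply Rmult_le_pos; auto. left; apply Rdiv_lt_0_compat; lra. }
    destruct (pow_small (Re s) (e / (2 * (K + 1)))) as [N0 [HN0 H]]. lra. apply Rdiv_lt_0_compat; lra.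
    exists N0.
    assert (B : forall n, (N0 <= n)%nat -> Cmod (Cminus (zeta_em n s) (zeta_em N0 s)) <= e / 2).
    { intros n Hn. eapply Rle_trans. apply zeta_em_cauchy; auto. fold K.
      specialize (H N0 (le_n _)). assert (E0 := exp_pos (- Re s * ln (INR n))).
      apply Rle_trans with ((K + 1) * (e / (2 * (K + 1)))). 2: right; field; lra.
      assert (E1 := exp_pos (- Re s * ln (INR N0))). nra. }
    intros n m Hn Hm. eapply Rle_trans; [apply (Cmod_minus_triangle _ (zeta_em N0 s))|].
    rewrite (Cmod_minus_sym (zeta_em N0 s)). assert (X := B n Hn). assert (Y := B m Hm). lra.
  - unfold zeta0. rewrite (CLim_conv _ l Hl). exact Hl.
Qed.

Lemma zeta_em_dist N s : (1 <= N)%nat -> 0 < Re s <= 3 -> s <> RtoC 1 ->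
  Cmod (Cminus (zeta_em N s) (zeta0 s)) <= Cmod s * (16 / Re s) * exp (- Re s * ln (INR N)).
Proof.
  intros HN Hs H1. apply le_epsilon. intros e He.
  destruct (zeta_em_conv s Hs H1 e He) as [M HM]. specialize (HM (max M N) (Nat.le_max_l _ _)).
  assert (X := zeta_em_cauchy N (max M N) s HN (Nat.le_max_r _ _) Hs H1).
  eapply Rle_trans; [apply (Cmod_minus_triangle _ (zeta_em (max M N) s))|]. rewrite Cmod_minus_sym.
  assert (0 <= Cmod s * (16 / Re s) * exp (- Re s * ln (INR (max M N)))).
  { apply Rmult_le_pos. apply Rmult_le_pos. apply Cmod_ge_0. left; apply Rdiv_lt_0_compat; lra. left; apply exp_pos. }
  lra.
Qed.

(** The estimate does not deteriorate as $s\to1$: all truncations share the principal part at 1, so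
    it cancels in their differences. *)
Lemma zeta_em_unif c0 B e : 0 < c0 -> 0 < e -> exists N0 : nat, (1 <= N0)%nat /\ forall N s, (N0 <= N)%nat ->
  c0 <= Re s <= 3 -> Cmod s <= B -> s <> RtoC 1 -> Cmod (Cminus (zeta_em N s) (zeta0 s)) <= e.
Proof.
  intros Hc He. set (K := (Rabs B + 1) * (16 / c0)).
  assert (HK : 0 < K). { apply Rmult_lt_0_compat. assert (q := Rabs_pos B); lra. apply Rdiv_lt_0_compat; lra. }
  destruct (pow_small c0 (e / K)) as [N0 [HN0 H]]; auto. now apply Rdiv_lt_0_compat.
  exists N0. split; auto. intros N s HN Hs HB H1.
  assert (N1 : (1 <= N)%nat) by lia.
  eapply Rle_trans. apply zeta_em_dist; auto; lra.
  assert (L : 0 <= ln (INR N)). { rewrite <- ln_1. apply ln_le. lra. apply (le_INR 1); auto. }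
  apply Rle_trans with (K * (e / K)). 2: right; field; lra.
  apply Rmult_le_compat.
  - apply Rmult_le_pos. apply Cmod_ge_0. left; apply Rdiv_lt_0_compat; lra.
  - left; apply exp_pos.
  - unfold K. apply Rmult_le_compat. apply Cmod_ge_0. left; apply Rdiv_lt_0_compat; lra.
    assert (q := Rle_abs B); lra. apply Rmult_le_compat_l. lra. apply Rinv_le_contravar; lra.
  - eapply Rle_trans; [|apply (H N HN)]. apply exp_le_mono. nra.
Qed.

Lemma continuous_CC_eps (f : C -> C) (x : C) :
  (forall e, 0 < e -> exists d, 0 < d /\ forall y, Cmod (Cminus y x) < d -> Cmod (Cminus (f y) (f x)) < e) -> continuous f x.
Proof.
  intros H. apply continuous_C; apply filterlim_locally; intros e; destruct (H e (cond_pos e)) as [d [Hd Hd']].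
  all: assert (Hd2 : 0 < d / 2) by lra; exists (mkposreal _ Hd2); intros y [Y1 Y2];
    assert (Hy : Cmod (Cminus y x) < d) by
     (change (Rabs (fst y - fst x) < d / 2) in Y1; change (Rabs (snd y - snd x) < d / 2) in Y2;
      apply Rle_lt_trans with (Rabs (fst y - fst x) + Rabs (snd y - snd x)); [|lra];
      replace (Cminus y x) with (Cplus (RtoC (fst y - fst x)) (0, snd y - snd x))
        by (destruct x, y; apply injective_projections; simpl; ring);
      eapply Rle_trans; [apply Cmod_triangle|]; rewrite Cmod_R; apply Rplus_le_compat_l;
      unfold Cmod; simpl; rewrite Rmult_0_l, Rplus_0_l, Rmult_1_r; fold (Rsqr (snd y - snd x)); rewrite sqrt_Rsqr_abs; lra).
  - change (Rabs (Re (f y) - Re (f x)) < e). eapply Rle_lt_trans; [apply (re_le_Cmod (Cminus (f y) (f x)))|auto].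
  - change (Rabs (Im (f y) - Im (f x)) < e).
    eapply Rle_lt_trans; [apply (Rle_trans _ _ _ (Rmax_r _ _) (Rmax_Cmod (Cminus (f y) (f x))))|auto].
Qed.

Lemma continuous_CC_inv (f : C -> C) (x : C) : continuous f x ->
  forall e, 0 < e -> exists d, 0 < d /\ forall y, Cmod (Cminus y x) < d -> Cmod (Cminus (f y) (f x)) < e.
Proof.
  intros H e He.
  assert (He2 : 0 < e / 2) by lra.
  destruct (proj1 (filterlim_locally f (f x)) H (mkposreal _ He2)) as [d Hd].
  exists d. split. apply cond_pos. intros y Hy.
  assert (B : ball x d y).
  { split.
    - change (Rabs (fst y - fst x) < d). eapply Rle_lt_trans; [apply (re_le_Cmod (Cminus y x))|auto].
    - change (Rabs (snd y - snd x) < d).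
      eapply Rle_lt_trans; [apply (Rle_trans _ _ _ (Rmax_r _ _) (Rmax_Cmod (Cminus y x)))|auto]. }
  destruct (Hd y B) as [B1 B2]. change (Rabs (fst (f y) - fst (f x)) < e / 2) in B1. change (Rabs (snd (f y) - snd (f x)) < e / 2) in B2.
  apply Rle_lt_trans with (Rabs (fst (f y) - fst (f x)) + Rabs (snd (f y) - snd (f x))); [|lra].
  replace (Cminus (f y) (f x)) with (Cplus (RtoC (fst (f y) - fst (f x))) (0, snd (f y) - snd (f x)))
        by (destruct (f x), (f y); apply injective_projections; simpl; ring).
  eapply Rle_trans; [apply Cmod_triangle|]; rewrite Cmod_R; apply Rplus_le_compat_l;
      unfold Cmod; simpl; rewrite Rmult_0_l, Rplus_0_l, Rmult_1_r; fold (Rsqr (snd (f y) - snd (f x))); rewrite sqrt_Rsqr_abs; lra.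
Qed.

Lemma continuous_Csum {U : UniformSpace} (f : nat -> U -> C) n x :
  (forall i, continuous (f i) x) -> continuous (fun y => Csum (fun i => f i y) n) x.
Proof. intros H; induction n; simpl. apply continuous_const. apply continuous_Cplus; auto. Qed.

Lemma zeta_em_continuous N s : (1 <= N)%nat -> s <> RtoC 1 -> continuous (zeta_em N) s.
Proof.
  intros HN Hs. unfold zeta_em, zeta_psum. apply continuous_Cminus.
  - apply (continuous_Csum (fun i s => cpow (INR (S i)) (Copp s))). intros i. unfold cpow; cont.
  - unfold cpow. cont. apply Cminus_neq_0; auto.
Qed.

Lemma zeta0_continuous s : 0 < Re s < 3 -> s <> RtoC 1 -> continuous zeta0 s.
Proof.
  intros Hs H1. apply continuous_CC_eps. intros e He.
  assert (H1' : 0 < Cmod (Cminus s (RtoC 1))) by (apply Cmod_gt_0, Cminus_neq_0; auto).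
  destruct (zeta_em_unif (Re s / 2) (Cmod s + 1) (e / 4)) as [N [HN1 HN]]. lra. lra.
  destruct (continuous_CC_inv _ _ (zeta_em_continuous N s HN1 H1) (e / 4)) as [d [Hd Hd']]. lra.
  set (d' := Rmin d (Rmin 1 (Rmin (Re s / 2) (Rmin (3 - Re s) (Cmod (Cminus s (RtoC 1))))))).
  exists d'. split. unfold d'; repeat apply Rmin_pos; lra.
  intros y Hy.
  assert (A1 : Cmod (Cminus y s) < d) by (eapply Rlt_le_trans; [apply Hy|apply Rmin_l]).
  assert (A2 : Cmod (Cminus y s) < Rmin 1 (Rmin (Re s / 2) (Rmin (3 - Re s) (Cmod (Cminus s (RtoC 1)))))) by (eapply Rlt_le_trans; [apply Hy|apply Rmin_r]).
  assert (A3 : Cmod (Cminus y s) < 1) by (eapply Rlt_le_trans; [apply A2|apply Rmin_l]).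
  assert (A4 : Cmod (Cminus y s) < Rmin (Re s / 2) (Rmin (3 - Re s) (Cmod (Cminus s (RtoC 1))))) by (eapply Rlt_le_trans; [apply A2|apply Rmin_r]).
  assert (A5 : Cmod (Cminus y s) < Re s / 2) by (eapply Rlt_le_trans; [apply A4|apply Rmin_l]).
  assert (A6 : Cmod (Cminus y s) < Rmin (3 - Re s) (Cmod (Cminus s (RtoC 1)))) by (eapply Rlt_le_trans; [apply A4|apply Rmin_r]).
  assert (A7 : Cmod (Cminus y s) < 3 - Re s) by (eapply Rlt_le_trans; [apply A6|apply Rmin_l]).
  assert (A8 : Cmod (Cminus y s) < Cmod (Cminus s (RtoC 1))) by (eapply Rlt_le_trans; [apply A6|apply Rmin_r]).
  assert (R1 := re_le_Cmod (Cminus y s)). replace (Re (Cminus y s)) with (Re y - Re s) in R1 by (unfold Re; simpl; ring).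
  assert (R2 : Rabs (Re y - Re s) < Re s / 2) by lra. assert (R3 : Rabs (Re y - Re s) < 3 - Re s) by lra.
  apply Rabs_def2 in R2. apply Rabs_def2 in R3.
  assert (Y1 : y <> RtoC 1).
  { intros ->. rewrite Cmod_minus_sym in A8. lra. }
  assert (Y2 : Cmod y <= Cmod s + 1).
  { replace y with (Cplus s (Cminus y s)) at 1 by ring. eapply Rle_trans; [apply Cmod_triangle|]. lra. }
  assert (B1 := HN N y (le_n _) ltac:(lra) Y2 Y1).
  assert (B2 := HN N s (le_n _) ltac:(lra) ltac:(lra) H1).
  assert (B3 := Hd' y A1).
  eapply Rle_lt_trans; [apply (Cmod_minus_triangle _ (zeta_em N y))|]. rewrite Cmod_minus_sym.
  assert (B4 := Cmod_minus_triangle (zeta_em N y) (zeta_em N s) (zeta0 s)). lra.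
Qed.

(** * Comparison with the alternating series *)

Definition eta_term (s : C) (n : nat) : C := Cmult (RtoC ((-1) ^ n)) (cpow (INR (S n)) (Copp s)).

(** Flipping the sign of the even terms subtracts $2\cdot2^{-s}\sum_{n\le N}n^{-s}$. The correction
    terms of the two truncations cancel because $2^{1-s}N^{1-s}=(2N)^{1-s}$, so the identity is
    exact. *)
Lemma eta_even N s : (1 <= N)%nat -> s <> RtoC 1 ->
  Csum (eta_term s) (2 * N) = Cminus (zeta_em (2 * N) s) (Cmult (cpow 2 (Cminus (RtoC 1) s)) (zeta_em N s)).
Proof.
  intros HN H1.
  assert (E : forall n, Csum (eta_term s) (2 * n) = Cminus (zeta_psum (2 * n) s) (Cmult (cpow 2 (Cminus (RtoC 1) s)) (zeta_psum n s))).
  { induction n.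
    - unfold zeta_psum; simpl. ring.
    - replace (2 * S n)%nat with (S (S (2 * n))) by lia. unfold zeta_psum in *. cbn [Csum]. rewrite IHn.
      unfold eta_term. replace ((-1) ^ S (2 * n)) with (-1) by (rewrite pow_1_odd; ring). rewrite pow_1_even.
      replace (INR (S (S (2 * n)))) with (2 * INR (S n)) by (rewrite !S_INR, mult_INR; simpl; ring).
      rewrite (cpow_mult 2 (INR (S n))) by (try lra; apply INR_S_pos).
      unfold Cminus. rewrite !cpow_plus, cpow_1_r by lra.
      replace (RtoC 2) with (Cplus (RtoC 1) (RtoC 1)) by (rewrite <- RtoC_plus; f_equal; ring).
      replace (RtoC (-1)) with (Copp (RtoC 1)) by (rewrite <- RtoC_opp; f_equal; ring). ring. }
  rewrite E. unfold zeta_em.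
  replace (INR (2 * N)) with (2 * INR N) by (rewrite mult_INR; simpl; ring).
  rewrite cpow_mult. ring. lra. apply lt_0_INR; lia.
Qed.

Lemma eta_conv s : 0 < Re s <= 3 -> s <> RtoC 1 ->
  conv (Csum (eta_term s)) (Cmult (Cminus (RtoC 1) (cpow 2 (Cminus (RtoC 1) s))) (zeta0 s)).
Proof.
  intros Hs H1 e He.
  assert (A : conv (fun n => Cminus (zeta_em (2 * n) s) (Cmult (cpow 2 (Cminus (RtoC 1) s)) (zeta_em n s)))
     (Cmult (Cminus (RtoC 1) (cpow 2 (Cminus (RtoC 1) s))) (zeta0 s))).
  { replace (Cmult (Cminus (RtoC 1) (cpow 2 (Cminus (RtoC 1) s))) (zeta0 s)) with
      (Cminus (zeta0 s) (Cmult (cpow 2 (Cminus (RtoC 1) s)) (zeta0 s))) by ring.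
    apply conv_minus; [|apply conv_scal; now apply zeta_em_conv].
    intros e' He'. destruct (zeta_em_conv s Hs H1 e' He') as [N HN]. exists N. intros n Hn. apply HN; lia. }
  destruct (A (e / 2)) as [N1 H1']. lra.
  destruct (pow_small (Re s) (e / 2)) as [N2 [HN2 H2]]. lra. lra.
  exists (2 * (N1 + N2) + 2)%nat. intros n Hn.
  (* A partial sum of odd length differs from one of even length by a single term of modulus
     $(2p+1)^{-\sigma}$, which tends to 0. *)
  assert (Hn2 := Nat.div2_odd n). set (p := Nat.div2 n) in *.
  assert (Hp : Cmod (Cminus (Csum (eta_term s) (2 * p)) (Cmult (Cminus (RtoC 1) (cpow 2 (Cminus (RtoC 1) s))) (zeta0 s))) <= e / 2).
  { rewrite eta_even; auto. 2: destruct (Nat.odd n); simpl in Hn2; lia.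
    apply H1'. destruct (Nat.odd n); simpl in Hn2; lia. }
  destruct (Nat.odd n); simpl Nat.b2n in Hn2.
  - rewrite Hn2, Nat.add_1_r. cbn [Csum].
    replace (Cminus (Cplus (Csum (eta_term s) (2 * p)) (eta_term s (2 * p))) (Cmult (Cminus (RtoC 1) (cpow 2 (Cminus (RtoC 1) s))) (zeta0 s)))
     with (Cplus (Cminus (Csum (eta_term s) (2 * p)) (Cmult (Cminus (RtoC 1) (cpow 2 (Cminus (RtoC 1) s))) (zeta0 s))) (eta_term s (2 * p))) by ring.
    eapply Rle_trans; [apply Cmod_triangle|].
    assert (Cmod (eta_term s (2 * p)) <= e / 2); [|lra].
    unfold eta_term. rewrite pow_1_even, Cmult_1_l, Cmod_cpow.
    replace (Re (Copp s)) with (- Re s) by reflexivity. apply H2; lia.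
  - rewrite Hn2, Nat.add_0_r. lra.
Qed.

Lemma zeta_zeta0 s : 0 < Re s <= 3 -> Cminus (RtoC 1) (cpow 2 (Cminus (RtoC 1) s)) <> RtoC 0 -> zeta s = zeta0 s.
Proof.
  intros Hs H. assert (H1 : s <> RtoC 1).
  { intros ->. apply H. replace (Cminus (RtoC 1) (RtoC 1)) with (RtoC 0) by ring.
    unfold cpow. rewrite Cmult_0_l, Cexp_0. ring. }
  unfold zeta, eta. fold (eta_term s). rewrite (CSeries_conv _ _ (eta_conv s Hs H1)). field. auto.
Qed.

Lemma two_pow_neq s : Re s <> 1 -> Cminus (RtoC 1) (cpow 2 (Cminus (RtoC 1) s)) <> RtoC 0.
Proof.
  intros H E. assert (X : cpow 2 (Cminus (RtoC 1) s) = RtoC 1).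
  { replace (cpow 2 (Cminus (RtoC 1) s)) with (Cminus (RtoC 1) (Cminus (RtoC 1) (cpow 2 (Cminus (RtoC 1) s)))) by ring.
    rewrite E; ring. }
  assert (Y := Cmod_cpow 2 (Cminus (RtoC 1) s)). rewrite X, Cmod_1 in Y.
  assert (Y' : exp 0 = exp ((1 + - Re s) * ln 2)) by (rewrite exp_0; exact Y).
  apply exp_inv in Y'. assert (0 < ln 2) by (rewrite <- ln_1; apply ln_increasing; lra).
  apply H. destruct (Rmult_integral (1 + - Re s) (ln 2)); lra.
Qed.

(** * Contours around 1 *)

(* Holomorphy on [U], expressed as the chain rule along real curves: this is the form consumed by [green], and it avoids complex derivatives. *)
Definition holo_with (U : C -> Prop) (F F' : C -> C) :=
  (forall g x l, cder g x l -> U (g x) -> cder (fun y => F (g y)) x (Cmult (F' (g x)) l)) /\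
  (forall s, U s -> continuous F s) /\ (forall s, U s -> continuous F' s).
Definition holo (U : C -> Prop) (F : C -> C) := exists F', holo_with U F F'.

Lemma holo_ext U F G : (forall s, F s = G s) -> holo U F -> holo U G.
Proof.
  intros E [F' [H1 [H2 H3]]]. exists F'. split; [|split]; auto.
  - intros g x l Hg Hu. apply cder_ext with (fun y => F (g y)). intros; apply E. now apply H1.
  - intros s Hs. apply continuous_ext with F. apply E. now apply H2.
Qed.
Lemma holo_const U c : holo U (fun _ => c).
Proof.
  exists (fun _ => RtoC 0). split; [|split]; intros; try apply continuous_const.
  eapply cder_eq. apply cder_const. ring.
Qed.
Lemma holo_plus U F G : holo U F -> holo U G -> holo U (fun s => Cplus (F s) (G s)).
Proof.
  intros [F' [F1 [F2 F3]]] [G' [G1 [G2 G3]]]. exists (fun s => Cplus (F' s) (G' s)). split; [|split].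
  - intros g x l Hg Hu. eapply cder_eq. apply (cder_plus (fun y => F (g y)) (fun y => G (g y))).
    now apply (F1 g x l). now apply (G1 g x l). ring.
  - intros s Hs. specialize (F2 s Hs). specialize (G2 s Hs). cont.
  - intros s Hs. specialize (F3 s Hs). specialize (G3 s Hs). cont.
Qed.
Lemma holo_mult U F G : holo U F -> holo U G -> holo U (fun s => Cmult (F s) (G s)).
Proof.
  intros [F' [F1 [F2 F3]]] [G' [G1 [G2 G3]]].
  exists (fun s => Cplus (Cmult (F' s) (G s)) (Cmult (F s) (G' s))). split; [|split].
  - intros g x l Hg Hu. eapply cder_eq. apply (cder_mult (fun y => F (g y)) (fun y => G (g y))).
    now apply (F1 g x l). now apply (G1 g x l). cbv beta. ring.
  - intros s Hs. specialize (F2 s Hs). specialize (G2 s Hs). cont.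
  - intros s Hs. specialize (F2 s Hs). specialize (G2 s Hs). specialize (F3 s Hs). specialize (G3 s Hs). cont.
Qed.
Lemma holo_opp U F : holo U F -> holo U (fun s => Copp (F s)).
Proof.
  intros H. apply holo_ext with (fun s => Cmult (RtoC (-1)) (F s)). intros; ring.
  apply holo_mult; auto. apply holo_const.
Qed.
Lemma holo_id U : holo U (fun s => s).
Proof.
  exists (fun _ => RtoC 1). split; [|split]; intros; try apply continuous_const; try apply continuous_id.
  eapply cder_eq. eassumption. ring.
Qed.
Lemma holo_Cexp U F : holo U F -> holo U (fun s => Cexp (F s)).
Proof.
  intros [F' [F1 [F2 F3]]]. exists (fun s => Cmult (Cexp (F s)) (F' s)). split; [|split].
  - intros g x l Hg Hu. eapply cder_eq. apply (cder_Cexp (fun y => F (g y))). now apply (F1 g x l). ring.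
  - intros s Hs. specialize (F2 s Hs). cont.
  - intros s Hs. specialize (F2 s Hs). specialize (F3 s Hs). cont.
Qed.
Lemma holo_Cinv U F : holo U F -> (forall s, U s -> F s <> RtoC 0) -> holo U (fun s => Cinv (F s)).
Proof.
  intros [F' [F1 [F2 F3]]] H0. exists (fun s => Copp (Cmult (F' s) (Cmult (Cinv (F s)) (Cinv (F s))))). split; [|split].
  - intros g x l Hg Hu. eapply cder_eq. apply (cder_Cinv (fun y => F (g y))). now apply (F1 g x l). now apply H0. cbv beta. ring.
  - intros s Hs. specialize (F2 s Hs). cont. auto.
  - intros s Hs. specialize (F2 s Hs). specialize (F3 s Hs). cont; auto.
Qed.
Lemma holo_pow U F n : holo U F -> holo U (fun s => Cpown (F s) n).
Proof. intros H; induction n; simpl. apply holo_const. now apply holo_mult. Qed.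
Lemma holo_Csum U (f : nat -> C -> C) n : (forall i, holo U (f i)) -> holo U (fun s => Csum (fun i => f i s) n).
Proof. intros H; induction n; simpl. apply holo_const. now apply holo_plus. Qed.

Definition not1 (s : C) := s <> RtoC 1.

Lemma holo_zeta_em N : holo not1 (zeta_em N).
Proof.
  unfold zeta_em, zeta_psum. apply holo_plus.
  - apply (holo_Csum not1 (fun i s => cpow (INR (S i)) (Copp s))). intros i. unfold cpow.
    apply holo_Cexp, holo_mult; [apply holo_opp, holo_id|apply holo_const].
  - apply holo_opp, holo_mult.
    + unfold cpow. apply holo_Cexp, holo_mult; [|apply holo_const].
      apply holo_plus; [apply holo_const|apply holo_opp, holo_id].
    + apply holo_Cinv. apply holo_plus; [apply holo_const|apply holo_opp, holo_id].
      intros s Hs. apply Cminus_neq_0. intros E. apply Hs. now symmetry.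
Qed.

(** Cauchy's theorem in homotopy form: [green] with $A=F(g)\,g_u$ and $B=F(g)\,g_v$. By the chain
    rule both cross derivatives equal $F'(g)\,g_u g_v+F(g)\,g_{uv}$. *)
Lemma path_green (U : C -> Prop) F (g gu gv guv : R -> R -> C) a b c d : holo U F -> a <= b -> c <= d ->
  (forall u v, a <= u <= b -> c <= v <= d ->
     U (g u v) /\ cder (fun u => g u v) u (gu u v) /\ cder (fun v => g u v) v (gv u v) /\
     cder (fun v => gu u v) v (guv u v) /\ cder (fun u => gv u v) u (guv u v) /\
     cont2 g u v /\ cont2 gu u v /\ cont2 gv u v /\ cont2 guv u v) ->
  Cminus (CI (fun v => Cmult (F (g b v)) (gv b v)) c d) (CI (fun v => Cmult (F (g a v)) (gv a v)) c d) =
  Cminus (CI (fun u => Cmult (F (g u d)) (gu u d)) a b) (CI (fun u => Cmult (F (g u c)) (gu u c)) a b).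
Proof.
  intros [F' [F1 [F2 F3]]] Hab Hcd H.
  assert (X := green (fun u v => Cmult (F (g u v)) (gu u v)) (fun u v => Cmult (F (g u v)) (gv u v))
    (fun u v => Cplus (Cmult (Cmult (F' (g u v)) (gu u v)) (gv u v)) (Cmult (F (g u v)) (guv u v))) a b c d Hab Hcd).
  assert (Cl : forall u, a <= u <= b -> contI (fun v => Cmult (F (g u v)) (gv u v)) c d).
  { intros u Hu v Hv. destruct (H u v Hu Hv) as (HU & _ & _ & _ & _ & C1 & C2 & C3 & C4).
    apply continuous_Cmult. apply (continuous_comp (fun v => g u v) F). apply (cont2_r g), C1. now apply F2.
    apply (cont2_r gv), C3. }
  assert (Cr : forall v, c <= v <= d -> contI (fun u => Cmult (F (g u v)) (gu u v)) a b).
  { intros v Hv u Hu. destruct (H u v Hu Hv) as (HU & _ & _ & _ & _ & C1 & C2 & C3 & C4).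
    apply continuous_Cmult. apply (continuous_comp (fun u => g u v) F). apply (cont2_l g), C1. now apply F2.
    apply (cont2_l gu), C2. }
  rewrite !CI_minus in X; auto; try (apply Cl; lra); try (apply Cr; lra).
  apply X. intros u v Hu Hv. destruct (H u v Hu Hv) as (HU & D1 & D2 & D3 & D4 & C1 & C2 & C3 & C4).
  split; [|split].
  - eapply cder_eq. apply (cder_mult (fun u => F (g u v)) (fun u => gv u v)). apply F1; eauto. eassumption. cbv beta; ring.
  - eapply cder_eq. apply (cder_mult (fun v => F (g u v)) (fun v => gu u v)). apply (F1 (fun v => g u v)); eauto. eassumption. cbv beta; ring.
  - assert (CF : continuous (fun p : R * R => F (g (fst p) (snd p))) (u, v)).
    { apply (continuous_comp (fun p : R * R => g (fst p) (snd p)) F). exact C1. now apply F2. }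
    assert (CF' : continuous (fun p : R * R => F' (g (fst p) (snd p))) (u, v)).
    { apply (continuous_comp (fun p : R * R => g (fst p) (snd p)) F'). exact C1. now apply F3. }
    unfold cont2 in *. cont.
Qed.

Definition Vint (F : C -> C) (c y1 y2 : R) : C := CI (fun t => F (c, t)) y1 y2.
Definition Hint (F : C -> C) (y x1 x2 : R) : C := CI (fun x => F (x, y)) x1 x2.
(** The contour integral over the circle of radius [r] about 1, divided by $i$. In this
    normalisation the residue is [Circ] divided by $2\pi$. *)
Definition Circ (F : C -> C) (r : R) : C :=
  CI (fun th => Cmult (F (Cplus (RtoC 1) (Cmult (RtoC r) (cis th)))) (Cmult (RtoC r) (cis th))) 0 (2 * PI).

Lemma rect_cauchy (U : C -> Prop) F x1 x2 y1 y2 : holo U F -> x1 <= x2 -> y1 <= y2 ->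
  (forall x y, x1 <= x <= x2 -> y1 <= y <= y2 -> U (x, y)) ->
  Cmult Ci (Cminus (Vint F x2 y1 y2) (Vint F x1 y1 y2)) = Cminus (Hint F y2 x1 x2) (Hint F y1 x1 x2).
Proof.
  intros HF Hx Hy HU.
  assert (X := path_green U F (fun u v => (u, v)) (fun _ _ => RtoC 1) (fun _ _ => Ci) (fun _ _ => RtoC 0) x1 x2 y1 y2 HF Hx Hy).
  assert (CV : forall x, x1 <= x <= x2 -> contI (fun t => F (x, t)) y1 y2).
  { intros x Hx' t Ht. destruct HF as [F' [F1 [F2 F3]]]. apply (continuous_comp (fun t => (x, t) : C) F). cont. auto. }
  unfold Vint, Hint.
  rewrite (CI_ext (fun v => Cmult (F (x2, v)) Ci) (fun v => Cmult Ci (F (x2, v)))) in X by (auto; intros; ring).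
  rewrite (CI_ext (fun v => Cmult (F (x1, v)) Ci) (fun v => Cmult Ci (F (x1, v)))) in X by (auto; intros; ring).
  rewrite !CI_scal in X by (auto; apply CV; lra).
  rewrite (CI_ext (fun v => Cmult (F (v, y2)) (RtoC 1)) (fun v => F (v, y2))) in X by (auto; intros; ring).
  rewrite (CI_ext (fun v => Cmult (F (v, y1)) (RtoC 1)) (fun v => F (v, y1))) in X by (auto; intros; ring).
  rewrite <- X. ring.
  intros u v Hu Hv. split; [now apply HU|].
  assert (D1 : forall c x, is_derive (fun _ : R => c) x 0) by (intros; apply (is_derive_const (V:=R_NormedModule))).
  assert (D2 : forall x, is_derive (fun y : R => y) x 1) by (intros; apply (is_derive_id (K:=R_AbsRing))).
  split; [|split; [|split; [|split; [|split; [|split; [|split]]]]]].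
  - apply (cder_pair (fun u => u) (fun _ => v)); auto.
  - apply (cder_pair (fun _ => u) (fun v => v)); auto.
  - apply cder_const.
  - apply cder_const.
  - unfold cont2; cont.
  - unfold cont2; cont.
  - unfold cont2; cont.
  - unfold cont2; cont.
Qed.

Lemma Cplus_1_eq z : Cplus (RtoC 1) z = RtoC 1 -> z = RtoC 0.
Proof. intros H. replace z with (Cminus (Cplus (RtoC 1) z) (RtoC 1)) by ring. rewrite H. ring. Qed.

Lemma cos_pos_quarter th : - (PI / 4) <= th <= PI / 4 -> 0 < cos th.
Proof. intros H. assert (P := PI_RGT_0). apply cos_gt_0; lra. Qed.

(* The region between the side of a square and the inscribed circular arc; the right-hand side is the difference of the two radial segments, which cancel when four such wedges are put together. *)
Lemma wedge F a w : holo not1 F -> 0 < a -> Cmod w = 1 ->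
  Cminus (CI (fun t => Cmult (F (Cplus (RtoC 1) (Cmult w (a, t)))) (Cmult w Ci)) (- a) a)
    (CI (fun th => Cmult (F (Cplus (RtoC 1) (Cmult w (Cmult (RtoC a) (cis th))))) (Cmult w (Cmult Ci (Cmult (RtoC a) (cis th))))) (- (PI / 4)) (PI / 4)) =
  Cminus
   (CI (fun u => Cmult (F (Cplus (RtoC 1) (Cmult (Cmult w (cis (PI / 4))) (RtoC (a * (1 - u + u / cos (PI / 4)))))))
           (Cmult (Cmult w (cis (PI / 4))) (RtoC (a * (- 1 + / cos (PI / 4)))))) 0 1)
   (CI (fun u => Cmult (F (Cplus (RtoC 1) (Cmult (Cmult w (cis (- (PI / 4)))) (RtoC (a * (1 - u + u / cos (PI / 4)))))))
           (Cmult (Cmult w (cis (- (PI / 4)))) (RtoC (a * (- 1 + / cos (PI / 4)))))) 0 1).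
Proof.
  intros HF Ha Hw. assert (PP := PI_RGT_0).
  assert (Hp : - (PI / 4) <= PI / 4) by lra.
  assert (w0 : w <> RtoC 0). { intros ->. rewrite Cmod_0 in Hw. lra. }
  (* In polar coordinates about 1 this interpolates between the circle of radius [a] at [u = 0] and
     the straight side at distance [a], of polar equation $a/\cos\theta$, at [u = 1]. The remaining
     abbreviations are its partial derivatives. *)
  set (rho := fun u th => a * (1 - u + u / cos th)).
  set (rho' := fun th => a * (- 1 + / cos th)).
  set (rv := fun u th => a * (u * (sin th / cos th ^ 2))).
  set (rv' := fun th => a * (sin th / cos th ^ 2)).
  assert (X := path_green not1 F
    (fun u th => Cplus (RtoC 1) (Cmult (Cmult w (cis th)) (RtoC (rho u th))))
    (fun u th => Cmult (Cmult w (cis th)) (RtoC (rho' th)))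
    (fun u th => Cmult (Cmult w (cis th)) (rv u th, rho u th))
    (fun u th => Cmult (Cmult w (cis th)) (rv' th, rho' th)) 0 1 (- (PI / 4)) (PI / 4) HF ltac:(lra) Hp).
  assert (Dcis : forall th, cder cis th (Cmult (cis th) (0, 1))).
  { intros th. apply (cder_cis (fun t => t)). apply (is_derive_id (K:=R_AbsRing)). }
  assert (CF : forall s, not1 s -> continuous F s) by (destruct HF as [F' [_ [F2 _]]]; auto).
  lapply X; [clear X; intros X|clear X].
  - match type of X with ?l = _ => transitivity l; [clear X|rewrite X; f_equal] end.
    2: { apply CI_ext; [lra|]. intros u Hu. unfold rho, rho'. now rewrite cos_neg. }
    f_equal.
    (* The side is parametrised by its angle, $t=a\tan\theta$. *)
    + transitivity (CI (fun y => Cmult (RtoC (a * (tan y ^ 2 + 1))) (Cmult (F (Cplus (RtoC 1) (Cmult w (a, a * tan y)))) (Cmult w Ci))) (- (PI / 4)) (PI / 4)).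
      * assert (Y := CI_comp (fun t => Cmult (F (Cplus (RtoC 1) (Cmult w (a, t)))) (Cmult w Ci)) (fun th => a * tan th) (fun th => a * (tan th ^ 2 + 1)) (- (PI / 4)) (PI / 4) Hp).
        rewrite Y; clear Y.
        rewrite tan_neg, tan_PI4. f_equal; ring.
        intros th Hth. apply continuous_Cmult; [|cont].
        apply (continuous_comp (fun t => Cplus (RtoC 1) (Cmult w (a, t))) F). cont.
        apply CF. intros E. cbv beta in E. assert (E' : Cmult w (a, a * tan th) = RtoC 0) by exact (Cplus_1_eq _ E).
        assert (E2 := f_equal Cmod E'). rewrite Cmod_mult, Hw, Cmod_0, Rmult_1_l in E2. apply Cmod_eq_0 in E2. injection E2; lra.
        intros th Hth. assert (K := cos_pos_quarter th Hth). split.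
        { apply (is_derive_scal tan). apply is_derive_tan. lra. }
        { cont. apply (ex_derive_continuous (V:=R_NormedModule) tan). eexists. apply is_derive_tan. lra. }
      * apply CI_ext; auto. intros th Hth. assert (K : 0 < cos th) by (apply cos_pos_quarter; lra).
        assert (E : Cmult w (a, a * tan th) = Cmult (Cmult w (cis th)) (RtoC (rho 1 th))).
        { rewrite <- Cmult_assoc. f_equal. unfold cis, Cexp, rho, tan; simpl. rewrite exp_0.
          apply injective_projections; simpl; field; lra. }
        rewrite E. rewrite Cmult_comm, <- Cmult_assoc. f_equal.
        rewrite <- !Cmult_assoc. f_equal.
        unfold cis, Cexp, rho, rv, tan, Ci; simpl. rewrite exp_0.
        assert (S := sin2_cos2 th). unfold Rsqr in S.
        apply injective_projections; simpl.
        { field; lra. }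
        { field; lra. }
    + apply CI_ext; auto. intros th Hth. assert (K : 0 < cos th) by (apply cos_pos_quarter; lra).
      assert (E : rho 0 th = a) by (unfold rho; field; lra).
      assert (E' : rv 0 th = 0) by (unfold rv; field; lra).
      rewrite E, E'. replace (Cmult w (Cmult (RtoC a) (cis th))) with (Cmult (Cmult w (cis th)) (RtoC a)) by ring.
      f_equal. replace ((0, a) : C) with (Cmult Ci (RtoC a)) by (apply injective_projections; simpl; ring). ring.
  - intros u th Hu Hth. assert (K := cos_pos_quarter th Hth).
    assert (Rp : 0 < rho u th).
    { unfold rho. apply Rmult_lt_0_compat; auto.
      assert (1 <= / cos th) by (rewrite <- Rinv_1 at 1; apply Rinv_le_contravar; auto; apply COS_bound).
      unfold Rdiv. nra. }
    split; [|split; [|split; [|split; [|split; [|split; [|split; [|split]]]]]]].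
    + intros E. assert (E' : Cmult (Cmult w (cis th)) (RtoC (rho u th)) = RtoC 0) by exact (Cplus_1_eq _ E).
      assert (E2 := f_equal Cmod E'). rewrite !Cmod_mult, Hw, Cmod_0, Cmod_cis, Cmod_R, Rabs_pos_eq in E2; lra.
    + eapply cder_eq. repeat cder_step. apply cder_RtoC with (l := rho' th).
      unfold rho, rho'. auto_derive; auto; field; lra. cbv beta; ring.
    + eapply cder_eq. apply cder_plus. apply cder_const. apply cder_mult. apply cder_mult. apply cder_const. apply Dcis.
      apply cder_RtoC with (l := rv u th).
      unfold rho, rv. auto_derive; try lra. field; lra.
      cbv beta. replace ((rv u th, rho u th) : C) with (Cplus (RtoC (rv u th)) (Cmult (0, 1) (RtoC (rho u th))))
        by (apply injective_projections; simpl; ring). ring.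
    + eapply cder_eq. apply cder_mult. apply cder_mult. apply cder_const. apply Dcis.
      apply cder_RtoC with (l := rv' th).
      unfold rho', rv'. auto_derive; try lra. field; lra.
      cbv beta. replace ((rv' th, rho' th) : C) with (Cplus (RtoC (rv' th)) (Cmult (0, 1) (RtoC (rho' th))))
        by (apply injective_projections; simpl; ring). ring.
    + eapply cder_eq. apply cder_mult. apply cder_const.
      apply cder_pair with (df := rv' th) (dg := rho' th).
      unfold rv, rv'. auto_derive; auto; field; lra. unfold rho, rho'. auto_derive; auto; field; lra.
      cbv beta. rewrite Cmult_0_l. apply Cplus_0_l.
    + unfold cont2, rho, Rdiv. cont; try (apply continuous_cis; cont); simpl; lra.
    + unfold cont2, rho', Rdiv. cont; try (apply continuous_cis; cont); simpl; lra.
    + unfold cont2, rv, rho, Rdiv. cont; try (apply continuous_cis; cont); simpl; try apply pow_nonzero; try lra. apply Rgt_not_eq; nra.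
    + unfold cont2, rv', rho', Rdiv. cont; try (apply continuous_cis; cont); simpl; try lra. apply Rgt_not_eq; nra.
Qed.

Lemma CI_reflect g a b : a <= b -> contI (fun t => g (- t)) a b -> contI g (- b) (- a) ->
  CI (fun t => g (- t)) a b = CI g (- b) (- a).
Proof.
  intros Hab C1 C2.
  assert (L : forall h : R -> R, contI (fun t => h (- t)) a b -> contI h (- b) (- a) -> RInt (fun t => h (- t)) a b = RInt h (- b) (- a)).
  { intros h Ch1 Ch2. rewrite <- (opp_RInt_swap (V:=R_CompleteNormedModule) h (- a) (- b)).
    2:{ apply (ex_RInt_swap (V:=R_NormedModule)), ex_RInt_contI; auto; lra. }
    rewrite <- (RInt_comp (V:=R_CompleteNormedModule) h Ropp (fun _ => -1)).
    - rewrite (RInt_scal (V:=R_CompleteNormedModule) (fun t => h (- t)) a b (-1)).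
      match goal with |- ?v = opp (scal _ ?u) => set (v0 := v : R); change (v0 = - (-1 * v0) :> R) end. ring.
      apply ex_RInt_contI; auto.
    - rewrite Rmin_left, Rmax_right by lra. intros x Hx. apply Ch2. lra.
    - intros; split; [auto_derive; auto; lra|apply continuous_const]. }
  apply injective_projections.
  - apply (L (fun x => Re (g x))); intros x Hx; apply continuous_Re; auto.
  - apply (L (fun x => Im (g x))); intros x Hx; apply continuous_Im; auto.
Qed.

Lemma CI_translate g h a b : a <= b -> contI g (a + h) (b + h) -> CI (fun t => g (t + h)) a b = CI g (a + h) (b + h).
Proof.
  intros Hab Cg.
  rewrite <- (CI_comp g (fun t => t + h) (fun _ => 1) a b Hab).
  - apply CI_ext; auto. intros; symmetry; apply Cmult_1_l.
  - intros x Hx. apply Cg. lra.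
  - intros x _. split; [auto_derive; auto; ring|apply continuous_const].
Qed.

Lemma cis_PI2 : cis (PI / 2) = Ci.
Proof. unfold cis, Cexp; simpl. rewrite exp_0, cos_PI2, sin_PI2. apply injective_projections; simpl; ring. Qed.
Lemma cis_2PI x : cis (x + 2 * PI) = cis x.
Proof. unfold cis, Cexp; simpl. rewrite cos_plus, sin_plus, cos_2PI, sin_2PI. apply injective_projections; simpl; ring. Qed.

Lemma holo_continuous U F s : holo U F -> U s -> continuous F s.
Proof. intros [F' [_ [H _]]]. auto. Qed.

Lemma circle_not1 a x : 0 < a -> Cplus (RtoC 1) (Cmult (RtoC a) (cis x)) <> RtoC 1.
Proof.
  intros Ha E. apply Cplus_1_eq in E. apply (f_equal Cmod) in E.
  rewrite Cmod_mult, Cmod_cis, Cmod_R, Cmod_0, Rabs_pos_eq in E; lra.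
Qed.

Lemma Circ_cont F a : holo not1 F -> 0 < a ->
  contR (fun th => Cmult (F (Cplus (RtoC 1) (Cmult (RtoC a) (cis th)))) (Cmult (RtoC a) (cis th))).
Proof.
  intros HF Ha x. apply continuous_Cmult.
  - apply (continuous_comp (fun th => Cplus (RtoC 1) (Cmult (RtoC a) (cis th))) F).
    cont. apply (continuous_cis (fun y => y)). cont.
    apply holo_continuous with not1; auto. intros E. now apply circle_not1 in E.
  - cont. apply (continuous_cis (fun y => y)). cont.
Qed.

(** The residue is defined by a circle, whereas moving a vertical line produces rectangles; this is
    the bridge. The left-hand side is the counterclockwise integral around the square, whose
    inscribed circle has radius [a]. The square is cut into the wedges at the angles
    $0,\pi/2,\pi,3\pi/2$. *)
Lemma square_circle F a : holo not1 F -> 0 < a ->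
  Cplus (Cmult Ci (Cminus (Vint F (1 + a) (- a) a) (Vint F (1 - a) (- a) a)))
    (Cminus (Hint F (- a) (1 - a) (1 + a)) (Hint F a (1 - a) (1 + a))) = Cmult Ci (Circ F a).
Proof.
  intros HF Ha. assert (PP := PI_RGT_0). assert (Haa : - a <= a) by lra.
  set (h := fun x => Cmult (F (Cplus (RtoC 1) (Cmult (RtoC a) (cis x)))) (Cmult (RtoC a) (cis x))).
  assert (Ch : contR h) by now apply Circ_cont.
  set (Ray := fun z => CI (fun u => Cmult (F (Cplus (RtoC 1) (Cmult z (RtoC (a * (1 - u + u / cos (PI / 4)))))))
           (Cmult z (RtoC (a * (- 1 + / cos (PI / 4)))))) 0 1).
  set (S := fun w => CI (fun t => Cmult (F (Cplus (RtoC 1) (Cmult w (a, t)))) (Cmult w Ci)) (- a) a).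
  assert (W : forall p, S (cis p) = Cplus (Cmult Ci (CI h (p - PI / 4) (p + PI / 4))) (Cminus (Ray (cis (p + PI / 4))) (Ray (cis (p - PI / 4))))).
  { intros p. assert (X := wedge F a (cis p) HF Ha (Cmod_cis p)).
    rewrite <- !cis_plus in X. fold (S (cis p)) in X.
    replace (CI _ (- (PI / 4)) (PI / 4)) with (Cmult Ci (CI h (p - PI / 4) (p + PI / 4))) in X.
    - change (p + - (PI / 4)) with (p - PI / 4) in X. fold (Ray (cis (p + PI / 4))) in X. fold (Ray (cis (p - PI / 4))) in X.
      rewrite <- X. ring.
    - replace (p - PI / 4) with (- (PI / 4) + p) by ring. replace (p + PI / 4) with (PI / 4 + p) by ring.
      rewrite <- CI_translate; [|lra|now apply contR_I].
      rewrite <- CI_scal; [|lra|]. 2:{ intros x _. apply (continuous_comp (fun t => t + p) h). cont. apply Ch. }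
      apply CI_ext; [lra|]. intros th _. unfold h.
      replace (Cmult (cis p) (Cmult (RtoC a) (cis th))) with (Cmult (RtoC a) (cis (th + p))) by (rewrite cis_plus; ring).
      rewrite cis_plus. ring. }
  assert (Cv : forall x, x <> 1 -> contR (fun t => F (x, t))).
  { intros x Hx t. apply (continuous_comp (fun t => (x, t) : C) F). cont.
    apply holo_continuous with not1; auto. intros E; injection E; auto. }
  assert (Chz : forall y, y <> 0 -> contR (fun x => F (x, y))).
  { intros y Hy x. apply (continuous_comp (fun x => (x, y) : C) F). cont.
    apply holo_continuous with not1; auto. intros E; injection E; auto. }
  assert (S0 : S (cis 0) = Cmult Ci (Vint F (1 + a) (- a) a)).
  { unfold S, Vint. rewrite cis_0, <- CI_scal; [|auto|apply contR_I, Cv; lra].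
    apply CI_ext; auto. intros t _. replace (Cplus (RtoC 1) (Cmult (RtoC 1) (a, t))) with ((1 + a, t) : C).
    ring. apply injective_projections; simpl; ring. }
  assert (S1 : S (cis (0 + PI / 2)) = Copp (Hint F a (1 - a) (1 + a))).
  { unfold S, Hint. rewrite Rplus_0_l, cis_PI2.
    rewrite (CI_ext _ (fun t => Cmult (RtoC (-1)) (F (- t + 1, a)))); auto.
    2:{ intros t _. replace (Cplus (RtoC 1) (Cmult Ci (a, t))) with ((- t + 1, a) : C) by (apply injective_projections; simpl; ring).
        replace (Cmult Ci Ci) with (RtoC (-1)) by (apply injective_projections; simpl; ring). ring. }
    rewrite CI_scal; auto. 2:{ intros t _. apply (continuous_comp (fun t => - t + 1) (fun x => F (x, a))). cont. apply Chz. lra. }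
    rewrite (CI_reflect (fun t => F (t + 1, a))); auto.
    2:{ intros t _. apply (continuous_comp (fun t => - t + 1) (fun x => F (x, a))). cont. apply Chz. lra. }
    2:{ intros t _. apply (continuous_comp (fun t => t + 1) (fun x => F (x, a))). cont. apply Chz. lra. }
    rewrite (CI_translate (fun x => F (x, a)) 1). 2: lra. 2: apply contR_I, Chz; lra.
    replace (- a + 1) with (1 - a) by ring. replace (- - a + 1) with (1 + a) by ring. ring. }
  assert (S2 : S (cis (0 + PI / 2 + PI / 2)) = Copp (Cmult Ci (Vint F (1 - a) (- a) a))).
  { unfold S, Vint. rewrite Rplus_0_l, cis_plus, cis_PI2.
    rewrite (CI_ext _ (fun t => Cmult (Copp Ci) (F (1 - a, - t)))); auto.
    2:{ intros t _. replace (Cmult Ci Ci) with (RtoC (-1)) by (apply injective_projections; simpl; ring).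
        replace (Cplus (RtoC 1) (Cmult (RtoC (-1)) (a, t))) with ((1 - a, - t) : C) by (apply injective_projections; simpl; ring).
        rewrite Cmult_comm. f_equal. apply injective_projections; simpl; ring. }
    assert (Cm : contR (fun t => F (1 - a, - t))).
    { intros t. apply (continuous_comp (fun t => - t) (fun x => F (1 - a, x))). cont. apply Cv. lra. }
    rewrite CI_scal; auto. 2: now apply contR_I.
    rewrite (CI_reflect (fun t => F (1 - a, t))); auto.
    2: now apply contR_I. 2: apply contR_I, Cv; lra.
    rewrite Ropp_involutive. ring. }
  assert (S3 : S (cis (0 + PI / 2 + PI / 2 + PI / 2)) = Hint F (- a) (1 - a) (1 + a)).
  { unfold S, Hint. rewrite Rplus_0_l, !cis_plus, cis_PI2.
    rewrite (CI_ext _ (fun t => F (t + 1, - a))); auto.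
    2:{ intros t _. replace (Cmult (Cmult Ci Ci) Ci) with (Copp Ci) by (apply injective_projections; simpl; ring).
        replace (Cplus (RtoC 1) (Cmult (Copp Ci) (a, t))) with ((t + 1, - a) : C) by (apply injective_projections; simpl; ring).
        replace (Cmult (Copp Ci) Ci) with (RtoC 1) by (apply injective_projections; simpl; ring). ring. }
    rewrite (CI_translate (fun x => F (x, - a)) 1). 2: lra. 2: apply contR_I, Chz; lra.
    replace (- a + 1) with (1 - a) by ring. replace (a + 1) with (1 + a) by ring. ring. }
  assert (E : Cplus (Cplus (S (cis 0)) (S (cis (0 + PI / 2)))) (Cplus (S (cis (0 + PI / 2 + PI / 2))) (S (cis (0 + PI / 2 + PI / 2 + PI / 2)))) = Cmult Ci (Circ F a)).
  { rewrite !W.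
    replace (0 - PI / 4) with (- (PI / 4)) by ring.
    replace (0 + PI / 4) with (PI / 4) by ring.
    replace (0 + PI / 2 - PI / 4) with (PI / 4) by field.
    replace (0 + PI / 2 + PI / 4) with (3 * (PI / 4)) by field.
    replace (0 + PI / 2 + PI / 2 - PI / 4) with (3 * (PI / 4)) by field.
    replace (0 + PI / 2 + PI / 2 + PI / 4) with (5 * (PI / 4)) by field.
    replace (0 + PI / 2 + PI / 2 + PI / 2 - PI / 4) with (5 * (PI / 4)) by field.
    replace (0 + PI / 2 + PI / 2 + PI / 2 + PI / 4) with (- (PI / 4) + 2 * PI) by field.
    rewrite cis_2PI.
    (* The four arcs begin at the angle $-\pi/4$, while [Circ] begins at 0; periodicity moves the
       first piece to the end. *)
    assert (K : Circ F a = Cplus (Cplus (CI h (- (PI / 4)) (PI / 4)) (CI h (PI / 4) (3 * (PI / 4))))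
       (Cplus (CI h (3 * (PI / 4)) (5 * (PI / 4))) (CI h (5 * (PI / 4)) (- (PI / 4) + 2 * PI)))).
    { rewrite CI_Chasles; [|lra|now apply contR_I]. rewrite CI_Chasles; [|lra|now apply contR_I].
      rewrite CI_Chasles; [|lra|now apply contR_I].
      unfold Circ. fold h.
      rewrite <- (CI_Chasles h 0 (- (PI / 4) + 2 * PI) (2 * PI)); [|lra|now apply contR_I].
      rewrite <- (CI_Chasles h (- (PI / 4)) 0 (- (PI / 4) + 2 * PI)); [|lra|now apply contR_I].
      replace (CI h (- (PI / 4) + 2 * PI) (2 * PI)) with (CI h (- (PI / 4)) 0). ring.
      replace (2 * PI) with (0 + 2 * PI) at 2 by ring.
      rewrite <- CI_translate; [|lra|now apply contR_I]. apply CI_ext. lra. intros x _. unfold h. now rewrite cis_2PI. }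
    rewrite K. ring. }
  rewrite S0, S1, S2, S3 in E. rewrite <- E. ring.
Qed.

(** The strip between the two lines, cut off at height $T$, is the square about 1 together with a
    rectangle above and one below, in which [rect_cauchy] applies. *)
Lemma line_shift_circle F a T : holo not1 F -> 0 < a <= T ->
  Cmult Ci (Cminus (Vint F (1 + a) (- T) T) (Vint F (1 - a) (- T) T)) =
  Cplus (Cmult Ci (Circ F a)) (Cminus (Hint F T (1 - a) (1 + a)) (Hint F (- T) (1 - a) (1 + a))).
Proof.
  intros HF Ha.
  assert (Cv : forall x, x <> 1 -> contR (fun t => F (x, t))).
  { intros x Hx t. apply (continuous_comp (fun t => (x, t) : C) F). cont.
    apply holo_continuous with not1; auto. intros E; injection E; auto. }
  assert (R1 := rect_cauchy not1 F (1 - a) (1 + a) a T HF ltac:(lra) ltac:(lra)).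
  assert (R2 := rect_cauchy not1 F (1 - a) (1 + a) (- T) (- a) HF ltac:(lra) ltac:(lra)).
  assert (Q := square_circle F a HF ltac:(lra)).
  assert (V : forall x, x <> 1 -> Vint F x (- T) T = Cplus (Cplus (Vint F x (- T) (- a)) (Vint F x (- a) a)) (Vint F x a T)).
  { intros x Hx. unfold Vint. rewrite CI_Chasles; [|lra|apply contR_I; auto]. rewrite CI_Chasles; [auto|lra|apply contR_I; auto]. }
  rewrite !V by lra.
  rewrite <- Q.
  assert (R1' : Cmult Ci (Cminus (Vint F (1 + a) a T) (Vint F (1 - a) a T)) = Cminus (Hint F T (1 - a) (1 + a)) (Hint F a (1 - a) (1 + a))).
  { apply R1. intros x y Hx Hy E. injection E; lra. }
  assert (R2' : Cmult Ci (Cminus (Vint F (1 + a) (- T) (- a)) (Vint F (1 - a) (- T) (- a))) = Cminus (Hint F (- a) (1 - a) (1 + a)) (Hint F (- T) (1 - a) (1 + a))).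
  { apply R2. intros x y Hx Hy E. injection E; lra. }
  transitivity (Cplus (Cplus (Cmult Ci (Cminus (Vint F (1 + a) (- T) (- a)) (Vint F (1 - a) (- T) (- a))))
     (Cmult Ci (Cminus (Vint F (1 + a) (- a) a) (Vint F (1 - a) (- a) a)))) (Cmult Ci (Cminus (Vint F (1 + a) a T) (Vint F (1 - a) a T)))). ring.
  rewrite R1', R2'. ring.
Qed.

(** [path_green] in polar coordinates on the annulus. The radial sides at the angles 0 and $2\pi$
    coincide, so their contributions cancel. *)
Lemma Circ_radius F r1 r2 : holo not1 F -> 0 < r1 <= r2 -> Circ F r1 = Circ F r2.
Proof.
  intros HF Hr. assert (PP := PI_RGT_0).
  assert (Dcis : forall th, cder cis th (Cmult (cis th) Ci)).
  { intros th. apply (cder_cis (fun t => t)). apply (is_derive_id (K:=R_AbsRing)). }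
  assert (X := path_green not1 F (fun u th => Cplus (RtoC 1) (Cmult (RtoC u) (cis th)))
    (fun u th => cis th) (fun u th => Cmult (RtoC u) (Cmult (cis th) Ci)) (fun u th => Cmult (cis th) Ci) r1 r2 0 (2 * PI) HF ltac:(lra) ltac:(lra)).
  assert (E : forall r, 0 < r -> CI (fun v => Cmult (F (Cplus (RtoC 1) (Cmult (RtoC r) (cis v)))) (Cmult (RtoC r) (Cmult (cis v) Ci))) 0 (2 * PI) = Cmult Ci (Circ F r)).
  { intros r Hr'. unfold Circ. rewrite <- CI_scal; [|lra|apply contR_I, Circ_cont; auto].
    apply CI_ext. lra. intros; ring. }
  cbv beta in X. rewrite !E in X by lra.
  assert (Y : Cminus (Cmult Ci (Circ F r2)) (Cmult Ci (Circ F r1)) = RtoC 0).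
  { rewrite X.
    - replace (2 * PI) with (0 + 2 * PI) by ring. rewrite !cis_2PI. ring.
    - intros u th Hu Hth.
      split; [|split; [|split; [|split; [|split; [|split; [|split; [|split]]]]]]].
      + apply circle_not1. lra.
      + eapply cder_eq. repeat cder_step. apply cder_RtoC with (l := 1). apply (is_derive_id (K:=R_AbsRing)). cbv beta; ring.
      + eapply cder_eq. apply cder_plus. apply cder_const. apply cder_mult. apply cder_const. apply Dcis. cbv beta; ring.
      + apply Dcis.
      + eapply cder_eq. apply cder_mult. apply cder_RtoC with (l := 1). apply (is_derive_id (K:=R_AbsRing)). apply cder_const. cbv beta; ring.
      + unfold cont2. cont. apply continuous_cis; cont.
      + unfold cont2. apply continuous_cis; cont.
      + unfold cont2. cont. apply continuous_cis; cont.
      + unfold cont2. cont. apply continuous_cis; cont. }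
  assert (Z : Cmult Ci (Cminus (Circ F r2) (Circ F r1)) = RtoC 0) by (rewrite <- Y; ring).
  assert (Z' : Cminus (Circ F r2) (Circ F r1) = RtoC 0).
  { replace (Cminus (Circ F r2) (Circ F r1)) with (Cmult (Copp Ci) (Cmult Ci (Cminus (Circ F r2) (Circ F r1)))).
    rewrite Z; ring. replace (Cmult (Copp Ci) (Cmult Ci (Cminus (Circ F r2) (Circ F r1)))) with (Cmult (Copp (Cmult Ci Ci)) (Cminus (Circ F r2) (Circ F r1))) by ring.
    replace (Copp (Cmult Ci Ci)) with (RtoC 1) by (apply injective_projections; simpl; ring). ring. }
  replace (Circ F r2) with (Cplus (Cminus (Circ F r2) (Circ F r1)) (Circ F r1)) by ring. rewrite Z'. ring.
Qed.

(** * The Mellin transform *)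

(* [G j v] stands for the [j]-th derivative of [f] at [exp v]. *)
Record mellin_data (alpha : R) (m : nat) (G : nat -> R -> C) : Prop := {
  mellin_data_cont : forall j, (j <= m)%nat -> contR (G j);
  mellin_data_der : forall j v, (j < m)%nat -> cder (G j) v (Cmult (RtoC (exp v)) (G (S j) v));
  mellin_data_bound : forall j, (j <= m)%nat -> exists K, 0 <= K /\
    forall v, Cmod (G j v) <= K /\ Cmod (G j v) <= K * exp (- (alpha + INR j) * v) }.

Lemma within_eps (h : R -> C) (D : R -> Prop) x l :
  filterlim h (within D (locally x)) (@locally C_UniformSpace l) ->
  forall e, 0 < e -> exists d, 0 < d /\ forall y, Rabs (y - x) < d -> D y -> Cmod (Cminus (h y) l) < e.
Proof.
  intros H e He. assert (He2 : 0 < e / 2) by lra.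
  destruct (proj1 (filterlim_locally (U:=C_UniformSpace) h l) H (mkposreal _ He2)) as [d Hd].
  exists d. split. apply cond_pos. intros y Hy HD.
  destruct (Hd y Hy HD) as [B1 B2].
  change (Rabs (fst (h y) - fst l) < e / 2) in B1. change (Rabs (snd (h y) - snd l) < e / 2) in B2.
  apply Rle_lt_trans with (Rabs (fst (h y) - fst l) + Rabs (snd (h y) - snd l)); [|lra].
  replace (Cminus (h y) l) with (Cplus (RtoC (fst (h y) - fst l)) (0, snd (h y) - snd l))
        by (destruct l, (h y); apply injective_projections; simpl; ring).
  eapply Rle_trans; [apply Cmod_triangle|]; rewrite Cmod_R; apply Rplus_le_compat_l;
      unfold Cmod; simpl; rewrite Rmult_0_l, Rplus_0_l, Rmult_1_r; fold (Rsqr (snd (h y) - snd l)); rewrite sqrt_Rsqr_abs; lra.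
Qed.

Lemma has_deriv_cont g g' x : has_deriv_nonneg g g' x ->
  forall e, 0 < e -> exists d, 0 < d /\ forall y, Rabs (y - x) < d -> 0 <= y -> Cmod (Cminus (g y) (g x)) < e.
Proof.
  intros H e He. destruct (within_eps _ _ _ _ H 1 Rlt_0_1) as [d [Hd Hd']].
  set (M := Cmod (g' x) + 1). assert (HM : 0 < M) by (assert (q := Cmod_ge_0 (g' x)); unfold M; lra).
  exists (Rmin d (e / M)). split. apply Rmin_pos; auto. now apply Rdiv_lt_0_compat.
  intros y Hy Hy0. destruct (Req_dec y x) as [->|N].
  - replace (Cminus (g x) (g x)) with (RtoC 0) by ring. now rewrite Cmod_0.
  - assert (Y1 : Rabs (y - x) < d) by (eapply Rlt_le_trans; [exact Hy|apply Rmin_l]).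
    assert (Y2 : Rabs (y - x) < e / M) by (eapply Rlt_le_trans; [exact Hy|apply Rmin_r]).
    specialize (Hd' y Y1 (conj Hy0 N)).
    assert (N' : RtoC (y - x) <> RtoC 0) by (apply RtoC_inj_0; lra).
    replace (Cminus (g y) (g x)) with (Cmult (Cdiv (Cminus (g y) (g x)) (RtoC (y - x))) (RtoC (y - x))) by (field; auto).
    rewrite Cmod_mult, Cmod_R.
    assert (B : Cmod (Cdiv (Cminus (g y) (g x)) (RtoC (y - x))) <= M).
    { replace (Cdiv (Cminus (g y) (g x)) (RtoC (y - x))) with (Cplus (g' x) (Cminus (Cdiv (Cminus (g y) (g x)) (RtoC (y - x))) (g' x))) by ring.
      eapply Rle_trans; [apply Cmod_triangle|]. unfold M; lra. }
    apply Rle_lt_trans with (M * Rabs (y - x)). apply Rmult_le_compat_r; auto. apply Rabs_pos.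
    apply Rlt_le_trans with (M * (e / M)). apply Rmult_lt_compat_l; auto. right; field; lra.
Qed.

Lemma has_deriv_cder g g' x : 0 < x -> has_deriv_nonneg g g' x -> cder g x (g' x).
Proof.
  intros Hx H.
  assert (L : forall e, 0 < e -> exists d, 0 < d /\ forall h, h <> 0 -> Rabs h < d ->
     Cmod (Cminus (Cdiv (Cminus (g (x + h)) (g x)) (RtoC h)) (g' x)) < e).
  { intros e He. destruct (within_eps _ _ _ _ H e He) as [d [Hd Hd']].
    exists (Rmin d x). split. now apply Rmin_pos. intros h Hh Hh'.
    assert (Y1 : Rabs h < d) by (eapply Rlt_le_trans; [exact Hh'|apply Rmin_l]).
    assert (Y2 : Rabs h < x) by (eapply Rlt_le_trans; [exact Hh'|apply Rmin_r]).
    apply Rabs_def2 in Y2.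
    specialize (Hd' (x + h)). replace (x + h - x) with h in Hd' by ring. apply Hd'; auto. split; lra. }
  split; apply is_derive_Reals; intros e He; destruct (L e He) as [d [Hd Hd']]; exists (mkposreal d Hd); intros h Hh Hh';
   specialize (Hd' h Hh Hh'); (eapply Rle_lt_trans; [|exact Hd']).
  - eapply Rle_trans; [|apply re_le_Cmod]. right. f_equal. unfold Re, Cdiv; simpl. field. nra.
  - eapply Rle_trans; [|apply (Rle_trans _ _ _ (Rmax_r _ _) (Rmax_Cmod (Cminus (Cdiv (Cminus (g (x + h)) (g x)) (RtoC h)) (g' x))))].
    right. f_equal. unfold Im, Cdiv; simpl. field. nra.
Qed.

(** Both bounds are required of the data: boundedness governs $v\to-\infty$, where $e^{(s+j)v}$
    decays, and the power decay governs $v\to\infty$. *)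
Lemma class_M_mellin_data alpha m f : 1 < alpha -> class_M alpha m f ->
  exists G, mellin_data alpha m G /\ forall v, G O v = f (exp v).
Proof.
  intros Hal [g [H0 [H1 [H2 H3]]]].
  exists (fun j v => g j (exp v)). split; [|intros v; apply H0; left; apply exp_pos].
  assert (C0 : forall j, (j <= m)%nat -> forall x, 0 <= x -> forall e, 0 < e -> exists d, 0 < d /\ forall y, Rabs (y - x) < d -> 0 <= y -> Cmod (Cminus (g j y) (g j x)) < e).
  { intros j Hj x Hx. destruct (Nat.eq_dec j m) as [->|N].
    - apply within_eps. now apply H2.
    - apply has_deriv_cont with (g (S j)). apply H1; auto. lia. }
  (* Continuity at 0 is one-sided in [class_M]; constant extension to the left of 0 gives a function
     continuous on the line, to which the extreme value theorem applies on $[0,X]$. *)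
  assert (C1 : forall j, (j <= m)%nat -> contR (fun x => g j (Rmax 0 x))).
  { intros j Hj x. apply continuous_C_eps. intros e He.
    destruct (C0 j Hj (Rmax 0 x) (Rmax_l 0 x) e He) as [d [Hd Hd']]. exists d; split; auto.
    intros y Hy. apply Hd'. 2: apply Rmax_l. eapply Rle_lt_trans; [|exact Hy].
    unfold Rmax. destruct (Rle_dec 0 y), (Rle_dec 0 x); unfold Rabs;
    repeat match goal with |- context [Rcase_abs ?u] => destruct (Rcase_abs u) end; lra. }
  split.
  - intros j Hj v.
    apply continuous_ext with (fun v => g j (Rmax 0 (exp v))).
    { intros w. rewrite Rmax_right; auto. left; apply exp_pos. }
    apply (continuous_comp exp (fun x => g j (Rmax 0 x))). cont. now apply C1.
  - intros j v Hj.
    assert (D := has_deriv_cder _ _ (exp v) (exp_pos v) (H1 j (exp v) Hj (Rlt_le _ _ (exp_pos v)))).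
    destruct D as [D1 D2].
    assert (De := is_derive_exp v).
    split.
    + replace (Re (Cmult (RtoC (exp v)) (g (S j) (exp v)))) with (scal (exp v) (Re (g (S j) (exp v)))).
      apply (is_derive_comp (fun x => Re (g j x)) exp); auto.
      unfold Re, scal; simpl. unfold mult; simpl. ring.
    + replace (Im (Cmult (RtoC (exp v)) (g (S j) (exp v)))) with (scal (exp v) (Im (g (S j) (exp v)))).
      apply (is_derive_comp (fun x => Im (g j x)) exp); auto.
      unfold Im, scal; simpl. unfold mult; simpl. ring.
  - intros j Hj. destruct (H3 j Hj) as [M [X [HX HM]]].
    destruct (continuity_ab_maj (fun x => Cmod (g j (Rmax 0 x))) 0 X) as [mx [Hmx _]]. lra.
    { intros x _. apply continuity_pt_filterlim. apply (continuous_Cmod (fun x => g j (Rmax 0 x))). now apply C1. }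
    set (B := Cmod (g j (Rmax 0 mx))). assert (PB : 0 <= B) by apply Cmod_ge_0.
    set (p := alpha + INR j). assert (Pj := pos_INR j). assert (Pp : 0 < p) by (unfold p; lra).
    assert (HB : forall x, 0 <= x <= X -> Cmod (g j x) <= B).
    { intros x Hx. specialize (Hmx x Hx). simpl in Hmx. rewrite (Rmax_right 0 x) in Hmx by lra. exact Hmx. }
    assert (HM' : forall v, X <= exp v -> Cmod (g j (exp v)) <= Rabs M * exp (- p * v)).
    { intros v Hv. eapply Rle_trans; [apply HM; auto|]. unfold Rpower. rewrite ln_exp.
      replace ((- alpha - INR j) * v) with (- p * v) by (unfold p; ring).
      apply Rmult_le_compat_r. left; apply exp_pos. apply Rle_abs. }
    assert (PM := Rabs_pos M).
    assert (PX := exp_pos (- p * ln X)). assert (PX' := exp_pos (p * ln X)).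
    (* The four summands settle the four cases: the uniform or the decaying bound, for [exp v <= X]
       or beyond. *)
    set (K := B + Rabs M * exp (- p * ln X) + B * exp (p * ln X) + Rabs M).
    assert (K0 : 0 <= Rabs M * exp (- p * ln X)) by (apply Rmult_le_pos; lra).
    assert (K1 : 0 <= B * exp (p * ln X)) by (apply Rmult_le_pos; lra).
    exists K. split. unfold K; lra.
    intros v. fold p. assert (Pe := exp_pos (- p * v)).
    destruct (Rle_dec (exp v) X) as [Hv|Hv].
    + assert (Bv := HB (exp v) (conj (Rlt_le _ _ (exp_pos v)) Hv)).
      split. unfold K; lra.
      assert (L : v <= ln X). { rewrite <- (ln_exp v). apply ln_le; auto. apply exp_pos. }
      assert (E : 1 <= exp (p * ln X) * exp (- p * v)).
      { rewrite <- exp_plus. rewrite <- exp_0 at 1. apply exp_le_mono. nra. }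
      apply Rle_trans with (B * exp (p * ln X) * exp (- p * v)). rewrite Rmult_assoc. nra.
      apply Rmult_le_compat_r; unfold K; lra.
    + apply Rnot_le_lt in Hv. assert (Bv := HM' v (Rlt_le _ _ Hv)).
      assert (L : ln X <= v). { rewrite <- (ln_exp v). apply ln_le; lra. }
      split.
      * apply Rle_trans with (Rabs M * exp (- p * ln X)); [|unfold K; lra].
        eapply Rle_trans; [exact Bv|]. apply Rmult_le_compat_l; auto. apply exp_le_mono. nra.
      * eapply Rle_trans; [exact Bv|]. apply Rmult_le_compat_r; unfold K; lra.
Qed.

Definition mellin (G0 : R -> C) (s : C) : C := IntR (fun v => Cmult (G0 v) (Cexp (Cmult s (RtoC v)))).

(** Each integration by parts replaces $f^{(j)}(x)x^{s+j}$ by $f^{(j+1)}(x)x^{s+j+1}$, whence the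
    exponent [s + j]. It compensates exactly the extra decay of the $j$-th derivative, so the strip
    is the same for every $j$. *)
Lemma mellin_data_dominated alpha m G j : mellin_data alpha m G -> (j <= m)%nat -> exists K, 0 <= K /\ forall e s, 0 < e -> e <= Re s <= alpha - e ->
  dominated (fun v => Cmult (G j v) (Cexp (Cmult (Cplus s (RtoC (INR j))) (RtoC v)))) (fun v => K * exp (- (e * Rabs v))).
Proof.
  intros HG Hj. destruct (mellin_data_bound _ _ _ HG j Hj) as [K [HK HB]]. exists K; split; auto.
  intros e s He Hs. split.
  - intros v. apply continuous_Cmult. apply (mellin_data_cont _ _ _ HG j Hj). cont.
  - intros v. rewrite Cmod_mult, Cmod_Cexp.
    replace (Re (Cmult (Cplus s (RtoC (INR j))) (RtoC v))) with ((Re s + INR j) * v) by (unfold Re; simpl; ring).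
    destruct (HB v) as [B1 B2]. assert (Pj := pos_INR j). assert (P0 := Cmod_ge_0 (G j v)).
    destruct (Rle_dec 0 v) as [Hv|Hv].
    + rewrite (Rabs_pos_eq v) by auto.
      apply Rle_trans with (K * exp (- (alpha + INR j) * v) * exp ((Re s + INR j) * v)).
      apply Rmult_le_compat_r; auto. left; apply exp_pos.
      rewrite Rmult_assoc, <- exp_plus. apply Rmult_le_compat_l; auto. apply exp_le_mono. nra.
    + rewrite Rabs_left by lra. apply Rmult_le_compat; auto. left; apply exp_pos. apply exp_le_mono. nra.
Qed.

Lemma good_weight_Kexp K e : 0 <= K -> 0 < e -> good_weight (fun v => K * exp (- (e * Rabs v))).
Proof. intros. apply good_weight_scal; auto. now apply good_weight_exp. Qed.

Lemma mellin_data_dom0 alpha m G : mellin_data alpha m G -> exists K, 0 <= K /\ forall e s, 0 < e -> e <= Re s <= alpha - e ->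
  dominated (fun v => Cmult (G O v) (Cexp (Cmult s (RtoC v)))) (fun v => K * exp (- (e * Rabs v))).
Proof.
  intros HG. destruct (mellin_data_dominated alpha m G O HG (Nat.le_0_l _)) as [K [HK H]]. exists K; split; auto.
  intros e s He Hs. destruct (H e s He Hs) as [C1 C2]. simpl INR in *.
  split. intros v. apply continuous_Cmult. apply (mellin_data_cont _ _ _ HG O). lia. cont.
  intros v. specialize (C2 v). replace (Cplus s (RtoC 0)) with s in C2 by ring. exact C2.
Qed.

Lemma mellin_decay alpha m G e : mellin_data alpha m G -> 0 < e -> exists B, 0 <= B /\ forall s, e <= Re s <= alpha - e ->
  Cmod (mellin (G O) s) <= B /\ Cmod (mellin (G O) s) * Rabs (Im s) ^ m <= B.
Proof.
  intros HG He.
  set (Mel := fun j s => IntR (fun v => Cmult (G j v) (Cexp (Cmult (Cplus s (RtoC (INR j))) (RtoC v))))).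
  (* One integration by parts. The sum of the two integrands is the derivative of
     $f^{(j)}(e^v)e^{(s+j)v}$, which tends to 0 at both ends; the integral of the sum is therefore
     0. *)
  assert (Rec : forall j s, (j < m)%nat -> e <= Re s <= alpha - e -> Cmult (Cplus s (RtoC (INR j))) (Mel j s) = Copp (Mel (S j) s)).
  { intros j s Hj Hs.
    destruct (mellin_data_dominated alpha m G j HG ltac:(lia)) as [K1 [HK1 D1]]. specialize (D1 e s He Hs).
    destruct (mellin_data_dominated alpha m G (S j) HG ltac:(lia)) as [K2 [HK2 D2]]. specialize (D2 e s He Hs).
    assert (I1 := Int_correct _ _ (good_weight_Kexp K1 e HK1 He) D1). assert (I2 := Int_correct _ _ (good_weight_Kexp K2 e HK2 He) D2).
    assert (I := is_Int_plus _ _ _ _ (proj1 D2) (fun v => continuous_Cmult _ _ v (continuous_const (Cplus s (RtoC (INR j))) v) (proj1 D1 v)) I2 (is_Int_scal _ (Cplus s (RtoC (INR j))) _ (proj1 D1) I1)).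
    fold (Mel j s) in I. fold (Mel (S j) s) in I.
    assert (J : is_Int (fun x => Cplus (Cmult (G (S j) x) (Cexp (Cmult (Cplus s (RtoC (INR (S j)))) (RtoC x))))
       (Cmult (Cplus s (RtoC (INR j))) (Cmult (G j x) (Cexp (Cmult (Cplus s (RtoC (INR j))) (RtoC x)))))) (RtoC 0)).
    { intros d Hd.
      assert (Hd2 : 0 < d / (2 * (K1 + 1))) by (apply Rdiv_lt_0_compat; lra).
      set (T := Rabs (ln (d / (2 * (K1 + 1)))) / e + 1).
      assert (T0 : 0 <= Rabs (ln (d / (2 * (K1 + 1)))) / e) by (apply Rdiv_le_0_compat; [apply Rabs_pos|auto]).
      exists T. split. unfold T; lra. intros a b Ha Hb.
      assert (Sm : forall v, T <= Rabs v -> Cmod (Cmult (G j v) (Cexp (Cmult (Cplus s (RtoC (INR j))) (RtoC v)))) <= d / 2).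
      { intros v Hv. eapply Rle_trans; [apply D1|].
        apply Rle_trans with ((K1 + 1) * (d / (2 * (K1 + 1)))); [|right; field; lra].
        apply Rmult_le_compat; auto. left; apply exp_pos. lra.
        apply Rle_trans with (exp (ln (d / (2 * (K1 + 1))))); [|rewrite exp_ln; lra].
        apply exp_le_mono. assert (X := Rle_abs (- ln (d / (2 * (K1 + 1))))). rewrite Rabs_Ropp in X.
        assert (e * (Rabs (ln (d / (2 * (K1 + 1)))) / e) <= e * Rabs v) by (apply Rmult_le_compat_l; unfold T in Hv; lra).
        replace (e * (Rabs (ln (d / (2 * (K1 + 1)))) / e)) with (Rabs (ln (d / (2 * (K1 + 1))))) in H by (field; lra). lra. }
      rewrite (CI_derive (fun v => Cmult (G j v) (Cexp (Cmult (Cplus s (RtoC (INR j))) (RtoC v))))).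
      - replace (Cminus _ (RtoC 0)) with (Cminus (Cmult (G j b) (Cexp (Cmult (Cplus s (RtoC (INR j))) (RtoC b)))) (Cmult (G j a) (Cexp (Cmult (Cplus s (RtoC (INR j))) (RtoC a))))) by ring.
        eapply Rle_trans; [apply Cmod_minus_le|].
        assert (TP : 0 < T) by (unfold T; lra).
        assert (X1 := Sm a ltac:(rewrite Rabs_left1; lra)). assert (X2 := Sm b ltac:(rewrite Rabs_pos_eq; lra)). lra.
      - unfold T in *; lra.
      - intros v _. eapply cder_eq.
        + apply cder_mult. apply (mellin_data_der _ _ _ HG); auto.
          apply (cder_Cexp (fun v => Cmult (Cplus s (RtoC (INR j))) (RtoC v))). apply cder_mult. apply cder_const.
          apply cder_RtoC. apply (is_derive_id (K:=R_AbsRing)).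
        + cbv beta. rewrite S_INR, RtoC_plus.
          replace (Cmult (Cplus s (Cplus (RtoC (INR j)) (RtoC 1))) (RtoC v)) with (Cplus (Cmult (Cplus s (RtoC (INR j))) (RtoC v)) (RtoC v)) by ring.
          rewrite Cexp_plus. replace (Cexp (RtoC v)) with (RtoC (exp v)).
          change (RtoC one) with (RtoC 1). ring.
          unfold Cexp; simpl. rewrite cos_0, sin_0. apply injective_projections; simpl; ring.
      - intros v _. apply continuous_Cplus. apply (proj1 D2). apply continuous_Cmult. apply continuous_const. apply (proj1 D1). }
    assert (E := eq_trans (eq_sym (is_Int_Int _ _ J)) (is_Int_Int _ _ I)).
    replace (Cmult (Cplus s (RtoC (INR j))) (Mel j s)) with (Cminus (Cplus (Mel (S j) s) (Cmult (Cplus s (RtoC (INR j))) (Mel j s))) (Mel (S j) s)) by ring.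
    rewrite <- E. ring. }
  assert (Bd : forall j, (j <= m)%nat -> exists B, 0 <= B /\ forall s, e <= Re s <= alpha - e -> Cmod (Mel j s) <= B).
  { intros j Hj. destruct (mellin_data_dominated alpha m G j HG Hj) as [K [HK D]].
    destruct (good_weight_bound _ (good_weight_Kexp K e HK He)) as [B [HB0 HB]]. exists B; split; auto.
    intros s Hs. specialize (D e s He Hs).
    apply (is_Int_bound _ _ _ B (proj1 (good_weight_Kexp K e HK He)) D HB). apply (Int_correct _ _ (good_weight_Kexp K e HK He) D). }
  (* Each use of the recursion gains a factor $|s+j|\ge|\mathrm{Im}\,s|$. *)
  assert (It : forall j s, (j <= m)%nat -> e <= Re s <= alpha - e -> Cmod (Mel O s) * Rabs (Im s) ^ j <= Cmod (Mel j s)).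
  { induction j; intros s Hj Hs. simpl; lra.
    specialize (IHj s ltac:(lia) Hs). assert (X := f_equal Cmod (Rec j s ltac:(lia) Hs)).
    rewrite Cmod_mult, Cmod_opp in X. rewrite <- X. simpl.
    assert (I : Rabs (Im s) <= Cmod (Cplus s (RtoC (INR j)))).
    { assert (Y := Rle_trans _ _ _ (Rmax_r _ _) (Rmax_Cmod (Cplus s (RtoC (INR j))))). simpl in Y. rewrite Rplus_0_r in Y. exact Y. }
    assert (P0 := Cmod_ge_0 (Mel O s)). assert (P1 := Cmod_ge_0 (Mel j s)).
    assert (P2 := Rabs_pos (Im s)). assert (P3 := pow_le _ j P2). nra. }
  assert (E0 : forall s, Mel O s = mellin (G O) s).
  { intros s. unfold Mel, mellin. simpl. f_equal. replace (Cplus s (RtoC 0)) with s by ring. reflexivity. }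
  destruct (Bd O ltac:(lia)) as [B0 [HB0 B0']]. destruct (Bd m ltac:(lia)) as [B1 [HB1 B1']].
  exists (B0 + B1). split. lra. intros s Hs. rewrite <- E0. split.
  specialize (B0' s Hs). lra. specialize (B1' s Hs). specialize (It m s ltac:(lia) Hs). lra.
Qed.

Lemma Cexp_minus_1 z : Cmod (Cminus (Cexp z) (RtoC 1)) <= Cmod z * exp (Cmod z).
Proof.
  rewrite <- Cexp_0.
  replace (Cminus (Cexp z) (Cexp (RtoC 0))) with (CI (fun t => Cmult (Cexp (Cmult (RtoC t) z)) z) 0 1).
  - replace (Cmod z * exp (Cmod z)) with ((1 - 0) * (Cmod z * exp (Cmod z))) by ring.
    apply CI_bound_const. lra. intros t _; cont.
    intros t Ht. rewrite Cmod_mult, Cmod_Cexp, Rmult_comm. apply Rmult_le_compat_l. apply Cmod_ge_0.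
    apply exp_le_mono. assert (X := re_le_Cmod z). assert (Y := Rle_abs (Re z)). assert (P := Cmod_ge_0 z).
    replace (Re (Cmult (RtoC t) z)) with (t * Re z) by (unfold Re; simpl; ring). nra.
  - rewrite (CI_derive (fun t => Cexp (Cmult (RtoC t) z))).
    + rewrite Cmult_1_l, Cmult_0_l. reflexivity.
    + lra.
    + intros t _. eapply cder_eq. apply cder_Cexp. apply cder_mult. apply cder_RtoC with (l := 1). apply (is_derive_id (K:=R_AbsRing)).
      apply cder_const. cbv beta. ring.
    + intros t _; cont.
Qed.

Lemma mellin_continuous alpha m G s : mellin_data alpha m G -> 0 < Re s < alpha -> continuous (mellin (G O)) s.
Proof.
  intros HG Hs. apply continuous_CC_eps. intros e He.
  set (ep := Rmin (Re s / 2) ((alpha - Re s) / 2)).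
  assert (Hep : 0 < ep) by (apply Rmin_pos; lra).
  assert (ep1 : ep <= Re s / 2) by apply Rmin_l. assert (ep2 : ep <= (alpha - Re s) / 2) by apply Rmin_r.
  destruct (mellin_data_dom0 alpha m G HG) as [K [HK D]].
  assert (Gd := good_weight_Kexp K ep HK Hep).
  destruct (good_weight_tail _ (e / 16) Gd) as [T HT]. lra. assert (T0 : 0 < T) by apply HT.
  destruct (good_weight_bound _ Gd) as [B [HB0 HB]].
  (* For $|v|\le T$ and $|s'-s|\le1$, [Cexp_minus_1] gives $|e^{(s'-s)v}-1|\le|s'-s|\,Q$. *)
  set (Q := T * exp T).
  assert (HQ : 0 < Q) by (apply Rmult_lt_0_compat; auto; apply exp_pos).
  set (d := Rmin ep (Rmin 1 (e / (4 * Q * (B + 1))))).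
  assert (Hd : 0 < d). { repeat apply Rmin_pos; try lra. apply Rdiv_lt_0_compat; nra. }
  exists d; split; auto. intros s' Hs'.
  assert (d1 : d <= ep) by apply Rmin_l.
  assert (d2 : d <= 1) by (eapply Rle_trans; [apply Rmin_r|apply Rmin_l]).
  assert (d3 : d <= e / (4 * Q * (B + 1))) by (eapply Rle_trans; [apply Rmin_r|apply Rmin_r]).
  assert (R1 := re_le_Cmod (Cminus s' s)). replace (Re (Cminus s' s)) with (Re s' - Re s) in R1 by (unfold Re; simpl; ring).
  assert (R2 : Rabs (Re s' - Re s) < ep) by lra. apply Rabs_def2 in R2.
  assert (Ds := D ep s Hep ltac:(lra)). assert (Ds' := D ep s' Hep ltac:(lra)).
  set (I := fun s => CI (fun v => Cmult (G O v) (Cexp (Cmult s (RtoC v)))) (- T) T).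
  assert (A1 : Cmod (Cminus (I s) (mellin (G O) s)) <= 4 * (e / 16)) by (apply (proj2 (Int_tail _ _ _ T Gd Ds HT)); lra).
  assert (A2 : Cmod (Cminus (I s') (mellin (G O) s')) <= 4 * (e / 16)) by (apply (proj2 (Int_tail _ _ _ T Gd Ds' HT)); lra).
  assert (A3 : Cmod (Cminus (I s') (I s)) <= e / 4).
  { unfold I. rewrite <- CI_minus; [|lra|apply contR_I, Ds'|apply contR_I, Ds].
    apply Rle_trans with (RInt (fun v => d * Q * (K * exp (- (ep * Rabs v)))) (- T) T).
    - apply CI_bound. lra.
      + intros v _. apply continuous_Cminus. apply Ds'. apply Ds.
      + intros v _. cont.
      + intros v Hv.
        replace (Cminus (Cmult (G O v) (Cexp (Cmult s' (RtoC v)))) (Cmult (G O v) (Cexp (Cmult s (RtoC v)))))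
         with (Cmult (Cminus (Cexp (Cmult (Cminus s' s) (RtoC v))) (RtoC 1)) (Cmult (G O v) (Cexp (Cmult s (RtoC v))))).
        2:{ replace (Cmult s' (RtoC v)) with (Cplus (Cmult (Cminus s' s) (RtoC v)) (Cmult s (RtoC v))) by ring. rewrite Cexp_plus. ring. }
        rewrite Cmod_mult. apply Rmult_le_compat; try apply Cmod_ge_0; [|apply Ds].
        eapply Rle_trans; [apply Cexp_minus_1|]. rewrite Cmod_mult, Cmod_R. unfold Q.
        assert (V : Rabs v <= T) by (apply Rabs_le; lra). assert (V0 := Rabs_pos v). assert (M0 := Cmod_ge_0 (Cminus s' s)).
        rewrite <- Rmult_assoc. apply Rmult_le_compat. nra. left; apply exp_pos.
        apply Rmult_le_compat; auto; lra. apply exp_le_mono. nra.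
    - rewrite (RInt_scal (V:=R_CompleteNormedModule)) by (apply ex_RInt_contR, Gd).
      change (d * Q * RInt (fun v => K * exp (- (ep * Rabs v))) (- T) T <= e / 4).
      assert (Y := HB (- T) T ltac:(lra)).
      apply Rle_trans with (d * Q * (B + 1)). apply Rmult_le_compat_l. nra. lra.
      apply Rle_trans with (e / (4 * Q * (B + 1)) * Q * (B + 1)).
      apply Rmult_le_compat_r. lra. apply Rmult_le_compat_r; lra. right; field; lra. }
  eapply Rle_lt_trans; [apply (Cmod_minus_triangle _ (I s'))|]. rewrite Cmod_minus_sym.
  assert (A4 := Cmod_minus_triangle (I s') (I s) (mellin (G O) s)). lra.
Qed.

Lemma contI_clamp {V : UniformSpace} (f : R -> V) p q : p <= q -> contI f p q -> contR (fun u => f (clamp p q u)).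
Proof.
  intros Hpq Cf u. apply (continuous_comp (clamp p q) f). apply (clamp_cont p q (fun u => u)), continuous_id.
  apply Cf. now apply clamp_in.
Qed.

Lemma contI_bounded (A : R -> C) p q : p <= q -> contI A p q -> exists M, 0 <= M /\ forall u, p <= u <= q -> Cmod (A u) <= M.
Proof.
  intros Hpq CA. destruct (continuity_ab_maj (fun x => Cmod (A x)) p q Hpq) as [mx [Hmx _]].
  { intros x Hx. apply continuity_pt_filterlim. apply (continuous_Cmod A). now apply CA. }
  exists (Cmod (A mx)). split. apply Cmod_ge_0. intros u Hu. apply (Hmx u Hu).
Qed.

(** This carries identities about path integrals of $e^{sv}$, valid for every $v$, over to path
    integrals of $f^*$; with the circle as path it evaluates the residue term. *)
Lemma mellin_Fubini_path alpha m G (A g : R -> C) p q e : mellin_data alpha m G -> p <= q -> 0 < e -> contI A p q -> contI g p q ->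
  (forall u, p <= u <= q -> e <= Re (g u) <= alpha - e) ->
  is_Int (fun v => Cmult (G O v) (CI (fun u => Cmult (A u) (Cexp (Cmult (g u) (RtoC v)))) p q))
    (CI (fun u => Cmult (A u) (mellin (G O) (g u))) p q).
Proof.
  intros HG Hpq He CA Cg Hg.
  destruct (mellin_data_dom0 alpha m G HG) as [K [HK D]].
  destruct (contI_bounded A p q Hpq CA) as [M [HM0 HM]].
  set (k := fun u v => Cmult (A (clamp p q u)) (Cmult (G O v) (Cexp (Cmult (g (clamp p q u)) (RtoC v))))).
  assert (D' : forall u, dominated (fun v => Cmult (G O v) (Cexp (Cmult (g (clamp p q u)) (RtoC v)))) (fun v => K * exp (- (e * Rabs v)))).
  { intros u. apply D; auto. apply Hg. now apply clamp_in. }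
  assert (X := Int_Fubini k (fun v => M * (K * exp (- (e * Rabs v)))) p q Hpq (good_weight_scal _ M HM0 (good_weight_Kexp K e HK He))).
  eapply is_Int_ext; [|eapply is_Int_eq; [apply X|]].
  - intros v. cbv beta. rewrite <- CI_scal; auto.
    + apply CI_ext; auto. intros u Hu. unfold k. rewrite clamp_id by lra. ring.
    + intros u Hu. specialize (CA u Hu). specialize (Cg u Hu). cont.
  - intros u v. unfold cont2, k.
    apply continuous_Cmult; [|apply continuous_Cmult].
    + apply (continuous_comp (fun p0 : R * R => fst p0) (fun u => A (clamp p q u))). cont. now apply (contI_clamp A).
    + apply (continuous_comp (fun p0 : R * R => snd p0) (G O)). cont. apply (mellin_data_cont _ _ _ HG). lia.
    + apply continuous_Cexp, continuous_Cmult; [|cont].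
      apply (continuous_comp (fun p0 : R * R => fst p0) (fun u => g (clamp p q u))). cont. now apply (contI_clamp g).
  - intros u v. unfold k. rewrite Cmod_mult. apply Rmult_le_compat; try apply Cmod_ge_0.
    apply HM. now apply clamp_in. apply (D' u).
  - apply CI_ext; auto. intros u Hu. unfold k, mellin. rewrite clamp_id by lra.
    apply is_Int_Int, is_Int_scal. apply D with e; auto. apply Hg; lra.
    apply (Int_correct _ (fun v => K * exp (- (e * Rabs v)))). now apply good_weight_Kexp. apply D; auto. apply Hg; lra.
Qed.

Lemma Cpown_bound z M k : Cmod z <= M -> Cmod (Cpown z k) <= M ^ k.
Proof.
  intros H. induction k; simpl. rewrite Cmod_1; lra. rewrite Cmod_mult.
  apply Rmult_le_compat; auto; apply Cmod_ge_0.
Qed.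

Lemma Cpown_diff k M : 0 <= M -> exists L, 0 <= L /\ forall a b, Cmod a <= M -> Cmod b <= M ->
  Cmod (Cminus (Cpown a k) (Cpown b k)) <= L * Cmod (Cminus a b).
Proof.
  intros HM. induction k.
  - exists 0. split. lra. intros a b _ _. simpl. replace (Cminus (RtoC 1) (RtoC 1)) with (RtoC 0) by ring. rewrite Cmod_0. lra.
  - destruct IHk as [L [HL IH]]. exists (M * L + M ^ k). assert (Pk := pow_le M k HM). split. nra.
    intros a b Ha Hb. simpl.
    replace (Cminus (Cmult a (Cpown a k)) (Cmult b (Cpown b k))) with (Cplus (Cmult a (Cminus (Cpown a k) (Cpown b k))) (Cmult (Cminus a b) (Cpown b k))) by ring.
    eapply Rle_trans; [apply Cmod_triangle|]. rewrite !Cmod_mult.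
    specialize (IH a b Ha Hb). assert (X := Cpown_bound b M k Hb).
    assert (P1 := Cmod_ge_0 (Cminus a b)). assert (P2 := Cmod_ge_0 a). assert (P3 := Cmod_ge_0 (Cminus (Cpown a k) (Cpown b k))).
    assert (Cmod a * Cmod (Cminus (Cpown a k) (Cpown b k)) <= M * (L * Cmod (Cminus a b))) by (apply Rmult_le_compat; auto).
    assert (Cmod (Cminus a b) * Cmod (Cpown b k) <= Cmod (Cminus a b) * M ^ k) by (apply Rmult_le_compat_l; auto).
    lra.
Qed.

Lemma zeta_em_path_conv k (A g : R -> C) p q c0 : p <= q -> 0 < c0 -> contI A p q -> contI g p q ->
  (forall u, p <= u <= q -> c0 <= Re (g u) < 3 /\ g u <> RtoC 1) ->
  conv (fun N => CI (fun u => Cmult (Cpown (zeta_em N (g u)) k) (A u)) p q) (CI (fun u => Cmult (Cpown (zeta0 (g u)) k) (A u)) p q).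
Proof.
  intros Hpq Hc CA Cg Hg e He.
  destruct (contI_bounded A p q Hpq CA) as [MA [HA0 HA]].
  destruct (contI_bounded g p q Hpq Cg) as [Mg [Hg0 HMg]].
  assert (CZ : contI (fun u => zeta0 (g u)) p q).
  { intros u Hu. apply (continuous_comp g zeta0). auto. destruct (Hg u Hu). apply zeta0_continuous; auto; lra. }
  destruct (contI_bounded _ p q Hpq CZ) as [MZ [HZ0 HZ]].
  (* The radius [MZ + 1] also covers the truncations, which lie within [d <= 1] of the limit along
     the path. *)
  destruct (Cpown_diff k (MZ + 1) ltac:(lra)) as [L [HL0 HL]].
  set (d := Rmin 1 (e / ((L + 1) * (MA + 1) * (q - p + 1)))).
  assert (P : 0 < (L + 1) * (MA + 1) * (q - p + 1)) by (repeat apply Rmult_lt_0_compat; lra).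
  assert (Hd : 0 < d) by (apply Rmin_pos; [lra|now apply Rdiv_lt_0_compat]).
  assert (d1 : d <= 1) by apply Rmin_l. assert (d2 : d <= e / ((L + 1) * (MA + 1) * (q - p + 1))) by apply Rmin_r.
  destruct (zeta_em_unif c0 Mg d Hc Hd) as [N0 [HN0 HN]].
  exists N0. intros n Hn.
  assert (Cn : contI (fun u => Cmult (Cpown (zeta_em n (g u)) k) (A u)) p q).
  { intros u Hu. apply continuous_Cmult; auto. apply continuous_Cpown. apply (continuous_comp g (zeta_em n)); auto.
    apply zeta_em_continuous. lia. apply Hg; auto. }
  assert (CZk : contI (fun u => Cmult (Cpown (zeta0 (g u)) k) (A u)) p q).
  { intros u Hu. apply continuous_Cmult; auto. apply continuous_Cpown. auto. }
  rewrite <- CI_minus; auto.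
  apply Rle_trans with ((q - p) * (L * d * MA)).
  - apply CI_bound_const; auto. intros u Hu; apply continuous_Cminus; auto.
    intros u Hu. replace (Cminus _ _) with (Cmult (Cminus (Cpown (zeta_em n (g u)) k) (Cpown (zeta0 (g u)) k)) (A u)) by ring.
    rewrite Cmod_mult. destruct (Hg u Hu) as [G1 G2].
    assert (X := HN n (g u) Hn ltac:(lra) (HMg u Hu) G2).
    apply Rmult_le_compat; try apply Cmod_ge_0; auto.
    eapply Rle_trans; [apply HL|].
    + replace (zeta_em n (g u)) with (Cplus (Cminus (zeta_em n (g u)) (zeta0 (g u))) (zeta0 (g u))) by ring.
      eapply Rle_trans; [apply Cmod_triangle|]. specialize (HZ u Hu). lra.
    + specialize (HZ u Hu). lra.
    + apply Rmult_le_compat_l; auto.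
  - apply Rle_trans with ((q - p + 1) * ((L + 1) * (e / ((L + 1) * (MA + 1) * (q - p + 1))) * (MA + 1))).
    2: right; field; lra.
    assert (0 <= L * d) by nra.
    apply Rmult_le_compat; try lra. nra. apply Rmult_le_compat; try lra. apply Rmult_le_compat; lra.
Qed.

(** * Contour shifts for zeta^k f* *)

(* A path [pg] on [[pp, pq]] with a weight [pd], not required to be the derivative of [pg], so that orientations and factors [i] are absorbed into it. *)
Record cpath := Path { pg : R -> C; pd : R -> C; pp : R; pq : R }.
Definition pint (F : C -> C) (P : cpath) : C := CI (fun u => Cmult (F (pg P u)) (pd P u)) (pp P) (pq P).
Fixpoint psum (F : C -> C) (ps : list cpath) : C :=
  match ps with nil => RtoC 0 | P :: ps => Cplus (pint F P) (psum F ps) end.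

Definition okpath (c0 c1 : R) (P : cpath) :=
  pp P <= pq P /\ contI (pg P) (pp P) (pq P) /\ contI (pd P) (pp P) (pq P) /\
  forall u, pp P <= u <= pq P -> c0 <= Re (pg P u) <= c1 /\ pg P u <> RtoC 1.

(** [Phi] at [y] is the integrand $\zeta^k f^* x^{-s}$ for $x=e^y$. It is a superposition, with
    weights $f(e^v)$, of the functions [zeta_pow_exp] at [v - y]. *)
Definition zeta_pow_exp (k : nat) (y : R) (s : C) : C := Cmult (Cpown (zeta0 s) k) (Cexp (Cmult s (RtoC y))).
Definition zeta_em_pow_exp (N k : nat) (y : R) (s : C) : C := Cmult (Cpown (zeta_em N s) k) (Cexp (Cmult s (RtoC y))).
Definition Phi (k : nat) (G0 : R -> C) (y : R) (s : C) : C :=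
  Cmult (Cmult (Cpown (zeta0 s) k) (mellin G0 s)) (Cexp (Cmult s (RtoC (- y)))).

Lemma holo_zeta_em_pow_exp N k y : holo not1 (zeta_em_pow_exp N k y).
Proof.
  apply holo_mult. apply holo_pow, holo_zeta_em. apply holo_Cexp, holo_mult. apply holo_id. apply holo_const.
Qed.

(** A contour identity is encoded as the vanishing of a weighted sum of path integrals. Each
    integral converges as $N\to\infty$, so the identity survives the limit. *)
Lemma psum_zeta_pow_exp k y c0 c1 ps : 0 < c0 -> c1 < 3 -> List.Forall (okpath c0 c1) ps ->
  (forall N, psum (zeta_em_pow_exp N k y) ps = RtoC 0) -> psum (zeta_pow_exp k y) ps = RtoC 0.
Proof.
  intros H0 H3 Hp HN. apply (conv_unique (fun N => psum (zeta_em_pow_exp N k y) ps)).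
  - clear HN. induction Hp as [|P ps HP Hp IH]; simpl. apply conv_const.
    apply conv_plus; auto. destruct HP as [A1 [A2 [A3 A4]]].
    assert (X := zeta_em_path_conv k (fun u => Cmult (Cexp (Cmult (pg P u) (RtoC y))) (pd P u)) (pg P) (pp P) (pq P) c0 A1 H0).
    unfold pint.
    rewrite (CI_ext _ (fun u => Cmult (Cpown (zeta0 (pg P u)) k) (Cmult (Cexp (Cmult (pg P u) (RtoC y))) (pd P u)))); auto.
    2: intros; unfold zeta_pow_exp; ring.
    eapply conv_ext; [|apply X]; auto.
    + intros N. apply CI_ext; auto. intros; unfold zeta_em_pow_exp; ring.
    + intros u Hu. specialize (A2 u Hu). specialize (A3 u Hu). cont.
    + intros u Hu. destruct (A4 u Hu). split; auto; lra.
  - apply (conv_ext (fun _ => RtoC 0)). intros; now rewrite HN. apply conv_const.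
Qed.

Lemma zeta0_pow_cont k (g : R -> C) p q : contI g p q ->
  (forall u, p <= u <= q -> 0 < Re (g u) < 3 /\ g u <> RtoC 1) -> contI (fun u => Cpown (zeta0 (g u)) k) p q.
Proof.
  intros Cg Hg u Hu. apply continuous_Cpown, (continuous_comp g zeta0). auto. destruct (Hg u Hu). now apply zeta0_continuous.
Qed.

(** Multiplying the identity for [v - y] by $f(e^v)$ and integrating over $v$ gives the identity for
    [Phi]. Complex derivatives of [zeta0] and [mellin] do not occur. *)
Lemma psum_Phi alpha m G k y c0 e ps : mellin_data alpha m G -> 0 < c0 -> 0 < e -> alpha - e < 3 -> e <= c0 ->
  List.Forall (okpath c0 (alpha - e)) ps ->
  (forall v, psum (zeta_pow_exp k v) ps = RtoC 0) -> psum (Phi k (G O) y) ps = RtoC 0.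
Proof.
  intros HG H0 He H3 Hec Hp HW.
  assert (X : is_Int (fun v => Cmult (G O v) (psum (zeta_pow_exp k (v - y)) ps)) (psum (Phi k (G O) y) ps) /\
     contR (fun v => Cmult (G O v) (psum (zeta_pow_exp k (v - y)) ps))).
  { clear HW. induction Hp as [|P ps HP Hp IH].
    - simpl. split. apply is_Int_ext with (fun _ => RtoC 0). intros; ring.
      apply is_Int_0.
      intros v. apply continuous_Cmult. apply (mellin_data_cont _ _ _ HG); lia. cont.
    - destruct IH as [IH1 IH2]. destruct HP as [A1 [A2 [A3 A4]]].
      assert (CZ : contI (fun u => Cpown (zeta0 (pg P u)) k) (pp P) (pq P)).
      { apply zeta0_pow_cont; auto. intros u Hu. destruct (A4 u Hu). split; auto; lra. }
      assert (Y := mellin_Fubini_path alpha m G (fun u => Cmult (Cmult (Cpown (zeta0 (pg P u)) k) (Cexp (Cmult (pg P u) (RtoC (- y))))) (pd P u))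
          (pg P) (pp P) (pq P) e HG A1 He).
      assert (Y' : is_Int (fun v => Cmult (G O v) (pint (zeta_pow_exp k (v - y)) P)) (pint (Phi k (G O) y) P)).
      { eapply is_Int_ext; [|eapply is_Int_eq; [apply Y; auto|]].
        - intros v. cbv beta. f_equal. apply CI_ext; auto. intros u _. unfold zeta_pow_exp.
          replace (Cmult (pg P u) (RtoC (v - y))) with (Cplus (Cmult (pg P u) (RtoC (- y))) (Cmult (pg P u) (RtoC v)))
            by (unfold Rminus; rewrite RtoC_plus; ring).
          rewrite Cexp_plus. ring.
        - intros u Hu. specialize (CZ u Hu). specialize (A2 u Hu). specialize (A3 u Hu). cont.
        - intros u Hu. destruct (A4 u Hu). lra.
        - unfold pint. apply CI_ext; auto. intros u _. unfold Phi. ring. }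
      assert (Cc : contR (fun v => Cmult (G O v) (pint (zeta_pow_exp k (v - y)) P))).
      { intros v. apply continuous_Cmult. apply (mellin_data_cont _ _ _ HG); lia.
        set (kk := fun w u => Cmult (zeta_pow_exp k (w - y) (pg P (clamp (pp P) (pq P) u))) (pd P (clamp (pp P) (pq P) u))).
        apply continuous_ext with (fun w => CI (kk w) (pp P) (pq P)).
        { intros w. unfold pint, kk. apply CI_ext; auto. intros u Hu. now rewrite clamp_id by lra. }
        apply continuous_CI_param; auto. intros w u _. unfold cont2, kk, zeta_pow_exp.
        assert (Q1 := contI_clamp _ _ _ A1 CZ). assert (Q2 := contI_clamp _ _ _ A1 A2). assert (Q3 := contI_clamp _ _ _ A1 A3).
        apply continuous_Cmult; [apply continuous_Cmult|].
        - apply (continuous_comp (fun p : R * R => snd p) (fun u => Cpown (zeta0 (pg P (clamp (pp P) (pq P) u))) k)). cont. apply Q1.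
        - apply continuous_Cexp, continuous_Cmult; [|cont].
          apply (continuous_comp (fun p : R * R => snd p) (fun u => pg P (clamp (pp P) (pq P) u))). cont. apply Q2.
        - apply (continuous_comp (fun p : R * R => snd p) (fun u => pd P (clamp (pp P) (pq P) u))). cont. apply Q3. }
      split.
      + simpl. eapply is_Int_ext; [|apply is_Int_plus with (3 := Y') (4 := IH1); auto]. intros; cbv beta; simpl; ring.
      + simpl. intros v. apply continuous_ext with (fun v => Cplus (Cmult (G O v) (pint (zeta_pow_exp k (v - y)) P)) (Cmult (G O v) (psum (zeta_pow_exp k (v - y)) ps))).
        intros w; symmetry; apply Cmult_plus_distr_l. apply continuous_Cplus; auto. }
  destruct X as [X _].
  rewrite <- (is_Int_Int _ _ X). apply is_Int_Int.
  apply is_Int_ext with (fun _ => RtoC 0). intros v; rewrite HW; ring.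
  apply is_Int_0.
Qed.

Definition Vpath (c : R) (w : C) (T : R) := Path (fun t => (c, t)) (fun _ => w) (- T) T.
Definition Hpath (y : R) (w : C) (x1 x2 : R) := Path (fun x => (x, y)) (fun _ => w) x1 x2.
Definition Cpath (r : R) (w : C) := Path (fun th => Cplus (RtoC 1) (Cmult (RtoC r) (cis th))) (fun th => Cmult w (Cmult (RtoC r) (cis th))) 0 (2 * PI).

Lemma pint_V F c w T : 0 <= T -> contR (fun t => F (c, t)) -> pint F (Vpath c w T) = Cmult w (Vint F c (- T) T).
Proof.
  intros HT CF. unfold pint, Vint; simpl. rewrite <- CI_scal; [|lra|now apply contR_I].
  apply CI_ext. lra. intros; ring.
Qed.
Lemma pint_H F y w x1 x2 : x1 <= x2 -> contI (fun t => F (t, y)) x1 x2 -> pint F (Hpath y w x1 x2) = Cmult w (Hint F y x1 x2).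
Proof.
  intros HT CF. unfold pint, Hint; simpl. rewrite <- CI_scal; auto.
  apply CI_ext. lra. intros; ring.
Qed.
Lemma pint_C F r w : contI (fun th => Cmult (F (Cplus (RtoC 1) (Cmult (RtoC r) (cis th)))) (Cmult (RtoC r) (cis th))) 0 (2 * PI) ->
  pint F (Cpath r w) = Cmult w (Circ F r).
Proof.
  intros CF. assert (PP := PI_RGT_0). unfold pint, Circ; simpl. rewrite <- CI_scal; auto; [|lra].
  apply CI_ext. lra. intros; ring.
Qed.

Lemma okpath_V c w T c0 c1 : 0 <= T -> c0 <= c <= c1 -> c <> 1 -> okpath c0 c1 (Vpath c w T).
Proof.
  intros HT Hc H1. split; [|split; [|split]]; simpl. lra. intros u _; cont. intros u _; cont.
  intros u _. split; auto. intros E; injection E; auto.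
Qed.
Lemma okpath_H y w x1 x2 c0 c1 : c0 <= x1 -> x1 <= x2 -> x2 <= c1 -> (y <> 0 \/ x2 < 1) -> okpath c0 c1 (Hpath y w x1 x2).
Proof.
  intros H0 H1 H2 Hy. split; [|split; [|split]]; simpl. lra. intros u _; cont. intros u _; cont.
  intros u Hu. split. lra. intros E; injection E; intros. destruct Hy; lra.
Qed.
Lemma okpath_C r w c0 c1 : 0 < r -> c0 <= 1 - r -> 1 + r <= c1 -> okpath c0 c1 (Cpath r w).
Proof.
  intros Hr H0 H1. assert (PP := PI_RGT_0). split; [|split; [|split]]; simpl. lra.
  intros u _; cont. apply (continuous_cis (fun y => y)); cont.
  intros u _; cont. apply (continuous_cis (fun y => y)); cont.
  intros u Hu. split. 2: now apply circle_not1.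
  unfold Re; simpl. rewrite exp_0. assert (X := COS_bound u). nra.
Qed.

Lemma Phi_cont_path alpha m G k y (g : R -> C) p q : mellin_data alpha m G -> contI g p q ->
  (forall u, p <= u <= q -> 0 < Re (g u) < 3 /\ Re (g u) < alpha /\ g u <> RtoC 1) -> contI (fun u => Phi k (G O) y (g u)) p q.
Proof.
  intros HG Cg Hg u Hu. specialize (Cg u Hu). destruct (Hg u Hu) as [H1 [H2 H3]].
  assert (A : continuous (fun u => zeta0 (g u)) u). { apply (continuous_comp g zeta0); auto. now apply zeta0_continuous. }
  assert (B : continuous (fun u => mellin (G O) (g u)) u). { apply (continuous_comp g (mellin (G O))); auto. apply mellin_continuous with alpha m; auto. lra. }
  unfold Phi. cont.
Qed.

Lemma Phi_line_circle alpha m G k y a T : mellin_data alpha m G -> 1 < alpha <= 2 -> 0 < a < 1 -> a < alpha - 1 -> a <= T ->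
  Cmult Ci (Cminus (Vint (Phi k (G O) y) (1 + a) (- T) T) (Vint (Phi k (G O) y) (1 - a) (- T) T)) =
  Cplus (Cmult Ci (Circ (Phi k (G O) y) a)) (Cminus (Hint (Phi k (G O) y) T (1 - a) (1 + a)) (Hint (Phi k (G O) y) (- T) (1 - a) (1 + a))).
Proof.
  intros HG Hal Ha Ha' HT. assert (PP := PI_RGT_0).
  (* The weights $\pm i$ and $\pm1$ are chosen so that the vanishing of the total is exactly the
     claimed identity, with all terms moved to one side. *)
  set (ps := [Vpath (1 + a) Ci T; Vpath (1 - a) (Copp Ci) T; Cpath a (Copp Ci); Hpath T (RtoC (-1)) (1 - a) (1 + a); Hpath (- T) (RtoC 1) (1 - a) (1 + a)]).
  assert (D : forall F, (forall s, 1 - a <= Re s <= 1 + a -> s <> RtoC 1 -> continuous F s) ->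
    psum F ps = Cminus (Cmult Ci (Cminus (Vint F (1 + a) (- T) T) (Vint F (1 - a) (- T) T)))
      (Cplus (Cmult Ci (Circ F a)) (Cminus (Hint F T (1 - a) (1 + a)) (Hint F (- T) (1 - a) (1 + a))))).
  { intros F CF. unfold ps; simpl. rewrite !pint_V, !pint_H, pint_C; try lra. ring.
    - intros th Hth. apply continuous_Cmult; [|cont; apply (continuous_cis (fun y => y)); cont].
      apply (continuous_comp (fun th => Cplus (RtoC 1) (Cmult (RtoC a) (cis th))) F). cont; apply (continuous_cis (fun y => y)); cont.
      apply CF. unfold Re; simpl. rewrite exp_0. assert (X := COS_bound th). nra. apply circle_not1; lra.
    - intros x Hx. apply (continuous_comp (fun x => (x, - T) : C) F). cont. apply CF; simpl; auto. intros E; injection E; lra.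
    - intros x Hx. apply (continuous_comp (fun x => (x, T) : C) F). cont. apply CF; simpl; auto. intros E; injection E; lra.
    - intros x. apply (continuous_comp (fun x => (1 - a, x) : C) F). cont. apply CF; simpl. lra. intros E; injection E; lra.
    - intros x. apply (continuous_comp (fun x => (1 + a, x) : C) F). cont. apply CF; simpl. lra. intros E; injection E; lra. }
  set (e := Rmin (1 - a) (alpha - 1 - a)).
  assert (He : 0 < e) by (apply Rmin_pos; lra). assert (e1 : e <= 1 - a) by apply Rmin_l. assert (e2 : e <= alpha - 1 - a) by apply Rmin_r.
  assert (ok : forall c1, 1 + a <= c1 -> List.Forall (okpath (1 - a) c1) ps).
  { intros c1 Hc1. unfold ps.
    apply List.Forall_cons; [apply okpath_V; lra|]. apply List.Forall_cons; [apply okpath_V; lra|].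
    apply List.Forall_cons; [apply okpath_C; lra|]. apply List.Forall_cons; [apply okpath_H; lra|].
    apply List.Forall_cons; [apply okpath_H; lra|]. apply List.Forall_nil. }
  assert (X : forall v, psum (zeta_pow_exp k v) ps = RtoC 0).
  { intros v. apply psum_zeta_pow_exp with (1 - a) (1 + a); try lra. apply ok; lra.
    intros N. rewrite D. rewrite line_shift_circle. ring. apply holo_zeta_em_pow_exp. lra.
    intros s _ Hs. apply holo_continuous with not1; auto. apply holo_zeta_em_pow_exp. }
  assert (Y : psum (Phi k (G O) y) ps = RtoC 0).
  {
    apply psum_Phi with alpha m (1 - a) e; auto; try lra. apply ok; lra. }
  rewrite D in Y.
  - match type of Y with Cminus ?p ?q = _ => replace p with (Cplus (Cminus p q) q) by ring; rewrite Y; ring end.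
  - intros s Hs H1.
    assert (A : continuous zeta0 s) by (apply zeta0_continuous; auto; lra).
    assert (B : continuous (mellin (G O)) s) by (apply mellin_continuous with alpha m; auto; lra).
    unfold Phi. cont.
Qed.

Lemma Phi_rect alpha m G k y x1 x2 T : mellin_data alpha m G -> 1 < alpha <= 2 -> 0 < x1 -> x1 <= x2 -> x2 < 1 -> 0 <= T ->
  Cmult Ci (Cminus (Vint (Phi k (G O) y) x2 (- T) T) (Vint (Phi k (G O) y) x1 (- T) T)) =
  Cminus (Hint (Phi k (G O) y) T x1 x2) (Hint (Phi k (G O) y) (- T) x1 x2).
Proof.
  intros HG Hal H1 Hx H2 HT.
  set (ps := [Vpath x2 Ci T; Vpath x1 (Copp Ci) T; Hpath T (RtoC (-1)) x1 x2; Hpath (- T) (RtoC 1) x1 x2]).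
  assert (D : forall F, (forall s, x1 <= Re s <= x2 -> s <> RtoC 1 -> continuous F s) ->
    psum F ps = Cminus (Cmult Ci (Cminus (Vint F x2 (- T) T) (Vint F x1 (- T) T)))
      (Cminus (Hint F T x1 x2) (Hint F (- T) x1 x2))).
  { intros F CF. unfold ps; simpl. rewrite !pint_V, !pint_H; try lra. ring.
    - intros x Hx'. apply (continuous_comp (fun x => (x, - T) : C) F). cont. apply CF; simpl; auto. intros E; injection E; lra.
    - intros x Hx'. apply (continuous_comp (fun x => (x, T) : C) F). cont. apply CF; simpl; auto. intros E; injection E; lra.
    - intros x. apply (continuous_comp (fun x => (x1, x) : C) F). cont. apply CF; simpl. lra. intros E; injection E; lra.
    - intros x. apply (continuous_comp (fun x => (x2, x) : C) F). cont. apply CF; simpl. lra. intros E; injection E; lra. }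
  set (e := Rmin x1 (alpha - x2)).
  assert (He : 0 < e) by (apply Rmin_pos; lra). assert (e1 : e <= x1) by apply Rmin_l. assert (e2 : e <= alpha - x2) by apply Rmin_r.
  assert (ok : forall c1, x2 <= c1 -> List.Forall (okpath x1 c1) ps).
  { intros c1 Hc1. unfold ps.
    apply List.Forall_cons; [apply okpath_V; lra|]. apply List.Forall_cons; [apply okpath_V; lra|].
    apply List.Forall_cons; [apply okpath_H; lra|].
    apply List.Forall_cons; [apply okpath_H; lra|]. apply List.Forall_nil. }
  assert (X : forall v, psum (zeta_pow_exp k v) ps = RtoC 0).
  { intros v. apply psum_zeta_pow_exp with x1 x2; try lra. apply ok; lra.
    intros N. rewrite D. rewrite (rect_cauchy not1). ring. apply holo_zeta_em_pow_exp. lra. lra.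
    intros x y' Hx' _ E. injection E; lra.
    intros s _ Hs. apply holo_continuous with not1; auto. apply holo_zeta_em_pow_exp. }
  assert (Y : psum (Phi k (G O) y) ps = RtoC 0).
  { apply psum_Phi with alpha m x1 e; auto; try lra. apply ok; lra. }
  rewrite D in Y.
  - match type of Y with Cminus ?p ?q = _ => replace p with (Cplus (Cminus p q) q) by ring; rewrite Y; ring end.
  - intros s Hs Hn1.
    assert (A : continuous zeta0 s) by (apply zeta0_continuous; auto; lra).
    assert (B : continuous (mellin (G O)) s) by (apply mellin_continuous with alpha m; auto; lra).
    unfold Phi. cont.
Qed.

Lemma zeta_pow_exp_Circ_cont k y r : 0 < r < 1 ->
  contR (fun th => Cmult (zeta_pow_exp k y (Cplus (RtoC 1) (Cmult (RtoC r) (cis th)))) (Cmult (RtoC r) (cis th))).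
Proof.
  intros Hr th.
  assert (A : continuous (fun th => Cplus (RtoC 1) (Cmult (RtoC r) (cis th))) th) by (cont; apply (continuous_cis (fun y => y)); cont).
  apply continuous_Cmult; [|cont; apply (continuous_cis (fun y => y)); cont].
  unfold zeta_pow_exp. apply continuous_Cmult; [|cont]. apply continuous_Cpown.
  apply (continuous_comp _ zeta0); auto. apply zeta0_continuous.
  unfold Re; simpl. rewrite exp_0. assert (X := COS_bound th). nra. apply circle_not1; lra.
Qed.

(** [Pres] uses the radius $1/2$, but $f^*$ is available only for $\mathrm{Re}\,s<\alpha$, which may
    force a smaller circle. *)
Lemma zeta_pow_exp_circle_radius k y r1 r2 : 0 < r1 -> r1 <= r2 -> r2 < 1 -> Circ (zeta_pow_exp k y) r1 = Circ (zeta_pow_exp k y) r2.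
Proof.
  intros H1 H2 H3.
  set (ps := [Cpath r2 (RtoC 1); Cpath r1 (RtoC (-1))]).
  assert (X : psum (zeta_pow_exp k y) ps = RtoC 0).
  { apply psum_zeta_pow_exp with (1 - r2) (1 + r2); try lra.
    - apply List.Forall_cons; [apply okpath_C; lra|]. apply List.Forall_cons; [apply okpath_C; lra|]. apply List.Forall_nil.
    - intros N. unfold ps; simpl.
      rewrite !pint_C by (apply contR_I, Circ_cont; [apply holo_zeta_em_pow_exp|lra]).
      rewrite (Circ_radius _ r1 r2). ring. apply holo_zeta_em_pow_exp. lra. }
  unfold ps in X; simpl in X. rewrite !pint_C in X by (apply contR_I, zeta_pow_exp_Circ_cont; lra).
  replace (Circ (zeta_pow_exp k y) r1) with (Cminus (Circ (zeta_pow_exp k y) r2) (Cplus (Cmult (RtoC 1) (Circ (zeta_pow_exp k y) r2)) (Cplus (Cmult (RtoC (-1)) (Circ (zeta_pow_exp k y) r1)) (RtoC 0)))) by ring.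
  rewrite X. ring.
Qed.

(** * Exponential sums *)

Fixpoint Rsum (f : nat -> R) (n : nat) : R := match n with O => 0 | S n => Rsum f n + f n end.

Lemma Rsum_le f g n : (forall i, (i < n)%nat -> f i <= g i) -> Rsum f n <= Rsum g n.
Proof. induction n; intros H; simpl. lra. assert (X := H n ltac:(lia)). assert (Y := IHn (fun i Hi => H i ltac:(lia))). lra. Qed.
Lemma Rsum_ext f g n : (forall i, (i < n)%nat -> f i = g i) -> Rsum f n = Rsum g n.
Proof. induction n; intros H; simpl; auto. rewrite IHn, H; auto. Qed.
Lemma Rsum_const c n : Rsum (fun _ => c) n = INR n * c.
Proof. induction n. simpl; ring. simpl Rsum. rewrite IHn, S_INR. ring. Qed.
Lemma Rsum_scal c f n : Rsum (fun i => c * f i) n = c * Rsum f n.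
Proof. induction n; simpl. ring. rewrite IHn; ring. Qed.
Lemma Rsum_pos f n : (forall i, (i < n)%nat -> 0 <= f i) -> 0 <= Rsum f n.
Proof. intros H. replace 0 with (Rsum (fun _ => 0) n). now apply Rsum_le. rewrite Rsum_const; ring. Qed.
Lemma Rsum_app f p q : Rsum f (p + q) = Rsum f p + Rsum (fun i => f (p + i)%nat) q.
Proof. induction q; simpl. rewrite Nat.add_0_r. ring. rewrite Nat.add_succ_r. simpl. rewrite IHq. ring. Qed.
Lemma Rsum_rev f n : Rsum (fun i => f (n - i)%nat) n = Rsum (fun i => f (S i)) n.
Proof.
  induction n; auto. transitivity (f (S n) + Rsum (fun i => f (n - i)%nat) n).
  - refine (eq_trans (Rsum_app (fun i => f (S n - i)%nat) 1 n) _). simpl Rsum.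
    rewrite Rplus_0_l. reflexivity.
  - rewrite IHn. simpl. ring.
Qed.

Lemma Csum_app f p q : Csum f (p + q) = Cplus (Csum f p) (Csum (fun i => f (p + i)%nat) q).
Proof. induction q; simpl. rewrite Nat.add_0_r. ring. rewrite Nat.add_succ_r. simpl. rewrite IHq. ring. Qed.
Lemma Csum_0 f n : (forall i, (i < n)%nat -> f i = RtoC 0) -> Csum f n = RtoC 0.
Proof. induction n; intros H; simpl; auto. rewrite IHn, H; auto. ring. Qed.
Lemma Csum_const c n : Csum (fun _ => c) n = Cmult (RtoC (INR n)) c.
Proof. induction n. simpl; ring. simpl Csum. rewrite IHn, S_INR, RtoC_plus. ring. Qed.
Lemma Csum_swap (f : nat -> nat -> C) n m :
  Csum (fun i => Csum (fun j => f i j) m) n = Csum (fun j => Csum (fun i => f i j) n) m.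
Proof.
  induction n; simpl. symmetry; now apply Csum_0.
  rewrite IHn, <- Csum_plus. reflexivity.
Qed.
Lemma Csum_Cmod f n : Cmod (Csum f n) <= Rsum (fun i => Cmod (f i)) n.
Proof. induction n; simpl. rewrite Cmod_0; lra. eapply Rle_trans; [apply Cmod_triangle|]. lra. Qed.
Lemma Csum_conj f n : Cconj (Csum f n) = Csum (fun i => Cconj (f i)) n.
Proof. induction n; simpl. apply injective_projections; simpl; ring. rewrite Cplus_conj, IHn. reflexivity. Qed.
Lemma Csum_RtoC f n : Csum (fun i => RtoC (f i)) n = RtoC (Rsum f n).
Proof. induction n; simpl; auto. rewrite IHn, RtoC_plus. reflexivity. Qed.

Lemma Rsum_sqr f n : (forall i, (i < n)%nat -> 0 <= f i) -> Rsum f n ^ 2 <= INR n * Rsum (fun i => f i ^ 2) n.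
Proof.
  induction n; intros H. simpl; lra.
  assert (IH := IHn (fun i Hi => H i ltac:(lia))). assert (Y := H n ltac:(lia)).
  change (Rsum f (S n)) with (Rsum f n + f n). change (Rsum (fun i => f i ^ 2) (S n)) with (Rsum (fun i => f i ^ 2) n + f n ^ 2).
  rewrite S_INR. set (s := Rsum f n) in *. set (q := Rsum (fun i => f i ^ 2) n) in *. set (y := f n) in *.
  assert (Pn := pos_INR n).
  destruct (Req_dec (INR n) 0) as [E|E].
  - rewrite E in *. assert (s = 0) by nra. assert (0 <= q). { apply Rsum_pos. intros; apply pow2_ge_0. } nra.
  - assert (Hn : 0 < INR n) by lra. assert (2 * s * y <= q + INR n * y ^ 2); [|nra].
    apply Rmult_le_reg_l with (INR n); auto.
    assert (0 <= (s - INR n * y) ^ 2) by apply pow2_ge_0. nra.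
Qed.

Lemma Cmod_sqr_conj z : RtoC (Cmod z ^ 2) = Cmult z (Cconj z).
Proof. rewrite Cmod2_alt. destruct z as [p q]. apply injective_projections; simpl; ring. Qed.

Lemma Csum_shifted_support (B b : nat -> C) H L h K :
  (forall n, (n < H)%nat -> B n = RtoC 0) -> (forall j, (j < L)%nat -> B (H + j)%nat = b j) ->
  (forall j, (L <= j)%nat -> B (H + j)%nat = RtoC 0) -> (h <= H)%nat -> (H + L <= h + K)%nat ->
  Csum (fun n => B (h + n)%nat) K = Csum b L.
Proof.
  intros H0 H1 H2 Hh HK.
  replace K with ((H - h) + (L + (h + K - H - L)))%nat by lia.
  rewrite Csum_app, Csum_app.
  rewrite (Csum_0 (fun n => B (h + n)%nat)) by (intros; apply H0; lia).
  rewrite (Csum_0 (fun i => B (h + (H - h + (L + i)))%nat)).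
  - rewrite (Csum_ext _ b). ring. intros i Hi. rewrite <- (H1 i Hi). f_equal. lia.
  - intros i Hi. rewrite <- (H2 (L + i)%nat) by lia. f_equal. lia.
Qed.

(** Weyl-van der Corput inequality. $H$ times the sum equals the sum over $n$ of the windows
    $\sum_{h<H}A(h+n)$; Cauchy-Schwarz over the $L+H$ values of $n$ and expansion of the square
    leave correlations that depend only on the difference of two shifts. *)
Lemma weyl (a : nat -> C) (E : nat -> R) L H : (1 <= H)%nat ->
  (forall d, (d < H)%nat -> Cmod (Csum (fun j => Cmult (a j) (Cconj (a (j + d)%nat))) (L - d)) <= E d) ->
  INR H * Cmod (Csum a L) ^ 2 <= INR (L + H) * (2 * Rsum E H).
Proof.
  intros HH HE.
  assert (PE : forall d, (d < H)%nat -> 0 <= E d). { intros d Hd. eapply Rle_trans; [apply Cmod_ge_0|apply (HE d Hd)]. }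
  (* Extension by zero, moved to the right by [H]: all shifts by [h < H] then keep the support
     inside the range of summation, with indices in [nat]. *)
  set (A := fun n => if andb (H <=? n)%nat (n <? H + L)%nat then a (n - H)%nat else RtoC 0).
  assert (A0 : forall n, (n < H)%nat -> A n = RtoC 0).
  { intros n Hn. unfold A. destruct (Nat.leb_spec H n); simpl; auto; lia. }
  assert (A1 : forall j, (j < L)%nat -> A (H + j)%nat = a j).
  { intros j Hj. unfold A. destruct (Nat.leb_spec H (H + j)); [|lia]. destruct (Nat.ltb_spec (H + j) (H + L)); [|lia].
    simpl. f_equal. lia. }
  assert (A2 : forall j, (L <= j)%nat -> A (H + j)%nat = RtoC 0).
  { intros j Hj. unfold A. destruct (Nat.leb_spec H (H + j)); [|lia]. destruct (Nat.ltb_spec (H + j) (H + L)); [lia|]. reflexivity. }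
  set (X := fun n => Csum (fun h => A (h + n)%nat) H).
  set (Rr := fun h1 h2 => Csum (fun n => Cmult (A (h1 + n)%nat) (Cconj (A (h2 + n)%nat))) (L + H)).
  assert (HS : Cmult (RtoC (INR H)) (Csum a L) = Csum X (L + H)).
  { rewrite <- Csum_const. unfold X. rewrite (Csum_swap (fun n h => A (h + n)%nat) (L + H) H). apply Csum_ext. intros h Hh.
    symmetry. apply (Csum_shifted_support A a H L h (L + H)); auto; lia. }
  assert (HX : RtoC (Rsum (fun n => Cmod (X n) ^ 2) (L + H)) = Csum (fun h1 => Csum (fun h2 => Rr h1 h2) H) H).
  { rewrite <- Csum_RtoC. unfold Rr.
    rewrite (Csum_ext (fun h1 => Csum (fun h2 => Csum (fun n => Cmult (A (h1 + n)%nat) (Cconj (A (h2 + n)%nat))) (L + H)) H)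
       (fun h1 => Csum (fun n => Csum (fun h2 => Cmult (A (h1 + n)%nat) (Cconj (A (h2 + n)%nat))) H) (L + H))).
    2: intros; apply Csum_swap.
    rewrite Csum_swap. apply Csum_ext. intros n Hn.
    transitivity (Cmult (X n) (Cconj (X n))).
    - apply Cmod_sqr_conj.
    - rewrite (Csum_ext (fun i => Csum (fun h2 => Cmult (A (i + n)%nat) (Cconj (A (h2 + n)%nat))) H)
        (fun i => Cmult (Csum (fun h2 => Cconj (A (h2 + n)%nat)) H) (A (i + n)%nat))).
      2: intros i Hi; rewrite Csum_scal; ring.
      rewrite Csum_scal. unfold X. rewrite Csum_conj. ring. }
  assert (HR1 : forall h1 h2, (h1 <= h2)%nat -> (h2 < H)%nat -> Cmod (Rr h1 h2) <= E (h2 - h1)%nat).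
  { intros h1 h2 H1 H2. unfold Rr. set (d := (h2 - h1)%nat).
    rewrite <- (Csum_ext (fun n => (fun m => Cmult (A m) (Cconj (A (m + d)%nat))) (h1 + n)%nat)).
    2:{ intros i Hi. cbv beta. do 3 f_equal. unfold d; lia. }
    rewrite (Csum_shifted_support (fun m => Cmult (A m) (Cconj (A (m + d)%nat))) (fun j => Cmult (a j) (Cconj (a (j + d)%nat))) H (L - d) h1 (L + H)); try lia.
    - apply HE. unfold d; lia.
    - intros n Hn. rewrite A0 by lia. ring.
    - intros j Hj. rewrite A1 by lia. do 2 f_equal. rewrite <- Nat.add_assoc. apply A1. lia.
    - intros j Hj. replace (H + j + d)%nat with (H + (j + d))%nat by lia. rewrite (A2 (j + d)%nat) by lia.
      replace (Cconj (RtoC 0)) with (RtoC 0) by (apply injective_projections; simpl; ring). ring. }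
  assert (HR2 : forall h1 h2, (h2 <= h1)%nat -> (h1 < H)%nat -> Cmod (Rr h1 h2) <= E (h1 - h2)%nat).
  { intros h1 h2 H1 H2. rewrite <- (Cmod_conj (Rr h1 h2)). unfold Rr. rewrite Csum_conj.
    rewrite (Csum_ext _ (fun n => Cmult (A (h2 + n)%nat) (Cconj (A (h1 + n)%nat)))). now apply HR1.
    intros i Hi. rewrite Cmult_conj, Cconj_conj. ring. }
  (* In a row each difference occurs at most once on either side of the diagonal, hence the factor
     2. *)
  assert (HRow : forall h1, (h1 < H)%nat -> Rsum (fun h2 => Cmod (Rr h1 h2)) H <= 2 * Rsum E H).
  { intros h1 Hh1.
    replace H with (h1 + (H - h1))%nat at 1 by lia. rewrite Rsum_app.
    assert (Y1 : Rsum (fun h2 => Cmod (Rr h1 h2)) h1 <= Rsum E H).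
    { apply Rle_trans with (Rsum (fun i => E (h1 - i)%nat) h1).
      apply Rsum_le. intros; apply HR2; lia.
      rewrite Rsum_rev. replace H with (1 + h1 + (H - h1 - 1))%nat by lia. rewrite Rsum_app, Rsum_app.
      simpl (Rsum E 1). assert (Q := PE O ltac:(lia)).
      assert (Q' : 0 <= Rsum (fun i => E (1 + h1 + i)%nat) (H - h1 - 1)) by (apply Rsum_pos; intros; apply PE; lia).
      change (fun i : nat => E (1 + i)%nat) with (fun i => E (S i)). lra. }
    assert (Y2 : Rsum (fun i => Cmod (Rr h1 (h1 + i)%nat)) (H - h1) <= Rsum E H).
    { apply Rle_trans with (Rsum E (H - h1)).
      apply Rsum_le. intros i Hi. replace (E i) with (E (h1 + i - h1)%nat) by (f_equal; lia). apply HR1; lia.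
      replace H with (H - h1 + h1)%nat at 2 by lia. rewrite Rsum_app.
      assert (Q' : 0 <= Rsum (fun i => E (H - h1 + i)%nat) h1) by (apply Rsum_pos; intros; apply PE; lia). lra. }
    lra. }
  assert (HT : Rsum (fun n => Cmod (X n) ^ 2) (L + H) <= INR H * (2 * Rsum E H)).
  { assert (P : 0 <= Rsum (fun n => Cmod (X n) ^ 2) (L + H)) by (apply Rsum_pos; intros; apply pow2_ge_0).
    rewrite <- (Rabs_pos_eq _ P), <- Cmod_R, HX. eapply Rle_trans; [apply Csum_Cmod|].
    rewrite <- Rsum_const. apply Rsum_le. intros h1 Hh1. eapply Rle_trans; [apply Csum_Cmod|]. now apply HRow. }
  assert (F : (INR H * Cmod (Csum a L)) ^ 2 <= INR (L + H) * (INR H * (2 * Rsum E H))).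
  { assert (PH := pos_INR H). rewrite <- (Rabs_pos_eq (INR H)) at 1 by auto. rewrite <- Cmod_R, <- Cmod_mult, HS.
    apply Rle_trans with (Rsum (fun n => Cmod (X n)) (L + H) ^ 2).
    - apply pow_incr. split. apply Cmod_ge_0. apply Csum_Cmod.
    - eapply Rle_trans. apply Rsum_sqr. intros; apply Cmod_ge_0. apply Rmult_le_compat_l; auto. apply pos_INR. }
  assert (PH : 0 < INR H) by (apply lt_0_INR; lia).
  apply Rmult_le_reg_l with (INR H); auto. nra.
Qed.

(** * Kusmin-Landau and the sums with alternating signs *)

Definition cotan2 (x : R) := cos (x / 2) / sin (x / 2).

Lemma cotan2_mono x y : 0 < x -> x <= y -> y < 2 * PI -> cotan2 y <= cotan2 x.
Proof.
  intros Hx Hxy Hy. unfold cotan2.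
  assert (Sx : 0 < sin (x / 2)) by (apply sin_gt_0; lra). assert (Sy : 0 < sin (y / 2)) by (apply sin_gt_0; lra).
  assert (D : 0 <= sin (y / 2 - x / 2)) by (apply sin_ge_0; lra). rewrite sin_minus in D.
  apply Rmult_le_reg_r with (sin (x / 2) * sin (y / 2)). nra.
  replace (cos (y / 2) / sin (y / 2) * (sin (x / 2) * sin (y / 2))) with (cos (y / 2) * sin (x / 2)) by (field; lra).
  replace (cos (x / 2) / sin (x / 2) * (sin (x / 2) * sin (y / 2))) with (cos (x / 2) * sin (y / 2)) by (field; lra).
  lra.
Qed.

(** The formula $1/(1-e^{ix})=\frac12\big(1+i\cot(x/2)\big)$: these reciprocals lie on a vertical
    line and move monotonically along it with $x$. *)
Lemma cotan2_inv x : 0 < x < 2 * PI ->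
  Cmult (Cminus (RtoC 1) (cis x)) (Cmult (RtoC (1/2)) (1, cotan2 x)) = RtoC 1.
Proof.
  intros Hx. unfold cotan2, cis, Cexp; simpl. rewrite exp_0.
  assert (Sx : 0 < sin (x / 2)) by (apply sin_gt_0; lra).
  assert (E1 : cos x = 1 - 2 * sin (x / 2) * sin (x / 2)). { replace x with (2 * (x / 2)) at 1 by field. apply cos_2a_sin. }
  assert (E2 : sin x = 2 * sin (x / 2) * cos (x / 2)). { replace x with (2 * (x / 2)) at 1 by field. apply sin_2a. }
  rewrite E1, E2. assert (S2 := sin2_cos2 (x / 2)). unfold Rsqr in S2.
  set (s := sin (x / 2)) in *. set (c := cos (x / 2)) in *.
  assert (K : c = c / s * s) by (field; lra). set (k := c / s) in *. rewrite K in S2 |- *.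
  apply injective_projections; simpl; [|field].
  transitivity (s * s + k * s * (k * s)); [field|lra].
Qed.

(** With $D_j$ the phase increments and $c_j=1/(1-e^{iD_j})$, each term is
    $c_j(e^{i\theta_j}-e^{i\theta_{j+1}})$. After summation by parts the variation of $c_j$ appears;
    since $D_j$ is monotone it telescopes to half a difference of two cotangents, at most $B$. The
    two boundary terms contribute $(1+B)/2$ each. *)
Lemma kusmin_landau (th : nat -> R) L B : 0 <= B ->
  (forall j, (j < L)%nat -> 0 < th (S j) - th j < 2 * PI /\ Rabs (cotan2 (th (S j) - th j)) <= B) ->
  (forall j, (S j < L)%nat -> th (S (S j)) - th (S j) <= th (S j) - th j) ->
  Cmod (Csum (fun j => cis (th j)) L) <= 1 + 2 * B.
Proof.
  intros HB H1 H2.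
  set (D := fun j => th (S j) - th j). set (c := fun j => Cmult (RtoC (1/2)) (1, cotan2 (D j))).
  assert (Hc : forall j, (j < L)%nat -> cis (th j) = Cmult (Cminus (cis (th j)) (cis (th (S j)))) (c j)).
  { intros j Hj. replace (th (S j)) with (th j + D j) by (unfold D; ring). rewrite cis_plus.
    replace (Cmult (Cminus (cis (th j)) (Cmult (cis (th j)) (cis (D j)))) (c j))
     with (Cmult (cis (th j)) (Cmult (Cminus (RtoC 1) (cis (D j))) (c j))) by ring.
    unfold c. rewrite cotan2_inv. ring. apply H1; auto. }
  assert (Mc : forall j, (j < L)%nat -> Cmod (c j) <= (1 + B) / 2).
  { intros j Hj. unfold c. rewrite Cmod_mult, Cmod_R, Rabs_pos_eq by lra.
    replace ((1, cotan2 (D j)) : C) with (Cplus (RtoC 1) (Cmult Ci (RtoC (cotan2 (D j))))) by (apply injective_projections; simpl; ring).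
    assert (X := Cmod_triangle (RtoC 1) (Cmult Ci (RtoC (cotan2 (D j))))). rewrite Cmod_mult, !Cmod_R, Rabs_R1 in X.
    assert (Mi : Cmod Ci = 1). { unfold Cmod, Ci; simpl. replace (0 * (0 * 1) + 1 * (1 * 1)) with 1 by ring. apply sqrt_1. }
    rewrite Mi in X. destruct (H1 j Hj) as [_ Y]. fold (D j) in Y. lra. }
  assert (R : forall n, (n < L)%nat -> Cmod (Cplus (Csum (fun j => cis (th j)) (S n)) (Cmult (cis (th (S n))) (c n)))
     <= (1 + B) / 2 + (cotan2 (D n) - cotan2 (D O)) / 2).
  { induction n; intros Hn.
    - simpl. replace (Cplus (Cplus (RtoC 0) (cis (th 0%nat))) (Cmult (cis (th 1%nat)) (c 0%nat))) with (Cmult (cis (th O)) (c O)).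
      rewrite Cmod_mult, Cmod_cis. specialize (Mc O Hn). lra.
      rewrite (Hc O Hn) at 2. ring.
    - specialize (IHn ltac:(lia)).
      change (Csum (fun j => cis (th j)) (S (S n))) with (Cplus (Csum (fun j => cis (th j)) (S n)) (cis (th (S n)))).
      replace (Cplus (Cplus (Csum (fun j => cis (th j)) (S n)) (cis (th (S n)))) (Cmult (cis (th (S (S n)))) (c (S n))))
       with (Cplus (Cplus (Csum (fun j => cis (th j)) (S n)) (Cmult (cis (th (S n))) (c n))) (Cmult (cis (th (S n))) (Cminus (c (S n)) (c n)))).
      2:{ rewrite (Hc (S n) Hn) at 3. ring. }
      eapply Rle_trans; [apply Cmod_triangle|]. rewrite Cmod_mult, Cmod_cis.
      assert (M : cotan2 (D n) <= cotan2 (D (S n))).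
      { apply cotan2_mono. apply (H1 (S n)); auto. apply (H2 n); auto. apply (H1 n); lia. }
      replace (Cminus (c (S n)) (c n)) with (Cmult (Cmult Ci (RtoC (1/2))) (RtoC (cotan2 (D (S n)) - cotan2 (D n))))
        by (unfold c; apply injective_projections; simpl; field).
      rewrite !Cmod_mult, !Cmod_R, (Rabs_pos_eq (1/2)), (Rabs_pos_eq (cotan2 (D (S n)) - cotan2 (D n))) by lra.
      assert (Mi : Cmod Ci = 1). { unfold Cmod, Ci; simpl. replace (0 * (0 * 1) + 1 * (1 * 1)) with 1 by ring. apply sqrt_1. }
      rewrite Mi. lra. }
  destruct L as [|L]. simpl. rewrite Cmod_0. lra.
  specialize (R L (Nat.lt_succ_diag_r L)). assert (M := Mc L (Nat.lt_succ_diag_r L)).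
  replace (Csum (fun j => cis (th j)) (S L)) with
    (Cminus (Cplus (Csum (fun j => cis (th j)) (S L)) (Cmult (cis (th (S L))) (c L))) (Cmult (cis (th (S L))) (c L))) by ring.
  eapply Rle_trans; [apply Cmod_minus_le|]. rewrite (Cmod_mult (cis _)), Cmod_cis.
  destruct (H1 L ltac:(lia)) as [_ Y1]. destruct (H1 O ltac:(lia)) as [_ Y0]. fold (D L) in Y1. fold (D O) in Y0.
  apply Rabs_le_between in Y1. apply Rabs_le_between in Y0. lra.
Qed.

Lemma cotan2_small x d : 0 < d -> d <= x -> x <= PI -> Rabs (cotan2 x) <= 2 / d.
Proof.
  intros Hd Hx HP. assert (PP := PI_RGT_0). unfold cotan2.
  assert (Sx : 0 < sin (x / 2)) by (apply sin_gt_0; lra).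
  assert (Cx : 0 <= cos (x / 2)) by (apply cos_ge_0; lra).
  rewrite Rabs_pos_eq by (apply Rdiv_le_0_compat; auto).
  (* This is $u\cos u\le\sin u$, as $\sin u-u\cos u$ has derivative $u\sin u\ge0$; it says
     $\cot(x/2)\le2/x$. *)
  assert (T : x / 2 * cos (x / 2) <= sin (x / 2)).
  { destruct (MVT_cor2 (fun u => sin u - u * cos u) (fun u => u * sin u) 0 (x / 2)) as [c [Hc1 Hc2]]. lra.
    intros c _. apply is_derive_Reals. auto_derive; auto. ring.
    rewrite sin_0, Rmult_0_l in Hc1. assert (0 <= sin c) by (apply sin_ge_0; lra). assert (0 <= c * sin c * (x / 2 - 0)) by (apply Rmult_le_pos; [apply Rmult_le_pos|]; lra). lra. }
  apply Rle_trans with (2 / x).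
  - apply Rmult_le_reg_r with (sin (x / 2) * x). nra.
    replace (cos (x / 2) / sin (x / 2) * (sin (x / 2) * x)) with (2 * (x / 2 * cos (x / 2))) by (field; lra).
    replace (2 / x * (sin (x / 2) * x)) with (2 * sin (x / 2)) by (field; lra). lra.
  - apply Rmult_le_compat_l. lra. apply Rinv_le_contravar; lra.
Qed.

(** The value is $-\tan(x/2)$ with $x/2\le1/2<\pi/4$. *)
Lemma cotan2_past_PI x : 0 <= x <= 1 -> Rabs (cotan2 (PI + x)) <= 1.
Proof.
  intros Hx. assert (PP := PI2_3_2). unfold cotan2. replace ((PI + x) / 2) with (PI / 2 + x / 2) by field.
  rewrite cos_plus, sin_plus, cos_PI2, sin_PI2.
  assert (S0 : 0 <= sin (x / 2)) by (apply sin_ge_0; lra).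
  assert (C0 : 0 < cos (x / 2)) by (apply cos_gt_0; lra).
  assert (SC : sin (x / 2) <= cos (x / 2)).
  { apply Rle_trans with (sin (PI / 2 - x / 2)). apply sin_incr_1; lra. rewrite sin_shift. lra. }
  replace ((0 * cos (x / 2) - 1 * sin (x / 2)) / (1 * cos (x / 2) + 0 * sin (x / 2))) with (- (sin (x / 2) / cos (x / 2))) by (field; lra).
  rewrite Rabs_Ropp, Rabs_pos_eq by (apply Rdiv_le_0_compat; auto). apply Rle_div_l; lra.
Qed.

Lemma abel_bound (w : nat -> R) (a : nat -> C) A L : (forall n, (n <= L)%nat -> Cmod (Csum a n) <= A) ->
  (forall n, 0 <= w n) -> (forall n, w (S n) <= w n) ->
  Cmod (Csum (fun j => Cmult (RtoC (w j)) (a j)) L) <= A * w O.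
Proof.
  intros HA Hw Hd.
  assert (X : forall n, (n <= L)%nat -> Cmod (Cminus (Csum (fun j => Cmult (RtoC (w j)) (a j)) n) (Cmult (RtoC (w n)) (Csum a n))) <= A * (w O - w n)).
  { induction n; intros Hn.
    - simpl. replace (Cminus (RtoC 0) (Cmult (RtoC (w 0%nat)) (RtoC 0))) with (RtoC 0) by ring. rewrite Cmod_0. lra.
    - specialize (IHn ltac:(lia)).
      replace (Cminus _ _) with (Cplus (Cminus (Csum (fun j => Cmult (RtoC (w j)) (a j)) n) (Cmult (RtoC (w n)) (Csum a n)))
         (Cmult (RtoC (w n - w (S n))) (Csum a (S n)))) by (simpl; rewrite RtoC_minus; ring).
      eapply Rle_trans; [apply Cmod_triangle|]. rewrite Cmod_mult, Cmod_R, Rabs_pos_eq by (specialize (Hd n); lra).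
      assert (Y := HA (S n) Hn). assert (0 <= w n - w (S n)) by (specialize (Hd n); lra). nra. }
  specialize (X L (le_n _)). specialize (HA L (le_n _)). specialize (Hw L).
  replace (Csum (fun j => Cmult (RtoC (w j)) (a j)) L) with
   (Cplus (Cminus (Csum (fun j => Cmult (RtoC (w j)) (a j)) L) (Cmult (RtoC (w L)) (Csum a L))) (Cmult (RtoC (w L)) (Csum a L))) by ring.
  eapply Rle_trans; [apply Cmod_triangle|]. rewrite (Cmod_mult (RtoC (w L))), Cmod_R, Rabs_pos_eq by auto. nra.
Qed.

Lemma ln_le_sub1 x : 0 < x -> ln x <= x - 1.
Proof.
  intros Hx. destruct (Req_dec (ln x) 0) as [E|E].
  - rewrite E. assert (x = 1). { rewrite <- (exp_ln x), E, exp_0; auto. } lra.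
  - assert (X := exp_ineq1 (ln x) E). rewrite exp_ln in X; lra.
Qed.
Lemma ln_ge_frac x : 0 < x -> 1 - / x <= ln x.
Proof. intros Hx. assert (X := ln_le_sub1 (/ x) (Rinv_0_lt_compat _ Hx)). rewrite ln_Rinv in X by auto. lra. Qed.
Lemma ln_1p_half x : 0 <= x <= 1 -> x / 2 <= ln (1 + x).
Proof.
  intros Hx. eapply Rle_trans; [|apply ln_ge_frac; lra].
  replace (1 - / (1 + x)) with (x / (1 + x)) by (field; lra). apply Rmult_le_compat_l. lra. apply Rinv_le_contravar; lra.
Qed.

Lemma harmonic n : (1 <= n)%nat -> Rsum (fun i => / INR (S i)) n <= 1 + ln (INR n).
Proof.
  intros Hn. induction Hn as [|n Hn IH].
  - simpl. rewrite ln_1. lra.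
  - change (Rsum (fun i => / INR (S i)) (S n)) with (Rsum (fun i => / INR (S i)) n + / INR (S n)).
    assert (P : 1 <= INR n) by (apply (le_INR 1); auto).
    assert (/ INR (S n) <= ln (INR (S n)) - ln (INR n)); [|lra].
    rewrite <- ln_div by (rewrite ?S_INR; lra). eapply Rle_trans; [|apply ln_ge_frac].
    rewrite S_INR. right. field. lra. rewrite S_INR. apply Rdiv_lt_0_compat; lra.
Qed.

(* The phases of the terms of [eta (sg - i t)]. The extra [PI * i] puts the increments between [PI] and [PI + 1] as soon as [t <= i], where Kusmin-Landau then bounds the whole tail at once. *)
Definition alt_phase (t : R) (i : nat) : R := PI * INR i + t * ln (INR (S i)).

Lemma cis_sum_trivial (th : nat -> R) L : Cmod (Csum (fun j => cis (th j)) L) <= INR L.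
Proof.
  eapply Rle_trans; [apply Csum_Cmod|]. rewrite (Rsum_ext _ (fun _ => 1)).
  rewrite Rsum_const; lra. intros; apply Cmod_cis.
Qed.

Lemma alt_tail t M L : 1 <= t -> t <= INR (S M) -> Cmod (Csum (fun j => cis (alt_phase t (M + j))) L) <= 3.
Proof.
  intros Ht HM. assert (PP := PI2_3_2). replace 3 with (1 + 2 * 1) by ring.
  assert (Pn : forall j, t <= INR (S (M + j))).
  { intros j. eapply Rle_trans; [exact HM|]. apply le_INR; lia. }
  assert (D : forall j, alt_phase t (M + S j) - alt_phase t (M + j) = PI + t * ln (1 + / INR (S (M + j)))).
  { intros j. unfold alt_phase. specialize (Pn j). rewrite Nat.add_succ_r.
    replace (1 + / INR (S (M + j))) with (INR (S (S (M + j))) / INR (S (M + j))) by (rewrite (S_INR (S (M + j))); field; lra).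
    rewrite ln_div by (rewrite ?S_INR in *; lra). rewrite (S_INR (M + j)). ring. }
  assert (B : forall j, 0 <= t * ln (1 + / INR (S (M + j))) <= 1).
  { intros j. specialize (Pn j). assert (Q : 0 < / INR (S (M + j))) by (apply Rinv_0_lt_compat; lra). split.
    - apply Rmult_le_pos. lra. rewrite <- ln_1. apply ln_le; lra.
    - apply Rle_trans with (t * / INR (S (M + j))). apply Rmult_le_compat_l. lra.
      eapply Rle_trans; [apply ln_le_sub1|]; lra. apply Rle_div_l; lra. }
  apply (kusmin_landau (fun j => alt_phase t (M + j))). lra.
  - intros j _. rewrite D. specialize (B j). split. lra. apply cotan2_past_PI; auto.
  - intros j _. rewrite !D. apply Rplus_le_compat_l, Rmult_le_compat_l. lra.
    assert (P1 := Pn j). assert (P2 := Pn (S j)). apply ln_le.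
    assert (Q : 0 < / INR (S (M + S j))) by (apply Rinv_0_lt_compat; lra). lra.
    apply Rplus_le_compat_l, Rinv_le_contravar. lra. apply le_INR; lia.
Qed.

(** Differencing turns the alternating sign into a constant phase. The increments of the differenced
    phase are $t\ln(1+\lambda)$ with $\lambda=d/(n(n+d+1))$; for $n$ between $P$ and $2P$ they lie
    between $td/(16P^2)$ and 1 and decrease, so Kusmin-Landau applies with $B=32P^2/(td)$. As $1\le
    P^2/(td)$, the bound $1+2B$ is at most 65 times that quotient. *)
Lemma alt_corr t M d L : 1 <= t -> (1 <= d)%nat -> t * INR d <= INR (S M) ^ 2 -> (d <= S M)%nat -> (L + d <= S M)%nat ->
  Cmod (Csum (fun j => Cmult (cis (alt_phase t (M + j))) (Cconj (cis (alt_phase t (M + (j + d)))))) L) <= 65 * INR (S M) ^ 2 / t / INR d.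
Proof.
  intros Ht Hd Htd HdM HL. assert (PP := PI2_3_2).
  set (P := INR (S M)) in *. set (D := INR d) in *.
  assert (HD : 1 <= D) by (apply (le_INR 1); auto).
  assert (HP : 1 <= P) by (apply (le_INR 1); lia).
  assert (HDP : D <= P) by (apply le_INR; auto).
  rewrite (Csum_ext _ (fun j => cis (alt_phase t (M + j) - alt_phase t (M + (j + d))))).
  2:{ intros j _. unfold Rminus. rewrite cis_plus. f_equal. unfold cis, Cexp, Cconj; simpl.
      rewrite cos_neg, sin_neg. apply injective_projections; simpl; ring. }
  set (lam := fun n => D / (n * (n + D + 1))).
  assert (Dl : forall j, (alt_phase t (M + S j) - alt_phase t (M + (S j + d))) - (alt_phase t (M + j) - alt_phase t (M + (j + d))) = t * ln (1 + lam (INR (S (M + j))))).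
  { intros j. unfold alt_phase, lam.
    replace (INR (S (M + (S j + d)))) with (INR (S (M + j)) + D + 1) by (unfold D; rewrite !S_INR, !plus_INR, !S_INR; ring).
    replace (INR (S (M + (j + d)))) with (INR (S (M + j)) + D) by (unfold D; rewrite !S_INR, !plus_INR; ring).
    replace (INR (S (M + S j))) with (INR (S (M + j)) + 1) by (rewrite !S_INR, !plus_INR, !S_INR; ring).
    assert (Q : 1 <= INR (S (M + j))) by (apply (le_INR 1); lia). set (n := INR (S (M + j))) in *.
    replace (1 + D / (n * (n + D + 1))) with ((n + 1) * (n + D) / (n * (n + D + 1))) by (field; lra).
    rewrite ln_div, !ln_mult by nra. rewrite !plus_INR, !S_INR. ring. }
  assert (Hl : forall j, (j <= L)%nat -> D / (8 * P ^ 2) <= lam (INR (S (M + j))) <= D / P ^ 2 /\ lam (INR (S (M + j))) <= 1).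
  { intros j Hj. unfold lam.
    assert (Q1 : P <= INR (S (M + j))) by (apply le_INR; lia).
    assert (Q2 : INR (S (M + j)) + D + 1 <= 4 * P).
    { replace (INR (S (M + j)) + D + 1) with (INR (S (M + j + d + 1))) by (unfold D; rewrite !S_INR, !plus_INR; simpl; ring).
      replace (4 * P) with (INR (4 * S M)) by (unfold P; rewrite mult_INR; simpl; ring). apply le_INR. lia. }
    assert (Q3 : INR (S (M + j)) <= 2 * P).
    { replace (2 * P) with (INR (2 * S M)) by (unfold P; rewrite mult_INR; simpl; ring). apply le_INR. lia. }
    set (n := INR (S (M + j))) in *. assert (0 < n * (n + D + 1)) by nra.
    split; [split|].
    - apply Rmult_le_compat_l. lra. apply Rinv_le_contravar; auto. nra.
    - apply Rmult_le_compat_l. lra. apply Rinv_le_contravar. nra. nra.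
    - apply Rle_div_l; auto. nra. }
  assert (Hb : forall j, (j <= L)%nat -> t * D / (16 * P ^ 2) <= t * ln (1 + lam (INR (S (M + j)))) <= 1).
  { intros j Hj. destruct (Hl j Hj) as [[A1 A2] A3]. assert (A0 : 0 < D / (8 * P ^ 2)) by (apply Rdiv_lt_0_compat; nra). split.
    - replace (t * D / (16 * P ^ 2)) with (t * (D / (8 * P ^ 2) / 2)) by (field; nra).
      apply Rmult_le_compat_l. lra. eapply Rle_trans; [|apply ln_1p_half; lra]. lra.
    - apply Rle_trans with (t * (D / P ^ 2)).
      apply Rmult_le_compat_l. lra. eapply Rle_trans; [apply ln_le_sub1|]; lra.
      replace (t * (D / P ^ 2)) with (t * D / P ^ 2) by (field; nra). apply Rle_div_l; nra. }
  assert (P0 : 0 < t * D / (16 * P ^ 2)) by (apply Rdiv_lt_0_compat; nra).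
  set (B := 2 / (t * D / (16 * P ^ 2))).
  assert (EB : B = 32 * P ^ 2 / t / D) by (unfold B; field; repeat split; nra).
  apply Rle_trans with (1 + 2 * B).
  - apply (kusmin_landau (fun j => alt_phase t (M + j) - alt_phase t (M + (j + d)))).
    + rewrite EB. apply Rdiv_le_0_compat; [apply Rdiv_le_0_compat|]; nra.
    + intros j Hj. rewrite Dl. specialize (Hb j ltac:(lia)). split. lra.
      apply cotan2_small; auto; lra.
    + intros j Hj. rewrite !Dl. apply Rmult_le_compat_l. lra.
      destruct (Hl j ltac:(lia)) as [[A1 A2] A3]. destruct (Hl (S j) ltac:(lia)) as [[A1' A2'] A3'].
      assert (A0 : 0 < D / (8 * P ^ 2)) by (apply Rdiv_lt_0_compat; nra).
      apply ln_le. lra. apply Rplus_le_compat_l. unfold lam.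
      assert (Q1 : P <= INR (S (M + j))) by (apply le_INR; lia).
      assert (Q2 : INR (S (M + S j)) = INR (S (M + j)) + 1) by (rewrite !S_INR, !plus_INR, !S_INR; ring).
      rewrite Q2. set (n := INR (S (M + j))) in *.
      apply Rmult_le_compat_l. lra. apply Rinv_le_contravar. nra. nra.
  - rewrite EB. assert (1 <= P ^ 2 / t / D).
    { replace (P ^ 2 / t / D) with (P ^ 2 / (t * D)) by (field; lra). apply Rle_div_r; nra. }
    replace (65 * P ^ 2 / t / D) with (P ^ 2 / t / D + 2 * (32 * P ^ 2 / t / D)) by (field; lra). lra.
Qed.

(* Weyl differencing with about [M^2 / t] shifts, for which the differenced phases have increments below 1. *)
Lemma alt_block t M L : 1 <= t -> INR (S M) <= t -> (L <= S M)%nat ->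
  Cmod (Csum (fun j => cis (alt_phase t (M + j))) L) <= 23 * (sqrt t * (1 + ln t)).
Proof.
  intros Ht HM HL. set (P := INR (S M)) in *.
  assert (HP : 1 <= P) by (apply (le_INR 1); lia).
  assert (Ln : 0 <= ln t). { rewrite <- ln_1. apply ln_le; lra. }
  assert (St : 1 <= sqrt t). { rewrite <- sqrt_1 at 1. apply sqrt_le_1_alt; lra. }
  assert (St2 : sqrt t * sqrt t = t) by (apply sqrt_sqrt; lra).
  assert (LP : INR L <= P) by (apply le_INR; auto).
  set (S0 := Cmod (Csum (fun j => cis (alt_phase t (M + j))) L)).
  assert (S0p : 0 <= S0) by apply Cmod_ge_0.
  assert (S0L : S0 <= INR L) by apply cis_sum_trivial.
  destruct (Rle_dec t (P ^ 2)) as [H1|H1].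
  (* A block of length at most $\sqrt t$ is estimated trivially. *)
  2:{ assert (P <= sqrt t). { apply Rsqr_incr_0_var; unfold Rsqr; nra. } nra. }
  (* The largest number of shifts allowed by the condition $td\le P^2$ of [alt_corr]. *)
  destruct (nfloor_ex (P ^ 2 / t)) as [H [HH1 HH2]]. apply Rdiv_le_0_compat; nra.
  assert (Q1 : 1 <= P ^ 2 / t) by (apply Rle_div_r; lra).
  assert (Q2 : P ^ 2 / t <= P) by (apply Rle_div_l; nra).
  assert (HH : (1 <= H)%nat). { destruct H; [simpl in HH2; lra|lia]. }
  assert (HHr : 1 <= INR H) by (apply (le_INR 1); auto).
  assert (HHP : (H <= S M)%nat). { apply INR_le. fold P. lra. }
  assert (tH : t * INR H <= P ^ 2). { apply Rle_trans with (t * (P ^ 2 / t)). apply Rmult_le_compat_l; lra. right; field; lra. }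
  assert (tH2 : P ^ 2 <= 2 * (t * INR H)).
  { replace (P ^ 2) with (t * (P ^ 2 / t)) by (field; lra). nra. }
  (* The shift 0 gives the number of terms, at most [P]; the other entries sum to a harmonic series,
     which is the source of the logarithm. *)
  set (E := fun d => match d with O => P | S _ => 65 * P ^ 2 / t / INR d end).
  assert (W := weyl (fun j => cis (alt_phase t (M + j))) E L H HH).
  assert (W' : INR H * S0 ^ 2 <= INR (L + H) * (2 * Rsum E H)).
  { apply W. intros d Hd. destruct d as [|d].
    - unfold E. rewrite Nat.sub_0_r. eapply Rle_trans; [apply Csum_Cmod|].
      eapply Rle_trans; [apply (Rsum_le _ (fun _ => 1))|].
      intros i Hi. rewrite Cmod_mult, Cmod_conj, !Cmod_cis. lra. rewrite Rsum_const. lra.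
    - unfold E. destruct (le_lt_dec L (S d)) as [Hl|Hl].
      + replace (L - S d)%nat with O by lia. simpl Csum. rewrite Cmod_0.
        apply Rdiv_le_0_compat; [apply Rdiv_le_0_compat|apply INR_S_pos]; nra.
      + apply alt_corr; auto; try lia. fold P.
        assert (INR (S d) <= INR H) by (apply le_INR; lia). nra. }
  assert (RE : Rsum E H <= P + 65 * P ^ 2 / t * (1 + ln t)).
  { destruct H as [|H']. lia.
    change (S H') with (1 + H')%nat. rewrite Rsum_app. simpl (Rsum E 1).
    assert (Y : Rsum (fun i => E (1 + i)%nat) H' <= 65 * P ^ 2 / t * (1 + ln t)).
    { unfold E. cbn [Nat.add]. rewrite (Rsum_ext _ (fun i => 65 * P ^ 2 / t * / INR (S i))) by reflexivity.
      rewrite Rsum_scal. apply Rmult_le_compat_l. apply Rdiv_le_0_compat; nra.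
      destruct (Nat.eq_dec H' 0) as [->|N]. simpl; lra.
      eapply Rle_trans; [apply harmonic; lia|]. apply Rplus_le_compat_l, ln_le. apply lt_0_INR; lia.
      rewrite S_INR in *. lra. }
    lra. }
  assert (LH : INR (L + H) <= 2 * P) by (rewrite plus_INR; apply le_INR in HHP; fold P in HHP; lra).
  assert (Z1 : INR H * S0 ^ 2 <= 2 * P * (2 * (P + 65 * P ^ 2 / t * (1 + ln t)))).
  { eapply Rle_trans; [exact W'|]. apply Rmult_le_compat; auto. apply pos_INR.
    assert (0 <= Rsum E H). { apply Rsum_pos. intros d Hd. destruct d; unfold E. lra. apply Rdiv_le_0_compat; [apply Rdiv_le_0_compat|apply INR_S_pos]; nra. }
    lra. lra. }
  assert (Z2 : P ^ 2 * S0 ^ 2 <= 2 * t * (2 * P * (2 * (P + 65 * P ^ 2 / t * (1 + ln t))))).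
  { apply Rle_trans with (2 * t * (INR H * S0 ^ 2)). assert (0 <= S0 ^ 2) by apply pow2_ge_0. nra.
    apply Rmult_le_compat_l; lra. }
  assert (Z3 : 2 * t * (2 * P * (2 * (P + 65 * P ^ 2 / t * (1 + ln t)))) = P ^ 2 * (8 * t + 520 * (P * (1 + ln t)))) by (field; lra).
  assert (Z4 : S0 ^ 2 <= 8 * t + 520 * (P * (1 + ln t))).
  { apply Rmult_le_reg_l with (P ^ 2). nra. lra. }
  assert (Z5 : P * (1 + ln t) <= t * (1 + ln t)) by (apply Rmult_le_compat_r; lra).
  (* Here $8t+520P(1+\ln t)\le528\,t(1+\ln t)^2$, and $528<23^2=529$. *)
  apply Rsqr_incr_0_var. 2: nra. unfold Rsqr.
  replace (23 * (sqrt t * (1 + ln t)) * (23 * (sqrt t * (1 + ln t)))) with (529 * t * (1 + ln t) ^ 2) by (rewrite <- St2 at 1; ring).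
  assert (t * (1 + ln t) <= t * (1 + ln t) ^ 2) by nra. assert (t <= t * (1 + ln t)) by nra. nra.
Qed.

Lemma ln_2_half : / 2 <= ln 2.
Proof. replace (/ 2) with (1 - / 2) by field. apply ln_ge_frac; lra. Qed.

(** Halving: the upper half of the range is one block of [alt_block], and the lower half is treated
    by induction. A halving lowers $\ln N$ by at least $\ln2\ge1/2$, which pays for one block in the
    factor $1+2\ln N$. *)
Lemma alt_sum_small t N : 1 <= t -> INR N <= t ->
  Cmod (Csum (fun j => cis (alt_phase t j)) N) <= 23 * (sqrt t * (1 + ln t)) * (1 + 2 * ln t).
Proof.
  intros Ht HN. set (D := 23 * (sqrt t * (1 + ln t))).
  assert (Ln : 0 <= ln t). { rewrite <- ln_1. apply ln_le; lra. }
  assert (D0 : 0 <= D). { unfold D. assert (0 <= sqrt t) by apply sqrt_pos. nra. }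
  assert (K : forall N, (1 <= N)%nat -> INR N <= t -> Cmod (Csum (fun j => cis (alt_phase t j)) N) <= D * (1 + 2 * ln (INR N))).
  { clear N HN. intros N. induction N as [N IH] using (well_founded_induction lt_wf). intros H1 HN.
    set (M := Nat.div2 N). assert (E := Nat.div2_odd N). fold M in E.
    assert (Hb : (Nat.b2n (Nat.odd N) <= 1)%nat) by (destruct (Nat.odd N); simpl; lia).
    set (L := (N - M)%nat). assert (NL : N = (M + L)%nat) by (unfold L; lia).
    rewrite NL at 1. rewrite Csum_app. eapply Rle_trans; [apply Cmod_triangle|].
    assert (B : Cmod (Csum (fun i => cis (alt_phase t (M + i))) L) <= D).
    { apply alt_block; auto. eapply Rle_trans; [|exact HN]. apply le_INR. lia. unfold L; lia. }
    assert (N1 : 1 <= INR N) by (apply (le_INR 1); auto).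
    destruct (Nat.eq_dec M 0) as [M0|M0].
    - rewrite M0 at 1. simpl Csum at 1. rewrite Cmod_0.
      assert (0 <= ln (INR N)) by (rewrite <- ln_1; apply ln_le; lra). nra.
    - assert (IHM := IH M ltac:(lia) ltac:(lia) ltac:(eapply Rle_trans; [|exact HN]; apply le_INR; lia)).
      assert (LL : ln (INR M) + ln 2 <= ln (INR N)).
      { rewrite <- ln_mult; try lra. apply ln_le. assert (0 < INR M) by (apply lt_0_INR; lia). lra.
        replace (INR M * 2) with (INR (2 * M)) by (rewrite mult_INR; simpl; ring). apply le_INR; lia.
        apply lt_0_INR; lia. }
      assert (L2 := ln_2_half). nra. }
  destruct (Nat.eq_dec N 0) as [->|N0].
  - simpl. rewrite Cmod_0. apply Rmult_le_pos; lra.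
  - eapply Rle_trans; [apply K; auto; lia|]. apply Rmult_le_compat_l; auto.
    assert (ln (INR N) <= ln t). { apply ln_le; auto. apply lt_0_INR; lia. } lra.
Qed.

(** The range is cut at $t$: the terms below give $2\cdot23=46$, and the tail adds at most 3
    whatever its length. *)
Lemma alt_sum t N : 1 <= t -> Cmod (Csum (fun j => cis (alt_phase t j)) N) <= 49 * (sqrt t * (1 + ln t) ^ 2).
Proof.
  intros Ht.
  assert (Ln : 0 <= ln t). { rewrite <- ln_1. apply ln_le; lra. }
  assert (St : 1 <= sqrt t). { rewrite <- sqrt_1 at 1. apply sqrt_le_1_alt; lra. }
  assert (X : 23 * (sqrt t * (1 + ln t)) * (1 + 2 * ln t) <= 46 * (sqrt t * (1 + ln t) ^ 2)).
  { assert (0 <= sqrt t * (1 + ln t)) by nra. nra. }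
  assert (Y : 1 <= sqrt t * (1 + ln t) ^ 2) by nra.
  destruct (Rle_dec (INR N) t) as [H|H].
  - assert (Z := alt_sum_small t N Ht H). lra.
  - destruct (nfloor_ex t) as [M [HM1 HM2]]. lra.
    assert (MN : (M <= N)%nat) by (apply INR_le; lra).
    replace N with (M + (N - M))%nat by lia. rewrite Csum_app. eapply Rle_trans; [apply Cmod_triangle|].
    assert (Z := alt_sum_small t M Ht HM1).
    assert (Z' := alt_tail t M (N - M) Ht ltac:(rewrite S_INR; lra)). lra.
Qed.

(* The gain [t^(- c0 / 8)] over [sqrt t] comes from estimating the first [t^(1/4)] terms trivially: the weights of the others are at most [t^(- c0 / 4)]. *)
Lemma alt_weighted c0 : 0 < c0 < 1 -> exists C, 0 < C /\ forall sg t N, c0 <= sg -> 1 <= t ->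
  Cmod (Csum (fun j => Cmult (RtoC (exp (- sg * ln (INR (S j))))) (cis (alt_phase t j))) N) <= C * exp ((1 / 2 - c0 / 8) * ln t).
Proof.
  (* With this [K] one has $1+\ln t\le K\,t^{c_0/16}$. The squared logarithm thus costs $t^{c_0/8}$,
     half of the saving $t^{-c_0/4}$ from the weights. The factor 98 below is $2\cdot49$, from a
     difference of two partial sums. *)
  intros Hc. set (K := 1 + 16 / c0). assert (HK : 1 < K) by (assert (0 < 16 / c0) by (apply Rdiv_lt_0_compat; lra); unfold K; lra).
  exists (2 + 98 * K ^ 2). split. nra. intros sg t N Hs Ht.
  assert (Ln : 0 <= ln t). { rewrite <- ln_1. apply ln_le; lra. }
  assert (LK : 1 + ln t <= K * exp (c0 / 16 * ln t)).
  { assert (A := exp_pos (c0 / 16 * ln t)).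
    assert (B : 1 + c0 / 16 * ln t <= exp (c0 / 16 * ln t)).
    { destruct (Req_dec (c0 / 16 * ln t) 0) as [E|E]. rewrite E, exp_0; lra. left; now apply exp_ineq1. }
    assert (0 <= c0 / 16 * ln t) by (apply Rmult_le_pos; lra).
    unfold K. rewrite Rmult_plus_distr_r, Rmult_1_l.
    assert (16 / c0 * (c0 / 16 * ln t) <= 16 / c0 * exp (c0 / 16 * ln t)).
    { apply Rmult_le_compat_l. left; apply Rdiv_lt_0_compat; lra. lra. }
    replace (16 / c0 * (c0 / 16 * ln t)) with (ln t) in H0 by (field; lra). lra. }
  set (w := fun j => exp (- sg * ln (INR (S j)))).
  assert (w0 : forall j, 0 <= w j) by (intros; left; apply exp_pos).
  assert (wd : forall j, w (S j) <= w j).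
  { intros j. unfold w. apply exp_le_mono. assert (ln (INR (S j)) <= ln (INR (S (S j)))).
    { apply ln_le. apply INR_S_pos. apply le_INR; lia. } nra. }
  assert (w1 : forall j, w j <= 1).
  { induction j. unfold w. simpl INR. rewrite ln_1, Rmult_0_r, exp_0. lra. specialize (wd j). lra. }
  destruct (nfloor_ex (exp (/ 4 * ln t))) as [M [HM1 HM2]]. left; apply exp_pos.
  assert (Hq : exp (/ 4 * ln t) <= exp ((1 / 2 - c0 / 8) * ln t)) by (apply exp_le_mono; nra).
  assert (Hd : forall n, (n <= M)%nat -> Cmod (Csum (fun j => Cmult (RtoC (w j)) (cis (alt_phase t j))) n) <= exp (/ 4 * ln t)).
  { intros n Hn. eapply Rle_trans; [apply Csum_Cmod|]. eapply Rle_trans; [apply (Rsum_le _ (fun _ => 1))|].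
    intros i _. rewrite Cmod_mult, Cmod_cis, Cmod_R, Rabs_pos_eq by auto. specialize (w1 i). lra.
    rewrite Rsum_const. apply le_INR in Hn. lra. }
  assert (Hp := exp_pos ((1 / 2 - c0 / 8) * ln t)).
  destruct (le_lt_dec N M) as [HN|HN].
  - specialize (Hd N HN). fold w. apply Rle_trans with (1 * exp ((1 / 2 - c0 / 8) * ln t)). unfold w in *; lra.
    apply Rmult_le_compat_r; nra.
  - replace N with (M + (N - M))%nat by lia. rewrite Csum_app. eapply Rle_trans; [apply Cmod_triangle|].
    assert (X := Hd M (le_n _)). unfold w in X.
    assert (Y : Cmod (Csum (fun j => Cmult (RtoC (w (M + j)%nat)) (cis (alt_phase t (M + j)))) (N - M)) <= 98 * (sqrt t * (1 + ln t) ^ 2) * w (M + 0)%nat).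
    { apply (abel_bound (fun j => w (M + j)%nat) (fun j => cis (alt_phase t (M + j)))).
      - intros n _.
        replace (Csum (fun j => cis (alt_phase t (M + j))) n) with (Cminus (Csum (fun j => cis (alt_phase t j)) (M + n)) (Csum (fun j => cis (alt_phase t j)) M)).
        eapply Rle_trans; [apply Cmod_minus_le|]. assert (A1 := alt_sum t (M + n) Ht). assert (A2 := alt_sum t M Ht). lra.
        rewrite Csum_app. ring.
      - auto.
      - intros n. rewrite Nat.add_succ_r. apply wd. }
    unfold w at 1 in Y.
    assert (WM : w (M + 0)%nat <= exp (- (c0 / 4) * ln t)).
    { unfold w. rewrite Nat.add_0_r. apply exp_le_mono. rewrite S_INR.
      assert (L : / 4 * ln t <= ln (INR M + 1)). { rewrite <- (ln_exp (/ 4 * ln t)). apply ln_le. apply exp_pos. lra. }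
      nra. }
    assert (Q : sqrt t * (1 + ln t) ^ 2 * w (M + 0)%nat <= K ^ 2 * exp ((1 / 2 - c0 / 8) * ln t)).
    { replace (exp ((1 / 2 - c0 / 8) * ln t)) with (exp (1 / 2 * ln t) * (exp (c0 / 16 * ln t) * exp (c0 / 16 * ln t)) * exp (- (c0 / 4) * ln t)).
      2: rewrite <- !exp_plus; f_equal; field.
      assert (ES : exp (1 / 2 * ln t) = sqrt t).
      { replace (1 / 2) with (/ 2) by field. apply (Rpower_sqrt t). lra. }
      rewrite ES.
      assert (P1 := exp_pos (c0 / 16 * ln t)). assert (P2 := exp_pos (- (c0 / 4) * ln t)). assert (P3 := sqrt_pos t).
      replace (K ^ 2 * (sqrt t * (exp (c0 / 16 * ln t) * exp (c0 / 16 * ln t)) * exp (- (c0 / 4) * ln t)))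
        with (sqrt t * (K * exp (c0 / 16 * ln t)) ^ 2 * exp (- (c0 / 4) * ln t)) by ring.
      apply Rmult_le_compat; auto. apply Rmult_le_pos; auto. apply pow2_ge_0.
      apply Rmult_le_compat_l; auto. apply pow_incr. lra. }
    lra.
Qed.

Lemma Cexp_conj z : Cconj (Cexp z) = Cexp (Cconj z).
Proof. destruct z as [p q]. unfold Cexp, Cconj, Re, Im; simpl. rewrite cos_neg, sin_neg. apply injective_projections; simpl; ring. Qed.

(** For $\mathrm{Im}\,s=-t<0$ the terms are $n^{-\sigma}$ times the exponentials with phases
    [alt_phase], the sign being absorbed through $(-1)^i=e^{i\pi i'}$ with $i'$ the index $i$.
    Positive imaginary parts follow by conjugation. *)
Lemma eta_partial_bound c0 : 0 < c0 < 1 -> exists C, 0 < C /\ forall s N, c0 <= Re s -> 1 <= Rabs (Im s) ->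
  Cmod (Csum (eta_term s) N) <= C * exp ((1 / 2 - c0 / 8) * ln (Rabs (Im s))).
Proof.
  intros Hc. destruct (alt_weighted c0 Hc) as [C [HC H]]. exists C; split; auto.
  assert (Neg : forall s N, c0 <= Re s -> 1 <= - Im s -> Cmod (Csum (eta_term s) N) <= C * exp ((1 / 2 - c0 / 8) * ln (- Im s))).
  { intros s N Hs Ht. eapply Rle_trans; [|apply (H (Re s) (- Im s) N Hs Ht)]. right. f_equal.
    apply Csum_ext. intros i _. unfold eta_term, alt_phase, cpow.
    rewrite Cexp_split, cis_plus.
    replace (Re (Cmult (Copp s) (RtoC (ln (INR (S i)))))) with (- Re s * ln (INR (S i))) by (unfold Re; simpl; ring).
    replace (Im (Cmult (Copp s) (RtoC (ln (INR (S i)))))) with (- Im s * ln (INR (S i))) by (unfold Im; simpl; ring).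
    replace (cis (PI * INR i)) with (RtoC ((-1) ^ i)). ring.
    clear. induction i.
    - simpl. rewrite Rmult_0_r. symmetry; apply cis_0.
    - rewrite S_INR, Rmult_plus_distr_l, cis_plus, <- IHi. simpl pow. rewrite Rmult_1_r, RtoC_mult.
      replace (cis PI) with (RtoC (-1)). ring.
      unfold cis, Cexp; simpl. rewrite exp_0, cos_PI, sin_PI. apply injective_projections; simpl; ring. }
  intros s N Hs Ht. destruct (Rle_dec 0 (Im s)) as [HI|HI].
  - assert (Ec : Cconj (Csum (eta_term s) N) = Csum (eta_term (Cconj s)) N).
    { rewrite Csum_conj. apply Csum_ext. intros i _. unfold eta_term, cpow.
      rewrite Cmult_conj. f_equal. apply injective_projections; simpl; ring.
      rewrite Cexp_conj. f_equal. generalize (ln (INR (S i))). intros l.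
      apply injective_projections; simpl; ring. }
    rewrite <- Cmod_conj, Ec. rewrite (Rabs_pos_eq (Im s)) in * by auto.
    replace (Im s) with (- Im (Cconj s)) at 1 by (unfold Im, Cconj; simpl; ring). apply Neg. exact Hs.
    unfold Im, Cconj in *; simpl. lra.
  - rewrite Rabs_left in * by lra. apply Neg; auto.
Qed.

(** * Dirichlet series of d_k *)

Fixpoint lsumC {A : Type} (F : A -> C) (T : list A) : C :=
  match T with nil => RtoC 0 | l :: T => Cplus (F l) (lsumC F T) end.
Fixpoint lsumR {A : Type} (F : A -> R) (T : list A) : R :=
  match T with nil => 0 | l :: T => F l + lsumR F T end.
Definition prodl (l : list nat) : nat := fold_right Nat.mul 1%nat l.

Lemma lsumC_app {A} (F : A -> C) S T : lsumC F (S ++ T) = Cplus (lsumC F S) (lsumC F T).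
Proof. induction S; simpl. ring. rewrite IHS. ring. Qed.
Lemma lsumR_app {A} (F : A -> R) S T : lsumR F (S ++ T) = lsumR F S + lsumR F T.
Proof. induction S; simpl. ring. rewrite IHS. ring. Qed.
Lemma lsumC_map {A B} (F : B -> C) (g : A -> B) T : lsumC F (map g T) = lsumC (fun a => F (g a)) T.
Proof. induction T; simpl; auto. now rewrite IHT. Qed.
Lemma lsumR_map {A B} (F : B -> R) (g : A -> B) T : lsumR F (map g T) = lsumR (fun a => F (g a)) T.
Proof. induction T; simpl; auto. now rewrite IHT. Qed.
Lemma lsumC_ext {A} (F G : A -> C) T : (forall a, In a T -> F a = G a) -> lsumC F T = lsumC G T.
Proof. induction T; simpl; intros H; auto. rewrite H, IHT; auto. Qed.
Lemma lsumR_le {A} (F G : A -> R) T : (forall a, In a T -> F a <= G a) -> lsumR F T <= lsumR G T.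
Proof. induction T; simpl; intros H. lra. assert (X := H a (or_introl eq_refl)). assert (Y := IHT (fun b Hb => H b (or_intror Hb))). lra. Qed.
Lemma lsumR_pos {A} (F : A -> R) T : (forall a, In a T -> 0 <= F a) -> 0 <= lsumR F T.
Proof. induction T; simpl; intros H. lra. assert (X := H a (or_introl eq_refl)). assert (Y := IHT (fun b Hb => H b (or_intror Hb))). lra. Qed.
Lemma lsumC_scal {A} c (F : A -> C) T : lsumC (fun a => Cmult c (F a)) T = Cmult c (lsumC F T).
Proof. induction T; simpl. ring. rewrite IHT. ring. Qed.
Lemma lsumC_minus {A} (F G : A -> C) T : lsumC (fun a => Cminus (F a) (G a)) T = Cminus (lsumC F T) (lsumC G T).
Proof. induction T; simpl. ring. rewrite IHT. ring. Qed.
Lemma lsumC_Cmod {A} (F : A -> C) T : Cmod (lsumC F T) <= lsumR (fun a => Cmod (F a)) T.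
Proof. induction T; simpl. rewrite Cmod_0; lra. eapply Rle_trans; [apply Cmod_triangle|]. lra. Qed.
Lemma lsumC_RtoC {A} (F : A -> R) T : lsumC (fun a => RtoC (F a)) T = RtoC (lsumR F T).
Proof. induction T; simpl; auto. rewrite IHT, RtoC_plus. reflexivity. Qed.
Lemma lsumR_minus {A} (F G : A -> R) T : lsumR (fun a => F a - G a) T = lsumR F T - lsumR G T.
Proof. induction T; simpl. ring. rewrite IHT. ring. Qed.
Lemma lsumC_flat_map {A B} (F : B -> C) (g : A -> list B) T : lsumC F (flat_map g T) = lsumC (fun a => lsumC F (g a)) T.
Proof. induction T; simpl; auto. rewrite lsumC_app, IHT. reflexivity. Qed.
Lemma lsumR_flat_map {A B} (F : B -> R) (g : A -> list B) T : lsumR F (flat_map g T) = lsumR (fun a => lsumR F (g a)) T.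
Proof. induction T; simpl; auto. rewrite lsumR_app, IHT. reflexivity. Qed.
Lemma lsumC_seq (F : nat -> C) N : lsumC F (seq 1 N) = Csum (fun i => F (S i)) N.
Proof.
  induction N; auto. rewrite seq_S, lsumC_app, IHN. simpl. ring.
Qed.

Lemma tuples_pos k N l : In l (tuples k (seq 1 N)) -> (1 <= prodl l)%nat.
Proof.
  revert l; induction k; intros l; simpl.
  - intros [<-|[]]. simpl. lia.
  - intros H. apply in_flat_map in H. destruct H as [a [Ha H]]. apply in_seq in Ha.
    apply in_map_iff in H. destruct H as [l' [<- H]]. specialize (IHk l' H). change (1 <= a * prodl l')%nat. nia.
Qed.

Lemma tuples_bound k N l : In l (tuples k (seq 1 N)) -> (prodl l <= N ^ k)%nat.
Proof.
  revert l; induction k; intros l; simpl.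
  - intros [<-|[]]. simpl. lia.
  - intros H. apply in_flat_map in H. destruct H as [a [Ha H]]. apply in_seq in Ha.
    apply in_map_iff in H. destruct H as [l' [<- H]]. specialize (IHk l' H).
    change (a * prodl l' <= N * N ^ k)%nat. apply Nat.mul_le_mono; lia.
Qed.

Lemma zeta_psum_pow k N s : Cpown (zeta_psum N s) k = lsumC (fun l => cpow (INR (prodl l)) (Copp s)) (tuples k (seq 1 N)).
Proof.
  induction k.
  - simpl. rewrite cpow_1_l. ring.
  - simpl tuples. rewrite lsumC_flat_map.
    rewrite (lsumC_ext _ (fun a => Cmult (Cpown (zeta_psum N s) k) (cpow (INR a) (Copp s)))).
    + rewrite lsumC_scal, (lsumC_seq (fun a => cpow (INR a) (Copp s))). apply Cmult_comm.
    + intros a Ha. apply in_seq in Ha. rewrite lsumC_map, IHk, Cmult_comm, <- lsumC_scal.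
      apply lsumC_ext. intros l Hl. assert (P := tuples_pos k N l Hl).
      change (prodl (a :: l)) with (a * prodl l)%nat. rewrite mult_INR. apply cpow_mult; apply lt_0_INR; lia.
Qed.

Lemma tuples_mono k M N (f : list nat -> R) : (M <= N)%nat -> (forall l, 0 <= f l) ->
  lsumR f (tuples k (seq 1 M)) <= lsumR f (tuples k (seq 1 N)).
Proof.
  intros HMN. revert f. induction k; intros f Hf. simpl; lra.
  simpl. rewrite !lsumR_flat_map.
  set (g := fun a => lsumR f (map (cons a) (tuples k (seq 1 N)))).
  assert (E : seq 1 N = seq 1 M ++ seq (1 + M) (N - M)) by (rewrite <- seq_app; f_equal; lia).
  rewrite E, lsumR_app.
  assert (X : 0 <= lsumR g (seq (1 + M) (N - M))).
  { apply lsumR_pos. intros a _. apply lsumR_pos. intros; auto. }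
  assert (Y : lsumR (fun a => lsumR f (map (cons a) (tuples k (seq 1 M)))) (seq 1 M) <= lsumR g (seq 1 M)).
  { apply lsumR_le. intros a _. unfold g. rewrite !lsumR_map. apply IHk. auto. }
  lra.
Qed.

(** [dk] with the range of the entries decoupled from the product: [dk k n] is [cnt k (seq 1 n) n].
    The partial sums of the Dirichlet series need one range for all $n\le N$. *)
Definition cnt (k : nat) (L : list nat) (n : nat) : nat := length (filter (fun l => Nat.eqb (prodl l) n) (tuples k L)).

Lemma filter_prodl_mul a n T : (1 <= a)%nat ->
  length (filter (fun l => Nat.eqb (a * prodl l) n) T) =
  if Nat.eqb (n mod a) 0 then length (filter (fun l => Nat.eqb (prodl l) (n / a)) T) else O.
Proof.
  intros Ha. induction T as [|l T IH]. simpl. now destruct (Nat.eqb (n mod a) 0).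
  assert (E := Nat.div_mod_eq n a). assert (Ml := Nat.mod_upper_bound n a ltac:(lia)).
  cbn [filter]. destruct (Nat.eqb_spec (n mod a) 0) as [H|H].
  - destruct (Nat.eqb_spec (a * prodl l) n) as [H1|H1], (Nat.eqb_spec (prodl l) (n / a)) as [H2|H2]; simpl; auto.
    + exfalso. apply H2. nia.
    + exfalso. apply H1. rewrite H2. lia.
  - destruct (Nat.eqb_spec (a * prodl l) n) as [H1|H1]; simpl; auto.
    exfalso. apply H. rewrite <- H1, Nat.mul_comm. apply Nat.Div0.mod_mul.
Qed.

Lemma filter_length_flat (p : list nat -> bool) (T : list (list nat)) (L : list nat) :
  length (filter p (flat_map (fun a => map (cons a) T) L)) = list_sum (map (fun a => length (filter (fun l => p (a :: l)) T)) L).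
Proof.
  induction L as [|a L IH]; auto. simpl. rewrite filter_app, length_app, IH. f_equal.
  clear. induction T; auto. simpl. destruct (p (a :: a0)); simpl; auto.
Qed.

(** The entries of a tuple with product $n\ge1$ divide $n$, so none exceeds it. In the induction on
    the length, only first entries dividing $n$ count, and they leave the product $n/a\le n$ to the
    other entries. *)
Lemma cnt_stable k n p : (1 <= n <= p)%nat -> cnt k (seq 1 p) n = cnt k (seq 1 n) n.
Proof.
  revert n p; induction k; intros n p Hn. reflexivity.
  set (g := fun a => if Nat.eqb (n mod a) 0 then cnt k (seq 1 (n / a)) (n / a) else O).
  assert (G : forall q, (n <= q)%nat -> cnt (S k) (seq 1 q) n = list_sum (map g (seq 1 n))).
  { intros q Hq. unfold cnt at 1. simpl tuples. rewrite filter_length_flat.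
    rewrite (map_ext_in _ g).
    - replace q with (n + (q - n))%nat by lia. rewrite seq_app, map_app, list_sum_app.
      rewrite (map_ext_in g (fun _ => O) (seq (1 + n) (q - n))).
      + assert (Z : forall L : list nat, list_sum (map (fun _ => O) L) = O) by (induction L; auto). rewrite Z. lia.
      + intros a Ha. apply in_seq in Ha. unfold g. rewrite Nat.mod_small by lia.
        destruct (Nat.eqb_spec n 0); auto; lia.
    - intros a Ha. apply in_seq in Ha. change (fun l => Nat.eqb (prodl (a :: l)) n) with (fun l => Nat.eqb (a * prodl l) n).
      rewrite filter_prodl_mul by lia. unfold g. destruct (Nat.eqb_spec (n mod a) 0) as [H|H]; auto.
      fold (cnt k (seq 1 q) (n / a)). apply IHk.
      assert (E := Nat.div_mod_eq n a). split. nia. assert (n / a <= n)%nat by (apply Nat.Div0.div_le_upper_bound; nia). lia. }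
  rewrite (G p), (G n); auto; lia.
Qed.

(** The tuples are grouped by their product. The left-hand index starts at the product 1, which
    positivity of the products justifies. *)
Lemma cnt_sum (F : nat -> C) N (T : list (list nat)) : (forall l, In l T -> (1 <= prodl l)%nat) ->
  Csum (fun i => Cmult (RtoC (INR (length (filter (fun l => Nat.eqb (prodl l) (S i)) T)))) (F (S i))) N =
  lsumC (fun l => if (prodl l <=? N)%nat then F (prodl l) else RtoC 0) T.
Proof.
  induction T as [|l T IH]; intros H.
  - simpl. apply Csum_0. intros; simpl. ring.
  - simpl lsumC. rewrite <- IH by (intros; apply H; now right). clear IH.
    assert (P := H l (or_introl eq_refl)). clear H.
    rewrite <- (Csum_ext (fun i => Cplus (if Nat.eqb (prodl l) (S i) then F (S i) else RtoC 0)
       (Cmult (RtoC (INR (length (filter (fun l => Nat.eqb (prodl l) (S i)) T)))) (F (S i))))).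
    + rewrite Csum_plus. f_equal.
      induction N; simpl. destruct (Nat.leb_spec (prodl l) 0); auto; lia.
      rewrite IHN. destruct (Nat.leb_spec (prodl l) N), (Nat.leb_spec (prodl l) (S N)), (Nat.eqb_spec (prodl l) (S N)); try lia; try ring.
      rewrite e. ring.
    + intros i _. cbn [filter]. destruct (Nat.eqb (prodl l) (S i)); cbn [length].
      rewrite S_INR, RtoC_plus. ring. ring.
Qed.

Definition dk_psum (k N : nat) (s : C) : C := Csum (fun i => Cmult (RtoC (INR (dk k (S i)))) (cpow (INR (S i)) (Copp s))) N.

Lemma dk_psum_tuples k N s : dk_psum k N s =
  lsumC (fun l => if (prodl l <=? N)%nat then cpow (INR (prodl l)) (Copp s) else RtoC 0) (tuples k (seq 1 N)).
Proof.
  unfold dk_psum. rewrite <- (cnt_sum (fun n => cpow (INR n) (Copp s))) by apply tuples_pos.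
  apply Csum_ext. intros i Hi. do 3 f_equal. symmetry. apply (cnt_stable k (S i) N). lia.
Qed.

Definition zeta_real_psum (N : nat) (c : R) : R := Rsum (fun i => exp (- c * ln (INR (S i)))) N.

Lemma cpow_real n c : cpow (INR n) (Copp (RtoC c)) = RtoC (exp (- c * ln (INR n))).
Proof.
  unfold cpow. rewrite <- RtoC_opp, <- RtoC_mult. unfold Cexp; simpl. rewrite cos_0, sin_0.
  apply injective_projections; simpl; ring.
Qed.

Lemma zeta_psum_real N c : zeta_psum N (RtoC c) = RtoC (zeta_real_psum N c).
Proof. unfold zeta_psum, zeta_real_psum. rewrite <- Csum_RtoC. apply Csum_ext. intros; apply cpow_real. Qed.

Lemma Cpown_RtoC x k : Cpown (RtoC x) k = RtoC (x ^ k).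
Proof. induction k; simpl; auto. rewrite IHk, RtoC_mult. reflexivity. Qed.

Lemma zeta_real_psum_pow k N c : zeta_real_psum N c ^ k = lsumR (fun l => exp (- c * ln (INR (prodl l)))) (tuples k (seq 1 N)).
Proof.
  assert (X := zeta_psum_pow k N (RtoC c)). rewrite zeta_psum_real, Cpown_RtoC in X.
  rewrite (lsumC_ext _ (fun l => RtoC (exp (- c * ln (INR (prodl l)))))) in X by (intros; apply cpow_real).
  rewrite lsumC_RtoC in X. now injection X.
Qed.

(** The difference is the sum over tuples with entries at most $N$ and product above $N$. Tuples
    with entries at most $M$ have product at most $M^k\le N$ and are not among them; the rest is
    bounded by absolute values, that is, at the real point $\mathrm{Re}\,s$. *)
Lemma dk_psum_dist k M N s : (M <= N)%nat -> (M ^ k <= N)%nat ->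
  Cmod (Cminus (Cpown (zeta_psum N s) k) (dk_psum k N s)) <= zeta_real_psum N (Re s) ^ k - zeta_real_psum M (Re s) ^ k.
Proof.
  intros H1 H2. rewrite zeta_psum_pow, dk_psum_tuples, <- lsumC_minus.
  eapply Rle_trans; [apply lsumC_Cmod|].
  set (f := fun l => if (prodl l <=? N)%nat then exp (- Re s * ln (INR (prodl l))) else 0).
  apply Rle_trans with (lsumR (fun l => exp (- Re s * ln (INR (prodl l))) - f l) (tuples k (seq 1 N))).
  - apply lsumR_le. intros l _. unfold f. destruct (prodl l <=? N)%nat.
    + replace (Cminus _ _) with (RtoC 0) by ring. rewrite Cmod_0. lra.
    + replace (Cminus _ _) with (cpow (INR (prodl l)) (Copp s)) by ring. rewrite Cmod_cpow. unfold Re; simpl. lra.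
  - rewrite lsumR_minus, <- zeta_real_psum_pow. apply Rplus_le_compat_l, Ropp_le_contravar.
    assert (Pf : forall l, 0 <= f l). { intros l; unfold f. destruct (prodl l <=? N)%nat. left; apply exp_pos. lra. }
    eapply Rle_trans; [|apply (tuples_mono k M N f H1 Pf)].
    rewrite zeta_real_psum_pow. apply lsumR_le. intros l Hl. unfold f. assert (B := tuples_bound k M l Hl).
    destruct (Nat.leb_spec (prodl l) N). lra. lia.
Qed.

Lemma zeta_psum_conv s : 1 < Re s <= 3 -> conv (fun N => zeta_psum N s) (zeta0 s).
Proof.
  intros Hs. assert (N1 : s <> RtoC 1) by (intros ->; simpl in Hs; lra).
  apply (conv_ext (fun N => Cplus (zeta_em N s) (Cmult (Cinv (Cminus (RtoC 1) s)) (cpow (INR N) (Cminus (RtoC 1) s))))).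
  { intros N. unfold zeta_em. ring. }
  replace (zeta0 s) with (Cplus (zeta0 s) (Cmult (Cinv (Cminus (RtoC 1) s)) (RtoC 0))) by ring.
  apply conv_plus. apply zeta_em_conv; auto; lra. apply conv_scal.
  intros e He. destruct (pow_small (Re s - 1) e) as [N0 [H0 H]]; auto. lra. exists N0. intros n Hn.
  replace (Cminus (cpow (INR n) (Cminus (RtoC 1) s)) (RtoC 0)) with (cpow (INR n) (Cminus (RtoC 1) s)) by ring.
  rewrite Cmod_cpow. replace (Re (Cminus (RtoC 1) s)) with (- (Re s - 1)) by (unfold Re; simpl; ring). auto.
Qed.

Lemma zeta_real_psum_mono M N c : (M <= N)%nat -> zeta_real_psum M c <= zeta_real_psum N c.
Proof.
  intros H. unfold zeta_real_psum. replace N with (M + (N - M))%nat by lia. rewrite Rsum_app.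
  assert (X : 0 <= Rsum (fun i => exp (- c * ln (INR (S (M + i))))) (N - M)) by (apply Rsum_pos; intros; left; apply exp_pos). lra.
Qed.
Lemma zeta_real_psum_pos N c : 0 <= zeta_real_psum N c.
Proof. apply Rsum_pos; intros; left; apply exp_pos. Qed.

Lemma zeta_psum_dist M N s : (M <= N)%nat -> Cmod (Cminus (zeta_psum N s) (zeta_psum M s)) <= zeta_real_psum N (Re s) - zeta_real_psum M (Re s).
Proof.
  intros H. unfold zeta_psum, zeta_real_psum. replace N with (M + (N - M))%nat by lia. rewrite Csum_app, Rsum_app.
  replace (Cminus _ _) with (Csum (fun i => cpow (INR (S (M + i))) (Copp s)) (N - M)) by ring.
  eapply Rle_trans; [apply Csum_Cmod|]. right. ring_simplify. apply Rsum_ext. intros i _. rewrite Cmod_cpow. reflexivity.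
Qed.

(** All tails are majorised by tails of the same series at the real point [c], so the rate is
    independent of $\mathrm{Im}\,s$. This uniformity permits summation under the integral over the
    vertical line. *)
Lemma dirichlet_unif k c e : 1 < c <= 3 -> 0 < e -> exists N0 : nat, forall N s, (N0 <= N)%nat -> Re s = c ->
  Cmod (Cminus (dk_psum k N s) (Cpown (zeta0 s) k)) <= e.
Proof.
  intros Hc He.
  assert (Cv := zeta_psum_conv (RtoC c) ltac:(simpl; lra)).
  assert (B : exists B, 0 <= B /\ forall N, zeta_real_psum N c <= B).
  { destruct (Cv 1 Rlt_0_1) as [N1 HN1]. exists (Cmod (zeta0 (RtoC c)) + 1).
    assert (P := Cmod_ge_0 (zeta0 (RtoC c))). split. lra. intros N.
    apply Rle_trans with (zeta_real_psum (max N N1) c). apply zeta_real_psum_mono; lia.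
    specialize (HN1 (max N N1) ltac:(lia)). rewrite zeta_psum_real in HN1.
    rewrite <- (Rabs_pos_eq (zeta_real_psum (max N N1) c)) by apply zeta_real_psum_pos. rewrite <- Cmod_R.
    replace (RtoC (zeta_real_psum (Nat.max N N1) c)) with (Cplus (Cminus (RtoC (zeta_real_psum (Nat.max N N1) c)) (zeta0 (RtoC c))) (zeta0 (RtoC c))) by ring.
    eapply Rle_trans; [apply Cmod_triangle|]. lra. }
  destruct B as [B [HB0 HB]].
  destruct (Cpown_diff k B HB0) as [L [HL0 HL]].
  set (d := e / (2 * (L + 1))). assert (Hd : 0 < d) by (apply Rdiv_lt_0_compat; lra).
  assert (Ld : L * d <= e / 2). { apply Rle_trans with ((L + 1) * d). nra. unfold d. right; field; lra. }
  destruct (Cv (d / 2)) as [M HM]. lra.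
  assert (RM : forall N, (M <= N)%nat -> zeta_real_psum N c - zeta_real_psum M c <= d).
  { intros N HN. assert (X := HM N HN). assert (Y := HM M (le_n _)). rewrite zeta_psum_real in X, Y.
    assert (Z := Cmod_minus_triangle (RtoC (zeta_real_psum N c)) (zeta0 (RtoC c)) (RtoC (zeta_real_psum M c))).
    rewrite (Cmod_minus_sym (zeta0 _)) in Z. rewrite <- RtoC_minus, Cmod_R in Z.
    assert (W := Rle_abs (zeta_real_psum N c - zeta_real_psum M c)). lra. }
  assert (SB : forall N s, Re s = c -> Cmod (zeta_psum N s) <= B).
  { intros N s Hs. eapply Rle_trans; [|apply (HB N)]. unfold zeta_psum, zeta_real_psum. eapply Rle_trans; [apply Csum_Cmod|].
    right. apply Rsum_ext. intros i _. rewrite Cmod_cpow, <- Hs. reflexivity. }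
  exists (M + M ^ k)%nat. intros N s HN Hs.
  assert (Zb : Cmod (zeta0 s) <= B).
  { apply (conv_bound (fun N => zeta_psum N s)). apply zeta_psum_conv; lra. intros; auto. }
  assert (D1 : Cmod (Cminus (zeta_psum N s) (zeta0 s)) <= d).
  { replace (Cminus (zeta_psum N s) (zeta0 s)) with (Copp (Cminus (zeta0 s) (zeta_psum N s))) by ring. rewrite Cmod_opp.
    apply (conv_bound (fun n => Cminus (zeta_psum (N + n) s) (zeta_psum N s))).
    - intros e' He'. destruct (zeta_psum_conv s ltac:(lra) e' He') as [N2 H2]. exists N2. intros n Hn.
      replace (Cminus _ _) with (Cminus (zeta_psum (N + n) s) (zeta0 s)) by ring. apply H2; lia.
    - intros n. eapply Rle_trans; [apply zeta_psum_dist; lia|]. rewrite Hs.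
      assert (X := RM (N + n)%nat ltac:(lia)). assert (Y := zeta_real_psum_mono M N c ltac:(lia)). lra. }
  assert (D2 : Cmod (Cminus (Cpown (zeta_psum N s) k) (dk_psum k N s)) <= L * d).
  { eapply Rle_trans; [apply (dk_psum_dist k M N); lia|]. rewrite Hs.
    apply Rle_trans with (Cmod (Cminus (Cpown (RtoC (zeta_real_psum N c)) k) (Cpown (RtoC (zeta_real_psum M c)) k))).
    - rewrite !Cpown_RtoC, <- RtoC_minus, Cmod_R. apply Rle_abs.
    - eapply Rle_trans; [apply HL; rewrite Cmod_R, Rabs_pos_eq by apply zeta_real_psum_pos; apply HB|].
      rewrite <- RtoC_minus, Cmod_R, Rabs_pos_eq. apply Rmult_le_compat_l; auto. apply RM; lia.
      assert (Y := zeta_real_psum_mono M N c ltac:(lia)). lra. }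
  eapply Rle_trans; [apply (Cmod_minus_triangle _ (Cpown (zeta_psum N s) k))|].
  rewrite Cmod_minus_sym.
  assert (D3 := HL _ _ (SB N s Hs) Zb). assert (L * Cmod (Cminus (zeta_psum N s) (zeta0 s)) <= L * d) by (apply Rmult_le_compat_l; auto).
  lra.
Qed.

(** * Shifting the line of integration *)

(** The factor $1-2^{1-s}$ stays on the left, since it has zeros on $\mathrm{Re}\,s=1$; each
    application supplies its own lower bound for it. *)
Lemma zeta0_growth c0 : 0 < c0 < 1 -> exists C, 0 < C /\ forall s, c0 <= Re s <= 3 -> 1 <= Rabs (Im s) ->
  Cmod (Cminus (RtoC 1) (cpow 2 (Cminus (RtoC 1) s))) * Cmod (zeta0 s) <= C * exp ((1 / 2 - c0 / 8) * ln (Rabs (Im s))).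
Proof.
  intros Hc. destruct (eta_partial_bound c0 Hc) as [C [HC H]]. exists C; split; auto.
  intros s Hs Ht. rewrite <- Cmod_mult. apply (conv_bound (Csum (eta_term s))).
  - apply eta_conv. lra. intros ->. simpl in Ht. rewrite Rabs_R0 in Ht. lra.
  - intros n. apply H; auto. lra.
Qed.

Lemma Rabs_pow_exp t m : 0 < Rabs t -> Rabs t ^ m = exp (INR m * ln (Rabs t)).
Proof. intros H. rewrite <- Rpower_pow by auto. reflexivity. Qed.

(** The exponent of $|\mathrm{Im}\,s|$ is at most $k(1/2-c_0/8)-m\le-1-kc_0/8\le-1-c_0/8$. Here [d]
    bounds $|1-2^{1-s}|$ from below at the point considered. *)
Lemma zeta_pow_mellin_decay alpha m G k c0 e : mellin_data alpha m G -> alpha <= 2 -> (1 <= k)%nat -> 1 + INR k / 2 <= INR m ->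
  0 < c0 < 1 -> 0 < e <= c0 -> exists K, 0 <= K /\ forall s d, c0 <= Re s <= alpha - e -> 1 <= Rabs (Im s) ->
  0 < d <= 1 -> d <= Cmod (Cminus (RtoC 1) (cpow 2 (Cminus (RtoC 1) s))) ->
  Cmod (Cmult (Cpown (zeta0 s) k) (mellin (G O) s)) <= K / d ^ k * exp (- (1 + c0 / 8) * ln (Rabs (Im s))).
Proof.
  intros HG Hal Hk Hm Hc He.
  destruct (zeta0_growth c0 Hc) as [C [HC HV]].
  destruct (mellin_decay alpha m G e HG ltac:(lra)) as [B [HB HD]].
  exists (C ^ k * B). assert (PC := pow_le C k ltac:(lra)). split. nra.
  intros s d Hs Ht Hd Hd'. set (t := Rabs (Im s)) in *.
  assert (Lt : 0 <= ln t) by (rewrite <- ln_1; apply ln_le; lra).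
  destruct (HD s ltac:(lra)) as [_ D2]. fold t in D2.
  unfold t in D2 at 1. rewrite Rabs_pow_exp in D2 by (fold t; lra). fold t in D2.
  specialize (HV s ltac:(lra) Ht). fold t in HV.
  set (q := (1 / 2 - c0 / 8) * ln t) in *.
  assert (Zb : Cmod (zeta0 s) <= C / d * exp q).
  { replace (C / d * exp q) with (C * exp q * / d) by (field; lra). apply le_mult_inv. lra.
    eapply Rle_trans; [|exact HV]. rewrite Rmult_comm. apply Rmult_le_compat_r; auto. apply Cmod_ge_0. }
  assert (Zk := Cpown_bound _ _ k Zb).
  assert (Fb : Cmod (mellin (G O) s) <= B * exp (- (INR m * ln t))).
  { rewrite exp_Ropp. apply le_mult_inv. apply exp_pos. auto. }
  rewrite Cmod_mult.
  apply Rle_trans with ((C / d * exp q) ^ k * (B * exp (- (INR m * ln t)))).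
  - apply Rmult_le_compat; auto; apply Cmod_ge_0.
  - rewrite Rpow_mult_distr. replace (exp q ^ k) with (exp (INR k * q)).
    2:{ rewrite <- Rpower_pow by apply exp_pos. unfold Rpower. rewrite ln_exp. reflexivity. }
    replace ((C / d) ^ k) with (C ^ k / d ^ k) by (unfold Rdiv; rewrite Rpow_mult_distr, pow_inv; reflexivity).
    replace (C ^ k / d ^ k * exp (INR k * q) * (B * exp (- (INR m * ln t))))
     with (C ^ k * B / d ^ k * (exp (INR k * q) * exp (- (INR m * ln t)))) by (unfold Rdiv; ring).
    rewrite <- exp_plus. apply Rmult_le_compat_l.
    + apply Rdiv_le_0_compat. nra. apply pow_lt; lra.
    + apply exp_le_mono. unfold q.
      assert (K1 : 1 <= INR k) by (apply (le_INR 1); auto).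
      replace (INR k * ((1 / 2 - c0 / 8) * ln t) + - (INR m * ln t)) with ((INR k / 2 - INR k * (c0 / 8) - INR m) * ln t) by field.
      apply Rmult_le_compat_r; auto. assert (c0 / 8 <= INR k * (c0 / 8)) by nra. lra.
Qed.

Lemma two_pow_line c : c <> 1 -> exists d, 0 < d <= 1 /\ forall t, d <= Cmod (Cminus (RtoC 1) (cpow 2 (Cminus (RtoC 1) (c, t)))).
Proof.
  intros Hc. set (q := exp ((1 - c) * ln 2)).
  assert (L2 : 0 < ln 2) by (rewrite <- ln_1; apply ln_increasing; lra).
  assert (Q : q <> 1).
  { unfold q. intros E. apply (f_equal ln) in E. rewrite ln_exp, ln_1 in E.
    destruct (Rmult_integral _ _ E); lra. }
  exists (Rmin 1 (Rabs (1 - q))). assert (P : 0 < Rabs (1 - q)) by (apply Rabs_pos_lt; lra).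
  split. split. apply Rmin_pos; lra. apply Rmin_l.
  intros t. eapply Rle_trans; [apply Rmin_r|].
  assert (E : Cmod (cpow 2 (Cminus (RtoC 1) (c, t))) = q) by (rewrite Cmod_cpow; reflexivity).
  set (z := cpow 2 (Cminus (RtoC 1) (c, t))) in *.
  apply Rabs_le. assert (X := Cmod_triangle (Cminus (RtoC 1) z) z). replace (Cplus (Cminus (RtoC 1) z) z) with (RtoC 1) in X by ring.
  assert (Y := Cmod_minus_triangle z (RtoC 1) (RtoC 0)). replace (Cminus z (RtoC 0)) with z in Y by ring.
  replace (Cminus (RtoC 1) (RtoC 0)) with (RtoC 1) in Y by ring. rewrite (Cmod_minus_sym z) in Y.
  rewrite Cmod_1 in X, Y. lra.
Qed.

(* On these heights [2^(1-s)] is a negative real number. *)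
Definition height (l : nat) : R := PI * (2 * INR l + 1) / ln 2.

Lemma two_pow_height l x (sg : bool) :
  1 <= Cmod (Cminus (RtoC 1) (cpow 2 (Cminus (RtoC 1) (x, if sg then height l else - height l)))).
Proof.
  assert (L2 : 0 < ln 2) by (rewrite <- ln_1; apply ln_increasing; lra).
  assert (E : cpow 2 (Cminus (RtoC 1) (x, if sg then height l else - height l)) = RtoC (- exp ((1 - x) * ln 2))).
  { unfold cpow. rewrite Cexp_split.
    replace (Re (Cmult (Cminus (RtoC 1) (x, if sg then height l else - height l)) (RtoC (ln 2)))) with ((1 - x) * ln 2) by (unfold Re; simpl; ring).
    assert (S0 : sin (PI * (2 * INR l + 1)) = 0).
    { replace (PI * (2 * INR l + 1)) with (PI + 2 * INR l * PI) by ring. rewrite sin_period. apply sin_PI. }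
    assert (C0 : cos (PI * (2 * INR l + 1)) = -1).
    { replace (PI * (2 * INR l + 1)) with (PI + 2 * INR l * PI) by ring. rewrite cos_period. apply cos_PI. }
    assert (I : cis (Im (Cmult (Cminus (RtoC 1) (x, if sg then height l else - height l)) (RtoC (ln 2)))) = RtoC (-1)).
    { destruct sg.
      - replace (Im _) with (- (PI * (2 * INR l + 1))).
        unfold cis, Cexp; simpl. rewrite exp_0, cos_neg, sin_neg, S0, C0. apply injective_projections; simpl; ring.
        unfold Im, height; simpl. field. lra.
      - replace (Im _) with (PI * (2 * INR l + 1)).
        unfold cis, Cexp; simpl. rewrite exp_0, S0, C0. apply injective_projections; simpl; ring.
        unfold Im, height; simpl. field. lra. }
    rewrite I, <- RtoC_mult. f_equal. ring. }
  rewrite E, <- RtoC_minus, Cmod_R. assert (X := exp_pos ((1 - x) * ln 2)). rewrite Rabs_pos_eq; lra.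
Qed.

Lemma height_large T : exists l, T <= height l /\ 1 <= height l.
Proof.
  destruct (nat_above (Rabs T + 1)) as [l Hl]. specialize (Hl l (le_n _)). exists l.
  assert (L2 : 0 < ln 2) by (rewrite <- ln_1; apply ln_increasing; lra).
  assert (L2' : ln 2 <= 1) by (assert (X := ln_le_sub1 2); lra).
  assert (PP := PI2_3_2). assert (RT := Rle_abs T). assert (RT0 := Rabs_pos T).
  assert (INR l <= height l). { unfold height. apply Rle_div_r; auto. nra. }
  lra.
Qed.

Lemma Phi_line_dominated alpha m G k c : mellin_data alpha m G -> alpha <= 2 -> (1 <= k)%nat -> 1 + INR k / 2 <= INR m ->
  0 < c < alpha -> c <> 1 -> exists w, good_weight w /\ dominated (fun t => Cmult (Cpown (zeta0 (c, t)) k) (mellin (G O) (c, t))) w.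
Proof.
  intros HG Hal Hk Hm Hc H1.
  set (c0 := Rmin (c / 2) (Rmin (1 / 2) (alpha - c))).
  assert (Hc0 : 0 < c0) by (repeat apply Rmin_pos; lra).
  assert (c1 : c0 <= c / 2) by apply Rmin_l. assert (c2 : c0 <= 1 / 2) by (eapply Rle_trans; [apply Rmin_r|apply Rmin_l]).
  assert (c3 : c0 <= alpha - c) by (eapply Rle_trans; [apply Rmin_r|apply Rmin_r]).
  destruct (zeta_pow_mellin_decay alpha m G k c0 c0 HG Hal Hk Hm ltac:(lra) ltac:(lra)) as [K [HK HD]].
  destruct (two_pow_line c H1) as [d [Hd Hd']].
  set (F := fun t => Cmult (Cpown (zeta0 (c, t)) k) (mellin (G O) (c, t))).
  assert (CF : contR F).
  { intros t. unfold F.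
    assert (A : continuous (fun t => zeta0 (c, t)) t).
    { apply (continuous_comp (fun t => (c, t) : C) zeta0). cont. apply zeta0_continuous. simpl; lra. intros E; injection E; lra. }
    assert (B : continuous (fun t => mellin (G O) (c, t)) t).
    { apply (continuous_comp (fun t => (c, t) : C) (mellin (G O))). cont. apply mellin_continuous with alpha m; auto. }
    cont. }
  destruct (contI_bounded F (-1) 1 ltac:(lra) (contR_I _ _ _ CF)) as [M [HM0 HM]].
  set (p := c0 / 8). set (w := fun t => exp (- (1 + p) * ln (1 + Rabs t))).
  assert (L2 : 0 < ln 2) by (rewrite <- ln_1; apply ln_increasing; lra).
  (* $Q=2^{1+p}$ pays for replacing $|t|$ by $1+|t|$ when $|t|\ge1$, and makes $Q\,w(t)\ge1$ when
     $|t|\le1$. *)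
  set (Q := exp ((1 + p) * ln 2)). assert (PQ : 0 < Q) by apply exp_pos.
  set (K' := K / d ^ k). assert (HK' : 0 <= K') by (apply Rdiv_le_0_compat; auto; apply pow_lt; lra).
  exists (fun t => (M + K') * Q * w t). split.
  - apply good_weight_scal. nra. apply good_weight_power. unfold p; lra.
  - split; auto. intros t. fold (F t).
    assert (Pt := Rabs_pos t). assert (Pw : 0 < w t) by apply exp_pos.
    destruct (Rle_dec 1 (Rabs t)) as [Ht|Ht].
    + apply Rle_trans with (K' * exp (- (1 + p) * ln (Rabs t))).
      * apply (HD (c, t) d); auto. simpl; lra.
      * apply Rle_trans with (K' * (Q * w t)).
        -- apply Rmult_le_compat_l; auto. unfold Q, w. rewrite <- exp_plus. apply exp_le_mono.
           assert (L : ln (1 + Rabs t) <= ln 2 + ln (Rabs t)). { rewrite <- ln_mult by lra. apply ln_le; lra. }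
           unfold p in *. nra.
        -- assert (0 <= M * (Q * w t)) by (apply Rmult_le_pos; nra). nra.
    + apply Rle_trans with M. apply HM. apply Rnot_le_lt in Ht. apply Rabs_def2 in Ht. lra.
      assert (1 <= Q * w t).
      { unfold Q, w. rewrite <- exp_plus. rewrite <- exp_0 at 1. apply exp_le_mono.
        assert (L : ln (1 + Rabs t) <= ln 2) by (apply ln_le; lra). unfold p; nra. }
      assert (0 <= K' * (Q * w t)) by (apply Rmult_le_pos; nra). nra.
Qed.

Lemma Phi_height alpha m G k x1 x2 e : mellin_data alpha m G -> alpha <= 2 -> (1 <= k)%nat -> 1 + INR k / 2 <= INR m ->
  0 < x1 -> x2 < alpha -> 0 < e -> exists T0, forall l x, T0 <= height l -> 1 <= height l -> x1 <= x <= x2 -> forall sg : bool,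
  Cmod (Cmult (Cpown (zeta0 (x, if sg then height l else - height l)) k) (mellin (G O) (x, if sg then height l else - height l))) <= e.
Proof.
  intros HG Hal Hk Hm H1 H2 He.
  set (c0 := Rmin x1 (Rmin (1 / 2) (alpha - x2))).
  assert (Hc0 : 0 < c0) by (repeat apply Rmin_pos; lra).
  assert (c1 : c0 <= x1) by apply Rmin_l. assert (c2 : c0 <= 1 / 2) by (eapply Rle_trans; [apply Rmin_r|apply Rmin_l]).
  assert (c3 : c0 <= alpha - x2) by (eapply Rle_trans; [apply Rmin_r|apply Rmin_r]).
  destruct (zeta_pow_mellin_decay alpha m G k c0 c0 HG Hal Hk Hm ltac:(lra) ltac:(lra)) as [K [HK HD]].
  exists (K / e). intros l x Hl Hl1 Hx sg.
  assert (A : Rabs (Im (x, if sg then height l else - height l)) = height l).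
  { unfold Im; simpl. destruct sg; [|rewrite Rabs_Ropp]; apply Rabs_pos_eq; lra. }
  assert (X := HD (x, if sg then height l else - height l) 1). rewrite A in X.
  eapply Rle_trans; [apply X; try lra|]. simpl; lra. apply two_pow_height.
  rewrite pow1. assert (L : 0 <= ln (height l)) by (rewrite <- ln_1; apply ln_le; lra).
  apply Rle_trans with (K * / height l).
  - replace (K / 1) with K by field. apply Rmult_le_compat_l; auto.
    rewrite <- (exp_ln (height l)) at 2 by lra. rewrite <- exp_Ropp. apply exp_le_mono. nra.
  - apply Rle_div_l. lra. apply Rle_trans with (e * (K / e)). right; field; lra. apply Rmult_le_compat_l; lra.
Qed.

Definition line_int (k : nat) (G0 : R -> C) (c y : R) : C := IntR (fun t => Phi k G0 y (c, t)).

Lemma Phi_split k G0 y s : Phi k G0 y s = Cmult (Cexp (Cmult s (RtoC (- y)))) (Cmult (Cpown (zeta0 s) k) (mellin G0 s)).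
Proof. unfold Phi. ring. Qed.

Lemma Cmod_Cexp_real s y : Cmod (Cexp (Cmult s (RtoC y))) = exp (Re s * y).
Proof. rewrite Cmod_Cexp. f_equal. unfold Re; simpl. ring. Qed.

Lemma dominated_scal_unit g w (u : R -> C) p : contR w -> 0 <= p -> dominated g w -> contR u -> (forall t, Cmod (u t) = p) -> dominated (fun t => Cmult (u t) (g t)) (fun t => p * w t).
Proof.
  intros Cw Hp [Cg Hg] Cu Hu. split.
  - intros t. specialize (Cg t). specialize (Cu t). cont.
  - intros t. rewrite Cmod_mult, Hu. now apply Rmult_le_compat_l.
Qed.

Section Assembly.
Variables (alpha : R) (k m : nat) (G : nat -> R -> C).
Hypothesis HG : mellin_data alpha m G.
Hypothesis Hal : 1 < alpha <= 2.
Hypothesis Hk : (1 <= k)%nat.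
Hypothesis Hm : 1 + INR k / 2 <= INR m.

Lemma Phi_dominated c : 0 < c < alpha -> c <> 1 -> exists w, good_weight w /\
  dominated (fun t => Cmult (Cpown (zeta0 (c, t)) k) (mellin (G O) (c, t))) w /\
  forall y, good_weight (fun t => exp (- c * y) * w t) /\ dominated (fun t => Phi k (G O) y (c, t)) (fun t => exp (- c * y) * w t).
Proof.
  intros Hc H1. destruct (Phi_line_dominated alpha m G k c HG (proj2 Hal) Hk Hm Hc H1) as [w [Gw Dw]].
  exists w. split; auto. split; auto. intros y. split. apply good_weight_scal; auto. left; apply exp_pos.
  assert (D : dominated (fun t => Cmult (Cexp (Cmult (c, t) (RtoC (- y)))) (Cmult (Cpown (zeta0 (c, t)) k) (mellin (G O) (c, t)))) (fun t => exp (- c * y) * w t)).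
  { apply dominated_scal_unit; auto. apply Gw. left; apply exp_pos. intros t; cont.
    intros t. rewrite Cmod_Cexp_real. f_equal. simpl. ring. }
  destruct D as [D1 D2]. split.
  - intros t. eapply continuous_ext; [|apply D1]. intros; symmetry; apply Phi_split.
  - intros t. rewrite Phi_split. apply D2.
Qed.

Lemma line_int_correct c y : 0 < c < alpha -> c <> 1 -> is_Int (fun t => Phi k (G O) y (c, t)) (line_int k (G O) c y).
Proof. intros Hc H1. destruct (Phi_dominated c Hc H1) as [w [_ [_ H]]]. destruct (H y). now apply Int_correct with (fun t => exp (- c * y) * w t). Qed.

(** Smallness is available only at the special heights. Arbitrarily large ones are enough: the
    vertical integrals converge, so their limits may be computed along any unbounded sequence of
    heights. *)
Lemma Hint_small x1 x2 y e : 0 < x1 -> x1 <= x2 -> x2 < alpha -> x2 < 3 -> 0 < e ->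
  forall T, exists T', T <= T' /\ 1 <= T' /\ Cmod (Hint (Phi k (G O) y) T' x1 x2) <= e /\ Cmod (Hint (Phi k (G O) y) (- T') x1 x2) <= e.
Proof.
  intros H1 H12 H2 H3 He T.
  (* Bound for $|e^{-sy}|$ on the segment, because $0<\mathrm{Re}\,s<\alpha\le2$. *)
  set (Q := exp (2 * Rabs y)). assert (PQ : 0 < Q) by apply exp_pos.
  assert (P : 0 < Q * (x2 - x1 + 1)) by nra.
  destruct (Phi_height alpha m G k x1 x2 (e / (Q * (x2 - x1 + 1))) HG (proj2 Hal) Hk Hm H1 H2) as [T0 HT0].
  now apply Rdiv_lt_0_compat.
  destruct (height_large (Rmax T T0)) as [l [Hl1 Hl2]].
  assert (q1 := Rmax_l T T0). assert (q2 := Rmax_r T T0).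
  assert (B : forall sg : bool, Cmod (Hint (Phi k (G O) y) (if sg then height l else - height l) x1 x2) <= e).
  { intros sg. unfold Hint.
    apply Rle_trans with ((x2 - x1) * (Q * (e / (Q * (x2 - x1 + 1))))).
    - apply CI_bound_const; auto.
      + apply (Phi_cont_path alpha m G k y (fun x => (x, if sg then height l else - height l))); auto.
        intros x _; cont. intros x Hx. simpl. split. lra. split. lra. intros E; injection E; destruct sg; lra.
      + intros x Hx. rewrite Phi_split, Cmod_mult, Cmod_Cexp_real. simpl Re.
        apply Rmult_le_compat; try apply Cmod_ge_0. left; apply exp_pos.
        * unfold Q. apply exp_le_mono. assert (X := Rle_abs (- y)). rewrite Rabs_Ropp in X. assert (X' := Rabs_pos y). nra.
        * apply HT0; auto. lra.
    - apply Rle_trans with ((x2 - x1 + 1) * (Q * (e / (Q * (x2 - x1 + 1))))).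
      apply Rmult_le_compat_r. apply Rmult_le_pos. lra. left; now apply Rdiv_lt_0_compat. lra.
      right; field; lra. }
  exists (height l). split. lra. split; auto. split; [apply (B true)|apply (B false)].
Qed.

Lemma line_int_circle a y : 0 < a < 1 -> a < alpha - 1 ->
  Cminus (line_int k (G O) (1 + a) y) (line_int k (G O) (1 - a) y) = Circ (Phi k (G O) y) a.
Proof.
  intros Ha Ha'. apply Cmod_small_eq. intros e He.
  destruct (line_int_correct (1 + a) y ltac:(lra) ltac:(lra) (e / 4)) as [T1 [HT1 X1]]. lra.
  destruct (line_int_correct (1 - a) y ltac:(lra) ltac:(lra) (e / 4)) as [T2 [HT2 X2]]. lra.
  destruct (Hint_small (1 - a) (1 + a) y (e / 4) ltac:(lra) ltac:(lra) ltac:(lra) ltac:(lra) ltac:(lra) (Rmax T1 T2)) as [T [HT [HT' [B1 B2]]]].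
  assert (q1 := Rmax_l T1 T2). assert (q2 := Rmax_r T1 T2).
  specialize (X1 (- T) T ltac:(lra) ltac:(lra)). specialize (X2 (- T) T ltac:(lra) ltac:(lra)).
  assert (E := Phi_line_circle alpha m G k y a T HG Hal Ha Ha' ltac:(lra)).
  fold (Vint (Phi k (G O) y) (1 + a) (- T) T) in X1. fold (Vint (Phi k (G O) y) (1 - a) (- T) T) in X2.
  set (V1 := Vint (Phi k (G O) y) (1 + a) (- T) T) in *. set (V2 := Vint (Phi k (G O) y) (1 - a) (- T) T) in *.
  set (H1 := Hint (Phi k (G O) y) T (1 - a) (1 + a)) in *. set (H2 := Hint (Phi k (G O) y) (- T) (1 - a) (1 + a)) in *.
  assert (E' : Cminus (Cminus V1 V2) (Circ (Phi k (G O) y) a) = Cmult (Copp Ci) (Cminus H1 H2)).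
  { assert (I2 : Cmult Ci Ci = RtoC (-1)) by (apply injective_projections; simpl; ring).
    transitivity (Cminus (Cmult (Copp Ci) (Cmult Ci (Cminus V1 V2))) (Cmult (Copp Ci) (Cmult Ci (Circ (Phi k (G O) y) a)))).
    - transitivity (Cmult (Copp (Cmult Ci Ci)) (Cminus (Cminus V1 V2) (Circ (Phi k (G O) y) a))). rewrite I2. replace (Copp (RtoC (-1))) with (RtoC 1) by (rewrite <- RtoC_opp; f_equal; ring). ring. ring.
    - rewrite E. ring. }
  replace (Cminus (Cminus (line_int k (G O) (1 + a) y) (line_int k (G O) (1 - a) y)) (Circ (Phi k (G O) y) a)) with
    (Cplus (Cminus (Cminus V2 (line_int k (G O) (1 - a) y)) (Cminus V1 (line_int k (G O) (1 + a) y))) (Cminus (Cminus V1 V2) (Circ (Phi k (G O) y) a))) by ring.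
  rewrite E'. eapply Rle_trans; [apply Cmod_triangle|]. rewrite Cmod_mult, Cmod_opp.
  assert (Mi : Cmod Ci = 1). { unfold Cmod, Ci; simpl. replace (0 * (0 * 1) + 1 * (1 * 1)) with 1 by ring. apply sqrt_1. }
  rewrite Mi. assert (Y1 := Cmod_minus_le (Cminus V2 (line_int k (G O) (1 - a) y)) (Cminus V1 (line_int k (G O) (1 + a) y))).
  assert (Y2 := Cmod_minus_le H1 H2). lra.
Qed.

Lemma line_int_const c1 c2 y : 0 < c1 -> c1 <= c2 -> c2 < 1 -> line_int k (G O) c1 y = line_int k (G O) c2 y.
Proof.
  intros H1 H12 H2. apply Cmod_small_eq. intros e He.
  destruct (line_int_correct c1 y ltac:(lra) ltac:(lra) (e / 4)) as [T1 [HT1 X1]]. lra.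
  destruct (line_int_correct c2 y ltac:(lra) ltac:(lra) (e / 4)) as [T2 [HT2 X2]]. lra.
  destruct (Hint_small c1 c2 y (e / 4) H1 H12 ltac:(lra) ltac:(lra) ltac:(lra) (Rmax T1 T2)) as [T [HT [HT' [B1 B2]]]].
  assert (q1 := Rmax_l T1 T2). assert (q2 := Rmax_r T1 T2).
  specialize (X1 (- T) T ltac:(lra) ltac:(lra)). specialize (X2 (- T) T ltac:(lra) ltac:(lra)).
  assert (E := Phi_rect alpha m G k y c1 c2 T HG Hal H1 H12 H2 ltac:(lra)).
  fold (Vint (Phi k (G O) y) c1 (- T) T) in X1. fold (Vint (Phi k (G O) y) c2 (- T) T) in X2.
  set (V1 := Vint (Phi k (G O) y) c1 (- T) T) in *. set (V2 := Vint (Phi k (G O) y) c2 (- T) T) in *.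
  assert (Mi : Cmod Ci = 1). { unfold Cmod, Ci; simpl. replace (0 * (0 * 1) + 1 * (1 * 1)) with 1 by ring. apply sqrt_1. }
  assert (E' : Cmod (Cminus V2 V1) <= e / 2).
  { rewrite <- (Rmult_1_l (Cmod (Cminus V2 V1))), <- Mi, <- Cmod_mult, E. eapply Rle_trans; [apply Cmod_minus_le|]. lra. }
  eapply Rle_trans; [apply (Cmod_minus_triangle _ V1)|]. rewrite Cmod_minus_sym.
  assert (Y := Cmod_minus_triangle V1 V2 (line_int k (G O) c2 y)). rewrite (Cmod_minus_sym V1 V2) in Y. lra.
Qed.

(** * Inversion on a line, the Dirichlet series and the residue *)

Lemma mellin_data_m2 : (2 <= m)%nat.
Proof.
  destruct m as [|[|m']]; try lia.
  - simpl in Hm. assert (X := pos_INR k). lra.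
  - simpl in Hm. assert (X : 1 <= INR k) by (apply (le_INR 1); auto). lra.
Qed.

(** The two bounds of [mellin_decay] combine to $2B/(1+t^2)$, because $m\ge1+k/2$ forces $m\ge2$.
    The line $\mathrm{Re}\,s=1$ is included, as zeta does not occur. *)
Lemma mellin_line_dominated c : 0 < c < alpha -> exists w, good_weight w /\ dominated (fun t => mellin (G O) (c, t)) w.
Proof.
  intros Hc. set (e := Rmin c (alpha - c)). assert (He : 0 < e) by (apply Rmin_pos; lra).
  assert (e1 : e <= c) by apply Rmin_l. assert (e2 : e <= alpha - c) by apply Rmin_r.
  destruct (mellin_decay alpha m G e HG He) as [B [HB HD]].
  exists (fun t => 2 * B * / (1 + t ^ 2)). split.
  - apply good_weight_scal. lra. apply good_weight_cauchy.
  - split.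
    + intros t. apply (continuous_comp (fun t => (c, t) : C) (mellin (G O))). cont. apply mellin_continuous with alpha m; auto.
    + intros t. destruct (HD (c, t)) as [D1 D2]. simpl; lra. simpl Im in D2.
      assert (P := Cmod_ge_0 (mellin (G O) (c, t))).
      apply le_mult_inv. nra.
      assert (Pt := Rabs_pos t). rewrite <- (pow2_abs t).
      destruct (Rle_dec 1 (Rabs t)) as [Ht|Ht].
      * assert (X : Rabs t ^ 2 <= Rabs t ^ m) by (apply Rle_pow; auto; apply mellin_data_m2). nra.
      * assert (Rabs t ^ 2 <= 1) by nra. nra.
Qed.

Lemma mellin_inversion c y : 0 < c < alpha ->
  is_Int (fun t => Cmult (mellin (G O) (c, t)) (Cexp (Cmult (c, t) (RtoC (- y))))) (Cmult (RtoC (2 * PI)) (G O y)).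
Proof.
  intros Hc. set (e := Rmin c (alpha - c)). assert (He : 0 < e) by (apply Rmin_pos; lra).
  assert (e1 : e <= c) by apply Rmin_l. assert (e2 : e <= alpha - c) by apply Rmin_r.
  destruct (mellin_data_dom0 alpha m G HG) as [K [HK D]].
  set (g := fun v => Cmult (G O v) (Cexp (Cmult (RtoC c) (RtoC v)))).
  assert (Dg : dominated g (fun v => K * exp (- (e * Rabs v)))) by (apply D; simpl; lra).
  assert (F : forall t, fourier g t = mellin (G O) (c, t)).
  { intros t. unfold fourier, mellin. f_equal.
    assert (E : forall v, Cmult (g v) (cis (v * t)) = Cmult (G O v) (Cexp (Cmult (c, t) (RtoC v)))).
    { intros v. unfold g. rewrite <- Cmult_assoc. f_equal. unfold cis. rewrite <- Cexp_plus. f_equal.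
      apply injective_projections; simpl; ring. }
    apply functional_extensionality. exact E. }
  destruct (mellin_line_dominated c Hc) as [w2 [Gw2 Dw2]].
  assert (Gs : good_weight (fun v => K * exp (- (e * Rabs (v + y))))).
  { apply (good_weight_le _ (fun v => K * exp (e * Rabs y) * exp (- (e * Rabs v)))).
    - intros v. cont.
    - intros v. split. apply Rmult_le_pos; auto. left; apply exp_pos.
      rewrite Rmult_assoc, <- exp_plus. apply Rmult_le_compat_l; auto. apply exp_le_mono.
      assert (X := Rabs_triang (v + y) (- y)). rewrite Rabs_Ropp in X. replace (v + y + - y) with v in X by ring. nra.
    - apply good_weight_scal. apply Rmult_le_pos; auto. left; apply exp_pos. now apply good_weight_exp. }
  assert (X := fourier_inv g (fun v => K * exp (- (e * Rabs v))) w2 y (good_weight_Kexp K e HK He) Dg Gs Gw2).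
  assert (Y : is_Int (fun t => Cmult (fourier g t) (cis (- y * t))) (Cmult (RtoC (2 * PI)) (g y))).
  { apply X. intros t. rewrite F. apply Dw2. }
  assert (CF : contR (fun t => Cmult (fourier g t) (cis (- y * t)))).
  { intros t. apply continuous_Cmult. apply (fourier_cont g _ (good_weight_Kexp K e HK He) Dg). apply continuous_cis; cont. }
  eapply is_Int_ext; [|eapply is_Int_eq; [apply is_Int_scal with (c := Cexp (Cmult (RtoC c) (RtoC (- y)))) (1 := CF) (2 := Y)|]].
  - intros t. cbv beta. rewrite F.
    replace (Cexp (Cmult (c, t) (RtoC (- y)))) with (Cmult (Cexp (Cmult (RtoC c) (RtoC (- y)))) (cis (- y * t))). ring.
    unfold cis. rewrite <- Cexp_plus. f_equal. apply injective_projections; simpl; ring.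
  - unfold g. transitivity (Cmult (Cmult (RtoC (2 * PI)) (G O y)) (Cmult (Cexp (Cmult (RtoC c) (RtoC (- y)))) (Cexp (Cmult (RtoC c) (RtoC y))))). ring.
    rewrite <- Cexp_plus. replace (Cplus (Cmult (RtoC c) (RtoC (- y))) (Cmult (RtoC c) (RtoC y))) with (RtoC 0) by (rewrite RtoC_opp; ring).
    rewrite Cexp_0. ring.
Qed.

(** For finite sums this is Mellin inversion at the points $nx$, term by term. The error is the
    integral of $f^*x^{-s}$ against the remainder of the Dirichlet series; that remainder is
    uniformly small on the line, and $f^*$ is integrable there. *)
Lemma series_line_int c y : 1 < c < alpha ->
  conv (Csum (fun n => Cmult (RtoC (INR (dk k (S n)))) (G O (y + ln (INR (S n)))))) (Cmult (RtoC (/ (2 * PI))) (line_int k (G O) c y)).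
Proof.
  intros Hc. assert (PP := PI_RGT_0).
  destruct (mellin_line_dominated c ltac:(lra)) as [w [Gw Dw]].
  set (D := fun N => fun t => Cmult (dk_psum k N (c, t)) (Cmult (mellin (G O) (c, t)) (Cexp (Cmult (c, t) (RtoC (- y)))))).
  assert (Cb : contR (fun t => Cmult (mellin (G O) (c, t)) (Cexp (Cmult (c, t) (RtoC (- y)))))).
  { intros t. apply continuous_Cmult. apply Dw. cont. }
  assert (CD : forall N, contR (D N)).
  { intros N t. unfold D. apply continuous_Cmult; [|apply Cb]. unfold dk_psum.
    apply (continuous_Csum (fun i t => Cmult (RtoC (INR (dk k (S i)))) (cpow (INR (S i)) (Copp (c, t))))).
    intros i. unfold cpow. cont. }
  assert (I : forall N, is_Int (D N) (Cmult (RtoC (2 * PI)) (Csum (fun n => Cmult (RtoC (INR (dk k (S n)))) (G O (y + ln (INR (S n))))) N))).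
  { induction N.
    - apply is_Int_ext with (fun _ => RtoC 0).
      { intros t. unfold D, dk_psum; simpl. ring. }
      eapply is_Int_eq. apply is_Int_0. simpl. ring.
    - assert (M := mellin_inversion c (y + ln (INR (S N))) ltac:(lra)).
      assert (CM : contR (fun t => Cmult (mellin (G O) (c, t)) (Cexp (Cmult (c, t) (RtoC (- (y + ln (INR (S N)))))))))
        by (intros t; apply continuous_Cmult; [apply Dw|cont]).
      assert (CM' : contR (fun t => Cmult (RtoC (INR (dk k (S N)))) (Cmult (mellin (G O) (c, t)) (Cexp (Cmult (c, t) (RtoC (- (y + ln (INR (S N))))))))))
        by (intros t; apply continuous_Cmult; [cont|apply CM]).
      eapply is_Int_ext; [|eapply is_Int_eq; [apply is_Int_plus with (1 := CD N) (3 := IHN) (2 := CM')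
         (4 := is_Int_scal _ (RtoC (INR (dk k (S N)))) _ CM M)|]].
      + intros t. cbv beta. unfold D, dk_psum. cbn [Csum]. unfold cpow at 3.
        replace (Cmult (c, t) (RtoC (- (y + ln (INR (S N)))))) with (Cplus (Cmult (c, t) (RtoC (- y))) (Cmult (Copp (c, t)) (RtoC (ln (INR (S N))))))
          by (rewrite !RtoC_opp, RtoC_plus; ring).
        rewrite Cexp_plus. ring.
      + cbn [Csum]. ring. }
  assert (IJ := line_int_correct c y ltac:(lra) ltac:(lra)).
  assert (CJ : contR (fun t => Phi k (G O) y (c, t))).
  { destruct (Phi_dominated c ltac:(lra) ltac:(lra)) as [w' [_ [_ H]]]. apply (H y). }
  destruct (good_weight_bound w Gw) as [B [HB0 HB]].
  assert (L : conv (fun N => Cmult (RtoC (2 * PI)) (Csum (fun n => Cmult (RtoC (INR (dk k (S n)))) (G O (y + ln (INR (S n))))) N)) (line_int k (G O) c y)).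
  { intros e He. set (Q := exp (- c * y)). assert (PQ : 0 < Q) by apply exp_pos.
    assert (He' : 0 < e / (Q * (B + 1))) by (apply Rdiv_lt_0_compat; nra).
    destruct (dirichlet_unif k c (e / (Q * (B + 1))) ltac:(lra) He') as [N0 HN0].
    exists N0. intros N HN.
    assert (X := is_Int_minus _ _ _ _ (CD N) CJ (I N) IJ).
    apply (is_Int_bound _ (fun t => e / (Q * (B + 1)) * Q * w t) _ e) in X; auto.
    - intros t. apply continuous_Rmult. apply continuous_const. apply Gw.
    - split. intros t. apply continuous_Cminus. apply CD. apply CJ.
      intros t. unfold D.
      replace (Cminus _ _) with (Cmult (Cmult (Cminus (dk_psum k N (c, t)) (Cpown (zeta0 (c, t)) k)) (Cexp (Cmult (c, t) (RtoC (- y))))) (mellin (G O) (c, t)))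
        by (unfold Phi; ring).
      rewrite !Cmod_mult, Cmod_Cexp_real. replace (exp (Re (c, t) * - y)) with Q by (unfold Q; simpl; f_equal; ring).
      apply Rmult_le_compat; try apply Cmod_ge_0. apply Rmult_le_pos. apply Cmod_ge_0. lra.
      apply Rmult_le_compat_r. lra. apply HN0; auto. apply Dw.
    - intros p q Hpq. rewrite (RInt_scal (V:=R_CompleteNormedModule)) by apply ex_RInt_contR, Gw.
      change (e / (Q * (B + 1)) * Q * RInt w p q <= e). assert (Y := HB p q Hpq).
      apply Rle_trans with (e / (Q * (B + 1)) * Q * (B + 1)). apply Rmult_le_compat_l. nra. lra. right; field; split; lra. }
  apply (conv_ext (fun N => Cmult (RtoC (/ (2 * PI))) (Cmult (RtoC (2 * PI)) (Csum (fun n => Cmult (RtoC (INR (dk k (S n)))) (G O (y + ln (INR (S n))))) N)))).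
  - intros N. rewrite Cmult_assoc, <- RtoC_mult, Rinv_l by lra. ring.
  - now apply conv_scal.
Qed.

(** The circle is a compact path, and $a<1$ and $a<\alpha-1$ keep it inside
    $0<\mathrm{Re}\,s<\alpha$, so [mellin_Fubini_path] applies; a translation of $v$ then absorbs
    the factor $x^{-s}$. *)
Lemma Circ_residue a y : 0 < a < 1 -> a < alpha - 1 ->
  is_Int (fun v => Cmult (G O (v + y)) (Circ (zeta_pow_exp k v) a)) (Circ (Phi k (G O) y) a).
Proof.
  clear Hal Hk Hm. intros Ha Ha'. assert (PP := PI_RGT_0).
  set (g := fun th => Cplus (RtoC 1) (Cmult (RtoC a) (cis th))).
  set (A := fun th => Cmult (Cmult (Cpown (zeta0 (g th)) k) (Cexp (Cmult (g th) (RtoC (- y))))) (Cmult (RtoC a) (cis th))).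
  assert (Cg : contR g) by (intros u; unfold g; cont; apply (continuous_cis (fun y => y)); cont).
  assert (Rg : forall u, 1 - a <= Re (g u) <= 1 + a).
  { intros u. unfold g, Re; simpl. rewrite exp_0. assert (X := COS_bound u). nra. }
  assert (CZ : contR (fun u => Cpown (zeta0 (g u)) k)).
  { intros u. apply continuous_Cpown, (continuous_comp g zeta0). apply Cg. apply zeta0_continuous. specialize (Rg u); lra. apply circle_not1; lra. }
  assert (CA : contR A).
  { intros u. specialize (CZ u). specialize (Cg u). unfold A. cont. apply (continuous_cis (fun y => y)); cont. }
  set (e := Rmin (1 - a) (alpha - 1 - a)). assert (He : 0 < e) by (apply Rmin_pos; lra).
  assert (e1 : e <= 1 - a) by apply Rmin_l. assert (e2 : e <= alpha - 1 - a) by apply Rmin_r.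
  assert (X := mellin_Fubini_path alpha m G A g 0 (2 * PI) e HG ltac:(lra) He (contR_I _ _ _ CA) (contR_I _ _ _ Cg)).
  assert (X' := X (fun u _ => ltac:(specialize (Rg u); lra))). clear X.
  assert (CX : contR (fun v => Cmult (G O v) (CI (fun u => Cmult (A u) (Cexp (Cmult (g u) (RtoC v)))) 0 (2 * PI)))).
  { intros v. apply continuous_Cmult. apply (mellin_data_cont _ _ _ HG); lia.
    apply (continuous_CI_param (fun v u => Cmult (A u) (Cexp (Cmult (g u) (RtoC v))))). lra.
    intros x u _. unfold cont2. apply continuous_Cmult. apply (continuous_comp (fun p : R * R => snd p) A). cont. apply CA.
    apply continuous_Cexp, continuous_Cmult; [|cont]. apply (continuous_comp (fun p : R * R => snd p) g). cont. apply Cg. }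
  assert (Y := is_Int_shift _ y _ CX X').
  eapply is_Int_ext; [|eapply is_Int_eq; [apply Y|]].
  - intros v. cbv beta. f_equal. unfold Circ. apply CI_ext. lra. intros u _. fold (g u). unfold A, zeta_pow_exp.
    replace (Cmult (g u) (RtoC v)) with (Cplus (Cmult (g u) (RtoC (- y))) (Cmult (g u) (RtoC (v + y)))) by (rewrite RtoC_plus, RtoC_opp; ring).
    rewrite Cexp_plus. ring.
  - unfold Circ. apply CI_ext. lra. intros u _. fold (g u). unfold A, Phi. ring.
Qed.

Lemma is_Int_reflect g l : contR g -> is_Int g l -> is_Int (fun v => g (- v)) l.
Proof.
  intros Cg H e He. destruct (H e He) as [T [HT HT']]. exists T; split; auto. intros a b Ha Hb.
  rewrite CI_reflect. apply HT'; lra. lra.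
  intros t _. apply (continuous_comp Ropp g). cont. apply Cg. now apply contR_I.
Qed.

Lemma line_int_cont c : 0 < c < alpha -> c <> 1 -> contR (line_int k (G O) c).
Proof.
  intros Hc H1. destruct (Phi_dominated c Hc H1) as [w [Gw [Dw _]]].
  assert (E : forall y, line_int k (G O) c y = Cmult (Cexp (Cmult (RtoC c) (RtoC (- y)))) (fourier (fun t => Cmult (Cpown (zeta0 (c, t)) k) (mellin (G O) (c, t))) (- y))).
  { intros y. apply is_Int_Int.
    assert (J := Int_correct _ _ Gw (dominated_cis _ _ (- y) Dw)).
    eapply is_Int_ext; [|apply is_Int_scal with (c := Cexp (Cmult (RtoC c) (RtoC (- y)))) (1 := proj1 (dominated_cis _ _ (- y) Dw)) (2 := J)].
    intros t. cbv beta. rewrite Phi_split.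
    replace (Cexp (Cmult (c, t) (RtoC (- y)))) with (Cmult (Cexp (Cmult (RtoC c) (RtoC (- y)))) (cis (t * - y))). ring.
    unfold cis. rewrite <- Cexp_plus. f_equal. apply injective_projections; simpl; ring. }
  intros y. apply continuous_ext with (fun y => Cmult (Cexp (Cmult (RtoC c) (RtoC (- y)))) (fourier (fun t => Cmult (Cpown (zeta0 (c, t)) k) (mellin (G O) (c, t))) (- y))).
  intros; symmetry; apply E.
  apply continuous_Cmult. cont.
  apply (continuous_comp Ropp (fourier (fun t => Cmult (Cpown (zeta0 (c, t)) k) (mellin (G O) (c, t))))). cont.
  apply (fourier_cont _ w Gw Dw).
Qed.

Lemma line_int_bound c : 0 < c < alpha -> c <> 1 -> exists B, 0 <= B /\ forall y, Cmod (line_int k (G O) c y) <= B * exp (- c * y).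
Proof.
  intros Hc H1. destruct (Phi_dominated c Hc H1) as [w [Gw [Dw H]]].
  destruct (good_weight_bound w Gw) as [B [HB0 HB]]. exists B; split; auto. intros y. destruct (H y) as [Gy Dy].
  apply (is_Int_bound _ _ _ _ (proj1 Gy) Dy).
  - intros p q Hpq. rewrite (RInt_scal (V:=R_CompleteNormedModule)) by apply ex_RInt_contR, Gw.
    change (exp (- c * y) * RInt w p q <= B * exp (- c * y)). rewrite Rmult_comm. apply Rmult_le_compat_r. left; apply exp_pos. auto.
  - now apply line_int_correct.
Qed.

(** The line through $s$ may replace the line [c], so [line_int] is up to an exponential factor the
    Fourier transform of $\zeta^k f^*$ on $\mathrm{Re}\,s=\sigma$. A second inversion requires that
    transform to be integrable: the bounds on the lines $\sigma-e$ and $\sigma+e$, both within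
    $(0,1)$, make it decay exponentially in the two directions. *)
Lemma final_inversion s c : 0 < Re s < 1 -> 0 < c < 1 ->
  is_Int (fun y => Cmult (Cmult (RtoC (/ (2 * PI))) (line_int k (G O) c y)) (Cexp (Cmult s (RtoC y))))
    (Cmult (Cpown (zeta0 s) k) (mellin (G O) s)).
Proof.
  intros Hs Hc. assert (PP := PI_RGT_0). set (sg := Re s) in *.
  assert (EJ : forall c1 c2 y, 0 < c1 < 1 -> 0 < c2 < 1 -> line_int k (G O) c1 y = line_int k (G O) c2 y).
  { intros c1 c2 y H1 H2. destruct (Rle_dec c1 c2). apply line_int_const; lra. symmetry; apply line_int_const; lra. }
  destruct (Phi_dominated sg ltac:(lra) ltac:(lra)) as [w [Gw [Dw _]]].
  set (g := fun t => Cmult (Cpown (zeta0 (sg, t)) k) (mellin (G O) (sg, t))) in *.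
  assert (E : forall v, fourier g v = Cmult (line_int k (G O) c (- v)) (RtoC (exp (- sg * v)))).
  { intros v. rewrite (EJ c sg) by lra. apply is_Int_Int.
    assert (J := line_int_correct sg (- v) ltac:(lra) ltac:(lra)).
    assert (CJ : contR (fun t => Phi k (G O) (- v) (sg, t))).
    { destruct (Phi_dominated sg ltac:(lra) ltac:(lra)) as [w' [_ [_ H]]]. apply (H (- v)). }
    eapply is_Int_ext; [|eapply is_Int_eq; [apply is_Int_scal with (c := RtoC (exp (- sg * v))) (1 := CJ) (2 := J)|apply Cmult_comm]].
    intros t. cbv beta. rewrite Phi_split. fold (g t). rewrite Ropp_involutive.
    rewrite (Cexp_split (Cmult (sg, t) (RtoC v))).
    replace (Re (Cmult (sg, t) (RtoC v))) with (sg * v) by (unfold Re; simpl; ring).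
    replace (Im (Cmult (sg, t) (RtoC v))) with (t * v) by (unfold Im; simpl; ring).
    transitivity (Cmult (RtoC (exp (- sg * v) * exp (sg * v))) (Cmult (cis (t * v)) (g t))). rewrite RtoC_mult; ring.
    rewrite <- exp_plus. replace (- sg * v + sg * v) with 0 by ring. rewrite exp_0. ring. }
  set (e := Rmin (sg / 2) ((1 - sg) / 2)). assert (He : 0 < e) by (apply Rmin_pos; lra).
  assert (e1 : e <= sg / 2) by apply Rmin_l. assert (e2 : e <= (1 - sg) / 2) by apply Rmin_r.
  destruct (line_int_bound (sg - e) ltac:(lra) ltac:(lra)) as [B1 [HB1 Hb1]].
  destruct (line_int_bound (sg + e) ltac:(lra) ltac:(lra)) as [B2 [HB2 Hb2]].
  assert (Db : forall v, Cmod (fourier g v) <= (B1 + B2) * exp (- (e * Rabs v))).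
  { intros v. rewrite E, Cmod_mult, Cmod_R, Rabs_pos_eq by (left; apply exp_pos).
    assert (Pe := exp_pos (- (e * Rabs v))).
    destruct (Rle_dec 0 v) as [Hv|Hv].
    - rewrite (EJ c (sg - e)) by lra. rewrite (Rabs_pos_eq v) in * by auto.
      apply Rle_trans with (B1 * exp (- (sg - e) * - v) * exp (- sg * v)). apply Rmult_le_compat_r. left; apply exp_pos. apply Hb1.
      rewrite Rmult_assoc, <- exp_plus. replace (- (sg - e) * - v + - sg * v) with (- (e * v)) by ring.
      apply Rmult_le_compat_r; lra.
    - rewrite (EJ c (sg + e)) by lra. rewrite (Rabs_left v) in * by lra.
      apply Rle_trans with (B2 * exp (- (sg + e) * - v) * exp (- sg * v)). apply Rmult_le_compat_r. left; apply exp_pos. apply Hb2.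
      rewrite Rmult_assoc, <- exp_plus. replace (- (sg + e) * - v + - sg * v) with (- (e * - v)) by ring.
      apply Rmult_le_compat_r; lra. }
  assert (Gd2 := good_weight_Kexp (B1 + B2) e ltac:(lra) He).
  assert (X := fourier_inv g w _ (Im s) Gw Dw (good_weight_shift w (Im s) Gw) Gd2 Db).
  assert (CX : contR (fun v => Cmult (fourier g v) (cis (- Im s * v)))).
  { intros v. apply continuous_Cmult. apply (fourier_cont g w Gw Dw). apply continuous_cis; cont. }
  assert (Y := is_Int_reflect _ _ CX X).
  assert (CY : contR (fun v => Cmult (fourier g (- v)) (cis (- Im s * - v)))).
  { intros v. apply (continuous_comp Ropp (fun v => Cmult (fourier g v) (cis (- Im s * v)))). cont. apply CX. }
  eapply is_Int_ext; [|eapply is_Int_eq; [apply is_Int_scal with (c := RtoC (/ (2 * PI))) (1 := CY) (2 := Y)|]].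
  - intros v. cbv beta. rewrite E, Ropp_involutive.
    rewrite (Cexp_split (Cmult s (RtoC v))).
    replace (Re (Cmult s (RtoC v))) with (- sg * - v) by (unfold sg, Re; simpl; ring).
    replace (Im (Cmult s (RtoC v))) with (- Im s * - v) by (unfold Im; simpl; ring). ring.
  - rewrite Cmult_assoc, <- RtoC_mult, Rinv_l by lra. unfold g, sg. destruct s as [p q]. simpl. ring.
Qed.

End Assembly.

(** * Return to the variable $x=e^v$ *)

Lemma is_RInt_gen_exp (h : R -> C) l : contR (fun v => h (exp v)) ->
  is_Int (fun v => Cmult (RtoC (exp v)) (h (exp v))) l ->
  is_RInt_gen (V:=C_R_NormedModule) h (at_right 0) (Rbar_locally p_infty) l.
Proof.
  intros Ch H.
  assert (Cx : forall x, 0 < x -> continuous h x).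
  { intros x Hx. apply (continuous_ext_loc (T:=R_UniformSpace) (U:=C_UniformSpace) h (fun x => h (exp (ln x))) x).
    - exists (mkposreal x Hx). intros y Hy. change (Rabs (y - x) < x) in Hy. apply Rabs_def2 in Hy. rewrite exp_ln; auto. lra.
    - apply (continuous_comp ln (fun v => h (exp v))). apply continuous_ln; auto. apply Ch. }
  intros P [ep HP].
  assert (He : 0 < ep / 2) by apply is_pos_div_2.
  destruct (H (ep / 2) He) as [T [HT HT']].
  (* Under $x=e^v$ the cutoff $|v|\ge T$ becomes $a<e^{-T}$ and $b>e^T$. *)
  exists (fun a => 0 < a < exp (- T)) (fun b => exp T < b).
  - exists (mkposreal _ (exp_pos (- T))). intros y Hy Hy0. change (Rabs (y - 0) < exp (- T)) in Hy. rewrite Rminus_0_r in Hy. apply Rabs_def2 in Hy. lra.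
  - exists (exp T). auto.
  - intros a b [Ha Ha'] Hb. assert (P1 := exp_pos T).
    assert (L1 : ln a <= - T). { rewrite <- (ln_exp (- T)). apply ln_le; lra. }
    assert (L2 : T <= ln b). { rewrite <- (ln_exp T). apply ln_le; lra. }
    assert (ab : a <= b). { assert (exp (- T) <= exp T) by (apply exp_le_mono; lra). lra. }
    exists (CI h a b). split.
    + apply is_RInt_CI; auto. intros x Hx; apply Cx; lra.
    + apply HP.
      assert (E : CI h a b = CI (fun v => Cmult (RtoC (exp v)) (h (exp v))) (ln a) (ln b)).
      { rewrite (CI_comp h exp exp); [|lra| |].
        rewrite !exp_ln by lra. reflexivity.
        intros x _. apply Cx, exp_pos.
        intros x _. split. apply is_derive_exp. cont. }
      rewrite E. assert (X := HT' (ln a) (ln b) L1 L2).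
      assert (Y : Cmod (Cminus (CI (fun v => Cmult (RtoC (exp v)) (h (exp v))) (ln a) (ln b)) l) < ep).
      { eapply Rle_lt_trans; [exact X|]. assert (Z := cond_pos ep). lra. }
      set (z := CI (fun v => Cmult (RtoC (exp v)) (h (exp v))) (ln a) (ln b)) in *.
      split.
      * change (Rabs (fst z - fst l) < ep). eapply Rle_lt_trans; [apply (re_le_Cmod (Cminus z l))|exact Y].
      * change (Rabs (snd z - snd l) < ep). eapply Rle_lt_trans; [apply (Rle_trans _ _ _ (Rmax_r _ _) (Rmax_Cmod (Cminus z l)))|exact Y].
Qed.

(* [zeta] and [zeta0] agree on the circle of [Pres]: its only points with [Re s = 1] are [1 +- i / 2]. *)
Lemma two_pow_circle th : Cminus (RtoC 1) (cpow 2 (Cminus (RtoC 1) (Cplus (RtoC 1) (Cmult (RtoC (1 / 2)) (cis th))))) <> RtoC 0.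
Proof.
  set (s := Cplus (RtoC 1) (Cmult (RtoC (1 / 2)) (cis th))).
  destruct (Req_dec (Re s) 1) as [E|E]; [|now apply two_pow_neq].
  assert (c0 : cos th = 0). { unfold s, Re in E; simpl in E. rewrite exp_0 in E. lra. }
  assert (s2 := sin2_cos2 th). unfold Rsqr in s2. rewrite c0 in s2.
  assert (L2 : 0 < ln 2) by (rewrite <- ln_1; apply ln_increasing; lra).
  assert (L2' : ln 2 <= 1) by (assert (X := ln_le_sub1 2); lra).
  assert (PP := PI2_3_2).
  intros H. assert (H' : Im (cpow 2 (Cminus (RtoC 1) s)) = 0).
  { apply (f_equal Im) in H. unfold Im in *; simpl in H. simpl. lra. }
  (* At $s=1\pm i/2$ the number $2^{1-s}$ has modulus 1 and argument $\mp(\ln2)/2$, so its imaginary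
     part is not 0 and it cannot equal 1. *)
  assert (E' : Im (cpow 2 (Cminus (RtoC 1) s)) = - sin (sin th * (ln 2 / 2))).
  { unfold cpow, s. rewrite Cexp_split. unfold Im, Re, cis, Cexp; simpl. rewrite !exp_0, c0.
    replace ((1 + - (1 + (1 / 2 * (1 * 0) - 0 * (1 * sin th)))) * ln 2 - (0 + - (0 + (1 / 2 * (1 * sin th) + 0 * (1 * 0)))) * 0) with 0 by ring.
    rewrite exp_0, <- sin_neg.
    match goal with |- _ = sin ?x => set (q := sin x) end.
    match goal with |- context [sin ?x] => replace (sin x) with q by (unfold q; f_equal; field) end.
    ring. }
  rewrite E' in H'.
  assert (D : sin th = 1 \/ sin th = -1).
  { assert ((sin th - 1) * (sin th + 1) = 0) by nra. destruct (Rmult_integral _ _ H0); lra. }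
  assert (S : 0 < sin (ln 2 / 2)) by (apply sin_gt_0; lra).
  destruct D as [D|D]; rewrite D in H'.
  - rewrite Rmult_1_l in H'. lra.
  - replace (-1 * (ln 2 / 2)) with (- (ln 2 / 2)) in H' by ring. rewrite sin_neg in H'. lra.
Qed.

(** The residue is taken of $\zeta^k(s)y^{s-1}$, while [zeta_pow_exp] carries $y^s$ with $y=e^v$;
    the factor $e^{-v}$ is the quotient. It later cancels against $dy=e^v\,dv$. *)
Lemma Pres_Circ k v : Pres k (exp v) = Cmult (RtoC (exp (- v) / (2 * PI))) (Circ (zeta_pow_exp k v) (1 / 2)).
Proof.
  assert (PP := PI_RGT_0).
  unfold Pres, Circ. rewrite <- CI_scal; [|lra|apply contR_I, zeta_pow_exp_Circ_cont; lra].
  apply (is_RInt_unique (V:=C_R_CompleteNormedModule)).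
  eapply (is_RInt_ext (V:=C_R_NormedModule)); [|apply is_RInt_CI; [lra|]].
  - intros th _. cbv beta zeta. fold (cis th).
    set (w := Cmult (RtoC (1 / 2)) (cis th)).
    assert (Zs : zeta (Cplus (RtoC 1) w) = zeta0 (Cplus (RtoC 1) w)).
    { apply zeta_zeta0. 2: apply two_pow_circle. unfold w, Re; simpl. rewrite exp_0. assert (X := COS_bound th). lra. }
    rewrite Zs. unfold zeta_pow_exp, cpow. rewrite ln_exp.
    replace (Cminus (Cplus (RtoC 1) w) (RtoC 1)) with w by ring.
    replace (Cmult (Cplus (RtoC 1) w) (RtoC v)) with (Cplus (RtoC v) (Cmult w (RtoC v))) by ring.
    rewrite Cexp_plus. replace (Cexp (RtoC v)) with (RtoC (exp v)).
    2:{ unfold Cexp; simpl. rewrite cos_0, sin_0. apply injective_projections; simpl; ring. }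
    unfold Rdiv. rewrite RtoC_mult.
    transitivity (Cmult (RtoC (exp (- v) * exp v)) (Cmult (RtoC (/ (2 * PI))) (Cmult (Cmult (Cpown (zeta0 (Cplus (RtoC 1) w)) k) (Cexp (Cmult w (RtoC v)))) w))).
    rewrite RtoC_mult. match goal with |- @eq _ ?x ?y => change (@eq C x y) end; ring.
    rewrite <- exp_plus. replace (- v + v) with 0 by ring. rewrite exp_0. apply Cmult_1_l.
  - intros th _. apply continuous_Cmult. apply continuous_const. apply zeta_pow_exp_Circ_cont. lra.
Qed.

Lemma Circ_zeta_pow_exp_cont k a : 0 < a < 1 -> contR (fun v => Circ (zeta_pow_exp k v) a).
Proof.
  intros Ha v. assert (PP := PI_RGT_0). unfold Circ.
  apply (continuous_CI_param (fun v th => Cmult (zeta_pow_exp k v (Cplus (RtoC 1) (Cmult (RtoC a) (cis th)))) (Cmult (RtoC a) (cis th)))). lra.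
  intros x u _. unfold cont2.
  assert (A : continuous (fun th => Cplus (RtoC 1) (Cmult (RtoC a) (cis th))) u) by (cont; apply (continuous_cis (fun y => y)); cont).
  assert (B : continuous (fun th => Cpown (zeta0 (Cplus (RtoC 1) (Cmult (RtoC a) (cis th)))) k) u).
  { apply continuous_Cpown, (continuous_comp _ zeta0); auto. apply zeta0_continuous.
    unfold Re; simpl. rewrite exp_0. assert (X := COS_bound u). nra. apply circle_not1; lra. }
  apply continuous_Cmult.
  - unfold zeta_pow_exp. apply continuous_Cmult.
    + apply (continuous_comp (fun p : R * R => snd p) (fun th => Cpown (zeta0 (Cplus (RtoC 1) (Cmult (RtoC a) (cis th)))) k)). cont. exact B.
    + cont. apply continuous_cis; cont.
  - cont. apply continuous_cis; cont.
Qed.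

Lemma mellin_data_le alpha alpha' m G : mellin_data alpha m G -> 0 < alpha' <= alpha -> mellin_data alpha' m G.
Proof.
  intros [B1 B2 B3] Ha. split; auto. intros j Hj. destruct (B3 j Hj) as [K [HK HB]].
  exists K; split; auto. intros v. destruct (HB v) as [Q1 Q2]. split; auto.
  assert (Pj := pos_INR j). destruct (Rle_dec 0 v).
  - eapply Rle_trans; [exact Q2|]. apply Rmult_le_compat_l; auto. apply exp_le_mono. nra.
  - eapply Rle_trans; [exact Q1|]. rewrite <- (Rmult_1_r K) at 1. apply Rmult_le_compat_l; auto.
    rewrite <- exp_0. apply exp_le_mono. nra.
Qed.

Theorem theorem4 (alpha : R) (k m : nat) (f : R -> C) (s : C) :
  1 < alpha -> (1 <= k)%nat -> 1 + INR k / 2 <= INR m ->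
  class_M alpha m f ->
  0 < Re s < 1 ->
  exists Fs : C,
    (* Fs = f^*(s), the Mellin transform *)
    @is_RInt_gen C_R_NormedModule (fun x : R => Cmult (f x) (cpow x (Cminus s (RtoC 1))))
                (at_right 0) (Rbar_locally p_infty) Fs /\
    @is_RInt_gen C_R_NormedModule
      (fun x : R =>
         Cmult
           (Cminus
              (CSeries (fun n => Cmult (RtoC (INR (dk k (S n)))) (f (INR (S n) * x))))
              (@RInt_gen C_R_CompleteNormedModule (fun y : R => Cmult (f (x * y)) (Pres k y))
                        (at_right 0) (Rbar_locally p_infty)))
           (cpow x (Cminus s (RtoC 1))))
      (at_right 0) (Rbar_locally p_infty)
      (Cmult (Cpown (zeta s) k) Fs).
Proof.
  intros Hal0 Hk Hm Hf Hs. assert (PP := PI_RGT_0).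
  destruct (class_M_mellin_data alpha m f Hal0 Hf) as [G [HG0 Gf]].
  (* Lowering $\alpha$ to at most 2 keeps every line and circle inside $\mathrm{Re}\,s<3$, where the
     truncation estimates hold. Only lines with real part below this new value are used. *)
  set (al := Rmin alpha 2).
  assert (Hal : 1 < al <= 2). { split. apply Rmin_glb_lt; lra. apply Rmin_r. }
  assert (HG : mellin_data al m G). { apply (mellin_data_le alpha); auto. split. lra. apply Rmin_l. }
  (* Half of the room between 1 and [al]: the circle stays where $f^*$ is defined, and its radius
     does not exceed the $1/2$ of [Pres]. *)
  clear HG0. set (a := (al - 1) / 2).
  assert (Ha : 0 < a < 1) by (unfold a; lra). assert (Ha' : a < al - 1) by (unfold a; lra). assert (Ha2 : a <= 1 / 2) by (unfold a; lra).
  assert (Epow : forall v, cpow (exp v) (Cminus s (RtoC 1)) = Cmult (RtoC (exp (- v))) (Cexp (Cmult s (RtoC v)))).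
  { intros v. unfold cpow. rewrite ln_exp.
    replace (RtoC (exp (- v))) with (Cexp (RtoC (- v))).
    rewrite <- Cexp_plus. f_equal. rewrite RtoC_opp. ring.
    unfold Cexp; simpl. rewrite cos_0, sin_0. apply injective_projections; simpl; ring. }
  (* The Jacobian $e^v$ of $x=e^v$ cancels the factor $x^{-1}$ in $x^{s-1}$. *)
  assert (Eexp : forall v z, Cmult (RtoC (exp v)) (Cmult (RtoC (exp (- v))) z) = z).
  { intros v z. rewrite Cmult_assoc, <- RtoC_mult, <- exp_plus. replace (v + - v) with 0 by ring. rewrite exp_0. ring. }
  assert (CG : contR (G O)) by (apply (mellin_data_cont _ _ _ HG); lia).
  exists (mellin (G O) s). split.
  - apply is_RInt_gen_exp.
    + intros v. apply continuous_ext with (fun v => Cmult (G O v) (Cmult (RtoC (exp (- v))) (Cexp (Cmult s (RtoC v))))).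
      intros w; now rewrite Epow, Gf. apply continuous_Cmult. apply CG. cont.
    + set (e := Rmin (Re s) (al - Re s)). assert (He : 0 < e) by (apply Rmin_pos; lra).
      assert (e1 : e <= Re s) by apply Rmin_l. assert (e2 : e <= al - Re s) by apply Rmin_r.
      destruct (mellin_data_dom0 al m G HG) as [K [HK D]].
      eapply is_Int_ext; [|apply (Int_correct _ _ (good_weight_Kexp K e HK He) (D e s He ltac:(lra)))].
      intros v. cbv beta. rewrite Epow, <- Gf.
      rewrite <- (Eexp v (Cmult (G O v) (Cexp (Cmult s (RtoC v))))) at 1. ring.
  - assert (Zs : zeta s = zeta0 s). { apply zeta_zeta0. lra. apply two_pow_neq. lra. }
    assert (ES : forall y, CSeries (fun n => Cmult (RtoC (INR (dk k (S n)))) (f (INR (S n) * exp y))) = Cmult (RtoC (/ (2 * PI))) (line_int k (G O) (1 + a) y)).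
    { intros y. apply CSeries_conv. eapply conv_ext; [|apply (series_line_int al k m G HG Hal Hk Hm (1 + a) y); lra].
      intros N. apply Csum_ext. intros i _. f_equal. rewrite Gf, exp_plus, exp_ln, Rmult_comm by apply INR_S_pos. reflexivity. }
    assert (EP : forall v, Pres k (exp v) = Cmult (RtoC (exp (- v) / (2 * PI))) (Circ (zeta_pow_exp k v) a)).
    { intros v. rewrite Pres_Circ. f_equal. symmetry. apply zeta_pow_exp_circle_radius; lra. }
    assert (ER : forall y, @RInt_gen C_R_CompleteNormedModule (fun u : R => Cmult (f (exp y * u)) (Pres k u)) (at_right 0) (Rbar_locally p_infty)
        = Cmult (RtoC (/ (2 * PI))) (Circ (Phi k (G O) y) a)).
    { intros y. apply (is_RInt_gen_unique (V:=C_R_CompleteNormedModule)).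
      assert (CGy : contR (fun v => G O (v + y))) by (intros v; apply (continuous_comp (fun v => v + y) (G O)); [cont|apply CG]).
      assert (CC := Circ_zeta_pow_exp_cont k a Ha).
      assert (Ef : forall v, f (exp y * exp v) = G O (v + y)) by (intros v; rewrite Gf, exp_plus, Rmult_comm; reflexivity).
      apply is_RInt_gen_exp.
      - intros v. apply continuous_ext with (fun v => Cmult (G O (v + y)) (Cmult (RtoC (exp (- v) / (2 * PI))) (Circ (zeta_pow_exp k v) a))).
        intros w; now rewrite Ef, EP.
        apply continuous_Cmult. apply CGy. apply continuous_Cmult. unfold Rdiv; cont. apply CC.
      - assert (X := Circ_residue al k m G HG a y Ha Ha').
        assert (CX : contR (fun v => Cmult (G O (v + y)) (Circ (zeta_pow_exp k v) a))) by (intros v; apply continuous_Cmult; [apply CGy|apply CC]).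
        eapply is_Int_ext; [|apply is_Int_scal with (c := RtoC (/ (2 * PI))) (1 := CX) (2 := X)].
        intros v. cbv beta. rewrite Ef, EP. unfold Rdiv. rewrite RtoC_mult.
        rewrite <- (Eexp v (Cmult (RtoC (/ (2 * PI))) (Cmult (G O (v + y)) (Circ (zeta_pow_exp k v) a)))). ring. }
    (* The series is the line integral at $1+a$ and the subtracted integral is the circle about 1,
       so by [line_int_circle] their difference is the line integral at $1-a$, inside the strip. *)
    assert (EH : forall y, Cminus (CSeries (fun n => Cmult (RtoC (INR (dk k (S n)))) (f (INR (S n) * exp y))))
         (@RInt_gen C_R_CompleteNormedModule (fun u : R => Cmult (f (exp y * u)) (Pres k u)) (at_right 0) (Rbar_locally p_infty))
        = Cmult (RtoC (/ (2 * PI))) (line_int k (G O) (1 - a) y)).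
    { intros y. rewrite ES, ER, <- (line_int_circle al k m G HG Hal Hk Hm a y Ha Ha'). ring. }
    apply is_RInt_gen_exp.
    + intros v. apply continuous_ext with (fun v => Cmult (Cmult (RtoC (/ (2 * PI))) (line_int k (G O) (1 - a) v)) (Cmult (RtoC (exp (- v))) (Cexp (Cmult s (RtoC v))))).
      intros w; now rewrite EH, Epow.
      apply continuous_Cmult; [|cont]. apply continuous_Cmult. apply continuous_const.
      apply (line_int_cont al k m G HG Hal Hk Hm); lra.
    + rewrite Zs. eapply is_Int_ext; [|apply (final_inversion al k m G HG Hal Hk Hm s (1 - a) Hs); lra].
      intros v. cbv beta. rewrite EH, Epow.
      rewrite <- (Eexp v (Cmult (Cmult (RtoC (/ (2 * PI))) (line_int k (G O) (1 - a) v)) (Cexp (Cmult s (RtoC v))))) at 1. ring.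
Qed.
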